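(* Suppose the weight function $w:\mathbb R^d\to[0,\infty)$ satisfies conditions W1, W2, W3 (stated in the context) with $w_{\max}<\infty$. Then for every $\lambda>0$ the limit $$\rho_{BM_w}(\lambda):=\lim_{s\to\infty}\frac{\mathbb E[BM_w(\mathcal H_{\lambda,s},\mathcal H'_{\lambda,s})]}{\lambda s^d}$$ exists and is finite. Also, if $nr_n^d\to t\in(0,\infty)$ as $n\to\infty$, then $$n^{-1}BM_{w,r_n}(\mathcal U_n,\mathcal V_n)\to\int_{\mathbb R^d}\rho_{BM_w}(tf_\mu(x))f_\mu(x)\,dx$$ as $n\to\infty$, both completely and in $L^2$.
   Context: Fix $d\in\mathbb N$. $\mu$ is a diffuse probability measure on $\mathbb R^d$ ($\mu(\{x\})=0$ for all $x$); $U_1,V_1,U_2,V_2,\dots$ are independent random vectors with common distribution $\mu$; $\mathcal U_n:=\{U_1,\dots,U_n\}$, $\mathcal V_n:=\{V_1,\dots,V_n\}$. $(r_n)_{n\ge1}$ is a sequence of positive reals. $f_\mu$ is the Lebesgue density of the absolutely continuous part of $\mu$ ($\mu$ may have a singular part). The integrand is taken as $0$ where $f_\mu(x)=0$. $Q_s:=[-s/2,s/2)^d$. $\mathcal H_\lambda,\mathcal H'_\lambda$ are independent homogeneous Poisson point processes of intensity $\lambda$ on $\mathbb R^d$; $\mathcal H_{\lambda,s}:=\mathcal H_\lambda\cap Q_s$, $\mathcal H'_{\lambda,s}:=\mathcal H'_\lambda\cap Q_s$. $\xi_n\to c$ completely means $\sum_n\mathbb P[|\xi_n-c|>\varepsilon]<\infty$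 for all $\varepsilon>0$. $w:\mathbb R^d\to[0,\infty)$ is measurable and $w_{\max}:=\sup_xw(x)$. With $\|\cdot\|$ the Euclidean norm and $o$ the origin: W1: $w(x)=w(-x)$ for all $x$. W2: $w(o)=0$ and $w(x)\to0$ as $x\to o$. W3: $w(x)\to w_{\max}$ as $\|x\|\to\infty$. For finite $\mathcal X\subset\mathbb R^d$, a near-perfect matching of $\mathcal X$ is a collection of $\lfloor|\mathcal X|/2\rfloor$ pairwise vertex-disjoint edges of the complete graph on $\mathcal X$. For disjoint finite $\mathcal U,\mathcal V\subset\mathbb R^d$ and an edge $xy$ with $x,y\in\mathcal U\cup\mathcal V$, let $w^*(xy):=w(y-x)$ if one endpoint is in $\mathcal U$ and the other in $\mathcal V$, and $w^*(xy):=w_{\max}$ if both are in $\mathcal U$ or both are in $\mathcal V$. Then $BM_w(\mathcal U,\mathcal V):=\min_\tau\sum_{e\in\tau}w^*(e)$, the minimum over all near-perfect matchings $\tau$ of $\mathcal U\cup\mathcal V$, and $BM_{w,r}(\mathcal U,\mathcal V):=BM_w(r^{-1}\mathcal U,r^{-1}\mathcal V)$ for $r>0$. (When $|\mathcal U|=|\mathcal V|$ this is the minimum weight of a perfect bipartite matching.) *)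

(* Defs.v *)
From HB Require Import structures.
From mathcomp Require Import all_boot all_order all_algebra finmap.
From mathcomp Require Import all_classical all_reals all_analysis.

Set Implicit Arguments.
Unset Strict Implicit.
Unset Printing Implicit Defensive.

Import Order.TTheory GRing.Theory Num.Theory.
Import numFieldNormedType.Exports.

Local Open Scope classical_set_scope.
Local Open Scope ring_scope.

(* R^d is 'rV[R]_d, with the sigma-algebra generated by the d coordinate maps
   (the convention of the library for tuples); it is the Borel sigma-algebra
   of the usual topology. *)
Definition measure_rV_display : measure_display.
Proof. exact: default_measure_display. Qed.

Section measurable_rV.
Variables (R : realType) (d : nat).

Definition rV_coord (i : 'I_d) (x : 'rV[R]_d) : measurableTypeR R := x ord0 i.

Let rV_set0 : g_sigma_preimage rV_coord set0.
Proof. exact: sigma_algebra0. Qed.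

Let rV_setC A : g_sigma_preimage rV_coord A -> g_sigma_preimage rV_coord (~` A).
Proof. exact: sigma_algebraC. Qed.

Let rV_bigcup (F : (set 'rV[R]_d)^nat) :
  (forall i, g_sigma_preimage rV_coord (F i)) ->
  g_sigma_preimage rV_coord (\bigcup_i (F i)).
Proof. exact: sigma_algebra_bigcup. Qed.

HB.instance Definition _ := @isMeasurable.Build measure_rV_display
  'rV[R]_d (g_sigma_preimage rV_coord) rV_set0 rV_setC rV_bigcup.

Lemma measurable_rV_coord (i : 'I_d) :
  measurable_fun [set: 'rV[R]_d] (rV_coord i).
Proof.
move=> _ Y mY; apply: sub_sigma_algebra; rewrite -bigcup_seq/=.
by exists i => /=; [rewrite mem_index_enum | exists Y].
Qed.

Lemma measurable_fun_rV (dT : measure_display) (T : measurableType dT)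
    (f : T -> 'rV[R]_d) :
  (forall i, measurable_fun [set: T] (rV_coord i \o f)) ->
  measurable_fun [set: T] f.
Proof.
move=> mf _ Y mY; rewrite setTI.
suff : g_sigma_preimage rV_coord `<=` [set A | measurable (f @^-1` A)].
  exact.
apply: smallest_sub.
  split=> /=.
  - by rewrite preimage_set0.
  - by move=> A mA; rewrite setTD preimage_setC; exact: measurableC.
  - by move=> F mF; rewrite preimage_bigcup; exact: bigcupT_measurable.
rewrite -bigcup_seq => A [i _ [B mB <-]] /=.
rewrite setTI -comp_preimage -[X in measurable X]setTI.
exact: mf.
Qed.

End measurable_rV.

Section lebesgue_rV.
Variable R : realType.
Local Open Scope ereal_scope.

Definition consrV (n : nat) (p : (measurableTypeR R * 'rV[R]_n)%type) : 'rV[R]_n.+1 :=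
  \row_i oapp (fun j => p.2 ord0 j) p.1 (unlift ord0 i).

Definition unconsrV (n : nat) (x : 'rV[R]_n.+1) : (measurableTypeR R * 'rV[R]_n)%type :=
  (x ord0 ord0, \row_j x ord0 (lift ord0 j)).

Lemma consrVK n : cancel (@consrV n) (@unconsrV n).
Proof.
move=> [a x]; rewrite /consrV /unconsrV !mxE unlift_none/=.
by congr pair; apply/rowP => j; rewrite !mxE liftK.
Qed.

Lemma measurable_consrV n : measurable_fun [set: _] (@consrV n).
Proof.
apply: measurable_fun_rV => i; rewrite /comp/rV_coord/consrV.
case: (unliftP ord0 i) => [j ->|->].
- rewrite (_ : (fun x => _) = rV_coord j \o snd).
    by apply: measurableT_comp => //; exact: measurable_rV_coord.
  by apply/funext => x; rewrite mxE liftK.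
- rewrite (_ : (fun x => _) = fst) //.
  by apply/funext => x; rewrite mxE unlift_none.
Qed.

Lemma measurable_unconsrV n : measurable_fun [set: _] (@unconsrV n).
Proof.
apply: measurable_fun_pair; first exact: (measurable_rV_coord ord0).
apply: measurable_fun_rV => i.
rewrite (_ : _ \o _ = rV_coord (lift ord0 i)).
  exact: measurable_rV_coord.
by apply/funext => x; rewrite /rV_coord/= mxE.
Qed.

Section lebesgue_rV_step.
Variables (n : nat) (m : {sigma_finite_measure set 'rV[R]_n -> \bar R}).

Definition lebesgue_consrV : set 'rV[R]_n.+1 -> \bar R :=
  pushforward (@lebesgue_measure R \x m) (@consrV n).

Let lebesgue_consrV0 : lebesgue_consrV set0 = 0.
Proof. by rewrite /lebesgue_consrV /pushforward preimage_set0 measure0. Qed.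

Let lebesgue_consrV_ge0 A : 0 <= lebesgue_consrV A.
Proof.
rewrite /lebesgue_consrV /pushforward.
exact: (measure_ge0 (lebesgue_measure \x m)).
Qed.

Let lebesgue_consrV_sigma_additive : semi_sigma_additive lebesgue_consrV.
Proof.
exact: (@measure_semi_sigma_additive _ _ _
  (measure_function_pushforward__canonical__measure_function_Measure
    _ (@measurable_consrV n))).
Qed.

HB.instance Definition _ := isMeasure.Build _ _ _ lebesgue_consrV
  lebesgue_consrV0 lebesgue_consrV_ge0 lebesgue_consrV_sigma_additive.

Let lebesgue_consrV_sigma_finite : sigma_finite setT lebesgue_consrV.
Proof.
have /sigma_finiteP[F [FT ndF mF]] := sigma_finiteT (@lebesgue_measure R).
have /sigma_finiteP[G [GT ndG mG]] := sigma_finiteT m.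
exists (fun k => @unconsrV n @^-1` (F k `*` G k)).
  rewrite -preimage_bigcup -[LHS](preimage_setT (@unconsrV n)).
  congr (_ @^-1` _); apply/esym; rewrite -subTset => -[x y] _.
  have : [set: measurableTypeR R] x by [].
  have : [set: 'rV[R]_n] y by [].
  rewrite FT GT => -[i _ Giy] [j _ Fjx]; exists (maxn i j) => //; split.
  - by move: Fjx; exact/subsetPset/ndF/leq_maxr.
  - by move: Giy; exact/subsetPset/ndG/leq_maxl.
move=> k; have [mFk Fk] := mF k; have [mGk Gk] := mG k; split.
  rewrite -[X in measurable X]setTI; apply: measurable_unconsrV => //.
  exact: measurableX.
rewrite /lebesgue_consrV /pushforward -comp_preimage.
rewrite (_ : _ \o _ = id); last by apply/funext => p; exact: consrVK.
by rewrite preimage_id product_measure1E// lte_mul_pinfty// ge0_fin_numE.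
Qed.

HB.instance Definition _ := Measure_isSigmaFinite.Build _ _ _ lebesgue_consrV
  lebesgue_consrV_sigma_finite.

End lebesgue_rV_step.

(* R^0 is a point of mass 1; R^n.+1 carries the product of the Lebesgue
   measures of R and R^n, transported by consrV. *)
Fixpoint lebesgue_rV (n : nat) : {sigma_finite_measure set 'rV[R]_n -> \bar R} :=
  match n with
  | 0 => [the {sigma_finite_measure set 'rV[R]_0 -> \bar R} of dirac (0%R : 'rV[R]_0)]
  | n'.+1 => [the {sigma_finite_measure set 'rV[R]_n'.+1 -> \bar R} of
                lebesgue_consrV (lebesgue_rV n')]
  end.

Lemma lebesgue_rV_box (n : nat) (A : 'I_n -> set (measurableTypeR R)) :
  (forall i, measurable (A i)) ->
  lebesgue_rV n [set x | forall i, A i (x ord0 i)] =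
  \prod_(i < n) lebesgue_measure (A i).
Proof.
elim: n A => [|n IH] A mA.
  by rewrite big_ord0/= diracE mem_set// => -[].
rewrite big_ord_recl -IH//.
rewrite -[LHS]/((lebesgue_measure \x lebesgue_rV n) (@consrV n @^-1` _)).
rewrite (_ : _ @^-1` _ = A ord0 `*`
    [set x : 'rV[R]_n | forall i, A (lift ord0 i) (x ord0 i)]).
  rewrite product_measure1E//.
  rewrite (_ : [set _ | _] = \bigcap_(i in [set: 'I_n])
      (rV_coord i @^-1` A (lift ord0 i))); last first.
    by apply/seteqP; split => [x xA i _|x xA i]; [exact: xA|exact: (xA i)].
  rewrite bigcap_mkcond/=.
  apply: fin_bigcap_measurable => // i _.
  rewrite in_setT -[X in measurable X]setTI.
  exact: measurable_rV_coord.
apply/seteqP; split => [[a x] /= H|[a x] /= [Ha Hx] i].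
- split; first by have := H ord0; rewrite mxE unlift_none.
  by move=> i; have := H (lift ord0 i); rewrite mxE liftK.
- by rewrite mxE; case: (unliftP ord0 i) => [j ->|->] //=; exact: Hx.
Qed.

End lebesgue_rV.

Section matching.
Variables (R : realType) (d : nat).
Implicit Types (w : 'rV[R]_d -> R) (U V : {fset 'rV[R]_d}).

Definition enorm (x : 'rV[R]_d) : R := Num.sqrt (\sum_i x ord0 i ^+ 2).

Definition wmax w : R := sup (range w).

Definition condW1 w := forall x, w x = w (- x).

Definition condW2 w :=
  w 0 = 0 /\ w x @[x --> (0 : 'rV[R]_d)] --> (0 : R).

Definition condW3 w :=
  forall e : R, 0 < e ->
    exists M : R, forall x, M < enorm x -> `|w x - wmax w| < e.

(* Edges of the complete graph on X are the two-element subsets of X. *)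
Definition near_perfect_matching (T : choiceType) (X : {fset T})
    (tau : {fset {fset T}}) : Prop :=
  [/\ #|` tau| = #|` X|./2,
      forall e, e \in tau -> (e `<=` X)%fset /\ #|` e| = 2
    & forall e e', e \in tau -> e' \in tau -> e != e' -> [disjoint e & e']%fset].

Definition wstar w U V (x y : 'rV[R]_d) : R :=
  if (x \in U) && (y \in V) || (x \in V) && (y \in U)
  then w (y - x) else wmax w.

(* The order in which the endpoints are enumerated is irrelevant when w is even;
   the default value is never reached on a two-element set. *)
Definition edge_weight w U V (e : {fset 'rV[R]_d}) : R :=
  if enum_fset e is [:: x; y] then wstar w U V x y else 0.

Definition matching_weight w U V (tau : {fset {fset 'rV[R]_d}}) : R :=
  \sum_(e <- tau) edge_weight w U V e.

(* Infimum of a finite nonempty set of reals, hence a minimum; see BM_min. *)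
Definition BM w U V : R :=
  inf [set matching_weight w U V tau |
       tau in [set tau | near_perfect_matching (U `|` V)%fset tau]].

Definition BMr w (r : R) U V : R :=
  BM w [fset r^-1 *: x | x in U]%fset [fset r^-1 *: x | x in V]%fset.

End matching.

Section near_perfect_matching_exists.
Variable T : choiceType.
Local Open Scope fset_scope.

Lemma near_perfect_matching_exists (X : {fset T}) :
  exists tau, near_perfect_matching X tau.
Proof.
have [n] := ubnP #|` X|; elim: n X => // n IH X Xn.
have [X1|X2] := leqP #|` X| 1.
  exists fset0; split; rewrite ?cardfs0//.
  by case: #|` X| X1 => [|[]].
have /fset0Pn[x xX] : X != fset0 by rewrite -cardfs_gt0 ltnW.
have /fset0Pn[y] : X `\ x != fset0.
  by rewrite -cardfs_gt0 -(ltn_add2l 1) addn0; move: X2; rewrite (cardfsD1 x) xX.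
rewrite 2!inE => /andP[yx yX].
pose Y := X `\ x `\ y.
have XY : #|` X| = #|` Y|.+2.
  by rewrite (cardfsD1 x) xX (cardfsD1 y (X `\ x)) 2!inE yx yX.
have [|tau [tauY tauE tauD]] := IH Y.
  by move: Xn; rewrite XY !ltnS => /ltnW.
have xy2 : #|` [fset x; y]| = 2 by rewrite cardfs2 eq_sym yx.
have disjY e : e `<=` Y -> [disjoint [fset x; y] & e].
  move=> /fsubsetP eY; apply/fdisjointP => z; rewrite !inE => /orP[] /eqP ->.
  - by apply/negP => /eY; rewrite !inE eqxx andbF.
  - by apply/negP => /eY; rewrite !inE eqxx.
have xyNtau : [fset x; y] \notin tau.
  apply/negP => /tauE[+ _] => /disjY /fdisjointP/(_ x).
  by rewrite !inE eqxx => /(_ isT).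
exists ([fset x; y] |` tau); split.
- by rewrite cardfsU1 xyNtau tauY XY.
- move=> e; rewrite in_fset1U => /orP[/eqP ->|/tauE[eY e2]]; split => //.
    by apply/fsubsetP => z; rewrite !inE => /orP[] /eqP ->.
  by apply: (fsubset_trans eY); apply/fsubsetP => z; rewrite !inE => /and3P[].
- move=> e e'; rewrite !in_fset1U.
  move=> /orP[/eqP ->|te] /orP[/eqP ->|te']; rewrite ?eqxx// => ee'.
  + by apply: disjY; have [] := tauE _ te'.
  + by rewrite fdisjoint_sym; apply: disjY; have [] := tauE _ te.
  + exact: tauD.
Qed.

End near_perfect_matching_exists.

Lemma BM_min (R : realType) (d : nat) (w : 'rV[R]_d -> R)
    (U V : {fset 'rV[R]_d}) :
  exists2 tau, near_perfect_matching (U `|` V)%fset tau &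
    BM w U V = matching_weight w U V tau /\
    forall tau', near_perfect_matching (U `|` V)%fset tau' ->
      BM w U V <= matching_weight w U V tau'.
Proof.
set X := (U `|` V)%fset.
pose s := fpowerset (fpowerset X).
pose p tau := `[< near_perfect_matching X tau >].
pose ms := [fset tau in s | p tau]%fset.
have npm_ms tau : near_perfect_matching X tau -> tau \in ms.
  move=> mtau; rewrite !inE; apply/andP; split; last exact/asboolP.
  rewrite fpowersetE; apply/fsubsetP => e etau; rewrite fpowersetE.
  by have [_ + _] := mtau => /(_ _ etau)[].
have ms_npm tau : tau \in ms -> near_perfect_matching X tau.
  by rewrite !inE => /andP[_ /asboolP].
have [tau0 /npm_ms mtau0] := near_perfect_matching_exists X.
pose i0 : ms := [` mtau0]%fset.
have [/= i _ imin] :=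
  @arg_minP _ _ ms i0 xpredT (fun i => matching_weight w U V (val i)) isT.
have lb tau' : near_perfect_matching X tau' ->
    matching_weight w U V (val i) <= matching_weight w U V tau'.
  by move=> /npm_ms mtau'; exact: (imin [` mtau']%fset).
have BME : BM w U V = matching_weight w U V (val i).
  apply/eqP; rewrite eq_le; apply/andP; split.
    apply: ge_inf; first by exists (matching_weight w U V (val i)) => _ [? /lb ? <-].
    by exists (val i) => //; exact/ms_npm/valP.
  apply: lb_le_inf.
    by exists (matching_weight w U V (val i)); exists (val i) => //; exact/ms_npm/valP.
  by move=> _ [? /lb ? <-].
exists (val i); first exact/ms_npm/valP.
by rewrite BME; split.
Qed.

Section probabilistic_notions.
Variable R : realType.

(* Mutual independence: the product rule over every finite subfamily. *)
Definition mutually_independent dO (Omega : measurableType dO)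
    (P : probability Omega R) dT (T : measurableType dT) (I : eqType)
    (X : I -> Omega -> T) : Prop :=
  forall (s : seq I) (A : I -> set T), uniq s -> (forall i, measurable (A i)) ->
    P (\bigcap_(i in [set` s]) (X i @^-1` A i)) =
    (\prod_(i <- s) P (X i @^-1` A i))%E.

Definition converges_completely dO (Omega : measurableType dO)
    (P : probability Omega R) (xi : nat -> Omega -> R) (c : R) : Prop :=
  forall e : R, 0 < e ->
    (\sum_(1 <= n <oo) P [set om | (e < `|xi n om - c|)%R] < +oo)%E.

Definition converges_L2 dO (Omega : measurableType dO)
    (P : probability Omega R) (xi : nat -> Omega -> R) (c : R) : Prop :=
  ('E_P[fun om => (`|xi n om - c| ^+ 2)%R])%E @[n --> \oo] --> 0%E.

Variable d : nat.

Definition diffuse (mu : probability 'rV[R]_d R) : Prop :=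
  forall x, mu [set x] = 0%E.

(* f is the density of the absolutely continuous part in the Lebesgue
   decomposition of mu, and mus is the singular part. *)
Definition ac_density (mu : probability 'rV[R]_d R) (f : 'rV[R]_d -> R) : Prop :=
  [/\ measurable_fun [set: 'rV[R]_d] f, forall x, 0 <= f x &
      exists mus : {measure set 'rV[R]_d -> \bar R},
        (exists N, [/\ measurable N, lebesgue_rV R d N = 0%E &
                       mus (~` N) = 0%E]) /\
        (forall A, measurable A ->
          mu A = (\int[lebesgue_rV R d]_(x in A) (f x)%:E + mus A)%E)].

End probabilistic_notions.

Section point_processes.
Variables (R : realType) (d : nat).
Variables (dO : measure_display) (Omega : measurableType dO).
Variable P : probability Omega R.
Implicit Types H : Omega -> set 'rV[R]_d.

Definition npoints H (B : set 'rV[R]_d) (om : Omega) : nat :=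
  #|` fset_set (H om `&` B)|.

(* The second argument of poisson_prob is a dummy; poisson_prob 0 is the
   point mass at 0. *)
Definition poisson_process (lam : R) H : Prop :=
  [/\ forall om (B : set 'rV[R]_d), bounded_set B -> finite_set (H om `&` B),
      forall B : set 'rV[R]_d, measurable B -> bounded_set B ->
        measurable_fun [set: Omega] (npoints H B),
      forall B : set 'rV[R]_d, measurable B -> bounded_set B -> forall A : set nat,
        P (npoints H B @^-1` A) =
        poisson_prob (lam * fine (lebesgue_rV R d B)) 0%N A &
      forall (m : nat) (B : 'I_m -> set 'rV[R]_d),
        (forall i, measurable (B i) /\ bounded_set (B i)) ->
        trivIset [set: 'I_m] B ->
        mutually_independent P (fun i => npoints H (B i))].

Definition sigma_process H : set (set Omega) :=
  <<s [set E | exists (B : set 'rV[R]_d) (A : set nat),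
         [/\ measurable B, bounded_set B & E = npoints H B @^-1` A]] >>.

Definition independent_processes H H' : Prop :=
  forall E E', sigma_process H E -> sigma_process H' E' ->
    P (E `&` E') = (P E * P E')%E.

End point_processes.

Definition cube (R : realType) (d : nat) (s : R) : set 'rV[R]_d :=
  [set x | forall i, - (s / 2) <= x ord0 i < s / 2].
Arguments cube {R} d s.

(* The sequence is indexed from 0: X 0, ..., X n.-1 are the first n points. *)
Definition first_points (R : realType) (d : nat) (Omega : Type)
    (X : nat -> Omega -> 'rV[R]_d) (n : nat) (om : Omega) : {fset 'rV[R]_d} :=
  [fset X (nat_of_ord i) om | i in 'I_n]%fset.

(* Main.v *)
(** Let M be the supremum of w. Edges inside one colour class have weight M, so
    the minimal weight of a matching is M times its number of edges minus the
    maximal total gain of a partial bipartite matching, the gain of the edge xy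
    being M - w (y - x) >= 0.  The maximal gain is superadditive over disjoint
    cells and changes by at most M when a point is added.  By superadditivity
    the mean gain of uniform samples of density lam in a cube has a limit
    Gam lam per unit volume, which is 2M-Lipschitz in lam; replacing Poisson
    counts by their means gives rho lam = M - Gam lam / lam.
    For samples from mu, approximate f in L1 by a function constant on small
    cells, and cover the singular part by cells of small total volume.  On a cell
    where f is close to a, the sample is close to a binomially thinned uniform
    one, and its gain divided by n tends to Gam (t a) b ^ d / t, with b the side of
    the cell.  A cell charged by the singular part contains so many points per
    rescaled unit volume that, by W2, nearly all of them are matched for free,
    with gain M each.  By W3 the interaction of distinct cells is negligible.
    Bounded differences then give exponentially small probabilities of
    deviating from the mean, hence complete and L2 convergence. *)

From HB Require Import structures.
Require Import Defs.
From mathcomp Require Import all_boot all_order all_algebra finmap.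
From mathcomp Require Import all_classical all_reals all_analysis.
From mathcomp Require Import measurable_realfun.
From mathcomp Require Import ring lra zify.

Set Implicit Arguments.
Unset Strict Implicit.
Unset Printing Implicit Defensive.

Import Order.TTheory GRing.Theory Num.Theory.
Import numFieldNormedType.Exports.

Local Open Scope classical_set_scope.
Local Open Scope ring_scope.

(** * Finite measures on products *)

(** No coupling of samples is built. A functional that grows by at most M with each added point is
    compared under two laws by replacing the points one at a time: total variation closeness on a
    cell costs M times the distance per point. The random number of points enters only through a
    binomial mean deviation, kept free of square roots by a parameter kap. The Poisson processes are
    arbitrary random sets known through their counts alone. The mean of a function of their points
    is recovered from the events that given disjoint regions contain one point each and the rest of
    the cube none; grids fine enough to separate all points make these events sufficient. The order
    of the constants is forced: a cell of the singular part loses C b ^ d, where C depends on the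
    tolerance and not on the cell, so that the total volume of such cells can be made small
    afterwards. The singular part gains M per unit of mass, which cancels the M paid per edge: it is
    free in the limit. Samples are lists that may repeat points. Deterministic bounds hold for all
    lists; almost sure distinctness enters only through means and null sets. *)

Lemma finite_measure_unique d (T : measurableType d) (R : realType)
    (G : set_system T) (m1 m2 : {measure set T -> \bar R}) :
  @measurable _ T = <<s G >> -> setI_closed G ->
  m1 setT = m2 setT -> (m1 setT < +oo)%E ->
  (forall A, G A -> m1 A = m2 A) ->
  forall A, measurable A -> m1 A = m2 A.
Proof.
move=> GE GI mT fT mG A; rewrite GE => sA.
have f1 B : measurable B -> (m1 B < +oo)%E.
  by move=> mB; apply: le_lt_trans fT; apply: le_measure; rewrite ?inE.
apply: (dynkin_induction (P := fun A => m1 A = m2 A) GE GI) sA => //.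
- move=> S mS mSE; have fT2 : (m2 setT < +oo)%E by rewrite -mT.
  have mD (m : {measure set T -> \bar R}) : (m setT < +oo)%E -> m (~` S) = (m setT - m S)%E.
    by move=> mfin; rewrite -setTD measureD// setTI.
  by rewrite !mD// mT mSE.
- move=> F mF tF mFE; rewrite !measure_bigcup//.
  by apply: eq_eseriesr => i _; exact: mFE.
Qed.

Definition boxes d (T : measurableType d) (X : Type) n (f : 'I_n -> X -> T)
    : set_system X :=
  [set B | exists2 A : 'I_n -> set T, (forall i, measurable (A i)) &
           B = [set x | forall i, A i (f i x)]].

Lemma boxes_setI d (T : measurableType d) (X : Type) n (f : 'I_n -> X -> T) :
  setI_closed (boxes f).
Proof.
move=> _ _ [A mA ->] [B mB ->]; exists (fun i => A i `&` B i).
  by move=> i; exact: measurableI.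
by apply/seteqP; split => [x [xA xB] i|x xAB]; split => //;
  try move=> i; by [case: (xAB i)|exact: xA|exact: xB].
Qed.

(** Cylinders over single coordinates generate the product sigma-algebra but are not closed under
    intersection. Boxes generate the same one and are, as Dynkin's argument requires. *)
Lemma g_sigma_preimage_boxes d (T : measurableType d) (X : Type) n
    (f : 'I_n -> X -> T) :
  g_sigma_preimage f = <<s boxes f >>.
Proof.
apply/seteqP; split; apply: smallest_sub; try exact: smallest_sigma_algebra.
- move=> A; rewrite -bigcup_seq => -[i _ [B mB <-]].
  apply: sub_sigma_algebra.
  exists (fun j => if j == i then B else setT) => [j|].
    by case: ifP.
  apply/seteqP; split => [x [_ Bx] j|x /(_ i)/=].
    by case: eqVneq => // ->.
  by rewrite eqxx.
- move=> _ [A mA ->].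
  have Sf i : g_sigma_preimage f (f i @^-1` A i).
    apply: sub_sigma_algebra; rewrite -bigcup_seq.
    exists i => /=; first by rewrite mem_index_enum.
    by exists (A i) => //; rewrite setTI.
  set S := (X in X _).
  have SC B : S B -> S (~` B) by rewrite -setTD; exact: sigma_algebraCD.
  (* A box is the complement of a countable union: the complements of its sides, followed by empty
     sets beyond index [n]. *)
  pose F k := if insub k is Some i then ~` (f i @^-1` A i) else set0.
  rewrite [X in S X](_ : _ = ~` \bigcup_k F k).
    apply: (SC); apply: (@sigma_algebra_bigcup _ setT) => k; rewrite /F; case: insubP => [i _ _|_].
      exact: SC (Sf i).
    exact: sigma_algebra0.
  apply/seteqP; split => [x xA [k _]|x xF i].
    by rewrite /F; case: insubP => // i _ _; apply; exact: xA.
  apply: contrapT => xA; apply: xF; exists i => //.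
  by rewrite /F valK.
Qed.

Lemma finite_measure_box_unique d (T : measurableType d) d' (X : measurableType d')
    (R : realType) n (f : 'I_n -> X -> T) (m1 m2 : {measure set X -> \bar R}) :
  @measurable _ X = g_sigma_preimage f ->
  (m1 setT < +oo)%E ->
  (forall A : 'I_n -> set T, (forall i, measurable (A i)) ->
    m1 [set x | forall i, A i (f i x)] = m2 [set x | forall i, A i (f i x)]) ->
  forall A, measurable A -> m1 A = m2 A.
Proof.
move=> mX fT mB; apply: (@finite_measure_unique _ _ _ (boxes f)) => //.
- by rewrite mX g_sigma_preimage_boxes.
- exact: boxes_setI.
- have := mB (fun=> setT) (fun=> measurableT).
  by rewrite (_ : [set x | _] = setT)//; apply/seteqP; split.
- by move=> _ [A mA ->]; exact: mB.
Qed.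

Lemma measurable_rVE (R : realType) d :
  @measurable _ 'rV[R]_d = g_sigma_preimage (@rV_coord R d).
Proof. by []. Qed.

Lemma measurable_tupleE dT (T : measurableType dT) n :
  @measurable _ (n.-tuple T) = g_sigma_preimage (fun i x => @tnth n T x i).
Proof. by []. Qed.

Lemma measurable_rV_box (R : realType) d (A : 'I_d -> set (measurableTypeR R)) :
  (forall i, measurable (A i)) ->
  measurable [set x : 'rV[R]_d | forall i, A i (x ord0 i)].
Proof.
move=> mA; rewrite measurable_rVE g_sigma_preimage_boxes.
by apply: sub_sigma_algebra; exists A.
Qed.

Lemma measurable_tuple_box dT (T : measurableType dT) n (A : 'I_n -> set T) :
  (forall i, measurable (A i)) ->
  measurable [set t : n.-tuple T | forall i, A i (tnth t i)].
Proof.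
move=> mA; rewrite measurable_tupleE g_sigma_preimage_boxes.
by apply: sub_sigma_algebra; exists A.
Qed.

(** * Independent samples *)

Section power.
Context dT (T : measurableType dT) (R : realType).
Local Open Scope ereal_scope.
Variable nu : probability T R.

Definition tcons n (p : T * n.-tuple T) : n.+1.-tuple T := [tuple of p.1 :: p.2].

Lemma measurable_tcons n : measurable_fun setT (@tcons n).
Proof. exact: measurable_cons. Qed.

HB.instance Definition _ n :=
  @isMeasurableFun.Build _ _ _ _ (@tcons n) (@measurable_tcons n).

Definition power_step n (P : probability (n.-tuple T) R) :
  probability (n.+1.-tuple T) R := distribution (nu \x P) (@tcons n).

(** The law of [n] independent points. Building it by consing lets Fubini integrate the head first;
    the only empty tuple carries the base case. *)
Fixpoint power n : probability (n.-tuple T) R :=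
  match n with
  | 0 => dirac [tuple]
  | n'.+1 => power_step (power n')
  end.

(** No measurability is asked of [h], since the space of empty tuples has a single point. *)
Lemma integral_power0 (h : 0.-tuple T -> \bar R) :
  \int[power 0]_t h t = h [tuple].
Proof.
rewrite integral_dirac ?diracT ?mul1e//.
move=> _ B mB; rewrite setTI.
have [hB|hB] := pselect (B (h [tuple])).
  rewrite (_ : _ @^-1` _ = setT)//.
  by apply/seteqP; split => t //= _; rewrite tuple0.
rewrite (_ : _ @^-1` _ = set0)//.
by apply/seteqP; split => t //=; rewrite tuple0.
Qed.

Lemma power_box n (A : 'I_n -> set T) : (forall i, measurable (A i)) ->
  power n [set t | forall i, A i (tnth t i)] = \prod_(i < n) nu (A i).
Proof.
elim: n A => [|n IH] A mA.
  by rewrite big_ord0 /= diracE mem_set// => -[].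
rewrite big_ord_recl -IH// -product_measure1E//; last first.
  exact: (measurable_tuple_box (fun i => mA (lift ord0 i))).
apply: (congr1 (nu \x power n)).
apply/seteqP; split => [[x t] /= H|[x t] /= [Hx Ht] i].
  by split => [|i]; [exact: (H ord0)|have := H (lift ord0 i); rewrite tnthS].
by case: (unliftP ord0 i) => [j ->|->//]; rewrite tnthS; exact: Ht.
Qed.

End power.

Section bounded_measurable.
Context dX (X : measurableType dX) (R : realType).
Implicit Types (P : probability X R) (f g : X -> R).

(** Boundedness makes such a function integrable for every probability, so this one predicate is the
    only side condition of the calculus of expectations below. *)
Definition mbf f := measurable_fun [set: X] f /\ exists C, forall x, `|f x| <= C.

Lemma mbf_integrable P f : mbf f -> P.-integrable setT (EFin \o f).
Proof.
move=> [mf [C fC]]; apply: (le_integrable measurableT (g := EFin \o cst C)).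
- exact/measurable_EFinP.
- by move=> x _; rewrite /= lee_fin (le_trans (fC x))// ler_norm.
- exact: finite_measure_integrable_cst.
Qed.

Lemma mbf_cst c : mbf (fun=> c).
Proof. by split; [exact: measurable_cst|exists `|c|]. Qed.

Lemma mbfD f g : mbf f -> mbf g -> mbf (fun x => f x + g x).
Proof.
move=> [mf [C fC]] [mg [D gD]]; split; first exact: measurable_funD.
by exists (C + D) => x; rewrite (le_trans (ler_normD _ _))// lerD.
Qed.

Lemma mbfM f g : mbf f -> mbf g -> mbf (fun x => f x * g x).
Proof.
move=> [mf [C fC]] [mg [D gD]]; split; first exact: measurable_funM.
by exists (C * D) => x; rewrite normrM ler_pM.
Qed.

Lemma mbfZ c f : mbf f -> mbf (fun x => c * f x).
Proof. by move=> mf; apply: mbfM => //; exact: mbf_cst. Qed.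

Lemma mbfB f g : mbf f -> mbf g -> mbf (fun x => f x - g x).
Proof.
move=> mf mg; under [X in mbf X]funext do rewrite -mulN1r.
by apply: mbfD => //; exact: mbfZ.
Qed.

Lemma mbf_norm f : mbf f -> mbf (fun x => `|f x|).
Proof.
move=> [mf [C fC]]; split; last by exists C => x; rewrite normr_id.
exact: measurableT_comp.
Qed.

Lemma mbf_sum (I : Type) (r : seq I) (F : I -> X -> R) :
  (forall i, mbf (F i)) -> mbf (fun x => \sum_(i <- r) F i x).
Proof.
move=> mF; elim: r => [|i r IH].
  by under [X in mbf X]funext do rewrite big_nil; exact: mbf_cst.
by under [X in mbf X]funext do rewrite big_cons; exact: mbfD.
Qed.

Lemma mbf_bool (b : X -> bool) : measurable [set x | b x] ->
  mbf (fun x => (b x)%:R).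
Proof.
move=> mb; split; last by exists 1 => x; case: (b x); rewrite ?normr1 ?normr0.
rewrite (_ : (fun x => _) = \1_[set x | b x]); first exact: measurable_indic.
apply/funext => x; rewrite indicE; case: (boolP (b x)) => bx.
  by rewrite mem_set.
by rewrite memNset// => /=; apply/negP.
Qed.

Lemma mbf_if (b : X -> bool) f g : measurable [set x | b x] ->
  mbf f -> mbf g -> mbf (fun x => if b x then f x else g x).
Proof.
move=> mb mf mg.
rewrite (_ : (fun x => _) = fun x => (b x)%:R * f x + (1 - (b x)%:R) * g x).
  by apply: mbfD; apply: mbfM => //; [|apply: mbfB; first exact: mbf_cst];
    exact: mbf_bool.
by apply/funext => x; case: (b x); rewrite ?mul1r ?mul0r ?subrr ?subr0 ?mul0r ?mul1r ?addr0 ?add0r.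
Qed.

Definition Ex P f : R := \int[P]_x f x.

Lemma Ex_cst P c : Ex P (fun=> c) = c.
Proof. by rewrite /Ex Rintegral_cst//= probability_setT mulr1. Qed.

Lemma ExD P f g : mbf f -> mbf g -> Ex P (fun x => f x + g x) = Ex P f + Ex P g.
Proof. by move=> mf mg; rewrite /Ex RintegralD//; exact: mbf_integrable. Qed.

Lemma ExB P f g : mbf f -> mbf g -> Ex P (fun x => f x - g x) = Ex P f - Ex P g.
Proof. by move=> mf mg; rewrite /Ex RintegralB//; exact: mbf_integrable. Qed.

Lemma ExZ P c f : mbf f -> Ex P (fun x => c * f x) = c * Ex P f.
Proof. by move=> mf; rewrite /Ex RintegralZl//; exact: mbf_integrable. Qed.

Lemma Ex_sum P (I : Type) (r : seq I) (F : I -> X -> R) :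
  (forall i, mbf (F i)) ->
  Ex P (fun x => \sum_(i <- r) F i x) = \sum_(i <- r) Ex P (F i).
Proof.
move=> mF; elim: r => [|i r IH].
  by rewrite big_nil; under [X in Ex _ X]funext do rewrite big_nil; exact: Ex_cst.
rewrite big_cons -IH -ExD//; last exact: mbf_sum.
by congr Ex; apply/funext => x; rewrite big_cons.
Qed.

Lemma le_Ex P f g : mbf f -> mbf g -> (forall x, f x <= g x) -> Ex P f <= Ex P g.
Proof.
by move=> mf mg fg; apply: le_Rintegral => //; exact: mbf_integrable.
Qed.

Lemma mbfDc f c : mbf f -> mbf (fun x => f x + c).
Proof. by move=> mf; apply: mbfD => //; exact: mbf_cst. Qed.

Lemma mbfBc f c : mbf f -> mbf (fun x => f x - c).
Proof. by move=> mf; apply: mbfB => //; exact: mbf_cst. Qed.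

Lemma ExDc P f c : mbf f -> Ex P (fun x => f x + c) = Ex P f + c.
Proof. by move=> mf; rewrite ExD ?Ex_cst//; exact: mbf_cst. Qed.

Lemma ExBc P f c : mbf f -> Ex P (fun x => f x - c) = Ex P f - c.
Proof. by move=> mf; rewrite ExB ?Ex_cst//; exact: mbf_cst. Qed.

Lemma le_ExDc P f g c : mbf f -> mbf g -> (forall x, g x <= f x + c) ->
  Ex P g <= Ex P f + c.
Proof. by move=> mf mg fg; rewrite -ExDc//; apply: le_Ex => //; exact: mbfDc. Qed.

Lemma Ex_le P f c : mbf f -> (forall x, f x <= c) -> Ex P f <= c.
Proof. by move=> mf fc; rewrite -[leRHS](Ex_cst P); apply: le_Ex => //; exact: mbf_cst. Qed.

Lemma Ex_ge0 P f : (forall x, 0 <= f x) -> 0 <= Ex P f.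
Proof. by move=> f0; apply: Rintegral_ge0. Qed.

Lemma EFin_Ex P f : mbf f -> (Ex P f)%:E = (\int[P]_x (f x)%:E)%E.
Proof.
move=> mf; rewrite /Ex /Rintegral fineK//.
by apply: integrable_fin_num => //; exact: mbf_integrable.
Qed.

Lemma le_Ex_norm P f C : mbf f -> (forall x, `|f x| <= C) -> `|Ex P f| <= C.
Proof.
move=> mf fC; rewrite ler_norml; apply/andP; split.
  rewrite -[leLHS](Ex_cst P); apply: le_Ex => //; first exact: mbf_cst.
  by move=> x; move: (fC x); rewrite ler_norml => /andP[].
rewrite -[leRHS](Ex_cst P); apply: le_Ex => //; first exact: mbf_cst.
by move=> x; move: (fC x); rewrite ler_norml => /andP[].
Qed.

Lemma le_norm_ExB P f g : mbf f -> mbf g ->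
  `|Ex P f - Ex P g| <= Ex P (fun x => `|f x - g x|).
Proof.
move=> mf mg; rewrite -ExB// ler_norml; have mfg := mbfB mf mg.
have mn := mbf_norm mfg; apply/andP; split; last first.
  by apply: le_Ex => // x; exact: ler_norm.
rewrite lerNl -mulN1r -ExZ//; apply: le_Ex => //; first exact: mbfZ.
by move=> x; rewrite mulN1r -normrN; exact: ler_norm.
Qed.

Lemma Ex_bool P (b : X -> bool) : measurable [set x | b x] ->
  (Ex P (fun x => (b x)%:R))%:E = P [set x | b x].
Proof.
move=> mb; rewrite EFin_Ex; last exact: mbf_bool.
rewrite -(setIT [set x | b x]) -integral_indic//; apply: eq_integral => x _.
rewrite indicE; congr (_%:E); case: (boolP (b x)) => bx.
  by rewrite mem_set.
by rewrite memNset// => /=; apply/negP.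
Qed.

End bounded_measurable.

Lemma mbf_comp dX (X : measurableType dX) dY (Y : measurableType dY)
    (R : realType) (phi : X -> Y) (f : Y -> R) :
  measurable_fun setT phi -> mbf f -> mbf (f \o phi).
Proof.
move=> mphi [mf [C fC]]; split; first exact: measurableT_comp.
by exists C => x; exact: fC.
Qed.

Section bounded_fubini.
Context dX (X : measurableType dX) dY (Y : measurableType dY) (R : realType).
Variables (P : probability X R) (Q : probability Y R).

Lemma mbf_section (f : X * Y -> R) x : mbf f -> mbf (fun y => f (x, y)).
Proof. by move=> mf; apply: (mbf_comp (phi := pair x)). Qed.

Lemma mbf_Ex (f : X * Y -> R) : mbf f -> mbf (fun x => Ex Q (fun y => f (x, y))).
Proof.
move=> mf; split; last first.
  by have [_ [C fC]] := mf; exists C => x; apply: le_Ex_norm => //; exact: mbf_section.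
apply/measurable_EFinP.
rewrite (_ : _ \o _ = fubini_F Q (EFin \o f)).
  by apply: (@measurable_fubini_F _ _ _ _ _ P); exact: mbf_integrable.
by apply/funext => x /=; rewrite EFin_Ex//; exact: mbf_section.
Qed.

Lemma Ex_prod (f : X * Y -> R) : mbf f ->
  Ex (P \x Q)%E f = Ex P (fun x => Ex Q (fun y => f (x, y))).
Proof.
move=> mf; apply: EFin_inj; rewrite !EFin_Ex//; last exact: mbf_Ex.
rewrite -(integral12_prod_meas1 (mbf_integrable (P \x Q)%E mf)).
by apply: eq_integral => x _; rewrite EFin_Ex//; exact: mbf_section.
Qed.

End bounded_fubini.

Lemma Ex_distribution dX (X : measurableType dX) dY (Y : measurableType dY)
    (R : realType) (P : probability X R) (phi : {mfun X >-> Y}) (f : Y -> R) :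
  mbf f -> Ex (distribution P phi) f = Ex P (f \o phi).
Proof.
move=> mf; apply: EFin_inj; rewrite !EFin_Ex//; last exact: mbf_comp.
rewrite integral_pushforward//; first exact/measurable_EFinP/(proj1 mf).
by apply/mbf_integrable; exact: mbf_comp.
Qed.

Lemma eq_Ex dX (X : measurableType dX) (R : realType) (P Q : probability X R)
    (f : X -> R) :
  (forall A, measurable A -> P A = Q A) -> Ex P f = Ex Q f.
Proof. by move=> PQ; congr fine; apply: eq_measure_integral => A mA _; exact: PQ. Qed.

Section sample.
Context dT (T : measurableType dT) (R : realType).
Implicit Types (nu : probability T R) (h : seq T -> R).

(** [h] lives on lists of all lengths, so that sample sizes can be compared for one and the same
    function; measurability is asked one length at a time. *)
Definition bmf n h := mbf (fun t : n.-tuple T => h t).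

Definition EE nu n h : R := Ex (power nu n) (fun t : n.-tuple T => h t).

Lemma EE0 nu h : EE nu 0 h = h [::].
Proof. by rewrite /EE /Ex /Rintegral integral_power0. Qed.

Lemma bmf_tcons n h : bmf n.+1 h ->
  mbf (fun p : T * n.-tuple T => h (p.1 :: p.2)).
Proof.
move=> mh; rewrite (_ : (fun _ => _) = (fun t : n.+1.-tuple T => h t) \o @tcons _ T n).
  by apply: mbf_comp => //; exact: measurable_tcons.
by apply/funext.
Qed.

Lemma bmf_cons n h x : bmf n.+1 h -> bmf n (fun s => h (x :: s)).
Proof. by move=> /bmf_tcons mh; exact: (mbf_section x mh). Qed.

Lemma mbf_EE_cons nu n h : bmf n.+1 h -> mbf (fun x => EE nu n (fun s => h (x :: s))).
Proof. by move=> /bmf_tcons mh; exact: (mbf_Ex nu (power nu n) mh). Qed.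

Lemma EES nu n h : bmf n.+1 h ->
  EE nu n.+1 h = Ex nu (fun x => EE nu n (fun s => h (x :: s))).
Proof.
move=> mh; rewrite /EE /= Ex_distribution//.
exact: (Ex_prod nu (power nu n) (bmf_tcons mh)).
Qed.

Lemma eq_EE nu n h h' : (forall s, size s = n -> h s = h' s) ->
  EE nu n h = EE nu n h'.
Proof.
move=> hh'; congr fine; apply: eq_integral => t _.
by rewrite hh'// size_tuple.
Qed.

Lemma le_EE nu n h h' : bmf n h -> bmf n h' ->
  (forall s, size s = n -> h s <= h' s) -> EE nu n h <= EE nu n h'.
Proof. by move=> mh mh' hh'; apply: le_Ex => // t; rewrite hh'// size_tuple. Qed.

Lemma le_EEDc nu n h h' c : bmf n h -> bmf n h' ->
  (forall s, size s = n -> h' s <= h s + c) -> EE nu n h' <= EE nu n h + c.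
Proof. by move=> mh mh' hh'; apply: le_ExDc => // t; rewrite hh'// size_tuple. Qed.

Lemma measurable_tuple_cat k l :
  measurable_fun setT (fun p : k.-tuple T * l.-tuple T =>
    [tuple of p.1 ++ p.2] : (k + l).-tuple T).
Proof.
apply/measurable_fun_tnthP => i.
rewrite -(splitK i); case: (fintype.split i) => j /=.
  rewrite (_ : _ \o _ = (@tnth _ T ^~ j) \o fst).
    by apply: measurableT_comp => //; exact: measurable_tnth.
  by apply/funext => p /=; rewrite tnth_lshift.
rewrite (_ : _ \o _ = (@tnth _ T ^~ j) \o snd).
  by apply: measurableT_comp => //; exact: measurable_tnth.
by apply/funext => p /=; rewrite tnth_rshift.
Qed.

Lemma bmf_cat k l h : bmf (k + l) h ->
  mbf (fun p : k.-tuple T * l.-tuple T => h (p.1 ++ p.2)).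
Proof.
move=> mh; exact: (mbf_comp (measurable_tuple_cat (k := k) (l := l)) mh).
Qed.

Lemma bmf_EE nu k l h : bmf (k + l) h ->
  bmf k (fun xs => EE nu l (fun ys => h (xs ++ ys))).
Proof. by move=> /bmf_cat mh; exact: (mbf_Ex (power nu k) (power nu l) mh). Qed.

Lemma bmf_catr k l h (s : k.-tuple T) : bmf (k + l) h -> bmf l (fun ys => h (s ++ ys)).
Proof. by move=> /bmf_cat mh; exact: (mbf_section s mh). Qed.

Lemma EE_cat nu k l h : bmf (k + l) h ->
  EE nu (k + l) h = EE nu k (fun xs => EE nu l (fun ys => h (xs ++ ys))).
Proof.
elim: k h => [|k IH] h mh; first by rewrite EE0.
rewrite EES//; last exact: bmf_EE mh.
rewrite addSn EES//; congr Ex; apply/funext => x.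
by rewrite IH//; exact: bmf_cons.
Qed.

End sample.

(** * Gain of partial bipartite matchings *)

Section gain.
Context (T : eqType) (R : realType).
Implicit Types (U V : seq T) (s : seq (T * T)) (a : pred T).

(** A partial bipartite matching as a list of oriented pairs. Uniqueness is asked of both
    projections together, so no point is used twice even if it occurs in [U] and in [V]; only
    membership in [U] and [V] counts, not order or multiplicity. *)
Definition pairing U V s : bool :=
  [&& uniq (unzip1 s ++ unzip2 s), all (mem U) (unzip1 s) & all (mem V) (unzip2 s)].

Lemma pairing_filter U V s (b : pred (T * T)) :
  pairing U V s -> pairing U V (seq.filter b s).
Proof.
have sub : {subset seq.filter b s <= s} by move=> p; rewrite mem_filter => /andP[].
move=> /and3P[us /allP sU /allP sV]; apply/and3P; split.
- apply: subseq_uniq us.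
  by apply: cat_subseq; apply: map_subseq; exact: filter_subseq.
- by apply/allP => x /mapP[p /sub ps ->]; apply: sU; exact: map_f.
- by apply/allP => x /mapP[p /sub ps ->]; apply: sV; exact: map_f.
Qed.

Lemma pairing_sub U V U' V' s : pairing U V s ->
  {subset unzip1 s <= U'} -> {subset unzip2 s <= V'} -> pairing U' V' s.
Proof.
by move=> /and3P[us _ _] sU sV; apply/and3P; split => //; apply/allP.
Qed.

Lemma pairing1 U V s : pairing U V s -> {subset unzip1 s <= U}.
Proof. by move=> /and3P[_ /allP]. Qed.

Lemma pairing2 U V s : pairing U V s -> {subset unzip2 s <= V}.
Proof. by move=> /and3P[_ _ /allP]. Qed.

Lemma size_pairing_filter U V s a : pairing U V s ->
  (size [seq p <- s | a p.1] <= count a U)%N.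
Proof.
move=> ps; have := ps => /and3P[]; rewrite cat_uniq => /andP[us _] _ _.
rewrite -(size_map fst) -size_filter.
have -> : [seq p.1 | p <- [seq p <- s | a p.1]] = [seq x <- unzip1 s | a x].
  by rewrite filter_map.
apply: uniq_leq_size; first exact: filter_uniq.
move=> x; rewrite !mem_filter => /andP[-> xs] /=; exact: (pairing1 ps).
Qed.

Lemma size_pairing U V s : pairing U V s -> (size s <= size U)%N.
Proof.
by move=> /(size_pairing_filter predT); rewrite filter_predT count_predT.
Qed.

Variable g : T -> T -> R.

Definition gain s : R := \sum_(p <- s) g p.1 p.2.

Definition MG U V : R := sup [set gain s | s in [set s | pairing U V s]].

Lemma gain_cat s s' : gain (s ++ s') = gain s + gain s'.
Proof. by rewrite /gain big_cat. Qed.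

Lemma gain_filter (b : pred (T * T)) s :
  gain s = gain (seq.filter b s) + gain (seq.filter (predC b) s).
Proof. by rewrite /gain !big_filter (bigID b). Qed.

Variable M : R.
Hypotheses (g_ge0 : forall x y, 0 <= g x y) (g_le : forall x y, g x y <= M).

Lemma gain_le (e : R) s : (forall p, p \in s -> g p.1 p.2 <= e) ->
  gain s <= e * (size s)%:R.
Proof.
move=> ge; rewrite /gain (le_trans (_ : _ <= \sum_(p <- s) e))//.
  by rewrite !big_seq; apply: ler_sum.
by rewrite big_const_seq count_predT iter_addr addr0 mulr_natr.
Qed.

Lemma gain_le_size s : gain s <= M * (size s)%:R.
Proof. exact: gain_le. Qed.

Lemma gain_ge0 s : 0 <= gain s.
Proof. by rewrite /gain; apply: sumr_ge0. Qed.

Hypothesis M_ge0 : 0 <= M.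

Lemma MG_ge U V s : pairing U V s -> gain s <= MG U V.
Proof.
move=> ps; apply: ub_le_sup; last by exists s.
exists (M * (size U)%:R) => _ [s' /= ps' <-].
rewrite (le_trans (gain_le_size _))// ler_wpM2l// ler_nat.
exact: size_pairing ps'.
Qed.

Lemma MG_le U V c : (forall s, pairing U V s -> gain s <= c) -> MG U V <= c.
Proof.
move=> sc; apply: ge_sup; first by exists (gain [::]), [::].
by move=> _ [s ps <-]; exact: sc.
Qed.

Lemma MG_ge0 U V : 0 <= MG U V.
Proof. exact: le_trans (gain_ge0 [::]) (@MG_ge U V [::] isT). Qed.

Lemma MG_subset U V U' V' : {subset U <= U'} -> {subset V <= V'} ->
  MG U V <= MG U' V'.
Proof.
move=> sU sV; apply: MG_le => s ps; apply: MG_ge; apply: (pairing_sub ps).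
  by move=> x /(pairing1 ps)/sU.
by move=> x /(pairing2 ps)/sV.
Qed.

Lemma eq_mem_MG U V U' V' : U =i U' -> V =i V' -> MG U V = MG U' V'.
Proof.
move=> UU' VV'; apply/eqP; rewrite eq_le; apply/andP; split; apply: MG_subset;
  by move=> x; rewrite ?UU' ?VV'.
Qed.

(** The pairs whose first end satisfies [a] are dropped. There are at most [count a U] of them, and
    each carries at most [M]. *)
Lemma MG_le_count U V a :
  MG U V <= MG [seq x <- U | ~~ a x] V + M * (count a U)%:R.
Proof.
apply: MG_le => s ps; rewrite (gain_filter (fun p => a p.1)) addrC lerD//.
  apply: MG_ge; have ps' := pairing_filter (predC (fun p => a p.1)) ps.
  apply: (pairing_sub ps') => x; last exact: (pairing2 ps').
  move=> xs'; rewrite mem_filter (pairing1 ps' xs') andbT.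
  by move/mapP: xs' => [p]; rewrite mem_filter => /andP[ap _] ->.
rewrite (le_trans (gain_le_size _))// ler_wpM2l// ler_nat.
exact: size_pairing_filter ps.
Qed.

Lemma MG_le_size U V : MG U V <= M * (size U)%:R.
Proof.
apply: MG_le => s ps; rewrite (le_trans (gain_le_size _))// ler_wpM2l// ler_nat.
exact: size_pairing ps.
Qed.

Lemma MG_consl x U V : MG U V <= MG (x :: U) V <= MG U V + M.
Proof.
apply/andP; split; first by apply: MG_subset => // y; rewrite inE orbC => ->.
have [xU|xU] := boolP (x \in U).
  rewrite (@eq_mem_MG (x :: U) V U V) ?lerDl// => y.
  by rewrite inE; case: eqVneq => // ->.
rewrite (le_trans (MG_le_count _ _ (pred1 x)))//= eqxx/= lerD//.
  by apply: MG_subset => // y; rewrite mem_filter => /andP[].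
by rewrite (count_memPn xU) addn0 mulr1.
Qed.

(** Pairings on the two sides of [a] share no point, so their concatenation is again a pairing. *)
Lemma MG_block a U V :
  MG [seq x <- U | a x] [seq x <- V | a x] +
  MG [seq x <- U | ~~ a x] [seq x <- V | ~~ a x] <= MG U V.
Proof.
rewrite -lerBrDr; apply: MG_le => s ps.
rewrite lerBrDr addrC -lerBrDr; apply: MG_le => s' ps'.
rewrite lerBrDr addrC -gain_cat; apply: MG_ge.
have as1 x : x \in unzip1 s ++ unzip2 s -> a x.
  rewrite mem_cat => /orP[/(pairing1 ps)|/(pairing2 ps)];
  by rewrite mem_filter => /andP[].
have as2 x : x \in unzip1 s' ++ unzip2 s' -> ~~ a x.
  rewrite mem_cat => /orP[/(pairing1 ps')|/(pairing2 ps')];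
  by rewrite mem_filter => /andP[].
apply/and3P; split.
- rewrite /unzip1 /unzip2 !map_cat -/(unzip1 _) -/(unzip2 _).
  rewrite (perm_uniq (_ : perm_eq _
    ((unzip1 s ++ unzip2 s) ++ (unzip1 s' ++ unzip2 s')))); last first.
    by rewrite perm_catACA.
  rewrite cat_uniq; have [-> _ _] := and3P ps; have [-> _ _] := and3P ps'.
  rewrite andbT/=; apply/hasPn => x /as2 ax; apply: contra ax; exact: as1.
- apply/allP => x; rewrite /unzip1 map_cat mem_cat -!/(unzip1 _).
  move=> /orP[/(pairing1 ps)|/(pairing1 ps')];
  by rewrite mem_filter => /andP[].
- apply/allP => x; rewrite /unzip2 map_cat mem_cat -!/(unzip2 _).
  move=> /orP[/(pairing2 ps)|/(pairing2 ps')];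
  by rewrite mem_filter => /andP[].
Qed.

Section cells.
Variables (K : eqType) (c : T -> K).

Definition cell v U := [seq x <- U | c x == v].

Lemma MG_cells (r : seq K) U V : uniq r ->
  \sum_(v <- r) MG (cell v U) (cell v V) <= MG U V.
Proof.
elim: r U V => [|v r IH] U V /=; first by rewrite big_nil MG_ge0.
move=> /andP[vr ur]; rewrite big_cons.
apply: le_trans (MG_block (fun x => c x == v) U V); rewrite lerD2l.
apply: le_trans (IH _ _ ur); rewrite big_seq [leRHS]big_seq.
apply: ler_sum => u ur'.
suff cE W : cell u [seq x <- W | c x != v] = cell u W by rewrite !cE.
rewrite /cell -filter_predI; apply: eq_filter => x /=.
by case: eqVneq => // ->; apply: contraNneq vr => <-.
Qed.

(* A pair whose ends lie in different cells is charged to its first end, which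
   is bad, or has small gain. *)
Lemma MG_local (r : seq K) (bad : pred T) (e : R) U V : uniq r -> 0 <= e ->
  (forall x, x \in U -> ~~ bad x -> c x \in r) ->
  (forall x y, ~~ bad x -> c x != c y -> g x y <= e) ->
  MG U V <= \sum_(v <- r) MG (cell v U) (cell v V)
            + M * (count bad U)%:R + e * (size U)%:R.
Proof.
move=> ur e0 cr ge; apply: MG_le => s ps.
rewrite (gain_filter (fun p => bad p.1)) addrAC [leLHS]addrC.
apply: lerD; last first.
  rewrite (le_trans (gain_le_size _))// ler_wpM2l// ler_nat.
  exact: size_pairing_filter ps.
have := pairing_filter (predC (fun p => bad p.1)) ps.
set s1 := seq.filter _ s => ps1.
rewrite (gain_filter (fun p => c p.1 == c p.2)); apply: lerD; last first.
  set s2 := seq.filter _ s1; rewrite (@le_trans _ _ (e * (size s2)%:R))//.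
    apply: gain_le => p; rewrite !mem_filter => /and3P[/= cp bp _].
    exact: ge.
  rewrite ler_wpM2l// ler_nat; exact: size_pairing (pairing_filter _ ps1).
set s2 := seq.filter _ s1.
(* Each remaining pair lies within one cell, and that cell occurs exactly once in [r] because its
   first end is not bad. *)
have -> : gain s2 = \sum_(v <- r) gain [seq p <- s2 | c p.1 == v].
  under [RHS]eq_bigr do rewrite /gain big_filter big_mkcond.
  rewrite exchange_big /=; apply: eq_big_seq => p ps2.
  rewrite -big_mkcond /= (big_rem (c p.1)) /= ?eqxx; last first.
    move: ps2; rewrite !mem_filter => /and3P[_ /= bp ps2].
    by apply: cr => //; apply: (pairing1 ps); exact: map_f.
  rewrite big_seq_cond big1 ?addr0// => v; rewrite mem_rem_uniq// !inE.
  by rewrite eq_sym; case: eqP => //=; rewrite andbF.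
apply: ler_sum => v _; apply: MG_ge.
have ps2 := pairing_filter (fun p => c p.1 == v)
  (pairing_filter (fun p => c p.1 == c p.2) ps1).
apply: (pairing_sub ps2) => x xs; rewrite mem_filter.
  rewrite (pairing1 ps2 xs) andbT.
  by move/mapP: xs => [p]; rewrite mem_filter => /andP[ap _] ->.
rewrite (pairing2 ps2 xs) andbT.
move/mapP: xs => [p]; rewrite mem_filter => /andP[ap].
by rewrite mem_filter => /andP[/eqP cp _] ->; rewrite -cp.
Qed.

End cells.

(** Pairing initial segments of the two lists in order is enough when every pair has gain at least
    [e]. *)
Lemma MG_min U V (e : R) : uniq (U ++ V) ->
  (forall x y, x \in U -> y \in V -> e <= g x y) ->
  e * (minn (size U) (size V))%:R <= MG U V.
Proof.
move=> uUV ge; set n := minn _ _.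
pose s := zip (take n U) (take n V).
have sU : size (take n U) = n by rewrite size_takel// geq_minl.
have sV : size (take n V) = n by rewrite size_takel// geq_minr.
have s1 : unzip1 s = take n U by rewrite unzip1_zip// sU sV.
have s2 : unzip2 s = take n V by rewrite unzip2_zip// sU sV.
have ps : pairing U V s.
  apply/and3P; rewrite s1 s2; split; [|by apply/allP => x /mem_take..].
  apply: subseq_uniq uUV; exact: cat_subseq (take_subseq _ _) (take_subseq _ _).
apply: le_trans (MG_ge ps); rewrite /gain.
have -> : n = size s by rewrite size_zip sU sV minnn.
rewrite mulr_natr -iter_addr_0 -[X in iter X](count_predT s) -big_const_seq.
rewrite !big_seq; apply: ler_sum => p ps'; apply: ge.
  by apply: (pairing1 ps); exact: map_f.
by apply: (pairing2 ps); exact: map_f.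
Qed.

End gain.

Lemma MG_map_le (T T' : eqType) (R : realType) (g : T' -> T' -> R) (M : R)
    (phi : T -> T') U V :
  (forall x y, 0 <= g x y) -> (forall x y, g x y <= M) -> 0 <= M ->
  injective phi ->
  MG (fun x y => g (phi x) (phi y)) U V <= MG g (map phi U) (map phi V).
Proof.
move=> g0 gM M0 phiI; apply: MG_le => s ps.
pose s' := [seq (phi p.1, phi p.2) | p <- s].
have s1 : unzip1 s' = map phi (unzip1 s) by rewrite /s' /unzip1 -!map_comp.
have s2 : unzip2 s' = map phi (unzip2 s) by rewrite /s' /unzip2 -!map_comp.
have -> : gain (fun x y => g (phi x) (phi y)) s = gain g s'.
  by rewrite /gain big_map.
apply: (MG_ge gM M0); apply/and3P; rewrite s1 s2; split.
- by rewrite -map_cat map_inj_uniq//; case/and3P: ps.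
- by apply/allP => _ /mapP[x /(pairing1 ps) xU ->]; exact: map_f.
- by apply/allP => _ /mapP[x /(pairing2 ps) xU ->]; exact: map_f.
Qed.

Lemma MG_map (T T' : eqType) (R : realType) (g : T' -> T' -> R) (M : R)
    (phi : T -> T') (psi : T' -> T) U V :
  (forall x y, 0 <= g x y) -> (forall x y, g x y <= M) -> 0 <= M ->
  cancel phi psi -> cancel psi phi ->
  MG g (map phi U) (map phi V) = MG (fun x y => g (phi x) (phi y)) U V.
Proof.
move=> g0 gM M0 phiK psiK; apply/eqP; rewrite eq_le.
rewrite (MG_map_le _ _ g0 gM M0 (can_inj phiK)) andbT.
have := @MG_map_le _ _ _ (fun x y => g (phi x) (phi y)) M psi
  (map phi U) (map phi V) (fun x y => g0 _ _) (fun x y => gM _ _) M0 (can_inj psiK).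
rewrite !(mapK phiK); apply: le_trans.
rewrite (_ : (fun x y => _) = g)//.
by apply/funext => x; apply/funext => y; rewrite !psiK.
Qed.

Lemma MG_swap_le (T : eqType) (R : realType) (g : T -> T -> R) (M : R) U V :
  (forall x y, g x y <= M) -> 0 <= M ->
  MG g U V <= MG (fun x y => g y x) V U.
Proof.
move=> gM M0; apply: MG_le => s ps; pose s' := [seq (p.2, p.1) | p <- s].
have s1 : unzip1 s' = unzip2 s by rewrite /unzip1 -map_comp.
have s2 : unzip2 s' = unzip1 s by rewrite /unzip2 -map_comp.
have -> : gain g s = gain (fun x y => g y x) s' by rewrite /gain big_map.
apply: (@MG_ge _ _ _ M) => //; have /and3P[us sU sV] := ps.
by apply/and3P; rewrite s1 s2 uniq_catC.
Qed.

(** Exchanging the colours, with [g] transposed, turns this into [MG_consl]. *)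
Lemma MG_consr (T : eqType) (R : realType) (g : T -> T -> R) (M : R) y U V :
  (forall x y, g x y <= M) -> 0 <= M ->
  MG g U V <= MG g U (y :: V) <= MG g U V + M.
Proof.
move=> gM M0.
have swap W W' : MG g W W' = MG (fun x y => g y x) W' W.
  apply/eqP; rewrite eq_le (MG_swap_le _ _ gM M0)/=.
  exact: (MG_swap_le _ _ (fun x y => gM y x) M0).
by rewrite !swap; apply: (MG_consl (fun x y => gM y x)).
Qed.

Lemma uniq_map_inj (T1 T2 : eqType) (f : T1 -> T2) (s : seq T1) :
  uniq (map f s) -> {in s &, injective f}.
Proof.
elim: s => [|x s IH]//= /andP[fxs us] y z; rewrite !inE.
move=> /predU1P[->|ys] /predU1P[->|zs] // fyz.
- by move: fxs; rewrite fyz map_f.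
- by move: fxs; rewrite -fyz map_f.
- exact: IH.
Qed.

Lemma fset_card2 (K : choiceType) (e : {fset K}) : #|` e| = 2 ->
  exists x, exists2 y, x != y & e = [fset x; y]%fset.
Proof.
have := fset_uniq e; case E : (enum_fset e) => [|x [|y [|z t]]]; rewrite /= ?E//.
rewrite inE andbT => xy _; exists x, y => //; apply/fsetP => z.
by rewrite -[z \in e]/(z \in enum_fset e) E !inE.
Qed.

(** * Minimal matchings and maximal gain *)

Section matching_gain.
Context (R : realType) (d : nat).
Variable w : 'rV[R]_d -> R.
Hypotheses (w_ge0 : forall x, 0 <= w x) (w_ub : has_ubound (range w)).
Hypothesis W1 : condW1 w.
Implicit Types U V : {fset 'rV[R]_d}.

Lemma w_le_wmax x : w x <= wmax w.
Proof. by apply: ub_le_sup => //; exists x. Qed.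

Lemma wmax_ge0 : 0 <= wmax w.
Proof. exact: le_trans (w_ge0 0) (w_le_wmax 0). Qed.

Definition gap (x y : 'rV[R]_d) : R := wmax w - w (y - x).

Lemma gap_ge0 x y : 0 <= gap x y.
Proof. by rewrite subr_ge0 w_le_wmax. Qed.

Lemma gap_le x y : gap x y <= wmax w.
Proof. by rewrite gerBl w_ge0. Qed.

Lemma wstarC U V x y : wstar w U V x y = wstar w U V y x.
Proof.
by rewrite /wstar -(opprB x y) -W1 orbC (andbC (x \in V)) (andbC (x \in U)).
Qed.

Lemma wstar_le U V x y : wstar w U V x y <= wmax w.
Proof. by rewrite /wstar; case: ifP => // _; exact: w_le_wmax. Qed.

Lemma edge_weight_le U V (e : {fset 'rV[R]_d}) : #|` e| = 2 ->
  edge_weight w U V e <= wmax w.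
Proof.
rewrite /edge_weight; case: (enum_fset e) => [|x [|y [|z t]]]//= _.
exact: wstar_le.
Qed.

(** The enumeration order of a two-element finite set is unknown; evenness of [w] makes both orders
    give the same weight. *)
Lemma edge_weight2 U V x y : x != y ->
  edge_weight w U V [fset x; y]%fset = wstar w U V x y.
Proof.
move=> xy; have := cardfs2 x y; rewrite xy /= -/(enum_fset _).
have ue := fset_uniq [fset x; y]%fset.
have xe : x \in enum_fset [fset x; y]%fset by rewrite !inE eqxx.
have ye : y \in enum_fset [fset x; y]%fset by rewrite !inE eqxx orbT.
rewrite /edge_weight; move: ue xe ye.
case: (enum_fset _) => [|a [|b [|c t]]]//= _; rewrite !inE.
move=> /orP[/eqP xa|/eqP xb] /orP[/eqP ya|/eqP yb] _.
- by rewrite xa ya eqxx in xy.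
- by rewrite xa yb.
- by rewrite xb ya wstarC.
- by rewrite xb yb eqxx in xy.
Qed.

(** Edges within one colour class weigh [wmax w] and bring no gain, so they are discarded; the
    others are oriented from [U] to [V], and disjointness of the edges makes them a pairing. *)
Lemma edge_seq_gain U V (L : seq {fset 'rV[R]_d}) :
  (forall e, e \in L -> (e `<=` U `|` V)%fset /\ #|` e| = 2) ->
  uniq L ->
  (forall e e', e \in L -> e' \in L -> e != e' -> [disjoint e & e']%fset) ->
  exists s, [/\ pairing U V s,
     forall x, x \in unzip1 s ++ unzip2 s -> exists2 e, e \in L & x \in e &
     \sum_(e <- L) (wmax w - edge_weight w U V e) <= gain gap s].
Proof.
elim: L => [|e L IH] Le uL Ld.
  by exists [::]; split => //; rewrite big_nil /gain big_nil.
move: uL => /= /andP[eL uL].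
have [||s [ps sL gs]] := IH _ uL.
- by move=> e' e'L; apply: Le; rewrite inE e'L orbT.
- by move=> e1 e2 L1 L2; apply: Ld; rewrite inE ?L1 ?L2 orbT.
have [eUV e2] := Le e (mem_head _ _).
have [x [y xy eE]] := fset_card2 e2.
have ns z : z \in e -> z \notin unzip1 s ++ unzip2 s.
  move=> ze; apply/negP => /sL[e' e'L ze'].
  have ee' : e != e' by apply: contraNneq eL => ->.
  have := Ld e e' (mem_head _ _); rewrite inE e'L orbT => /(_ isT ee').
  by move=> /fdisjointP/(_ _ ze); rewrite ze'.
have sL' z : z \in unzip1 s ++ unzip2 s -> exists2 e0, e0 \in e :: L & z \in e0.
  by move=> /sL[e' e'L ze']; exists e' => //; rewrite inE e'L orbT.
have xe : x \in e by rewrite eE !inE eqxx.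
have ye : y \in e by rewrite eE !inE eqxx orbT.
(* By [ns], an edge shares no vertex with the pairing built so far, so it may be put in front of
   it. *)
have key a b : a \in e -> b \in e -> a != b -> a \in U -> b \in V ->
    exists s', [/\ pairing U V s',
     forall x, x \in unzip1 s' ++ unzip2 s' -> exists2 e', e' \in e :: L & x \in e' &
     gap a b + gain gap s <= gain gap s'].
  move=> ae be ab aU bV; exists ((a, b) :: s); split.
  - have /and3P[us sU sV] := ps; apply/and3P; split; [|by rewrite /= aU|by rewrite /= bV].
    rewrite (perm_uniq (_ : perm_eq _
      (([:: a] ++ [:: b]) ++ (unzip1 s ++ unzip2 s)))); last first.
      exact/permPl/(perm_catACA [:: a] (unzip1 s) [:: b] (unzip2 s)).
    rewrite cat_uniq us andbT; apply/andP; split; first by rewrite /= inE ab.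
    apply/hasPn => z zs; apply/negP; rewrite !inE.
    by move=> /orP[]/eqP zab; move: zs; rewrite zab; apply/negP; exact: ns.
  - move=> z; rewrite /= in_cons mem_cat in_cons => /orP[/eqP ->|].
      by exists e => //; exact: mem_head.
    rewrite orbCA => /orP[/eqP ->|]; first by exists e => //; exact: mem_head.
    by rewrite -mem_cat; exact: sL'.
  - by rewrite /gain big_cons.
rewrite big_cons eE edge_weight2// /wstar.
case: ifPn => [/orP[/andP[xU yV]|/andP[xV yU]]|_].
- have [s' [ps' sL2 gs']] := key x y xe ye xy xU yV; exists s'; split => //.
    by rewrite -eE.
  by apply: le_trans gs'; rewrite lerD2l.
- have yx : y != x by rewrite eq_sym.
  have [s' [ps' sL2 gs']] := key y x ye xe yx yU xV; exists s'; split => //.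
    by rewrite -eE.
  by apply: le_trans gs'; rewrite /gap -(opprB y x) -W1 lerD2l.
- exists s; split => //; first by rewrite -eE.
  by rewrite subrr add0r.
Qed.

Lemma half_subD n k : (k.*2 <= n)%N -> (k + (n - k.*2)./2 = n./2)%N.
Proof.
move=> kn; rewrite -[in RHS](subnKC kn) halfD doubleK odd_double/= add0n//.
Qed.

Lemma BM_MG U V :
  BM w U V = wmax w * (#|` (U `|` V)%fset|./2)%:R - MG gap U V.
Proof.
apply/eqP; rewrite eq_le; apply/andP; split; last first.
  have [tau [tau2 tauE tauD] [-> _]] := BM_min w U V.
  have [s [ps _ gs]] := edge_seq_gain tauE (fset_uniq tau) tauD.
  rewrite lerBlDr -lerBlDl; apply: le_trans (MG_ge gap_le wmax_ge0 ps).
  apply: le_trans gs; rewrite sumrB -/(matching_weight w U V tau) lerD2r.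
  rewrite big_const_seq count_predT iter_addr addr0 -tau2 mulr_natr.
  by rewrite -/(enum_fset tau).
rewrite lerBrDr -lerBrDl; apply: MG_le => s ps; rewrite lerBrDl -lerBrDr.
pose X := (U `|` V)%fset; have /and3P[us /allP sU /allP sV] := ps.
have [us1 us2 s12] : [/\ uniq (unzip1 s), uniq (unzip2 s) &
    forall x, x \in unzip1 s -> x \in unzip2 s -> false].
  move: us; rewrite cat_uniq => /and3P[-> s12 ->]; split => // x x1 x2.
  by move/hasPn : s12 => /(_ _ x2); rewrite x1.
pose Z := [fset x in unzip1 s ++ unzip2 s]%fset.
have cZ : #|` Z| = (size s).*2.
  by rewrite card_fseq undup_id// size_cat !size_map addnn.
have ZE x : (x \in Z) = (x \in unzip1 s) || (x \in unzip2 s).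
  by rewrite -mem_cat in_fset /=.
have ZX : (Z `<=` X)%fset.
  apply/fsubsetP => x; rewrite ZE => xZ; rewrite in_fsetU.
  by case/orP : xZ => [/sU/= ->//|/sV/= ->]; rewrite orbT.
pose Y := (X `\` Z)%fset.
have cY : #|` Y| = (#|` X| - (size s).*2)%N by rewrite cardfsD (fsetIidPr ZX) cZ.
have cX : ((size s).*2 <= #|` X|)%N by rewrite -cZ fsubset_leq_card.
(* The leftover points are matched arbitrarily. *)
have [tau [tau2 tauE tauD]] := near_perfect_matching_exists Y.
pose ed (p : 'rV[R]_d * 'rV[R]_d) := [fset p.1; p.2]%fset.
have p12 p q : p \in s -> q \in s -> p.1 != q.2.
  move=> ps1 qs; apply/eqP => pq.
  suff : false by [].
  by apply: (s12 p.1); [exact: map_f|rewrite pq; exact: map_f].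
have edI p q x : p \in s -> q \in s -> x \in ed p -> x \in ed q -> p = q.
  move=> ps1 qs; rewrite !inE => /orP[/eqP ->|/eqP ->] /orP[] /eqP.
  - exact: (uniq_map_inj us1).
  - by move=> pq; have := p12 p q ps1 qs; rewrite pq eqxx.
  - by move=> pq; have := p12 q p qs ps1; rewrite pq eqxx.
  - exact: (uniq_map_inj us2).
have edp p : p.1 \in ed p by rewrite !inE eqxx.
have us0 : uniq s by exact: map_uniq us1.
pose L := map ed s.
have uL : uniq L.
  by rewrite map_inj_in_uniq// => p q ps1 qs pq; apply: (edI p q p.1); rewrite -?pq.
have LZ p x : p \in s -> x \in ed p -> x \in Z.
  move=> ps1; rewrite ZE !inE => /orP[] /eqP ->; apply/orP.
    by left; exact: map_f.
  by right; exact: map_f.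
have LtauN e e' : e \in L -> e' \in tau -> [disjoint e & e']%fset.
  move=> /mapP[p ps1 ->] /tauE[/fsubsetP e'Y _]; apply/fdisjointP => x xp.
  by apply/negP => /e'Y; rewrite inE (LZ p).
have uLtau : uniq (L ++ enum_fset tau).
  rewrite cat_uniq uL fset_uniq andbT/=; apply/hasPn => e etau.
  apply/negP => eL; have [_ e2] := tauE e etau.
  have /fset0Pn[x xe] : e != fset0 by rewrite -cardfs_gt0 e2.
  by have /fdisjointP/(_ x xe) := LtauN e e eL etau; rewrite xe.
pose tau' := [fset e in L ++ enum_fset tau]%fset.
have tau'E e : (e \in tau') = (e \in L) || (e \in tau) by rewrite in_fset /= mem_cat.
have ptau' : near_perfect_matching X tau'.
  split.
  - rewrite card_fseq undup_id// size_cat size_map.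
    by rewrite -[size (enum_fset tau)]/(#|` tau|) tau2 cY half_subD.
  - move=> e; rewrite tau'E => /orP[/mapP[p ps1 ->]|/tauE[eY e2]]; split => //.
    + by apply: fsubset_trans ZX; apply/fsubsetP => x; exact: LZ.
    + by rewrite cardfs2 p12.
    + by apply: fsubset_trans eY _; exact: fsubsetDl.
  - move=> e e'; rewrite !tau'E => /orP[eL|etau] /orP[e'L|e'tau] ee'.
    + move/mapP : eL e'L ee' => [p ps1 ->] /mapP[q qs ->] pq.
      apply/fdisjointP => x xp; apply/negP => xq.
      by move: pq; rewrite (edI p q x)// eqxx.
    + exact: LtauN.
    + by rewrite fdisjoint_sym; exact: LtauN.
    + exact: tauD.
have [_ _ [_ /(_ _ ptau') BMle]] := BM_min w U V.
apply: (le_trans BMle); rewrite /matching_weight.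
rewrite (perm_big (L ++ enum_fset tau)) /=; last first.
  apply: uniq_perm => //; first exact: fset_uniq.
  by move=> e; rewrite tau'E mem_cat.
rewrite big_cat /= big_map -(half_subD cX) natrD mulrDr -cY -tau2 addrAC lerD//.
  rewrite -[X in _ <= X - _](_ : \sum_(p <- s) wmax w = _); last first.
    by rewrite big_const_seq count_predT iter_addr addr0 mulr_natr.
  rewrite /gain -sumrB !big_seq; apply: ler_sum => p ps1.
  have p1U : p.1 \in U by apply: sU; exact: map_f.
  have p2V : p.2 \in V by apply: sV; exact: map_f.
  rewrite /ed edge_weight2 ?p12// /wstar p1U p2V /=.
  by rewrite /gap subKr.
rewrite (le_trans (_ : _ <= \sum_(e <- enum_fset tau) wmax w))//.
  by rewrite !big_seq; apply: ler_sum => e /tauE[_ /edge_weight_le].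
by rewrite big_const_seq count_predT iter_addr addr0 mulr_natr.
Qed.

End matching_gain.

(** * Measurability of the gain of a sample *)

Section measurable_bool.
Context dX (X : measurableType dX) (R : realType).
Implicit Types b : X -> bool.

Lemma measurable_bool_set b : measurable_fun [set: X] b -> measurable [set x | b x].
Proof. by move=> mb; rewrite -[X in measurable X]setTI; exact: (mb measurableT [set true]). Qed.

Lemma measurable_set_bool b : measurable [set x | b x] -> measurable_fun [set: X] b.
Proof.
move=> mb; apply: (measurable_fun_bool true) => //.
by rewrite [X in measurable X](_ : _ = [set x | b x]) // setTI preimage_true.
Qed.

Lemma measurable_all (I : Type) (r : seq I) (b : I -> X -> bool) :
  (forall i, measurable_fun [set: X] (b i)) ->
  measurable_fun [set: X] (fun x => all (b ^~ x) r).
Proof.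
by move=> mb; elim: r => [|i r IH] /=; [exact: measurable_cst|exact: measurable_and].
Qed.

Lemma measurable_eq_rV d (f h : X -> 'rV[R]_d) :
  measurable_fun [set: X] f -> measurable_fun [set: X] h ->
  measurable_fun [set: X] (fun x => f x == h x).
Proof.
move=> mf mh.
rewrite (_ : (fun x => f x == h x) =
    fun x => all (fun i => rV_coord i (f x) == rV_coord i (h x)) (enum 'I_d)).
  apply: (@measurable_all _ _ (fun i x => rV_coord i (f x) == rV_coord i (h x))) => i.
  by apply: measurable_fun_eqr;
    apply: (measurableT_comp (measurable_rV_coord i)).
apply/funext => x; apply/eqP/allP => [-> //|fh].
by apply/rowP => i; apply/eqP/fh; rewrite mem_enum.
Qed.

Lemma measurable_uniq d (I : Type) (r : seq I) (f : I -> X -> 'rV[R]_d) :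
  (forall i, measurable_fun [set: X] (f i)) ->
  measurable_fun [set: X] (fun x => uniq [seq f i x | i <- r]).
Proof.
move=> mf; elim: r => [|i r IH] /=; first exact: measurable_cst.
apply: measurable_and => //.
rewrite (_ : (fun x => _) = fun x => all (fun j => ~~ (f i x == f j x)) r).
  apply: (@measurable_all _ _ (fun j x => ~~ (f i x == f j x))) => j.
  by apply: measurable_neg; exact: measurable_eq_rV.
apply/funext => x; elim: r {IH} => //= j r IH.
by rewrite inE negb_or IH.
Qed.

End measurable_bool.

Section measurable_gain.
Context (R : realType) (d : nat).
Notation T := 'rV[R]_d.
Variables (g : T -> T -> R) (M : R).
Hypotheses (g_ge0 : forall x y, 0 <= g x y) (g_le : forall x y, g x y <= M).
Hypothesis M_ge0 : 0 <= M.
Hypothesis g_meas : measurable_fun setT (fun p : T * T => g p.1 p.2).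

(** The supremum exceeds [c] exactly when some list of index pairs gives an admissible pairing of
    gain above [c]. There are countably many such lists, and each one defines a measurable event. *)
Lemma bmf_MG k N (a : pred T) : measurable_fun setT a ->
  bmf N (fun s => MG g [seq x <- take k s | a x] [seq x <- drop k s | a x]).
Proof.
move=> ma; set F := fun s => _; split; last first.
  exists (M * N%:R) => t; rewrite ger0_norm ?(MG_ge0 g_ge0 g_le)//.
  rewrite (le_trans (MG_le_size g_le M_ge0 _ _))// ler_wpM2l// ler_nat.
  rewrite size_filter (leq_trans (count_size _ _))//.
  by rewrite size_take size_tuple; case: ltnP => // kN; exact: ltnW.
pose ok (sg : seq ('I_N * 'I_N)) (c : R) (t : N.-tuple T) :=
  [&& uniq [seq tnth t i | i <- unzip1 sg ++ unzip2 sg],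
      all (fun p : ('I_N * 'I_N) => [&& (p.1 < k)%N, (k <= p.2)%N, a (tnth t p.1) & a (tnth t p.2)]) sg
    & c < \sum_(p <- sg) g (tnth t p.1) (tnth t p.2)].
have okP c : [set t : N.-tuple T | c < F t] = \bigcup_sg [set t | ok sg c t].
  apply/seteqP; split => [t /= cF|t [sg _ /= /and3P[usg asg csg]]].
    have [|_ [s ps <-] cs] := sup_gt _ cF; first by exists 0, [::]; rewrite // /gain big_nil.
    (* Points of a pairing are turned back into positions in [t]: below [k] for the first colour,
       from [k] on for the second. *)
    have lift (b : seq T) (P : pred nat) x : x \in [seq x <- b | a x] ->
        (forall y, y \in b -> exists2 i : 'I_N, P i & tnth t i = y) ->
        exists i : 'I_N, [/\ P i, a (tnth t i) & tnth t i = x].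
      by rewrite mem_filter => /andP[ax xb] /(_ _ xb)[i Pi iE]; exists i; rewrite iE.
    have lift1 x : x \in [seq x <- take k t | a x] ->
        exists i : 'I_N, [/\ (i < k)%N, a (tnth t i) & tnth t i = x].
      move=> xU; apply: (lift (take k t) (fun i => i < k)%N) => // y.
      move=> /(nthP 0)[i]; rewrite size_take size_tuple => ik <-.
      have iN : (i < N)%N.
        by move: ik; case: (ltnP k N); lia.
      have ik' : (i < k)%N by move: ik; case: (ltnP k N); lia.
      by exists (Ordinal iN) => //; rewrite nth_take// (tnth_nth 0).
    have lift2 x : x \in [seq x <- drop k t | a x] ->
        exists i : 'I_N, [/\ (k <= i)%N, a (tnth t i) & tnth t i = x].
      move=> xU; apply: (lift (drop k t) (fun i => k <= i)%N) => // y.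
      move=> /(nthP 0)[i]; rewrite size_drop size_tuple => ik <-.
      have iN : (k + i < N)%N by rewrite -ltn_subRL.
      by exists (Ordinal iN); rewrite ?leq_addr//= nth_drop (tnth_nth 0).
    have [sg sgE asg] : exists2 sg : seq ('I_N * 'I_N),
        s = [seq (tnth t p.1, tnth t p.2) | p <- sg] &
        all (fun p : ('I_N * 'I_N) => [&& (p.1 < k)%N, (k <= p.2)%N, a (tnth t p.1) & a (tnth t p.2)]) sg.
      move: (pairing1 ps) (pairing2 ps); elim: s {ps cs} => [|[x y] s IH] s1 s2.
        by exists [::].
      have [||sg -> asg] := IH.
      - by move=> z zs; apply: s1; rewrite inE zs orbT.
      - by move=> z zs; apply: s2; rewrite inE zs orbT.
      have [i [ik ai <-]] := lift1 x (s1 x (mem_head _ _)).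
      have [j [kj aj <-]] := lift2 y (s2 y (mem_head _ _)).
      by exists ((i, j) :: sg) => //=; rewrite ik kj ai aj.
    exists sg => //; apply/and3P; split => //; last first.
      by move: cs; rewrite /gain sgE big_map.
    have /and3P[us _ _] := ps; move: us; rewrite sgE /unzip1 /unzip2 -!map_comp.
    by rewrite map_cat -!map_comp.
  pose s := [seq (tnth t p.1, tnth t p.2) | p <- sg].
  suff ps : pairing [seq x <- take k t | a x] [seq x <- drop k t | a x] s.
    apply: (lt_le_trans csg); apply: le_trans (MG_ge g_le M_ge0 ps).
    by rewrite /gain big_map.
  apply/and3P; split.
  - by move: usg; rewrite map_cat /unzip1 /unzip2 -!map_comp.
  - apply/allP => _ /mapP[_ /mapP[p /(allP asg) /and4P[p1 p2 ap1 ap2] ->] ->] /=.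
    rewrite mem_filter ap1 /= (tnth_nth 0) -(nth_take _ p1).
    by apply: mem_nth; rewrite size_take size_tuple; case: (ltnP k N) => _; rewrite ?p1 ?ltn_ord.
  - apply/allP => _ /mapP[_ /mapP[p /(allP asg) /and4P[p1 p2 ap1 ap2] ->] ->] /=.
    rewrite mem_filter ap2 /= (tnth_nth 0) -(subnKC p2) -nth_drop.
    by apply: mem_nth; rewrite size_drop size_tuple ltn_sub2rE ?ltn_ord.
apply: (measurability _ (RGenOInfty.measurableE R)).
move=> _ [_ [c ->] <-]; rewrite setTI.
rewrite (_ : _ @^-1` _ = [set t : N.-tuple T | c < F t]); last first.
  by apply/seteqP; split => t /=; rewrite in_itv/= andbT.
rewrite okP; apply: countable_bigcupT_measurable => [|sg]; first exact: countableP.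
apply: measurable_bool_set; apply: measurable_and.
  apply: measurable_uniq => i; exact: measurable_tnth.
apply: measurable_and.
  apply: (@measurable_all _ _ _ _ (fun (p : 'I_N * 'I_N) t =>
    [&& (p.1 < k)%N, (k <= p.2)%N, a (tnth t p.1) & a (tnth t p.2)])) => p.
  do 2 (apply: measurable_and; first exact: measurable_cst).
  by apply: measurable_and; apply: (measurableT_comp ma); exact: measurable_tnth.
apply: measurable_fun_ltr => //.
apply: measurable_sum => p.
rewrite (_ : (fun _ => _) = (fun q : T * T => g q.1 q.2) \o
  (fun t : N.-tuple T => (tnth t p.1, tnth t p.2)))//.
apply: measurableT_comp => //.
by apply: measurable_fun_pair; exact: measurable_tnth.
Qed.

End measurable_gain.

Section two_samples.
Context dT (T : measurableType dT) (R : realType).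
Implicit Types (F : seq T -> seq T -> R) (a : pred T).

Definition mbf2 F := forall k l,
  mbf (fun p : k.-tuple T * l.-tuple T => F p.1 p.2).

Lemma mbf2_bmf F k l (nu : probability T R) : mbf2 F ->
  bmf k (fun xs => EE nu l (fun ys => F xs ys)).
Proof. by move=> mF; apply: (mbf_Ex (power nu k) (power nu l) (mF k l)). Qed.

Lemma mbf2_bmfr F k l (t : k.-tuple T) : mbf2 F -> bmf l (fun ys => F t ys).
Proof. by move=> mF; exact: (mbf_section t (mF k l)). Qed.

Lemma mbf2_swap F : mbf2 F -> mbf2 (fun xs ys => F ys xs).
Proof.
move=> mF k l.
apply: (mbf_comp (phi := fun p : k.-tuple T * l.-tuple T => (p.2, p.1)) _ (mF l k)).
exact: measurable_fun_pair.
Qed.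

Lemma mbf2_bmf_cat F k l : mbf2 F -> bmf (k + l) (fun s => F (take k s) (drop k s)).
Proof.
move=> mF.
have tk (t : (k + l).-tuple T) : size (take k t) == k.
  by rewrite size_takel// size_tuple leq_addr.
have dk (t : (k + l).-tuple T) : size (drop k t) == l.
  by rewrite size_drop size_tuple addKn.
apply: (mbf_comp (phi := fun t : (k + l).-tuple T => (Tuple (tk t), Tuple (dk t))) _ (mF k l)).
apply: measurable_fun_pair; apply/measurable_fun_tnthP => i.
  rewrite (_ : _ \o _ = (@tnth _ T ^~ (lshift l i))); first exact: measurable_tnth.
  apply/funext => t /=; have x0 := tnth t (lshift l i).
  by rewrite !(tnth_nth x0)/= nth_take.
rewrite (_ : _ \o _ = (@tnth _ T ^~ (rshift k i))); first exact: measurable_tnth.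
apply/funext => t /=; have x0 := tnth t (rshift k i).
by rewrite !(tnth_nth x0)/= nth_drop.
Qed.

Lemma mbf2_catE F (nu : probability T R) k l : mbf2 F ->
  EE nu (k + l) (fun s => F (take k s) (drop k s)) =
  EE nu k (fun xs => EE nu l (fun ys => F xs ys)).
Proof.
move=> mF; rewrite EE_cat; last exact: mbf2_bmf_cat.
apply: eq_EE => xs sxs; apply: eq_EE => ys sys.
by rewrite take_size_cat// drop_size_cat.
Qed.

Lemma measurable_fun_thead dX (X : measurableType dX) n (f : X -> n.+1.-tuple T) :
  measurable_fun [set: X] f -> measurable_fun [set: X] (fun x => thead (f x)).
Proof. by move=> mf; exact: (measurableT_comp (measurable_tnth ord0) mf). Qed.

Lemma measurable_fun_behead dX (X : measurableType dX) n (f : X -> n.+1.-tuple T) :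
  measurable_fun [set: X] f ->
  measurable_fun [set: X] (fun x => [tuple of behead (f x)] : n.-tuple T).
Proof.
move=> mf; rewrite (_ : (fun x => _) =
  (fun t : n.+1.-tuple T => [tuple of behead t] : n.-tuple T) \o f)//.
by apply: measurableT_comp => //; exact: measurable_behead.
Qed.

Lemma mbf2_filterr a F : measurable_fun [set: T] a -> mbf2 F ->
  mbf2 (fun xs ys => F xs [seq y <- ys | a y]).
Proof.
move=> ma mF k l; elim: l k F mF => [|l IH] k F mF.
  rewrite (_ : (fun _ => _) = (fun p : k.-tuple T * 0.-tuple T => F p.1 p.2)) //.
  by apply/funext => -[x t] /=; rewrite tuple0.
(* A kept head is parked in front of the first sample, which keeps the sizes deterministic, and [F']
   moves it back in front of the second. The value 0 occurs only for an empty first sample, which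
   [k.+1] excludes. *)
pose F' zs ys := if zs is z :: zs' then F zs' (z :: ys) else 0.
have mF' : mbf2 F'.
  move=> [|k'] l'.
    rewrite (_ : (fun _ => _) = fun=> 0); first exact: mbf_cst.
    by apply/funext => -[x t] /=; rewrite tuple0.
  rewrite (_ : (fun _ => _) = (fun p : k'.-tuple T * l'.+1.-tuple T => F p.1 p.2) \o
    (fun p : k'.+1.-tuple T * l'.-tuple T =>
       ([tuple of behead p.1], [tuple of thead p.1 :: p.2]))).
    apply: mbf_comp => //; apply: measurable_fun_pair.
      exact: measurable_fun_behead.
    by apply: measurable_cons => //; exact: measurable_fun_thead.
  by apply/funext => -[x t] /=; case/tupleP: x.
have mth : measurable_fun setT (fun p : k.-tuple T * l.+1.-tuple T => thead p.2).
  exact: measurable_fun_thead.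
have mbh : measurable_fun setT
    (fun p : k.-tuple T * l.+1.-tuple T => [tuple of behead p.2]).
  exact: measurable_fun_behead.
rewrite (_ : (fun _ => _) = fun p : k.-tuple T * l.+1.-tuple T =>
   if a (thead p.2) then F' (thead p.2 :: p.1) [seq y <- behead p.2 | a y]
   else F p.1 [seq y <- behead p.2 | a y]); last first.
  by apply/funext => -[x t] /=; case/tupleP: t => y t /=; case: ifP.
apply: mbf_if.
- by apply: measurable_bool_set; exact: (measurableT_comp ma).
- apply: (mbf_comp (phi := fun p : k.-tuple T * l.+1.-tuple T =>
    ([tuple of thead p.2 :: p.1], [tuple of behead p.2])) _ (IH k.+1 F' mF')).
  by apply: measurable_fun_pair => //; exact: measurable_cons.
- apply: (mbf_comp (phi := fun p : k.-tuple T * l.+1.-tuple T =>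
    (p.1, [tuple of behead p.2])) _ (IH k F mF)).
  exact: measurable_fun_pair.
Qed.

Lemma mbf2_filter a F : measurable_fun [set: T] a -> mbf2 F ->
  mbf2 (fun xs ys => F [seq x <- xs | a x] [seq y <- ys | a y]).
Proof.
move=> ma mF; apply: (@mbf2_filterr a (fun xs ys => F [seq x <- xs | a x] ys)) => //.
exact: (mbf2_swap (mbf2_filterr ma (mbf2_swap mF))).
Qed.

Lemma bmf_filter a (h : seq T -> R) n : measurable_fun [set: T] a ->
  (forall n, bmf n h) -> bmf n (fun s => h [seq x <- s | a x]).
Proof.
move=> ma mh.
have mF : mbf2 (fun (_ ys : seq T) => h ys).
  by move=> k l; apply: (mbf_comp (phi := snd) _ (mh l)).
exact: (@mbf2_bmfr (fun _ ys => h [seq y <- ys | a y]) 0 n [tuple]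
  (mbf2_filterr ma mF)).
Qed.

End two_samples.

(** * Binomial thinning *)

Section thinning.
Context (R : realType) (q : R).
Hypothesis q01 : 0 <= q <= 1.
Implicit Types phi psi : nat -> R.

(* Expectation of phi at a binomial variable with parameters n and q. *)
Fixpoint thin n phi : R :=
  if n is n'.+1 then (1 - q) * thin n' phi + q * thin n' (phi \o succn) else phi 0.

Lemma thinD n phi psi : thin n (fun k => phi k + psi k) = thin n phi + thin n psi.
Proof.
by elim: n phi psi => [//|n IH] phi psi /=; rewrite -!/(fun k => _) !IH; ring.
Qed.

Lemma thinZ n c phi : thin n (fun k => c * phi k) = c * thin n phi.
Proof. by elim: n phi => [//|n IH] phi /=; rewrite !IH; ring. Qed.

Lemma thin_cst n c : thin n (fun=> c) = c.
Proof. by elim: n => [//|n IH] /=; rewrite !IH; ring. Qed.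

Lemma le_thin n phi psi : (forall k, phi k <= psi k) -> thin n phi <= thin n psi.
Proof.
move/andP: q01 => [q0 q1]; elim: n phi psi => [|n IH] phi psi le /=; first exact: le.
by rewrite lerD// ler_wpM2l ?subr_ge0//; apply: IH => // k; exact: le.
Qed.

(** Binomial variance plus squared bias; the bias is kept general because the induction shifts [c]
    by one. *)
Lemma thin_sqr n c :
  thin n (fun k => (k%:R - c) ^+ 2) = n%:R * q * (1 - q) + (n%:R * q - c) ^+ 2.
Proof.
elim: n c => [|n IH] c /=; first by ring.
have -> : (fun k => (k%:R - c) ^+ 2) \o succn = (fun k => (k%:R - (c - 1)) ^+ 2 : R).
  by apply/funext => k /=; rewrite -natr1; ring.
by rewrite !IH -natr1; ring.
Qed.

(** From y <= (kap y ^ 2 + 1 / kap) / 2 applied to the deviation y. A small [kap] makes the first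
    term a small fraction of the mean, while the term in 1 / kap disappears after division by the
    sample size. *)
Lemma thin_dist n (kap : R) : 0 < kap ->
  thin n (fun k => `|k%:R - n%:R * q|) <= (kap * (n%:R * q) + kap^-1) / 2.
Proof.
move=> k0; move/andP: q01 => [q0 q1].
apply: (@le_trans _ _ (thin n (fun k => kap / 2 * (k%:R - n%:R * q) ^+ 2 + kap^-1 / 2))).
  apply: le_thin => k; set y := `|_|.
  rewrite -(real_normK (num_real (k%:R - n%:R * q))) -/y.
  rewrite -subr_ge0 (_ : _ - y = (kap * y - 1) ^+ 2 * (kap^-1 / 2)).
    by rewrite mulr_ge0 ?sqr_ge0 ?divr_ge0 ?invr_ge0 ?ltW.
  by field; rewrite gt_eqF.
rewrite thinD thinZ thin_cst thin_sqr subrr expr0n addr0 mulrDl lerD2r.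
rewrite mulrAC ler_pM2r// ler_pM2l// ler_piMr ?mulr_ge0//.
by rewrite gerBl.
Qed.

Lemma thin_near n phi (M kap : R) k0 : 0 < kap -> 0 <= M ->
  (forall k l, `|phi k - phi l| <= M * `|k%:R - l%:R|) ->
  `|thin n phi - phi k0| <=
    M * ((kap * (n%:R * q) + kap^-1) / 2 + `|n%:R * q - k0%:R|).
Proof.
move=> kap0 M0 phiM; set c := n%:R * q.
have le k : `|phi k - phi k0| <= M * (`|k%:R - c| + `|c - k0%:R|).
  rewrite (le_trans (phiM _ _))// ler_wpM2l//.
  by rewrite (le_trans _ (ler_normD _ _))// addrA subrK.
have B : thin n (fun k => M * (`|k%:R - c| + `|c - k0%:R|)) <=
    M * ((kap * c + kap^-1) / 2 + `|c - k0%:R|).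
  by rewrite thinZ thinD thin_cst ler_wpM2l// lerD2r; exact: thin_dist.
set D := (fun k => _) in B.
have A1 : thin n phi <= phi k0 + thin n D.
  rewrite -(thin_cst n (phi k0)) -thinD; apply: le_thin => k.
  by have := le k; rewrite ler_norml /D; lra.
have A2 : phi k0 <= thin n phi + thin n D.
  rewrite -{1}(thin_cst n (phi k0)) -thinD; apply: le_thin => k.
  by have := le k; rewrite ler_norml /D; lra.
by rewrite ler_norml; lra.
Qed.

End thinning.

Lemma Ex_thin dX (X : measurableType dX) (R : realType) (u : probability X R)
    (q : R) n (phi : X -> nat -> R) : (forall k, mbf (phi ^~ k)) ->
  mbf (fun x => thin q n (phi x)) /\
  Ex u (fun x => thin q n (phi x)) = thin q n (fun k => Ex u (phi ^~ k)).
Proof.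
elim: n phi => [|n IH] phi mphi /=; first by split.
have [m1 e1] := IH phi mphi.
have [|m2 e2] := IH (fun x => phi x \o succn); first by move=> k; exact: mphi.
split; first by apply: mbfD; exact: mbfZ.
by rewrite ExD ?ExZ// ?e1 ?e2//; exact: mbfZ.
Qed.

(** * Restricting a sample to a region *)

Section filter_sample.
Context dT (T : measurableType dT) (R : realType).
Variables (nu u : probability T R) (a : pred T) (q e M : R).
Hypotheses (ma : measurable_fun [set: T] a) (q01 : 0 <= q <= 1) (M_ge0 : 0 <= M).
(** The restriction of [nu] to [a] and the measure q u are [e]-close in the sense of total
    variation, tested on functions with values in [0, 1]. *)
Hypothesis near : forall phi : T -> R, mbf phi -> (forall x, 0 <= phi x <= 1) ->
  `|Ex nu (fun x => (a x)%:R * phi x) - q * Ex u phi| <= e.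

Definition incr_le (h : seq T -> R) :=
  forall s1 x s2, h (s1 ++ s2) <= h (s1 ++ x :: s2) <= h (s1 ++ s2) + M.

Lemma near_scaled (phi : T -> R) : mbf phi -> (forall x, 0 <= phi x <= M) ->
  `|Ex nu (fun x => (a x)%:R * phi x) - q * Ex u phi| <= M * e.
Proof.
move=> mphi phi0M; have [M0|M0] := eqVneq M 0.
  have phi0 : phi = fun=> 0.
    apply/funext => x; apply/eqP; rewrite eq_le.
    by have := phi0M x; rewrite M0 => /andP[-> ->].
  rewrite phi0 M0 mul0r Ex_cst mulr0 subr0.
  by under [X in Ex _ X]funext do rewrite mulr0; rewrite Ex_cst normr0.
have Mp : 0 < M by rewrite lt_neqAle eq_sym M0.
have mphi' : mbf (fun x => M^-1 * phi x) by exact: mbfZ.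
have phi01 x : 0 <= M^-1 * phi x <= 1.
  have /andP[p0 pM] := phi0M x.
  apply/andP; split; last by rewrite ler_pdivrMl// mulr1.
  by apply: mulr_ge0 => //; rewrite invr_ge0.
have := near mphi' phi01; rewrite ExZ//.
have -> : (fun x => (a x)%:R * (M^-1 * phi x)) = (fun x => M^-1 * ((a x)%:R * phi x)).
  by apply/funext => x; rewrite mulrCA.
rewrite ExZ; last by apply: mbfM => //; apply: mbf_bool; exact: measurable_bool_set.
rewrite mulrCA -mulrBr normrM gtr0_norm ?invr_gt0// ler_pdivrMl//.
Qed.

Lemma EE_incr_cons (n : nat) (h : seq T -> R) x (nu' : probability T R) :
  (forall n, bmf n h) -> incr_le h ->
  EE nu' n h <= EE nu' n (fun s => h (x :: s)) <= EE nu' n h + M.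
Proof.
move=> mh ih; have mhx : bmf n (fun s => h (x :: s)) by exact: bmf_cons.
apply/andP; split.
  by apply: le_EE => // s _; have /andP[] := ih [::] x s.
by apply: le_EEDc => // s _; have /andP[] := ih [::] x s.
Qed.

(** Points are replaced one at a time. The effect of one point on the mean of the rest lies in
    [0, M], so exchanging its law costs at most M e; there are [n] exchanges, and what they leave is
    a binomial number of points of law [u]. *)
Lemma EE_filter_thin n h : (forall n, bmf n h) -> incr_le h ->
  `|EE nu n (fun s => h [seq x <- s | a x]) - thin q n (fun k => EE u k h)|
    <= n%:R * (M * e).
Proof.
have mf := bmf_filter (a := a) (R := R) _ ma.
elim: n h => [|n IH] h mh ih; first by rewrite /= !EE0 subrr normr0 mul0r.
have mhx x k : bmf k (fun s => h (x :: s)) by apply: bmf_cons; exact: mh.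
have ihx x : incr_le (fun s => h (x :: s)) by move=> s1 y s2; exact: (ih (x :: s1)).
pose H1 := EE nu n (fun s => h [seq x <- s | a x]).
pose A x := EE nu n (fun s => h (x :: [seq y <- s | a y])).
have mhf k : bmf k (fun s => h [seq x <- s | a x]) by exact: mf.
have mcat : mbf2 (fun xs ys => h (xs ++ ys)) by move=> k l; exact: bmf_cat.
have mA : mbf A.
  have m1 := mbf2_bmf 1 n nu (mbf2_filterr ma mcat).
  apply: (mbf_comp (phi := fun x : T => [tuple x]) _ m1).
  by apply: measurable_cons => //; exact: measurable_cst.
have A01 x : 0 <= A x - H1 <= M.
  have mhxf : bmf n (fun s => h (x :: [seq y <- s | a y])).
    exact: (mf (fun s => h (x :: s))).
  rewrite subr_ge0 lerBlDl; apply/andP; split.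
    by apply: le_EE => // s _; have /andP[] := ih [::] x [seq y <- s | a y].
  by apply: le_EEDc => // s _; have /andP[] := ih [::] x [seq y <- s | a y].
have mAH : mbf (fun x => A x - H1) by exact: mbfBc.
have mab : mbf (fun x => (a x)%:R : R) by apply: mbf_bool; exact: measurable_bool_set.
have E1 : EE nu n.+1 (fun s => h [seq x <- s | a x]) =
    H1 + Ex nu (fun x => (a x)%:R * (A x - H1)).
  rewrite EES; last exact: mf.
  rewrite -[X in X + _](Ex_cst nu) -ExD//; [|exact: mbf_cst|exact: mbfM].
  congr Ex; apply/funext => x /=.
  by case: (a x); rewrite ?mul1r ?mul0r ?addr0// addrC subrK.
have nA := near_scaled mAH A01.
have [mt Et] := Ex_thin u q n (phi := fun x k => EE u k (fun s => h (x :: s)))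
  (fun k => mbf_EE_cons u (mh k.+1)).
have E2 : thin q n.+1 (fun k => EE u k h) = (1 - q) * thin q n (fun k => EE u k h) +
    q * Ex u (fun x => thin q n (fun k => EE u k (fun s => h (x :: s)))).
  rewrite Et /=; congr (_ + q * thin q n _); apply/funext => k /=.
  exact: EES.
have I1 := IH h mh ih.
have I2 : `|Ex u A - Ex u (fun x => thin q n (fun k => EE u k (fun s => h (x :: s))))|
    <= n%:R * (M * e).
  apply: (le_trans (le_norm_ExB u mA mt)).
  apply: Ex_le; first by apply: mbf_norm; exact: mbfB.
  by move=> x; exact: (IH (fun s => h (x :: s))).
rewrite ExBc// in nA.
rewrite -natr1 mulrDl mul1r E1 E2.
move: nA I1 I2; rewrite -/H1.
set X := Ex nu _; set Y := Ex u A; set Z := Ex u _; set W := thin _ _ _.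
move=> nA I1 I2.
(* The first bracket is the cost of replacing the head; the second is a convex combination of two
   errors covered by the induction hypothesis. *)
have -> : H1 + X - ((1 - q) * W + q * Z) =
  (X - q * (Y - H1)) + ((1 - q) * (H1 - W) + q * (Y - Z)) by ring.
apply: (le_trans (ler_normD _ _)); rewrite [leRHS]addrC; apply: lerD => //.
move/andP: q01 => [q0 q1]; rewrite (le_trans (ler_normD _ _))// !normrM.
rewrite (ger0_norm q0) ger0_norm ?subr_ge0//.
rewrite (_ : n%:R * _ = (1 - q) * (n%:R * (M * e)) + q * (n%:R * (M * e))).
  by rewrite lerD// ler_wpM2l// subr_ge0.
by ring.
Qed.

(* By AM-GM, (kap * n q + 1 / kap) / 2 bounds the mean deviation of a binomial
   variable from its mean n q. *)
Lemma EE_filter n h (kap : R) k0 : 0 < kap -> (forall n, bmf n h) -> incr_le h ->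
  `|EE nu n (fun s => h [seq x <- s | a x]) - EE u k0 h| <=
   M * (n%:R * e + (kap * (n%:R * q) + kap^-1) / 2 + `|n%:R * q - k0%:R|).
Proof.
move=> kap0 mh ih.
(* The mean is [M]-Lipschitz in the sample size, which allows the binomial size to be replaced by
   the fixed [k0]. *)
have L k l : `|EE u (k + l) h - EE u k h| <= M * l%:R.
  elim: l => [|l IH]; first by rewrite addn0 subrr normr0 mulr0.
  rewrite addnS EES//.
  have mx := mbf_EE_cons u (mh (k + l).+1).
  have H : `|Ex u (fun x => EE u (k + l) (fun s => h (x :: s))) - EE u (k + l) h| <= M.
    rewrite -(Ex_cst u (EE u (k + l) h)) (le_trans (le_norm_ExB _ _ _))//.
      exact: mbf_cst.
    apply: Ex_le; first by apply: mbf_norm; exact: mbfBc.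
    by move=> x; have := EE_incr_cons (k + l) x u mh ih; rewrite ler_norml; lra.
  rewrite -natr1 mulrDr mulr1; move: H IH; rewrite !ler_norml; lra.
have Lip k l : `|EE u k h - EE u l h| <= M * `|k%:R - l%:R|.
  wlog kl : k l / (k <= l)%N => [H|].
    by case: (leqP k l) => [/H //|/ltnW /H]; rewrite distrC (distrC k%:R).
  have := L k (l - k)%N; rewrite subnKC// natrB// distrC => /le_trans; apply.
  by rewrite ler_wpM2l// distrC ler_norm.
have H2 := thin_near q01 n k0 kap0 M_ge0 Lip.
have H1 := EE_filter_thin n mh ih.
rewrite -(subrKA (thin q n (fun k => EE u k h))) (le_trans (ler_normD _ _))//.
by rewrite -addrA mulrDr lerD// mulrCA.
Qed.

(** The samples are restricted one after the other, with the remaining one held fixed; hence the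
    factor 2. *)
Lemma EE2_filter n F (kap : R) k0 : 0 < kap -> mbf2 F ->
  (forall ys, incr_le (F ^~ ys)) -> (forall xs, incr_le (F xs)) ->
  `|EE nu n (fun xs => EE nu n (fun ys => F [seq x <- xs | a x] [seq y <- ys | a y]))
    - EE u k0 (fun xs => EE u k0 (fun ys => F xs ys))| <=
   2 * (M * (n%:R * e + (kap * (n%:R * q) + kap^-1) / 2 + `|n%:R * q - k0%:R|)).
Proof.
move=> kap0 mF i1 i2; set B := M * _.
have bF xs k : bmf k (F xs).
  exact: (mbf2_bmfr k (in_tuple xs) mF).
have mff := mbf2_filter ma mF.
have m1 := mbf2_bmf n n nu mff.
have m2 k : bmf k (fun xs => EE u k0 (fun ys => F xs ys)) := mbf2_bmf k k0 u mF.
have m3 := bmf_filter n ma m2.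
have H1 : `|EE nu n (fun xs => EE nu n (fun ys => F [seq x <- xs | a x] [seq y <- ys | a y]))
    - EE nu n (fun xs => EE u k0 (fun ys => F [seq x <- xs | a x] ys))| <= B.
  apply: (le_trans (le_norm_ExB (power nu n) m1 m3)).
  apply: Ex_le; first by apply: mbf_norm; exact: mbfB.
  by move=> xs; apply: EE_filter.
have H2 : `|EE nu n (fun xs => EE u k0 (fun ys => F [seq x <- xs | a x] ys))
    - EE u k0 (fun xs => EE u k0 (fun ys => F xs ys))| <= B.
  apply: (EE_filter n k0 (h := fun xs => EE u k0 (fun ys => F xs ys))) => // s1 x s2.
  apply/andP; split.
    by apply: le_EE => // ys _; have /andP[] := i1 ys s1 x s2.
  by apply: le_EEDc => // ys _; have /andP[] := i1 ys s1 x s2.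
by move: H1 H2; rewrite !ler_norml; lra.
Qed.

End filter_sample.

(** * Uniform samples in cubes *)

Section cubes.
Context (R : realType) (d : nat).
Notation T := 'rV[R]_d.
Notation leb := (lebesgue_rV R d).

Definition box (c : T) (b : R) : set T :=
  [set x | forall i, c ord0 i <= x ord0 i < c ord0 i + b].

Lemma measurable_box c b : measurable (box c b).
Proof.
rewrite (_ : box c b = [set x : T | forall i,
    [set` `[c ord0 i, (c ord0 i + b)[ ] (x ord0 i)]).
  apply: (@measurable_rV_box R d (fun i => [set` `[c ord0 i, (c ord0 i + b)[ ])) => i.
  exact: measurable_itv.
by apply/seteqP; split => x /= xb i; move: (xb i); rewrite /= in_itv.
Qed.

Lemma lebesgue_rV_cube c (b : R) : 0 <= b -> leb (box c b) = (b ^+ d)%:E.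
Proof.
move=> b0; rewrite (_ : box c b = [set x : T | forall i,
    [set` `[c ord0 i, (c ord0 i + b)[ ] (x ord0 i)]); last first.
  by apply/seteqP; split => x /= xb i; move: (xb i); rewrite /= in_itv.
rewrite (@lebesgue_rV_box R d (fun i => [set` `[c ord0 i, (c ord0 i + b)[ ])); last first.
  by move=> i; exact: measurable_itv.
rewrite (eq_bigr (fun=> b%:E)) => [|i _].
  by rewrite prodEFin prodr_const card_ord.
rewrite lebesgue_measure_itv /= lte_fin ltrDl.
move: b0; rewrite le_eqVlt => /predU1P[<-|->]; first by rewrite ltxx.
by rewrite -EFinB addrC addKr.
Qed.

Definition affine (c : T) (b : R) (x : T) : T := c + b *: x.

Lemma measurable_affine c b : measurable_fun [set: T] (affine c b).
Proof.
apply: measurable_fun_rV => i.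
rewrite (_ : _ \o _ = fun x => c ord0 i + b * rV_coord i x).
  apply: measurable_funD; first exact: measurable_cst.
  apply: measurable_funM; first exact: measurable_cst.
  exact: measurable_rV_coord.
by apply/funext => x; rewrite /rV_coord /affine/= !mxE.
Qed.

HB.instance Definition _ c b := @isMeasurableFun.Build _ _ _ _ (affine c b)
  (measurable_affine c b).

(** The scaled image measure has the right value on half-open intervals, so uniqueness of Lebesgue
    measure applies. *)
Lemma lebesgue_affine (c b : R) (A : set (measurableTypeR R)) : 0 < b -> measurable A ->
  lebesgue_measure A = (b%:E * lebesgue_measure ((fun x => (c + b * x)%R) @^-1` A))%E.
Proof.
move=> b0 mA; pose aff : measurableTypeR R -> measurableTypeR R := fun x => c + b * x.
have maff : measurable_fun setT aff.
  by apply: measurable_funD => //; exact: measurable_funM.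
pose m := mscale (NngNum (ltW b0)) (pushforward lebesgue_measure aff).
pose affm := HB.pack_for {mfun (measurableTypeR R) >-> (measurableTypeR R)} aff
  (isMeasurableFun.Build _ _ _ _ aff maff).
rewrite (@lebesgue_measure_unique _
  (mscale (NngNum (ltW b0)) (pushforward lebesgue_measure affm)))//.
move=> _ [[x y] _ <-].
transitivity (b%:E * lebesgue_measure (aff @^-1` `]x, y]%classic))%E; last by [].
rewrite (_ : _ @^-1` _ = [set` `](x - c) / b, (y - c) / b]]); last first.
  apply/seteqP; split => z /=; rewrite !in_itv/= ler_pdivlMr// ltr_pdivrMr//;
  by rewrite ltrBlDl lerBrDl mulrC.
rewrite !lebesgue_measure_itv/= !lte_fin ltr_pM2r ?invr_gt0// ltrD2r.
case: ifP => _; last by rewrite mule0.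
by rewrite -!EFinB -EFinM; congr (_%:E); field; rewrite gt_eqF.
Qed.

Lemma prode_scale n (b : R) (y : 'I_n -> \bar R) :
  (\prod_(i < n) (b%:E * y i) = (b ^+ n)%:E * \prod_(i < n) y i)%E.
Proof.
elim: n y => [|n IH] y; first by rewrite !big_ord0 expr0 mul1e.
by rewrite !big_ord_recr/= IH exprSr EFinM muleACA.
Qed.

Definition unif : set T -> \bar R := mrestr leb (measurable_box 0 1).

HB.instance Definition _ := Measure.on unif.

Let unif_setT : unif setT = 1%E.
Proof. by rewrite /unif /mrestr setTI lebesgue_rV_cube// expr1n. Qed.

HB.instance Definition _ := @Measure_isProbability.Build _ _ R unif unif_setT.

Definition unifP : probability T R := unif.

Definition unif_box c b : probability T R := distribution unifP (affine c b).

(** Both sides are finite measures in [A]. On product sets they factor into coordinates, where the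
    one-dimensional affine change of variables applies. *)
Lemma unif_boxE c (b : R) A : 0 < b -> measurable A ->
  leb (A `&` box c b) = ((b ^+ d)%:E * unif_box c b A)%E.
Proof.
move=> b0 mA; have bd0 : 0 <= b ^+ d by exact/exprn_ge0/ltW.
have mb := measurable_box c b.
pose m1 := mrestr leb mb; pose m2 := mscale (NngNum bd0) (unif_box c b).
apply: (@finite_measure_box_unique _ _ _ _ _ _ (@rV_coord R d) m1 m2) => //.
  by rewrite /m1/= /mrestr setTI lebesgue_rV_cube ?ltry// ltW.
move=> B mB; rewrite /m1/= /mrestr /m2 /mscale/= /unif_box/= /distribution /pushforward.
rewrite /unifP/= /unif /mrestr.
pose I i : set (measurableTypeR R) := [set` `[c ord0 i, (c ord0 i + b)[ ].
pose I1 : set (measurableTypeR R) := [set` `[0, (1:R)[ ].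
have mI i : measurable (I i) by exact: measurable_itv.
have mI1 : measurable I1 by exact: measurable_itv.
have maff i : measurable ((fun x : measurableTypeR R => c ord0 i + b * x) @^-1` B i).
  have maff1 : measurable_fun setT
      (fun x : measurableTypeR R => c ord0 i + b * x : measurableTypeR R).
    by apply: measurable_funD => //; exact: measurable_funM.
  by have := maff1 measurableT _ (mB i); rewrite setTI.
have -> : [set x | forall i, B i (rV_coord i x)] `&` box c b =
    [set x : T | forall i, (B i `&` I i) (x ord0 i)].
  apply/seteqP; split => [x [xB xI] i|x xBI].
    by split; [exact: xB|rewrite /I /= in_itv; exact: xI].
  by split => i; have [Bx] := xBI i; rewrite /I /= in_itv.
rewrite (@lebesgue_rV_box R d (fun i => B i `&` I i)); last by move=> i; exact: measurableI.
have -> : affine c b @^-1` [set x | forall i, B i (rV_coord i x)] `&` box 0 1 =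
    [set x : T | forall i,
    (((fun x : measurableTypeR R => c ord0 i + b * x) @^-1` B i) `&` I1) (x ord0 i)].
  apply/seteqP; split => [x [xB xI] i|x xBI].
    split; first by have := xB i; rewrite /rV_coord /affine/= !mxE.
    by have := xI i; rewrite /I1 /= in_itv/= mxE add0r.
  split => i; have [/= Bx] := xBI i; rewrite /I1 /= in_itv/=.
    by rewrite /rV_coord /affine !mxE.
  by rewrite mxE add0r.
rewrite (@lebesgue_rV_box R d (fun i =>
  ((fun x : measurableTypeR R => c ord0 i + b * x) @^-1` B i) `&` I1)); last first.
  by move=> i; exact: measurableI.
rewrite -prode_scale; apply: eq_bigr => i _.
rewrite (lebesgue_affine (c ord0 i) b0); last exact: measurableI.
congr (_ * lebesgue_measure _)%E; rewrite preimage_setI; congr (_ `&` _).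
apply/seteqP; split => x; rewrite /I /I1 /= !in_itv/= lerDl ltrD2l pmulr_rge0//;
  by rewrite -ltr_pdivlMl// mulVf// gt_eqF.
Qed.

Lemma unif_box_out c (b : R) : 0 < b -> unif_box c b (~` box c b) = 0%E.
Proof.
move=> b0; have := @unif_boxE c b (~` box c b) b0 (measurableC (measurable_box c b)).
rewrite setICl measure0 => /esym/eqP; rewrite mule_eq0 eqe expf_eq0 (gt_eqF b0) andbF/=.
by move/eqP.
Qed.

Lemma integral_box c (b : R) (phi : T -> \bar R) : 0 < b -> measurable_fun setT phi ->
  (forall x, 0 <= phi x)%E ->
  (\int[leb]_(x in box c b) phi x = (b ^+ d)%:E * \int[unif_box c b]_x phi x)%E.
Proof.
move=> b0 mphi phi0; have bd0 : 0 <= b ^+ d by exact/exprn_ge0/ltW.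
have mb := measurable_box c b.
rewrite (@eq_measure_integral _ _ _ _ (mscale (NngNum bd0) (unif_box c b))); last first.
  move=> A mA /setIidPl AB; rewrite -[in LHS]AB; exact: unif_boxE.
rewrite ge0_integral_mscale//=; last exact: measurable_funTS.
congr (_ * _)%E; rewrite [RHS](ge0_negligible_integral (N := ~` box c b))//.
- by rewrite setTD setCK.
- exact: measurableC.
- exact: unif_box_out.
Qed.

End cubes.

Lemma EE_distribution dT (T : measurableType dT) dT' (T' : measurableType dT')
    (R : realType) (P : probability T R) (phi : {mfun T >-> T'}) n (h : seq T' -> R) :
  (forall n, bmf n h) ->
  (forall n, bmf n (fun s => h (map phi s))) /\
  EE (distribution P phi) n h = EE P n (fun s => h (map phi s)).
Proof.
move=> mh; split.
  move=> k; apply: (mbf_comp (phi := fun t : k.-tuple T => [tuple of map phi t]) _ (mh k)).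
  apply/measurable_fun_tnthP => i.
  rewrite (_ : _ \o _ = phi \o (@tnth _ T ^~ i)); last first.
    by apply/funext => t /=; rewrite tnth_map.
  by apply: measurableT_comp => //; exact: measurable_tnth.
have mmap (h' : seq T' -> R) : (forall n, bmf n h') ->
    forall n, bmf n (fun s => h' (map phi s)).
  move=> mh' k; apply: (mbf_comp (phi := fun t : k.-tuple T => [tuple of map phi t]) _ (mh' k)).
  apply/measurable_fun_tnthP => i.
  rewrite (_ : _ \o _ = phi \o (@tnth _ T ^~ i)); last first.
    by apply/funext => t /=; rewrite tnth_map.
  by apply: measurableT_comp => //; exact: measurable_tnth.
elim: n h mh => [|n IH] h mh; first by rewrite !EE0.
rewrite EES// EES; last exact: mmap.
rewrite Ex_distribution; last exact: mbf_EE_cons.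
congr Ex; apply/funext => x /=; apply: IH => k.
by apply: bmf_cons.
Qed.

(** * The limiting gain density *)

Section rescaled_gain.
Context (R : realType) (d : nat).
Notation T := 'rV[R]_d.
Variable w : T -> R.
Hypotheses (w_ge0 : forall x, 0 <= w x) (w_ub : has_ubound (range w)).
Hypothesis w_meas : measurable_fun [set: T] w.

Definition sgap (s : R) (x y : T) : R := wmax w - w (s *: (y - x)).

Notation M := (wmax w).
Let M0 : 0 <= M := wmax_ge0 w_ge0 w_ub.

Lemma sgap_ge0 s x y : 0 <= sgap s x y.
Proof. by rewrite subr_ge0 w_le_wmax. Qed.

Lemma sgap_le s x y : sgap s x y <= M.
Proof. by rewrite gerBl w_ge0. Qed.

Lemma measurable_sgap s : measurable_fun setT (fun p : T * T => sgap s p.1 p.2).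
Proof.
apply: measurable_funB; first exact: measurable_cst.
rewrite (_ : (fun _ => _) = w \o (fun p : T * T => s *: (p.2 - p.1)))//.
apply: measurableT_comp => //; apply: measurable_fun_rV => i.
rewrite (_ : _ \o _ = fun p => s * (rV_coord i p.2 - rV_coord i p.1)).
  apply: measurable_funM; first exact: measurable_cst.
  by apply: measurable_funB;
    apply: (measurableT_comp (measurable_rV_coord i)).
by apply/funext => p; rewrite /rV_coord /= !mxE.
Qed.

Lemma mbf2_MG s : mbf2 (MG (sgap s)).
Proof.
move=> k l; have m1 : measurable_fun setT (predT : pred T) by exact: measurable_cst.
have := bmf_cat (bmf_MG (sgap_ge0 s) (sgap_le s) M0 (measurable_sgap s) k (k + l) m1).
rewrite (_ : (fun _ => _) = (fun p : k.-tuple T * l.-tuple T => MG (sgap s) p.1 p.2))//.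
apply/funext => -[xs ys] /=; rewrite !filter_predT.
by rewrite take_size_cat ?size_tuple// drop_size_cat ?size_tuple.
Qed.

Lemma MG_incrl s ys : incr_le M (MG (sgap s) ^~ ys).
Proof.
move=> s1 x s2; rewrite /= (@eq_mem_MG _ _ _ _ (sgap_le s) M0 (s1 ++ x :: s2) ys (x :: s1 ++ s2) ys)//.
  exact: MG_consl (sgap_le s) M0 _ _ _.
by move=> z; rewrite mem_cat !inE mem_cat orbCA.
Qed.

Lemma MG_incrr s xs : incr_le M (MG (sgap s) xs).
Proof.
move=> s1 x s2; rewrite /= (@eq_mem_MG _ _ _ _ (sgap_le s) M0 xs (s1 ++ x :: s2) xs (x :: s1 ++ s2))//.
  exact: MG_consr (sgap_le s) M0.
by move=> z; rewrite mem_cat !inE mem_cat orbCA.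
Qed.

Definition EE2 (nu : probability T R) n (F : seq T -> seq T -> R) : R :=
  EE nu n (fun xs => EE nu n (fun ys => F xs ys)).

(** By scaling, this is the mean maximal gain of two independent uniform samples of [k] points in a
    cube of side [s]. *)
Definition Jgain (s : R) (k : nat) : R := EE2 (unifP R d) k (MG (sgap s)).

Lemma EE2_distribution (P : probability T R) (phi : {mfun T >-> T}) n F :
  mbf2 F -> EE2 (distribution P phi) n F =
            EE2 P n (fun xs ys => F (map phi xs) (map phi ys)).
Proof.
move=> mF; rewrite /EE2.
have [m1 ->] := EE_distribution P phi n (fun k => mbf2_bmf k n (distribution P phi) mF).
apply: eq_EE => xs _.
by have [_ ->] := EE_distribution P phi n (fun k => mbf2_bmfr k (in_tuple (map phi xs)) mF).
Qed.

(** The gain depends on differences only, so the corner [c] drops out and the side [b] is absorbed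
    into the scale. *)
Lemma EE2_unif_box (c : T) (b s : R) k : 0 < b ->
  EE2 (unif_box c b) k (MG (sgap s)) = Jgain (s * b) k.
Proof.
move=> b0; rewrite EE2_distribution; last exact: mbf2_MG.
apply: eq_EE => xs _; apply: eq_EE => ys _ /=.
rewrite (@MG_map _ _ _ (sgap s) M (affine c b) (affine (- b^-1 *: c) b^-1))//.
- congr MG; apply/funext => x; apply/funext => y; congr (_ - w _).
  by rewrite /affine opprD addrACA subrr add0r -scalerBr scalerA.
- exact: sgap_ge0.
- exact: sgap_le.
- move=> x; rewrite /affine scalerDr scalerA mulVf ?gt_eqF// scale1r scaleNr.
  by rewrite addrA addNr add0r.
- move=> x; rewrite /affine scalerDr !scalerA mulrN mulfV ?gt_eqF// scale1r scaleN1r.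
  by rewrite addrA addrN add0r.
Qed.

Lemma EE_incr (nu : probability T R) h (k l : nat) : (forall n, bmf n h) -> incr_le M h ->
  (k <= l)%N -> EE nu k h <= EE nu l h <= EE nu k h + M * (l - k)%:R.
Proof.
move=> mh ih /subnKC <-; rewrite addKn; elim: (l - k)%N => {l} [|l IH].
  by rewrite addn0 mulr0 addr0 lexx.
rewrite addnS -natr1 mulrDr mulr1.
suff : EE nu (k + l) h <= EE nu (k + l).+1 h <= EE nu (k + l) h + M.
  by move: IH => /andP[? ?] /andP[? ?]; apply/andP; split; lra.
rewrite EES//; have mx := mbf_EE_cons nu (mh (k + l).+1).
have H x := EE_incr_cons (k + l) x nu mh ih.
apply/andP; split.
  rewrite -(Ex_cst nu (EE nu (k + l) h)); apply: le_Ex => //; first exact: mbf_cst.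
  by move=> x; have /andP[] := H x.
by apply: Ex_le => // x; have /andP[] := H x.
Qed.

(** Enlarging the two samples in turn costs [M] per added point in each, hence 2 M. *)
Lemma EE2_incr (nu : probability T R) s (k l : nat) : (k <= l)%N ->
  EE2 nu k (MG (sgap s)) <= EE2 nu l (MG (sgap s))
    <= EE2 nu k (MG (sgap s)) + 2 * M * (l - k)%:R.
Proof.
move=> kl; have mF := mbf2_MG s.
have mr (xs : seq T) n : bmf n (MG (sgap s) xs) := mbf2_bmfr n (in_tuple xs) mF.
have ml n k' : bmf n (fun xs => EE nu k' (MG (sgap s) xs)) := mbf2_bmf n k' nu mF.
have il k' : incr_le M (fun xs => EE nu k' (MG (sgap s) xs)).
  move=> s1 x s2; apply/andP; split.
    by apply: le_EE => // ys _; have /andP[] := MG_incrl s ys s1 x s2.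
  by apply: le_EEDc => // ys _; have /andP[] := MG_incrl s ys s1 x s2.
have /andP[A1 A2] := EE_incr nu (fun n => ml n l) (il l) kl.
have B1 : EE nu k (fun xs => EE nu k (MG (sgap s) xs)) <=
          EE nu k (fun xs => EE nu l (MG (sgap s) xs)).
  apply: le_EE => // xs _.
  by have /andP[] := EE_incr nu (mr xs) (MG_incrr s xs) kl.
have B2 : EE nu k (fun xs => EE nu l (MG (sgap s) xs)) <=
    EE nu k (fun xs => EE nu k (MG (sgap s) xs)) + M * (l - k)%:R.
  apply: le_EEDc => // xs _.
  by have /andP[] := EE_incr nu (mr xs) (MG_incrr s xs) kl.
by rewrite /EE2; apply/andP; split; lra.
Qed.

Lemma Jgain_lip s k l : `|Jgain s k - Jgain s l| <= 2 * M * `|k%:R - l%:R|.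
Proof.
wlog kl : k l / (k <= l)%N => [H|].
  by case: (leqP k l) => [/H //|/ltnW /H]; rewrite distrC (distrC k%:R).
have /andP[] := EE2_incr (unifP R d) s kl; rewrite natrB// -/(Jgain s k) -/(Jgain s l).
by rewrite (distrC k%:R) (@ger0_norm _ (l%:R - k%:R)) ?subr_ge0 ?ler_nat// ler_norml; lra.
Qed.

Lemma EE2_ge0 nu s k : 0 <= EE2 nu k (MG (sgap s)).
Proof.
apply: Ex_ge0 => xs; apply: Ex_ge0 => ys.
exact: MG_ge0 (sgap_ge0 s) (sgap_le s) M0 _ _.
Qed.

Lemma Jgain_le s k : Jgain s k <= M * k%:R.
Proof.
apply: Ex_le; first exact: mbf2_bmf (mbf2_MG s).
move=> xs; apply: Ex_le; first exact: mbf2_bmfr (mbf2_MG s).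
by move=> ys; rewrite -[in leRHS](size_tuple xs); exact: MG_le_size (sgap_le s) M0 _ _.
Qed.

End rescaled_gain.

(** * Cubic grids *)

Section grid.
Context (R : realType) (d : nat).
Notation T := 'rV[R]_d.

Definition cellf (b : R) (x : T) : 'rV[int]_d := \row_i Num.floor (x ord0 i / b).

Definition corner (b : R) (v : 'rV[int]_d) : T := \row_i (b * (v ord0 i)%:~R).

Lemma cellf_box (b : R) x v : 0 < b -> (cellf b x == v) <-> box (corner b v) b x.
Proof.
move=> b0; split => [/eqP <- i|xb].
  have /andP[f1 f2] := floor_itv (x ord0 i / b).
  rewrite !mxE mulrC -ler_pdivlMr// f1/=.
  by move: f2; rewrite intrD ltr_pdivrMr// mulrDl mul1r.
apply/eqP/rowP => i; rewrite mxE; apply: floor_def.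
have := xb i; rewrite !mxE mulrC -ler_pdivlMr// => /andP[-> /=].
by rewrite intrD ltr_pdivrMr// mulrDl mul1r.
Qed.

Lemma measurable_cellf (b : R) v : 0 < b -> measurable_fun [set: T] (fun x => cellf b x == v).
Proof.
move=> b0; apply: measurable_set_bool.
rewrite (_ : [set x | _] = box (corner b v) b); first exact: measurable_box.
by apply/seteqP; split => x /(cellf_box _ _ b0).
Qed.

Definition cells (m : nat) : seq 'rV[int]_d :=
  [seq \row_i (nat_of_ord (v i))%:Z | v : {ffun 'I_d -> 'I_m}].

Lemma cells_uniq m : uniq (cells m).
Proof.
rewrite map_inj_uniq ?enum_uniq// => u v uv; apply/ffunP => i; apply/val_inj.
by move/rowP : uv => /(_ i); rewrite !mxE => -[].
Qed.

Lemma size_cells m : size (cells m) = (m ^ d)%N.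
Proof. by rewrite size_map -cardE card_ffun !card_ord. Qed.

Lemma mem_cells m (v : 'rV[int]_d) :
  (v \in cells m) = [forall i, (0 <= v ord0 i < m%:Z)%R].
Proof.
apply/mapP/forallP => [[u _ ->] i|vm]; first by rewrite mxE lez_nat ltz_nat ltn_ord.
have vn i : exists j : 'I_m, v ord0 i = j%:Z.
  have /andP[v0 v1] := vm i.
  have jm : (`|v ord0 i| < m)%N by rewrite -ltz_nat gez0_abs.
  by exists (Ordinal jm); rewrite /= gez0_abs.
have [f fE] := choice vn.
exists [ffun i => f i]; first by rewrite mem_enum.
by apply/rowP => i; rewrite mxE ffunE fE.
Qed.

End grid.

Section EE2_theory.
Context (R : realType) (d : nat).
Notation T := 'rV[R]_d.
Implicit Types (nu : probability T R) (F : seq T -> seq T -> R).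

Lemma EE2E nu n F : mbf2 F ->
  EE2 nu n F = Ex (power nu n \x power nu n)%E (fun p => F p.1 p.2).
Proof. by move=> mF; rewrite (Ex_prod (power nu n) (power nu n) (mF n n)). Qed.

Lemma le_EE2 nu n F F' : mbf2 F -> mbf2 F' ->
  (forall xs ys, size xs = n -> size ys = n -> F xs ys <= F' xs ys) ->
  EE2 nu n F <= EE2 nu n F'.
Proof.
move=> mF mF' FF'; rewrite !EE2E//.
apply: le_Ex; [exact: (mF n n)|exact: (mF' n n)|].
by move=> p; apply: FF'; rewrite size_tuple.
Qed.

Lemma mbf2_sum (I : Type) (r : seq I) (F : I -> seq T -> seq T -> R) :
  (forall i, mbf2 (F i)) -> mbf2 (fun xs ys => \sum_(i <- r) F i xs ys).
Proof. by move=> mF k l; apply: mbf_sum => i; exact: (mF i k l). Qed.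

Lemma EE2_sum nu n (I : Type) (r : seq I) (F : I -> seq T -> seq T -> R) :
  (forall i, mbf2 (F i)) ->
  EE2 nu n (fun xs ys => \sum_(i <- r) F i xs ys) = \sum_(i <- r) EE2 nu n (F i).
Proof.
move=> mF; rewrite EE2E; last exact: mbf2_sum.
rewrite (Ex_sum (power nu n \x power nu n)%E r (F := fun i p => F i p.1 p.2)) => [|i].
  by apply: eq_bigr => i _; rewrite EE2E.
exact: (mF i n n).
Qed.

Lemma EE2D nu n F F' : mbf2 F -> mbf2 F' ->
  EE2 nu n (fun xs ys => F xs ys + F' xs ys) = EE2 nu n F + EE2 nu n F'.
Proof.
move=> mF mF'; rewrite !EE2E//; last by move=> k l; apply: mbfD; [exact: mF|exact: mF'].
by apply: ExD; [exact: mF|exact: mF'].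
Qed.

Lemma Ex_region dX (X : measurableType dX) (nu : probability X R) (a : pred X) (phi : X -> R) :
  measurable_fun [set: X] a -> mbf phi ->
  (Ex nu (fun x => (a x)%:R * phi x))%:E = (\int[nu]_(x in [set x | a x]) (phi x)%:E)%E.
Proof.
move=> ma mphi; rewrite EFin_Ex; last first.
  by apply: mbfM => //; apply: mbf_bool; exact: measurable_bool_set.
rewrite [RHS]integral_mkcond; apply: eq_integral => x _; rewrite patchE.
case: ifPn => [|/negP].
  by rewrite inE /= => ->; rewrite mul1r.
by rewrite inE /= => /negP/negbTE ->; rewrite mul0r.
Qed.

Lemma cellf_boxE (b : R) v : 0 < b ->
  [set x : T | cellf b x == v] = box (corner b v) b.
Proof. by move=> b0; apply/seteqP; split => x /(cellf_box _ _ b0). Qed.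

Lemma Ex_cell_leb (b : R) v (phi : T -> R) : 0 < b -> mbf phi -> (forall x, 0 <= phi x) ->
  (\int[lebesgue_rV R d]_(x in [set x | cellf b x == v]) (phi x)%:E)%E =
  (b ^+ d * Ex (unif_box (corner b v) b) phi)%:E.
Proof.
move=> b0 mphi phi0; rewrite cellf_boxE// integral_box//.
  by rewrite EFinM EFin_Ex.
by apply/measurable_EFinP; exact: (proj1 mphi).
Qed.

(** The condition m b <= 1 keeps these cells inside the unit cube, where the uniform law is Lebesgue
    measure. *)
Lemma unif_cell (b : R) v (m : nat) (phi : T -> R) : 0 < b -> m%:R * b <= 1 ->
  v \in cells d m -> mbf phi -> (forall x, 0 <= phi x) ->
  Ex (unifP R d) (fun x => (cellf b x == v)%:R * phi x) =
  b ^+ d * Ex (unif_box (corner b v) b) phi.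
Proof.
move=> b0 mb; rewrite mem_cells => /forallP vm mphi phi0.
apply: EFin_inj; rewrite -Ex_cell_leb//.
rewrite Ex_region//; last exact: measurable_cellf.
apply: eq_measure_integral => A mA; rewrite cellf_boxE// => AB.
rewrite /unifP/= /unif /mrestr (setIidl (subset_trans AB _))// => x xb i.
have /andP[v0 v1] := vm i; have := xb i; rewrite !mxE add0r => /andP[x0 x1].
apply/andP; split; first by rewrite (le_trans _ x0)// mulr_ge0 ?ler0z// ltW.
rewrite (lt_le_trans x1)// (le_trans _ mb)// -[X in _ + X]mulr1 -mulrDr mulrC.
have : ((v ord0 i + 1)%:~R : R) <= m%:Z%:~R by rewrite ler_int lezD1.
by rewrite intrD => vm'; apply: ler_wpM2r => //; exact: ltW.
Qed.

End EE2_theory.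

Section superadditivity.
Context (R : realType) (d : nat).
Notation T := 'rV[R]_d.
Variable w : T -> R.
Hypotheses (w_ge0 : forall x, 0 <= w x) (w_ub : has_ubound (range w)).
Hypothesis w_meas : measurable_fun [set: T] w.
Notation M := (wmax w).
Let M0 : 0 <= M := wmax_ge0 w_ge0 w_ub.

(** The unit cube contains m ^ d cells of side [b]. The points falling into one of them form an
    exact binomial thinning of probability b ^ d with uniform law, so [EE2_filter] applies with
    distance 0, and only the fluctuation of the number of points is paid. *)
Lemma Jgain_superadd (s b kap : R) (m n k0 : nat) : (0 < m)%N -> 0 < b -> m%:R * b <= 1 -> 0 < kap ->
  (m ^ d)%:R * (Jgain w (s * b) k0 -
    2 * (M * ((kap * (n%:R * b ^+ d) + kap^-1) / 2 + `|n%:R * b ^+ d - k0%:R|)))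
  <= Jgain w s n.
Proof.
move=> m1 b0 mb kap0; set B := 2 * _.
have mF := mbf2_MG w_ge0 w_ub w_meas s.
have mc v := @measurable_cellf R d b v b0.
have mFv v := mbf2_filter (mc v) mF.
have : EE2 (unifP R d) n (fun xs ys => \sum_(v <- cells d m)
    MG (sgap w s) [seq x <- xs | cellf b x == v] [seq y <- ys | cellf b y == v])
  <= Jgain w s n.
  apply: le_EE2 => //; first exact: mbf2_sum.
  move=> xs ys _ _; apply: (MG_cells (sgap_ge0 w_ub s) (sgap_le w_ge0 s) M0).
  exact: cells_uniq.
apply: le_trans; rewrite EE2_sum//.
rewrite -(size_cells d m) mulr_natl -[leLHS]addr0 -iter_addr -[X in iter X](count_predT).
rewrite -big_const_seq big_seq [leRHS]big_seq; apply: ler_sum => v vm.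
have q01 : 0 <= b ^+ d <= 1.
  have b1 : b <= 1.
    by apply: le_trans mb; rewrite ler_peMl ?ler1n// ltW.
  by apply/andP; split; [exact/exprn_ge0/ltW|apply: exprn_ile1 => //; exact: ltW].
have near phi : mbf phi -> (forall x, 0 <= phi x <= 1) ->
    `|Ex (unifP R d) (fun x => (cellf b x == v)%:R * phi x)
      - b ^+ d * Ex (unif_box (corner b v) b) phi| <= 0.
  move=> mphi phi01; rewrite (unif_cell b0 mb vm)// ?subrr ?normr0// => x.
  by case/andP: (phi01 x).
have := EE2_filter (mc v) q01 M0 near n k0 kap0 mF (MG_incrl w_ge0 w_ub s) (MG_incrr w_ge0 w_ub s).
rewrite -/(EE2 _ _ _) -/(EE2 (unif_box _ _) _ _) mulr0 add0r EE2_unif_box//.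
by rewrite ler_norml /B /EE2; lra.
Qed.

End superadditivity.

Section liminf_limit.
Context (R : realType).

Definition liminf_at_infty (f : R -> R) : R :=
  sup [set x | exists S, forall s, S <= s -> x <= f s].

(** A form of Fekete's lemma: if every late value f s0 is eventually almost a lower bound for [f],
    then no late value can exceed the lower limit by more than [e], and the lower limit is a
    limit. *)
Lemma liminf_at_inftyP (f : R -> R) (C : R) :
  (forall s, 1 <= s -> 0 <= f s <= C) ->
  (forall e, 0 < e -> exists S1, forall s0, S1 <= s0 ->
     exists S2, forall s, S2 <= s -> f s0 - e <= f s) ->
  forall e, 0 < e -> exists S, forall s, S <= s -> `|f s - liminf_at_infty f| <= e.
Proof.
move=> fC fe e e0; set A := [set x | exists S, forall s, S <= s -> x <= f s].
have A0 : A 0 by exists 1 => s /fC /andP[].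
have supA : has_sup A.
  split; first by exists 0.
  exists C => x [S xS]; have := xS (Num.max S 1); rewrite le_max lexx => /(_ isT).
  by move=> /le_trans; apply; have /andP[] := fC (Num.max S 1) ltac:(by rewrite le_max lexx orbT).
have [x [S xS] xL] := sup_adherent e0 supA.
have [S1 fS1] := fe _ e0.
exists (Num.max S S1) => s; rewrite ge_max => /andP[sS sS1].
have := xS s sS; move: xL; rewrite -/(liminf_at_infty f) => xL xs.
have : f s - e <= liminf_at_infty f.
  by apply: ub_le_sup; [case: supA|exact: fS1].
by rewrite ler_norml; lra.
Qed.

End liminf_limit.

Section gain_density.
Context (R : realType) (d : nat).
Hypothesis d_gt0 : (0 < d)%N.
Notation T := 'rV[R]_d.
Variable w : T -> R.
Hypotheses (w_ge0 : forall x, 0 <= w x) (w_ub : has_ubound (range w)).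
Hypothesis w_meas : measurable_fun [set: T] w.
Notation M := (wmax w).
Let M0 : 0 <= M := wmax_ge0 w_ge0 w_ub.

Definition again (lam s : R) : R := Jgain w s (Num.truncn (lam * s ^+ d)) / s ^+ d.

Definition Gam (lam : R) : R := liminf_at_infty (again lam).

Lemma again_bound (lam s : R) : 0 <= lam -> 1 <= s -> 0 <= again lam s <= M * lam.
Proof.
move=> l0 s1; have s0 : 0 < s by exact: lt_le_trans s1.
have sd0 : 0 < s ^+ d by exact: exprn_gt0.
apply/andP; split.
  by apply: divr_ge0; [exact: EE2_ge0|exact: ltW].
rewrite /again ler_pdivrMr//.
apply: (le_trans (Jgain_le w_ge0 w_ub w_meas _ _)); rewrite -mulrA ler_wpM2l//.
by rewrite truncn_le; apply: mulr_ge0 => //; exact: ltW.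
Qed.

Lemma bernoulli_ineq (x : R) n : 0 <= x <= 1 -> 1 - n%:R * x <= (1 - x) ^+ n.
Proof.
move=> /andP[x0 x1]; elim: n => [|n IH]; first by rewrite mul0r subr0 expr0.
have p1 : (1 - x) ^+ n <= 1 by rewrite exprn_ile1 ?subr_ge0// gerBl.
by rewrite exprSr -natr1; nra.
Qed.

(** Needed with a [y] of either sign: a negative [y] only grows under multiplication by t <= 1. *)
Lemma near1_mulr (t e y C : R) : t <= 1 -> 1 - e <= t -> 0 <= e -> 0 <= C -> y <= C ->
  y - t * y <= e * C.
Proof.
move=> t1 te e0 C0 yC; have eC : e * y <= e * C by exact: ler_wpM2l.
have [y0|y0] := leP 0 y.
  apply: le_trans eC; rewrite -{1}[y]mul1r -mulrBl ler_wpM2r//; lra.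
apply: (@le_trans _ _ 0); last exact: mulr_ge0.
by rewrite -{1}[y]mul1r -mulrBl mulr_ge0_le0// ?subr_ge0// ltW.
Qed.

(** The cube of side [s] holds truncn (s / s0) cubes of side [s0] along each axis, covering at least
    a fraction 1 - d s0 / s of the volume. The losses are the fluctuation of counts in the small
    cubes, in terms of [kap] and 1 / s0, and the uncovered part. *)
Lemma again_superadd (lam s0 s kap : R) : 0 <= lam -> 1 <= s0 -> s0 <= s -> 0 < kap ->
  again lam s0 - (M * kap * lam + 2 * M * (kap^-1 / 2 + 1) / s0)
    - d%:R * (s0 / s) * (M * lam) <= again lam s.
Proof.
move=> l0 s01 s0s kap0.
have s0p : 0 < s0 by exact: lt_le_trans s01.
have sp : 0 < s by exact: lt_le_trans s0s.
have s0d : 0 < s0 ^+ d by exact: exprn_gt0.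
have sd : 0 < s ^+ d by exact: exprn_gt0.
pose b := s0 / s; have b0 : 0 < b by rewrite divr_gt0.
have b1 : b <= 1 by rewrite ler_pdivrMr// mul1r.
pose m := Num.truncn (s / s0).
have ss0 : 0 <= s / s0 by rewrite divr_ge0// ltW.
have /andP[mle mlt] : m%:R <= s / s0 < m.+1%:R by exact: truncn_itv.
have sb : s / s0 * b = 1 by rewrite /b; field; rewrite !gt_eqF.
have mb : m%:R * b <= 1.
  by rewrite -[leRHS]sb; apply: ler_wpM2r => //; exact: ltW.
have mb1 : 1 - b <= m%:R * b.
  by rewrite lerBlDr -[X in _ + X]mul1r -mulrDl natr1 -[leLHS]sb; apply: ler_wpM2r; exact: ltW.
have m_gt0 : (0 < m)%N.
  by rewrite truncn_gt0 ler_pdivlMr// mul1r.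
pose n := Num.truncn (lam * s ^+ d); pose k0 := Num.truncn (lam * s0 ^+ d).
have /andP[nle nlt] : n%:R <= lam * s ^+ d < n.+1%:R.
  by apply: truncn_itv; rewrite mulr_ge0// ltW.
have /andP[kle klt] : k0%:R <= lam * s0 ^+ d < k0.+1%:R.
  by apply: truncn_itv; rewrite mulr_ge0// ltW.
have bd0 : 0 < b ^+ d by exact: exprn_gt0.
have bd1 : b ^+ d <= 1 by rewrite exprn_ile1// ltW.
have lbd : lam * s ^+ d * b ^+ d = lam * s0 ^+ d.
  by rewrite -mulrA -exprMn; congr (_ * _ ^+ _); rewrite /b; field; rewrite gt_eqF.
have nb1 : n%:R * b ^+ d <= lam * s0 ^+ d by rewrite -lbd ler_wpM2r// ltW.
have nb2 : lam * s0 ^+ d - 1 <= n%:R * b ^+ d.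
  have : lam * s ^+ d * b ^+ d <= n.+1%:R * b ^+ d by apply: ler_wpM2r; exact: ltW.
  by rewrite lbd -natr1 mulrDl mul1r; lra.
(* Both numbers lie within 1 below lam s0 ^ d. *)
have nk : `|n%:R * b ^+ d - k0%:R| <= 1.
  by move: klt; rewrite -natr1 ler_norml; lra.
have := Jgain_superadd w_ge0 w_ub w_meas s n k0 m_gt0 b0 mb kap0.
rewrite (_ : s * b = s0); last by rewrite /b; field; rewrite gt_eqF.
set J0 := Jgain w s0 k0; set Js := Jgain w s n => JJ.
pose E := 2 * (M * ((kap * (lam * s0 ^+ d) + kap^-1) / 2 + 1)).
pose t := (m%:R * b) ^+ d.
have t0 : 0 <= t by rewrite exprn_ge0// mulr_ge0// ltW.
have t1 : t <= 1 by rewrite exprn_ile1// mulr_ge0// ltW.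
have tb : 1 - d%:R * b <= t.
  apply: (le_trans (bernoulli_ineq d _)); first by rewrite ltW.
  by rewrite lerXn2r// ?nnegrE ?subr_ge0// mulr_ge0// ltW.
have H1 : t * (again lam s0 - E / s0 ^+ d) <= again lam s.
  rewrite /again -/n -/k0 -/J0 -/Js ler_pdivlMr//; apply: le_trans JJ.
  rewrite natrX.
  rewrite (_ : t * (J0 / s0 ^+ d - E / s0 ^+ d) * s ^+ d = m%:R ^+ d * (J0 - E)); last first.
    rewrite /t exprMn /b expr_div_n; field; rewrite !gt_eqF//.
  rewrite ler_wpM2l ?exprn_ge0// lerD2l lerN2 ler_pM2l// ler_wpM2l// lerD//.
  by rewrite ler_pM2r// lerD2r ler_pM2l.
have H2 : E / s0 ^+ d <= M * kap * lam + 2 * M * (kap^-1 / 2 + 1) / s0.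
  rewrite (_ : E / s0 ^+ d = M * kap * lam + 2 * M * (kap^-1 / 2 + 1) / s0 ^+ d); last first.
    by rewrite /E; field; rewrite !gt_eqF.
  rewrite lerD2l ler_wpM2l//.
    by rewrite !mulr_ge0// addr_ge0// divr_ge0// invr_ge0 ltW.
  rewrite lef_pV2 ?posrE// -[leLHS]expr1 ler_weXn2l//.
have /andP[a0 aM] := again_bound l0 s01.
have E0 : 0 <= E / s0 ^+ d.
  have ki : 0 <= kap^-1 by rewrite invr_ge0 ltW.
  have kl : 0 <= kap * (lam * s0 ^+ d).
    by apply: mulr_ge0; [exact: ltW|apply: mulr_ge0 => //; exact: ltW].
  apply: divr_ge0; last exact: ltW.
  by rewrite /E; apply: mulr_ge0 => //; apply: mulr_ge0 => //; lra.
have db : 0 <= d%:R * b by apply: mulr_ge0 => //; exact: ltW.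
have C0 : 0 <= M * lam by exact: mulr_ge0.
rewrite -/b; set y := again lam s0 - E / s0 ^+ d in H1.
have H3 : y - d%:R * b * (M * lam) <= t * y.
  have yC : y <= M * lam by rewrite (le_trans _ aM)// gerBl.
  by rewrite lerBlDr -lerBlDl; exact: near1_mulr.
by apply: le_trans (le_trans H3 H1); rewrite lerD2r lerD2l lerN2.
Qed.

(** The choices come in order: [kap] makes the fluctuation small, then [s0] beats 1 / kap, then [s]
    beats [s0]. Each of the three losses is at most e / 3. *)
Lemma again_cvg (lam e : R) : 0 <= lam -> 0 < e ->
  exists S, forall s, S <= s -> `|again lam s - Gam lam| <= e.
Proof.
move=> l0; apply: (@liminf_at_inftyP _ (again lam) (M * lam)).
  by move=> s s1; exact: again_bound.
move=> {}e e0.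
have C0 : 0 <= M * lam by exact: mulr_ge0.
pose kap := e / (3 * (M * lam + 1)).
have kap0 : 0 < kap by rewrite divr_gt0// mulr_gt0// ltr_wpDl.
have kapi0 : 0 < kap^-1 by rewrite invr_gt0.
have H1 : M * kap * lam <= e / 3.
  rewrite (_ : M * kap * lam = e / 3 * (M * lam / (M * lam + 1))); last first.
    by rewrite /kap; field; rewrite gt_eqF// ltr_wpDl.
  apply: ler_piMr; first by rewrite divr_ge0// ltW.
  by rewrite ler_pdivrMr ?ltr_wpDl// mul1r lerDl.
pose D := 2 * M * (kap^-1 / 2 + 1).
have D0 : 0 <= D by rewrite /D; apply: mulr_ge0; [rewrite mulr_ge0|lra].
exists (Num.max 1 (3 * D / e + 1)) => s0; rewrite ge_max => /andP[s01 s0D].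
have s0p : 0 < s0 by exact: lt_le_trans s01.
have H2 : D / s0 <= e / 3.
  rewrite ler_pdivrMr//; have : 3 * D / e <= s0 by lra.
  by rewrite ler_pdivrMr//; lra.
pose F := d%:R * s0 * (M * lam).
have F0 : 0 <= F by rewrite /F; apply: mulr_ge0 => //; apply: mulr_ge0 => //; exact: ltW.
exists (Num.max s0 (3 * F / e + 1)) => s; rewrite ge_max => /andP[s0s sF].
have sp : 0 < s by exact: lt_le_trans s0s.
have H3 : d%:R * (s0 / s) * (M * lam) <= e / 3.
  rewrite (_ : _ * (M * lam) = F / s); last by rewrite /F; field; rewrite gt_eqF.
  rewrite ler_pdivrMr//; have : 3 * F / e <= s by lra.
  by rewrite ler_pdivrMr//; lra.
by have := again_superadd l0 s01 s0s kap0; rewrite -/D; lra.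
Qed.

(** The two sample sizes differ by the difference of densities times the volume, plus at most 1 from
    rounding; the rounding gives the term in 1 / s. *)
Lemma again_lip (lam lam' s : R) : 0 <= lam -> 0 <= lam' -> 1 <= s ->
  `|again lam s - again lam' s| <= 2 * M * (`|lam - lam'| + s^-1).
Proof.
move=> l0 l'0 s1; have sp : 0 < s by exact: lt_le_trans s1.
have sd : 0 < s ^+ d by exact: exprn_gt0.
have ssd : s <= s ^+ d by rewrite -[leLHS]expr1 ler_weXn2l.
rewrite /again -mulrBl normrM (ger0_norm (_ : 0 <= (s ^+ d)^-1)) ?invr_ge0 ?(ltW sd)//.
rewrite ler_pdivrMr//; apply: (le_trans (Jgain_lip w_ge0 w_ub w_meas _ _ _)).
rewrite -[leRHS]mulrA; apply: ler_wpM2l; first by rewrite mulr_ge0.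
have /andP[n1 n2] := @truncn_itv _ (lam * s ^+ d) (mulr_ge0 l0 (ltW sd)).
have /andP[n3 n4] := @truncn_itv _ (lam' * s ^+ d) (mulr_ge0 l'0 (ltW sd)).
have H : `|lam * s ^+ d - lam' * s ^+ d| = `|lam - lam'| * s ^+ d.
  by rewrite -mulrBl normrM (ger0_norm (ltW sd)).
have H' : 1 <= s^-1 * s ^+ d by rewrite mulrC ler_pdivlMr// mul1r.
rewrite mulrDl -H; move: H' n1 n2 n3 n4; rewrite -!natr1.
set A := lam * _; set B := lam' * _ => H' n1 n2 n3 n4.
rewrite (le_trans (_ : _ <= `|A - B| + 1)) ?lerD2l//.
have := ler_norm (A - B); have := ler_norm (- (A - B)); rewrite normrN.
by rewrite ler_norml; lra.
Qed.

Lemma Gam_lip (lam lam' : R) : 0 <= lam -> 0 <= lam' ->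
  `|Gam lam - Gam lam'| <= 2 * M * `|lam - lam'|.
Proof.
move=> l0 l'0; apply/ler_addgt0Pr => e e0.
have e4 : 0 < e / 4 by rewrite divr_gt0.
have [S1 H1] := again_cvg l0 e4; have [S2 H2] := again_cvg l'0 e4.
pose s := Num.max (Num.max S1 S2) (Num.max 1 (8 * M / e + 1)).
have sS1 : S1 <= s by rewrite !le_max lexx.
have sS2 : S2 <= s by rewrite !le_max lexx orbT.
have s1 : 1 <= s by rewrite !le_max lexx !orbT.
have sM : 8 * M / e + 1 <= s by rewrite !le_max lexx !orbT.
have sp : 0 < s by exact: lt_le_trans s1.
have H3 : 2 * M * s^-1 <= e / 4.
  rewrite ler_pdivrMr//; have : 8 * M / e <= s by lra.
  by rewrite ler_pdivrMr//; lra.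
have := again_lip l0 l'0 s1; have := H1 _ sS1; have := H2 _ sS2.
by rewrite mulrDr !ler_norml; lra.
Qed.

Lemma Gam_bound (lam : R) : 0 <= lam -> 0 <= Gam lam <= M * lam.
Proof.
move=> l0; apply/andP; split; apply/ler_addgt0Pr => e e0.
  have [S HS] := again_cvg l0 e0.
  have s1 : 1 <= Num.max S 1 by rewrite le_max lexx orbT.
  have := HS (Num.max S 1); rewrite le_max lexx => /(_ isT).
  by have /andP[] := again_bound l0 s1; rewrite ler_norml; lra.
have [S HS] := again_cvg l0 e0.
have s1 : 1 <= Num.max S 1 by rewrite le_max lexx orbT.
have := HS (Num.max S 1); rewrite le_max lexx => /(_ isT).
by have /andP[] := again_bound l0 s1; rewrite ler_norml; lra.
Qed.

End gain_density.

(** * Mixtures of measures *)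

Section mixture.
Context dX (X : measurableType dX) dY (Y : measurableType dY) (R : realType).
Local Open Scope ereal_scope.

(** A multiple of the counting measure of a list, with multiplicity; [y0] is only the default of
    [nth]. *)
Definition list_measure (y0 : Y) (c : {nonneg R}) (L : seq Y) : set Y -> \bar R :=
  mscale c (msum (fun i => dirac (nth y0 L i)) (size L)).

HB.instance Definition _ y0 c L := Measure.on (list_measure y0 c L).

Lemma list_measureE y0 c L A :
  list_measure y0 c L A = (c%:num * \sum_(t <- L) \1_A t)%:E.
Proof.
rewrite /list_measure /mscale /msum EFinM -sumEFin; congr (_ * _).
by rewrite [RHS](big_nth y0) big_mkord /=; apply: eq_bigr => i _; rewrite /dirac.
Qed.

Lemma integral_list_measure y0 c L (f : Y -> R) : measurable_fun setT f ->
  (forall y, (0 <= f y)%R) ->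
  \int[list_measure y0 c L]_y (f y)%:E = (c%:num * \sum_(t <- L) f t)%:E.
Proof.
move=> mf f0; have mf' : measurable_fun setT (EFin \o f) by exact/measurable_EFinP.
have f0' (y : Y) : setT y -> 0 <= (f y)%:E by rewrite lee_fin.
rewrite ge0_integral_mscale// ge0_integral_measure_sum// EFinM -sumEFin; congr (_ * _).
rewrite [RHS](big_nth y0) big_mkord; apply: eq_bigr => i _.
by rewrite integral_dirac// diracT mul1e.
Qed.

Import HBNNSimple.

(** If [m] averages the measures [l x], integrals against [m] are averages of integrals: linearity
    settles simple functions and monotone convergence the rest. It serves both the random orderings
    of Poisson points and the decomposition of [mu]. *)
Lemma integral_mixture (P : {measure set X -> \bar R}) (m : {measure set Y -> \bar R})
    (l : X -> {measure set Y -> \bar R}) (f : Y -> \bar R) :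
  (forall A, measurable A -> measurable_fun setT (l ^~ A)) ->
  (forall A, measurable A -> m A = \int[P]_x l x A) ->
  measurable_fun setT f -> (forall y, 0 <= f y) ->
  \int[m]_y f y = \int[P]_x \int[l x]_y f y.
Proof.
move=> ml mE mf f0; pose f_ := nnsfun_approx measurableT mf.
have nn n : \int[m]_y (f_ n y)%:E = \int[P]_x \int[l x]_y (f_ n y)%:E.
  under [RHS]eq_integral do rewrite integralT_nnsfun sintegralE.
  rewrite integralT_nnsfun sintegralE ge0_integral_fsum//; last 2 first.
  - move=> r; apply: emeasurable_funM; first exact: measurable_cst.
    by apply: ml; exact: measurable_sfunP.
  - by move=> r x _; exact: nnsfun_mulemu_ge0.
  apply: eq_fsbigr => r _; rewrite mE; last exact: measurable_sfunP.
  have [r0|r0] := leP 0%R r.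
    rewrite ge0_integralZl//; first by apply: ml; exact: measurable_sfunP.
  (* A nonnegative simple function does not take the negative value [r], so both sides vanish. *)
  have e0 (mu : {measure set Y -> \bar R}) : mu (f_ n @^-1` [set r]) = 0.
    by rewrite preimage_nnfun0 ?measure0.
  rewrite [LHS](_ : _ = 0); last first.
    rewrite integral0_eq ?mule0// => x _; exact: e0.
  by rewrite integral0_eq// => x _; rewrite e0 mule0.
have lim (mu : {measure set Y -> \bar R}) :
    \int[mu]_y f y = limn (fun n => \int[mu]_y (f_ n y)%:E).
  rewrite -monotone_convergence//.
  - by apply: eq_integral => y _; apply/esym/cvg_lim => //; exact: cvg_nnsfun_approx.
  - by move=> n; exact/measurable_EFinP.
  - by move=> n y _; rewrite lee_fin.
  - by move=> y _ a b ab; rewrite lee_fin; exact/lefP/nd_nnsfun_approx.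
rewrite lim; under eq_fun do rewrite nn.
under [RHS]eq_integral do rewrite lim.
rewrite -monotone_convergence//.
- move=> n; apply: measurable_fun_integral_kernel => //.
    by move=> z; rewrite lee_fin.
  exact/measurable_EFinP.
- by move=> n x _; apply: integral_ge0 => y _; rewrite lee_fin.
- move=> x _ a b ab; apply: ge0_le_integral => //.
  + by move=> z _; rewrite lee_fin.
  + exact/measurable_EFinP.
  + exact/measurable_EFinP.
  + by move=> z _; rewrite lee_fin; exact/lefP/nd_nnsfun_approx.
Qed.

End mixture.

(** * Distinctness of the points of a sample *)

Section distinct.
Context (R : realType) (d : nat).
Notation T := 'rV[R]_d.
Variable nu : probability T R.
Hypothesis nu_diffuse : diffuse nu.

Lemma measurable_uniq_tuple n : measurable [set t : n.-tuple T | uniq t].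
Proof.
apply: measurable_bool_set.
rewrite (_ : (fun t : n.-tuple T => uniq t) =
    fun t => uniq [seq tnth t i | i <- enum 'I_n]).
  by apply: measurable_uniq => i; exact: measurable_tnth.
by apply/funext => t; rewrite map_tnth_enum.
Qed.

Lemma bmf_uniq n : bmf n (fun s : seq T => (uniq s)%:R : R).
Proof. by apply: mbf_bool; exact: measurable_uniq_tuple. Qed.

Lemma measurable_rV_set1 (x : T) : measurable [set x].
Proof.
rewrite (_ : [set x] = [set y | y == x]).
  by apply: measurable_bool_set; apply: measurable_eq_rV.
by apply/seteqP; split => y /=; [move->|move/eqP].
Qed.

Lemma set_cons (y : T) (s : seq T) :
  [set x | x \in y :: s] = [set y] `|` [set x | x \in s].
Proof.
by apply/seteqP; split => x /=; rewrite inE;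
  [move=> /predU1P|move=> ?; apply/predU1P].
Qed.

Lemma measurable_seq (s : seq T) : measurable [set x | x \in s].
Proof.
elim: s => [|z s IH].
  by rewrite (_ : [set x | _] = set0)//; apply/seteqP; split.
by rewrite set_cons; apply: measurableU => //; exact: measurable_rV_set1.
Qed.

Lemma diffuse_seq (s : seq T) : nu [set x | x \in s] = 0%E.
Proof.
elim: s => [|y s IH].
  by rewrite (_ : [set x | _] = set0) ?measure0//; apply/seteqP; split.
have ms := measurable_seq s.
apply/eqP; rewrite eq_le measure_ge0 andbT set_cons.
rewrite (le_trans (measureU2 _ (measurable_rV_set1 y) ms))//.
have n0 : (nu [set y] + nu [set x | x \in s] = 0)%E by rewrite IH adde0; exact: nu_diffuse.
by move: n0 => /= ->.
Qed.

(** Given the other points, the last one avoids them almost surely, a finite set being null for a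
    diffuse law. *)
Lemma EE_uniq n : EE nu n (fun s => (uniq s)%:R) = 1.
Proof.
elim: n => [|n IH]; first by rewrite EE0.
rewrite -[n.+1]addn1 EE_cat; last exact: bmf_uniq.
rewrite -{}[RHS]IH; apply: eq_EE => xs _.
rewrite EES; last first.
  exact: (bmf_catr (k := size xs) (in_tuple xs) (bmf_uniq (size xs + 1))).
under [X in Ex _ X]funext do rewrite EE0.
transitivity (Ex nu (fun x => (uniq xs)%:R * (1 - (x \in xs)%:R))).
  congr Ex; apply/funext => x; rewrite cat_uniq /= orbF andbT.
  by case: (uniq xs); case: (x \in xs); rewrite /= ?mul1r ?mul0r ?subrr ?subr0.
have mx := measurable_seq xs.
have mb := mbf_bool R mx.
rewrite ExZ; last by apply: mbfB => //; exact: mbf_cst.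
rewrite ExB//; last exact: mbf_cst.
have -> : Ex nu (fun x => (x \in xs)%:R) = 0.
  by apply: EFin_inj; rewrite Ex_bool// diffuse_seq.
by rewrite Ex_cst subr0 mulr1.
Qed.

Lemma power_not_uniq n : power nu n [set t : n.-tuple T | ~~ uniq t] = 0%E.
Proof.
have mu := @measurable_uniq_tuple n.
have -> : [set t : n.-tuple T | ~~ uniq t] = ~` [set t | uniq t].
  by apply/seteqP; split => t /= /negP.
have e1 : power nu n [set t | uniq t] = 1%E.
  by rewrite -Ex_bool//; congr (_%:E); exact: EE_uniq.
by rewrite probability_setC// e1 subee.
Qed.

(** Inequalities between means need to be checked on samples of distinct points only. *)
Lemma le_EE_uniq n (h h' : seq T -> R) : bmf n h -> bmf n h' ->
  (forall s, size s = n -> uniq s -> h s <= h' s) -> EE nu n h <= EE nu n h'.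
Proof.
move=> mh mh' le; have [_ [C hC]] := mh; have [_ [C' hC']] := mh'.
have mu := bmf_uniq n.
(* The added penalty has mean 0 and makes the inequality true at samples with repetitions as
   well. *)
have : EE nu n h <= EE nu n (fun s => h' s + (C + C') * (1 - (uniq s)%:R)).
  apply: le_EE => //.
    by apply: mbfD => //; apply: mbfZ; apply: mbfB => //; exact: mbf_cst.
  move=> s sn; have [us|us] := boolP (uniq s).
    by rewrite subrr mulr0 addr0 le.
  have /eqP sn' := sn; have := hC (Tuple sn'); have := hC' (Tuple sn').
  by rewrite /= subr0 mulr1 !ler_norml; lra.
move=> /le_trans; apply.
rewrite /EE ExD//; last by apply: mbfZ; apply: mbfB => //; exact: mbf_cst.
rewrite ExZ; last by apply: mbfB => //; exact: mbf_cst.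
rewrite ExB//; last exact: mbf_cst.
have -> : Ex (power nu n) (fun t : n.-tuple T => (uniq t)%:R) = 1 by exact: EE_uniq.
by rewrite Ex_cst subrr mulr0 addr0.
Qed.

End distinct.

(** * Counting patterns *)

Section patterns.
Context (I T : eqType).
Variable a : I -> pred T.
Hypothesis a_disj : forall i j x, a i x -> a j x -> i = j.

Lemma count_all2 (r : seq I) (t : seq T) i : all2 a r t ->
  count (a i) t = count_mem i r.
Proof.
elim: r t => [|j r IH] [|x t]//= /andP[ajx /IH ->]; congr (_ + _)%N.
by case: eqVneq => [<-|ji]; [rewrite ajx|case: (boolP (a i x)) => // /a_disj/(_ ajx) ij; rewrite ij eqxx in ji].
Qed.

Lemma all2_unique (r : seq I) (t t' : seq T) : uniq r -> uniq t -> perm_eq t t' ->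
  all2 a r t -> all2 a r t' -> t = t'.
Proof.
elim: r t t' => [|i r IH] [|x t] [|x' t']//= /andP[ir ur] /andP[xt ut] ptt'
  /andP[aix at_] /andP[aix' at'].
have xx' : x = x'.
  apply/eqP/negPn/negP => xx'.
  have x't : x' \in t.
    by have := perm_mem ptt' x'; rewrite !inE eqxx eq_sym (negbTE xx').
  have : (0 < count (a i) t)%N by rewrite -has_count; apply/hasP; exists x'.
  by rewrite (count_all2 i at_) (count_memPn ir).
move: ptt'; rewrite {}xx' perm_cons => ptt'.
by rewrite (IH t t').
Qed.

Lemma all2_exists (r : seq I) (xs : seq T) : uniq r -> size xs = size r ->
  all (fun i => count (a i) xs == 1) r ->
  exists2 t, perm_eq t xs & all2 a r t.
Proof.
elim: r xs => [|i r IH] xs /=.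
  by move=> _ /eqP; rewrite size_eq0 => /eqP ->; exists [::].
move=> /andP[ir ur] sxs /andP[/eqP ci /allP cr].
have /hasP[x xxs aix] : has (a i) xs by rewrite has_count ci.
have pxs := perm_to_rem xxs.
have [||t pt rt] := IH (rem x xs) ur.
- by have := perm_size pxs; rewrite sxs /= => -[].
- apply/allP => j jr; have /eqP := cr j jr.
  rewrite (permP pxs) /=; case: (boolP (a j x)) => [/a_disj/(_ aix) ji|_].
    by rewrite -ji jr in ir.
  by rewrite add0n => ->.
exists (x :: t); last by rewrite /= aix.
by rewrite (perm_trans _ (_ : perm_eq (x :: rem x xs) xs)) ?perm_cons// perm_sym.
Qed.

(** Disjointness of the regions leaves at most one ordering of the points that visits them in the
    prescribed order. *)
Lemma count_permutations (r : seq I) (xs : seq T) : uniq r -> uniq xs ->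
  count (all2 a r) (permutations xs) =
  (size xs == size r) && all (fun i => count (a i) xs == 1) r.
Proof.
move=> ur uxs; case: (boolP (_ && _)) => [/andP[/eqP sxs cxs]|ncond].
  have [t pt rt] := all2_exists ur sxs cxs.
  rewrite (@eq_in_count _ _ (pred1 t)); last first.
    move=> t' /=; rewrite mem_permutations => pt'; apply/idP/eqP => [rt'|->//].
    apply: (all2_unique ur _ _ rt' rt); first by rewrite (perm_uniq pt').
    by rewrite (perm_trans pt')// perm_sym.
  by rewrite count_uniq_mem ?permutations_uniq// mem_permutations pt.
apply/eqP; rewrite -leqn0 leqNgt -has_count; apply: contra ncond => /hasP[t].
rewrite mem_permutations => pt rt; have st : size t = size r.
  by move: rt; elim: (r) (t) => [|i r' IH] [|x t']//= /andP[_ /IH ->].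
rewrite -(perm_size pt) st eqxx /=; apply/allP => i ir.
by rewrite -(permP pt) (count_all2 i rt) count_uniq_mem// ir.
Qed.

End patterns.

(** * Counts of a Poisson process *)

Lemma poisson_prob1 (R : realType) (rate : R) (j : nat) : 0 <= rate ->
  poisson_prob rate 0%N [set j] = (rate ^+ j / j`!%:R * expR (- rate))%:E.
Proof.
rewrite /poisson_prob le_eqVlt => /predU1P[<-|rate0].
  rewrite ltxx oppr0 expR0 mulr1 diracE; case: j => [|j].
    by rewrite mem_set// expr0 fact0 divr1.
  by rewrite memNset// expr0n mul0r.
by rewrite rate0 esum_set1 ?lee_fin ?poisson_pmf_ge0// /poisson_pmf rate0.
Qed.

Section poisson_counts.
Context (R : realType) (d : nat) dO (Omega : measurableType dO).
Notation T := 'rV[R]_d.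
Notation leb := (lebesgue_rV R d).
Variables (P : probability Omega R) (lam : R) (H : Omega -> set T).
Hypotheses (lam_gt0 : 0 < lam) (HP : poisson_process P lam H).
Variable B : set T.
Hypotheses (mB : measurable B) (bB : bounded_set B) (fB : (leb B < +oo)%E).

Definition points (om : Omega) : seq T := fset_set (H om `&` B).

Lemma bounded_sub (A : set T) : A `<=` B -> bounded_set A.
Proof.
move=> AB; have [M [Mr BM]] := bB; exists M; split => // M' MM' x /AB.
exact: BM.
Qed.

Lemma finite_points om : finite_set (H om `&` B).
Proof. by have [+ _ _ _] := HP; apply. Qed.

Lemma points_uniq om : uniq (points om).
Proof. exact: fset_uniq. Qed.

Lemma mem_points om x : (x \in points om) = (x \in H om `&` B).
Proof. by rewrite -[LHS]/(x \in fset_set _) in_fset_set//; exact: finite_points. Qed.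

Lemma npointsE (A : set T) om : A `<=` B ->
  npoints H A om = count (mem A) (points om).
Proof.
move=> AB; rewrite /npoints -size_filter; apply/perm_size/uniq_perm.
- exact: fset_uniq.
- by rewrite filter_uniq// points_uniq.
have fA : finite_set (H om `&` A).
  by apply: sub_finite_set (finite_points om) => x [Hx /AB].
move=> x; rewrite -[LHS]/(x \in fset_set _) in_fset_set// mem_filter mem_points.
apply/idP/andP => [/set_mem[Hx Ax]|[/set_mem Ax /set_mem[Hx _]]]; last exact/mem_set.
by split; apply/mem_set => //; split => //; exact: AB.
Qed.

Lemma npoints_size om : npoints H B om = size (points om).
Proof. by []. Qed.

Lemma npoints_prob (A : set T) j : measurable A -> A `<=` B ->
  P (npoints H A @^-1` [set j]) =
  ((lam * fine (leb A)) ^+ j / j`!%:R * expR (- (lam * fine (leb A))))%:E.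
Proof.
move=> mA AB; have [_ _ + _] := HP; move=> -> //; last exact: bounded_sub.
by rewrite poisson_prob1// mulr_ge0 ?fine_ge0// ltW.
Qed.

Lemma measurable_npoints (A : set T) j : measurable A -> A `<=` B ->
  measurable (npoints H A @^-1` [set j]).
Proof.
move=> mA AB; have [_ + _ _] := HP.
by move=> /(_ A mA (bounded_sub AB) measurableT [set j] I); rewrite setTI.
Qed.

Section pattern.
Variables (k : nat) (A : 'I_k -> set T).
Hypotheses (mA : forall i, measurable (A i)) (AB : forall i, A i `<=` B).
Hypothesis A_disj : forall i j x, A i x -> A j x -> i = j.

(** With disjoint regions in [B], this says one point in each and none elsewhere in [B]. *)
Definition pattern : set Omega :=
  [set om | npoints H B om = k /\ forall i, npoints H (A i) om = 1%N].

Let mbigA : measurable (\bigcup_i A i).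
Proof. by apply: fin_bigcup_measurable => // i _; exact: mA. Qed.

Let rest := B `\` \bigcup_i A i.
(** Index 0 is the rest of [B], which must be empty; the other indices are the regions, with one
    point each. Together they partition [B], so counts on them are independent. *)
Let F (j : 'I_k.+1) := if unlift ord0 j is Some i then A i else rest.
Let C (j : 'I_k.+1) : set nat := if unlift ord0 j is Some i then [set 1%N] else [set 0%N].

Let mF j : measurable (F j).
Proof. by rewrite /F; case: unliftP => [i|] _; [exact: mA|exact: measurableD]. Qed.

Let FB j : F j `<=` B.
Proof. by rewrite /F; case: unliftP => [i|] _; [exact: AB|move=> x []]. Qed.

Let F_disj i j x : F i x -> F j x -> i = j.
Proof.
rewrite /F; case: unliftP => [i'|] ->; case: unliftP => [j'|] ->//.
- by move=> Ai Aj; rewrite (A_disj Ai Aj).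
- by move=> Ai [_ []]; exists i'.
- by move=> [_ nA] Aj; case: nA; exists j'.
Qed.

Let F_cover : \bigcup_j F j = B.
Proof.
apply/seteqP; split => [x [j _ /FB]//|x Bx].
have [[i _ Ai]|nA] := pselect ((\bigcup_i A i) x).
  by exists (lift ord0 i) => //; rewrite /F liftK.
by exists ord0 => //; rewrite /F unlift_none.
Qed.

Lemma size_points_cover om :
  size (points om) = (\sum_j npoints H (F j) om)%N.
Proof.
under eq_bigr do rewrite npointsE//.
rewrite -(count_predT (points om)).
have : {in points om, forall x, exists j, F j x}.
  move=> x; rewrite mem_points inE => -[_]; rewrite -F_cover => -[j _ Fj].
  by exists j.
elim: (points om) => [|x s IH] sF /=; first by rewrite big1.
rewrite IH; last by move=> y ys; apply: sF; rewrite inE ys orbT.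
rewrite big_split /=; congr (_ + _)%N.
have [j Fj] := sF x (mem_head _ _).
rewrite (bigD1 j)//= mem_set// big1 ?addn0// => i ij.
by rewrite memNset// => Fi; rewrite (F_disj Fi Fj) eqxx in ij.
Qed.

Lemma patternE : pattern = \bigcap_(j in [set` enum 'I_k.+1]) (npoints H (F j) @^-1` C j).
Proof.
apply/seteqP; split => [om [Nk NA] j _|om omF].
- have := Nk; rewrite npoints_size size_points_cover big_ord_recl.
  under eq_bigr do rewrite /F liftK NA.
  rewrite sum1_card card_ord => Nr; rewrite /C /=; case: unliftP => [i ji|j0] /=.
    by rewrite ji /F liftK; exact: NA.
  by rewrite j0; lia.
- have NA i : npoints H (A i) om = 1%N.
    have := omF (lift ord0 i); rewrite /F /C liftK; apply.
    by rewrite /= mem_enum.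
  split=> //; rewrite npoints_size size_points_cover big_ord_recl.
  have := omF ord0; rewrite /F /C unlift_none => /= -> //; last by rewrite mem_enum.
  under eq_bigr do rewrite liftK NA.
  by rewrite sum1_card card_ord.
Qed.

Lemma measurable_pattern : measurable pattern.
Proof.
rewrite patternE; apply: fin_bigcap_measurable => // j _.
by rewrite /C; case: unliftP => [i|] _; exact: measurable_npoints.
Qed.

(** Membership in the sigma-algebra of the process is what makes patterns of the two processes
    independent. *)
Lemma sigma_pattern : sigma_process H pattern.
Proof.
rewrite patternE.
have gen j : sigma_process H (npoints H (F j) @^-1` C j).
  apply: sub_sigma_algebra; exists (F j), (C j); split => //.
  exact: bounded_sub.
rewrite (_ : \bigcap_(j in _) _ = ~` \bigcup_n (if insub n is Some j
    then ~` (npoints H (F j) @^-1` C j) else set0)).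
  rewrite /sigma_process -setTD; apply: sigma_algebraCD.
  apply: (@sigma_algebra_bigcup _ setT) => n; case: insubP => [j _ _|_].
    by rewrite -setTD; apply: sigma_algebraCD; exact: gen.
  exact: sigma_algebra0.
apply/seteqP; split => [om omF [n _]|om omF j _].
  by case: insubP => // j _ _; apply; apply: omF; rewrite /= mem_enum.
by apply: contrapT => nj; apply: omF; exists j => //; rewrite valK.
Qed.

(** The exponentials of the pieces multiply to that of the whole volume of [B], so the shape of the
    regions enters only through the product of their volumes. *)
Lemma prob_pattern : P pattern =
  (expR (- (lam * fine (leb B))) * lam ^+ k * \prod_i fine (leb (A i)))%:E.
Proof.
have [_ _ _ indep] := HP.
have mbF j : measurable (F j) /\ bounded_set (F j).
  by split => //; exact: bounded_sub.
have tF : trivIset [set: 'I_k.+1] F.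
  by move=> i j _ _ [x [Fi Fj]]; exact: F_disj Fi Fj.
rewrite patternE (indep _ _ mbF tF _ C (enum_uniq _) (fun=> I)).
rewrite big_enum /= big_ord_recl.
have -> : P (npoints H (F ord0) @^-1` C ord0) = (expR (- (lam * fine (leb rest))))%:E.
  by rewrite /F /C unlift_none npoints_prob// ?expr0 ?fact0 ?divr1 ?mul1r//;
    [exact: measurableD|move=> x []].
have -> : (\prod_(i < k) P (npoints H (F (lift ord0 i)) @^-1` C (lift ord0 i)) =
    (\prod_(i < k) (lam * fine (leb (A i)) * expR (- (lam * fine (leb (A i)))))%R)%:E)%E.
  rewrite -prodEFin; apply: eq_bigr => i _.
  by rewrite /F /C liftK npoints_prob// expr1 (_ : 1`! = 1%N)// divr1.
rewrite -EFinM; congr (_%:E).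
have fA (A' : set T) : measurable A' -> A' `<=` B -> leb A' \is a fin_num.
  move=> mA' A'B; rewrite ge0_fin_numE//; apply: le_lt_trans fB.
  by apply: le_measure; rewrite ?inE.
have lebB : fine (leb B) = fine (leb rest) + \sum_i fine (leb (A i)).
  have -> : leb B = (\sum_j leb (F j))%E.
    rewrite -measure_bigsetU_ord//; congr (leb _).
    rewrite -F_cover -bigcup_seq; apply/seteqP; split => x [j _ Fj]; exists j => //=.
    by rewrite mem_index_enum.
  rewrite -sum_fine => [|j _]; last exact: fA.
  rewrite big_ord_recl /F unlift_none; congr (_ + _).
  by apply: eq_bigr => i _; rewrite liftK.
rewrite !big_split /= prodr_const card_ord.
rewrite -expR_sum.
rewrite [RHS](_ : _ = expR (- (lam * fine (leb B))) * (lam ^+ k * \prod_i fine (leb (A i)))); last by rewrite mulrA.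
rewrite mulrCA mulrC; congr (_ * _); rewrite -expRD; congr expR.
by rewrite lebB sumrN -mulr_sumr; ring.
Qed.

End pattern.
End poisson_counts.

Lemma all2_enumP (T : eqType) k (a : 'I_k -> pred T) (t : seq T) : size t = k ->
  reflect (forall (i : 'I_k) x0, a i (nth x0 t i)) (all2 a (enum 'I_k) t).
Proof.
move=> st; rewrite all2E size_enum_ord st eqxx /=.
case: t st => [|x t] st.
  have k0 (i : 'I_k) : false by have := ltn_ord i; rewrite -{2}st.
  rewrite (_ : zip _ _ = [::]); last by case: (enum _).
  by apply: (iffP idP) => // _ i; have := k0 i.
have sz : size (zip (enum 'I_k) (x :: t)) = k by rewrite size1_zip ?size_enum_ord// st.
apply: (iffP idP) => [/all_nthP H i x0|H].
  have := H (i, x0) i; rewrite sz => /(_ (ltn_ord i)).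
  by rewrite nth_zip ?size_enum_ord ?st//= nth_ord_enum.
have k0 : (0 < k)%N by rewrite -st.
apply/(all_nthP (Ordinal k0, x)) => j; rewrite sz => jk.
rewrite nth_zip ?size_enum_ord ?st//=.
by rewrite -[j]/(nat_of_ord (Ordinal jk)) nth_ord_enum; exact: H.
Qed.

(** * Separating finitely many points by a fine grid *)

Section separation.
Context (R : realType) (d : nat).
Notation T := 'rV[R]_d.

Definition mesh (p : nat) : R := p.+1%:R^-1.

Lemma mesh_gt0 p : 0 < mesh p.
Proof. by rewrite invr_gt0. Qed.

Lemma separate_pair (x y : T) : x != y ->
  exists p0, forall p, (p0 <= p)%N -> cellf (mesh p) x != cellf (mesh p) y.
Proof.
move=> xy; have [i xyi] : exists i, x ord0 i != y ord0 i.
  apply/existsP; apply: contraNT xy; rewrite negb_exists => /forallP xy.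
  by apply/eqP/rowP => i; apply/eqP/negPn; exact: xy.
have D0 : 0 < `|x ord0 i - y ord0 i| by rewrite normr_gt0 subr_eq0.
exists (Num.truncn `|x ord0 i - y ord0 i|^-1) => p pp; apply/eqP => xyE.
have := mesh_gt0 p; set b := mesh p => b0.
have xb : box (corner b (cellf b x)) b x by apply/(cellf_box _ _ b0).
have yb : box (corner b (cellf b x)) b y by apply/(cellf_box _ _ b0); rewrite /b xyE.
have : `|x ord0 i - y ord0 i| < b.
  by have := xb i; have := yb i; rewrite ltr_norml; lra.
apply/negP; rewrite -leNgt /b /mesh invf_ple ?posrE//.
rewrite (le_trans (ltW (truncnS_gt _)))// ler_nat ltnS//.
Qed.

(** Every pair is separated by all sufficiently fine meshes, so the maximum of finitely many
    thresholds works. *)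
Lemma separate_seq (s : seq T) :
  exists p, {in s &, injective (cellf (mesh p))}.
Proof.
have [p0 H] : exists p0, forall p, (p0 <= p)%N ->
    forall q, q \in [seq (x, y) | x <- s, y <- s] -> q.1 != q.2 ->
    cellf (mesh p) q.1 != cellf (mesh p) q.2.
  elim: [seq (x, y) | x <- s, y <- s] => [|[x y] L [p1 IH]]; first by exists 0%N.
  have [->|xy] := eqVneq x y.
    by exists p1 => p pp q; rewrite inE => /predU1P[->|/IH/=]; [rewrite eqxx|exact].
  have [p2 H2] := separate_pair xy.
  exists (maxn p1 p2) => p; rewrite geq_max => /andP[pp1 pp2] q.
  by rewrite inE => /predU1P[-> _|qL]; [exact: H2|exact: IH].
exists p0 => x y xs ys /eqP; apply: contraTeq => xy.
by apply: (H p0 (leqnn _) (x, y)) => //; apply/allpairsP; exists (x, y).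
Qed.

End separation.

(** * The points of two independent Poisson processes *)

Section poisson_pair.
Context (R : realType) (d : nat) dO (Omega : measurableType dO).
Hypothesis d_gt0 : (0 < d)%N.
Notation T := 'rV[R]_d.
Notation leb := (lebesgue_rV R d).
Variables (P : probability Omega R) (lam : R) (H H' : Omega -> set T).
Hypotheses (lam_gt0 : 0 < lam) (HP : poisson_process P lam H)
  (HP' : poisson_process P lam H') (HH' : independent_processes P H H').
Variables (c0 : T) (s : R).
Hypothesis s_gt0 : 0 < s.
Notation B := (box c0 s).
Hypothesis bB : bounded_set B.
Notation u := (unif_box c0 s).

Let mB : measurable B := measurable_box c0 s.

Let fB : (leb B < +oo)%E.
Proof. by rewrite lebesgue_rV_cube ?ltry// ltW. Qed.

Definition pois k : R := (lam * s ^+ d) ^+ k / k`!%:R * expR (- (lam * s ^+ d)).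

Lemma pois_ge0 k : 0 <= pois k.
Proof.
apply: mulr_ge0; last exact: expR_ge0.
apply: divr_ge0 => //; apply: exprn_ge0; apply: mulr_ge0; first exact: ltW.
by apply: exprn_ge0; exact: ltW.
Qed.

(** A point is a product of null sets, and the product is not empty because d > 0. *)
Lemma unif_box_diffuse : diffuse u.
Proof.
move=> x; have mx := measurable_rV_set1 x.
have := @unif_boxE R d c0 s [set x] s_gt0 mx.
have -> : leb ([set x] `&` B) = 0%E.
  apply/eqP; rewrite eq_le measure_ge0 andbT.
  rewrite (@le_trans _ _ (leb [set x]))//.
    by apply: le_measure; rewrite ?inE//; exact: measurableI.
  rewrite (_ : [set x] = [set y : T | forall i, [set x ord0 i] (y ord0 i)]); last first.
    by apply/seteqP; split => [y /= -> //|y /= yx]; apply/rowP => i; exact: yx.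
  rewrite (@lebesgue_rV_box R d (fun i => [set x ord0 i])); last first.
    by move=> i; exact: measurable_set1.
  under eq_bigr do rewrite lebesgue_measure_set1.
  by case: (d) d_gt0 => // d' _; rewrite big_ord_recl mul0e.
move=> /esym/eqP; rewrite mule_eq0 eqe expf_eq0 (gt_eqF s_gt0) andbF/=.
by move/eqP.
Qed.

Lemma leb_unif (A : set T) : measurable A -> A `<=` B ->
  fine (leb A) = s ^+ d * fine (u A).
Proof.
move=> mA /setIidPl AB; rewrite -[in LHS]AB unif_boxE// fineM//.
by rewrite ge0_fin_numE// (le_lt_trans (probability_le1 _ mA))// ltry.
Qed.

Section tuples.
Variables k l : nat.
Notation n := (k + l)%N.
Notation X := (points H B).
Notation X' := (points H' B).

Let t0 : n.-tuple T := nseq_tuple n 0.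
Let mk (z : seq T) : n.-tuple T := insubd t0 z.

(** The empty list outside the event of [k] and [l] points makes [theta] vanish there, so the
    restriction to given counts is built in. On that event all sizes are right and the default of
    [mk] is not reached. *)
Definition split_list (om : Omega) : seq (n.-tuple T) :=
  if (size (X om) == k) && (size (X' om) == l)
  then [seq mk (t ++ t') | t <- permutations (X om), t' <- permutations (X' om)]
  else [::].

Let c : {nonneg R} := ((k`!%:R * l`!%:R)^-1)%:nng.

(* The law of the points of both processes, each in uniformly random order. *)
Definition theta (om : Omega) : {measure set (n.-tuple T) -> \bar R} :=
  list_measure t0 c (split_list om).

Definition dbox (A : 'I_k -> set T) (A' : 'I_l -> set T) : set (n.-tuple T) :=
  [set z | (forall i, A i (tnth z (lshift l i))) /\
           (forall j, A' j (tnth z (rshift k j)))].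

Lemma split_listP om z : z \in split_list om ->
  exists t t', [/\ size (X om) = k, size (X' om) = l, perm_eq t (X om),
    perm_eq t' (X' om) & tval z = t ++ t'].
Proof.
rewrite /split_list; case: ifP => // /andP[/eqP sX /eqP sX'].
move=> /allpairsP[[t t'] /= []]; rewrite !mem_permutations => pt pt' ->.
exists t, t'; split => //.
by rewrite val_insubd size_cat (perm_size pt) (perm_size pt') sX sX' eqxx.
Qed.

Section disjoint_box.
Variables (A : 'I_k -> set T) (A' : 'I_l -> set T).
Hypotheses (mA : forall i, measurable (A i)) (AB : forall i, A i `<=` B).
Hypotheses (mA' : forall i, measurable (A' i)) (AB' : forall i, A' i `<=` B).
Hypothesis A_disj : forall i j x, A i x -> A j x -> i = j.
Hypothesis A_disj' : forall i j x, A' i x -> A' j x -> i = j.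

Let glue (i : 'I_n) := match fintype.split i with inl j => A j | inr j => A' j end.

Let dboxE : dbox A A' = [set z | forall i, glue i (tnth z i)].
Proof.
apply/seteqP; split => [z [zA zA'] i|z zAA'].
  by rewrite /glue -(splitK i); case: (fintype.split i) => j; rewrite unsplitK.
split => j.
  by have := zAA' (lshift l j); rewrite /glue -[lshift l j]/(unsplit (inl j)) unsplitK.
by have := zAA' (rshift k j); rewrite /glue -[rshift k j]/(unsplit (inr j)) unsplitK.
Qed.

Let mglue i : measurable (glue i).
Proof. by rewrite /glue; case: fintype.split. Qed.

Lemma measurable_dbox : measurable (dbox A A').
Proof. by rewrite dboxE; exact: measurable_tuple_box. Qed.

Lemma power_dbox (nu : probability T R) : power nu n (dbox A A') =
  ((\prod_i fine (nu (A i))) * \prod_j fine (nu (A' j)))%:E.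
Proof.
rewrite dboxE power_box// big_split_ord EFinM -!prodEFin; congr (_ * _)%E;
  apply: eq_bigr => j _; rewrite fineK; try exact: fin_num_measure.
  by rewrite /glue -[lshift l j]/(unsplit (inl j)) unsplitK.
by rewrite /glue -[rshift k j]/(unsplit (inr j)) unsplitK.
Qed.

(** At most one ordering of each point set visits the disjoint regions in order, so the count of
    successful orderings is the indicator of the two patterns. *)
Lemma theta_dbox om : theta om (dbox A A') =
  (c%:num * \1_(pattern H B A `&` pattern H' B A') om)%:E.
Proof.
apply: (etrans (list_measureE t0 c (split_list om) _)).
congr (_ * _)%:E; rewrite /split_list.
have aD i j x : x \in A i -> x \in A j -> i = j.
  by move=> /set_mem Ai /set_mem Aj; exact: A_disj Ai Aj.
have aD' i j x : x \in A' i -> x \in A' j -> i = j.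
  by move=> /set_mem Ai /set_mem Aj; exact: A_disj' Ai Aj.
have pE : (om \in pattern H B A) =
    (size (X om) == size (enum 'I_k)) && all (fun i => count (mem (A i)) (X om) == 1) (enum 'I_k).
  rewrite size_enum_ord; apply/idP/andP => [/set_mem[Nk NA]|[/eqP Nk /allP NA]].
    split; first by rewrite -npoints_size Nk.
    by apply/allP => i _; rewrite -(npointsE HP bB)// NA.
  apply/mem_set; split; first by rewrite npoints_size.
  by move=> i; rewrite (npointsE HP bB)//; apply/eqP/NA; rewrite mem_enum.
have pE' : (om \in pattern H' B A') =
    (size (X' om) == size (enum 'I_l)) && all (fun i => count (mem (A' i)) (X' om) == 1) (enum 'I_l).
  rewrite size_enum_ord; apply/idP/andP => [/set_mem[Nk NA]|[/eqP Nk /allP NA]].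
    split; first by rewrite -npoints_size Nk.
    by apply/allP => i _; rewrite -(npointsE HP' bB)// NA.
  apply/mem_set; split; first by rewrite npoints_size.
  by move=> i; rewrite (npointsE HP' bB)//; apply/eqP/NA; rewrite mem_enum.
have ind : \1_(pattern H B A `&` pattern H' B A') om =
    ((om \in pattern H B A) && (om \in pattern H' B A'))%:R :> R.
  by rewrite indicE in_setI.
rewrite ind pE pE'; case: ifPn => [/andP[/eqP sX /eqP sX']|sXX']; last first.
  rewrite big_nil !size_enum_ord; case: eqP sXX' => //= _; case: eqP => //= _.
  by rewrite andbF.
rewrite -mulnb natrM.
rewrite -(count_permutations (a := fun i => mem (A i)) aD) ?enum_uniq ?points_uniq//.
rewrite -(count_permutations (a := fun i => mem (A' i)) aD') ?enum_uniq ?points_uniq//.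
rewrite -!sum1_count !natr_sum big_distrlr /= [RHS]big_mkcond /= big_allpairs_dep /=.
rewrite big_seq [RHS]big_seq; apply: eq_bigr => t; rewrite mem_permutations => pt.
have st : size t = k by rewrite (perm_size pt).
transitivity (\sum_(t' <- permutations (X' om))
    (if all2 (fun i => mem (A i)) (enum 'I_k) t then
       (if all2 (fun i => mem (A' i)) (enum 'I_l) t' then 1 else 0) else 0 : R)).
  rewrite big_seq [RHS]big_seq; apply: eq_bigr => t'; rewrite mem_permutations => pt'.
  have st' : size t' = l by rewrite (perm_size pt').
  have zt i x0 : tnth (mk (t ++ t')) (lshift l i) = nth x0 t i.
    by rewrite (tnth_nth x0) val_insubd size_cat st st' eqxx nth_cat /= st ltn_ord.
  have zt' i x0 : tnth (mk (t ++ t')) (rshift k i) = nth x0 t' i.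
    by rewrite (tnth_nth x0) val_insubd size_cat st st' eqxx nth_cat /= st ltnNge leq_addr addKn.
  rewrite indicE; case: (all2_enumP (fun i => mem (A i)) st) => HA; last first.
    rewrite memNset// => -[zA _]; apply: HA => i x0; apply/mem_set.
    by rewrite -(zt i x0).
  case: (all2_enumP (fun i => mem (A' i)) st') => HA'; last first.
    rewrite memNset// => -[_ zA']; apply: HA' => i x0; apply/mem_set.
    by rewrite -(zt' i x0).
  rewrite mem_set//; split => i.
    by rewrite (zt i 0); apply/set_mem/HA.
  by rewrite (zt' i 0); apply/set_mem/HA'.
case: ifP => _; last by rewrite big1.
by rewrite [RHS]big_mkcond /=; apply: eq_bigr => t' _; rewrite mulr1.
Qed.

Lemma prob_pattern_pair :
  P (pattern H B A `&` pattern H' B A') =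
  (pois k * pois l * (k`!%:R * l`!%:R) * ((\prod_i fine (u (A i))) * \prod_j fine (u (A' j))))%:E.
Proof.
have e1 : sigma_process H (pattern H B A) by exact: (sigma_pattern lam_gt0 HP mB bB fB mA AB A_disj).
have e2 : sigma_process H' (pattern H' B A') by exact: (sigma_pattern lam_gt0 HP' mB bB fB mA' AB' A_disj').
have fk : k`!%:R != 0 :> R by rewrite pnatr_eq0 -lt0n fact_gt0.
have fl : l`!%:R != 0 :> R by rewrite pnatr_eq0 -lt0n fact_gt0.
have prE m (D : 'I_m -> set T) : (forall i, measurable (D i)) -> (forall i, D i `<=` B) ->
    \prod_i fine (leb (D i)) = (s ^+ d) ^+ m * \prod_i fine (u (D i)).
  move=> mD DB; under eq_bigr do rewrite leb_unif//.
  by rewrite big_split /= prodr_const card_ord.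
have ppE : P (pattern H B A) = (expR (- (lam * s ^+ d)) * lam ^+ k *
    ((s ^+ d) ^+ k * \prod_i fine (u (A i))))%:E.
  rewrite (prob_pattern lam_gt0 HP mB bB fB mA AB A_disj).
  by rewrite lebesgue_rV_cube ?(ltW s_gt0)//; congr (_ * _)%:E; exact: prE.
have ppE' : P (pattern H' B A') = (expR (- (lam * s ^+ d)) * lam ^+ l *
    ((s ^+ d) ^+ l * \prod_i fine (u (A' i))))%:E.
  rewrite (prob_pattern lam_gt0 HP' mB bB fB mA' AB' A_disj').
  by rewrite lebesgue_rV_cube ?(ltW s_gt0)//; congr (_ * _)%:E; exact: prE.
rewrite HH'// ppE ppE' -EFinM; congr (_%:E).
rewrite /pois !exprMn /=; field.
by rewrite fk fl.
Qed.

End disjoint_box.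

(** The mean of [theta] is the law of k + l independent uniform points, weighted by the Poisson
    probabilities of the counts (Janossy's description). Measurability is carried along because
    countable sums and differences need it. *)
Definition theta_mean (S : set (n.-tuple T)) :=
  [/\ measurable S, measurable_fun [set: Omega] (theta ^~ S) &
      (\int[P]_om theta om S = (pois k * pois l)%:E * power u n S)%E].

Lemma theta_mean_bigcup (F : (set (n.-tuple T))^nat) : trivIset setT F ->
  (forall i, theta_mean (F i)) -> theta_mean (\bigcup_i F i).
Proof.
move=> tF tm; have mF i : measurable (F i) by have [] := tm i.
have bF (m : {measure set (n.-tuple T) -> \bar R}) :
    m (\bigcup_i F i) = (\sum_(0 <= i <oo) m (F i))%E.
  by rewrite measure_bigcup//; apply: eq_eseriesl => i; rewrite in_setT.
split; first exact: bigcupT_measurable.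
  rewrite (_ : theta ^~ _ = fun om => (\sum_(0 <= i <oo | i \in xpredT) theta om (F i))%E).
    by apply: ge0_emeasurable_sum => // i _; have [] := tm i.
  by apply/funext => om; rewrite bF; apply: eq_eseriesl.
under eq_integral do rewrite bF.
rewrite integral_nneseries//; last by move=> i; have [] := tm i.
rewrite bF -nneseriesZl//.
by apply: eq_eseriesr => i _; have [] := tm i.
Qed.

(** All masses involved are finite, so the identity can be subtracted. *)
Lemma theta_mean_diff (S D : set (n.-tuple T)) : S `<=` D ->
  theta_mean S -> theta_mean D -> theta_mean (D `\` S).
Proof.
move=> SD [mS mfS iS] [mD mfD iD].
have mDS : measurable (D `\` S) by exact: measurableD.
have split_ (m : {measure set (n.-tuple T) -> \bar R}) : m D = (m S + m (D `\` S))%E.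
  by rewrite (measureDI m mD mS) addeC; congr (m _ + _)%E; exact/setIidPr.
have finth om A : theta om A \is a fin_num.
  have thE : theta om A = _%:E := list_measureE t0 c (split_list om) A.
  by rewrite thE.
have mDSf : measurable_fun setT (theta ^~ (D `\` S)).
  rewrite (_ : theta ^~ _ = (theta ^~ D \- theta ^~ S)%E); first exact: emeasurable_funB.
  apply/funext => om /=; by rewrite split_ addeAC subee ?add0e//; exact: finth.
split=> //.
have pf A : measurable A -> power u n A \is a fin_num.
  by move=> mA; exact: fin_num_measure.
have : (\int[P]_om theta om D = \int[P]_om theta om S + \int[P]_om theta om (D `\` S))%E.
  rewrite -ge0_integralD//; apply: eq_integral => om _; exact: split_.
rewrite iS iD (split_ (power u n)) muleDr ?ge0_adde_def ?inE//.
have fS : ((pois k * pois l)%:E * power u n S \is a fin_num)%E by rewrite fin_numM// pf.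
move=> eD; rewrite -[LHS](addeK _ fS) [X in (X - _)%E]addeC -eD.
by rewrite [X in (X - _)%E]addeC addeK.
Qed.

Lemma theta_mean_dbox A A' :
  (forall i, measurable (A i)) -> (forall i, A i `<=` B) ->
  (forall i, measurable (A' i)) -> (forall i, A' i `<=` B) ->
  (forall i j x, A i x -> A j x -> i = j) ->
  (forall i j x, A' i x -> A' j x -> i = j) ->
  theta_mean (dbox A A').
Proof.
move=> mA AB mA' AB' dA dA'.
have mp := measurableI _ _ (measurable_pattern lam_gt0 HP mB bB fB mA AB dA)
  (measurable_pattern lam_gt0 HP' mB bB fB mA' AB' dA').
split; first exact: measurable_dbox.
  under eq_fun do rewrite theta_dbox//.
  by apply/measurable_EFinP; apply: measurable_funM => //.
under eq_integral do rewrite theta_dbox// EFinM.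
rewrite ge0_integralZl//; last by apply/measurable_EFinP.
rewrite integral_indic// setIT power_dbox//.
apply: (etrans (congr1 (mule _) (prob_pattern_pair mA AB mA' AB' dA dA'))).
rewrite -!EFinM; congr (_%:E).
have fk : k`!%:R != 0 :> R by rewrite pnatr_eq0 -lt0n fact_gt0.
have fl : l`!%:R != 0 :> R by rewrite pnatr_eq0 -lt0n fact_gt0.
by rewrite /=; field; rewrite fk fl.
Qed.

(** The formula is known for disjoint regions only. Intersecting such a box with any product box
    shrinks the regions and keeps them disjoint, so Dynkin's argument runs inside each fixed box of
    disjoint regions. *)
Lemma theta_mean_capdbox S A A' : measurable S ->
  (forall i, measurable (A i)) -> (forall i, A i `<=` B) ->
  (forall i, measurable (A' i)) -> (forall i, A' i `<=` B) ->
  (forall i j x, A i x -> A j x -> i = j) ->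
  (forall i j x, A' i x -> A' j x -> i = j) ->
  theta_mean (S `&` dbox A A').
Proof.
move=> mS mA AB mA' AB' dA dA'.
have GE : @measurable _ (n.-tuple T) = <<s boxes (fun i x => @tnth n T x i) >>.
  by rewrite measurable_tupleE g_sigma_preimage_boxes.
have sS : <<s boxes (fun i x => @tnth n T x i) >> S by rewrite -GE.
have tD := theta_mean_dbox mA AB mA' AB' dA dA'.
apply: (dynkin_induction (P := fun S => theta_mean (S `&` dbox A A')) GE) sS.
- exact: boxes_setI.
- by rewrite setTI.
- move=> _ [F mF ->].
  rewrite (_ : _ `&` _ = dbox (fun i => F (lshift l i) `&` A i)
      (fun j => F (rshift k j) `&` A' j)).
    apply: theta_mean_dbox.
    + by move=> i; exact: measurableI.
    + by move=> i x [_ /AB].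
    + by move=> i; exact: measurableI.
    + by move=> i x [_ /AB'].
    + by move=> i j x [_ Ai] [_ Aj]; exact: dA Ai Aj.
    + by move=> i j x [_ Ai] [_ Aj]; exact: dA' Ai Aj.
  apply/seteqP; split => [z [zF [zA zA']]|z [zA zA']]; first by split => i; split.
  split; last by split => i; [have [] := zA i|have [] := zA' i].
  move=> i; rewrite -(splitK i); case: (fintype.split i) => j.
    by have [] := zA j.
  by have [] := zA' j.
- move=> S' _ tS'.
  rewrite (_ : _ `&` _ = dbox A A' `\` (S' `&` dbox A A')).
    by apply: theta_mean_diff => // z [].
  by apply/seteqP; split => z [zS zD]; split => //; [case|move=> S'z; apply: zD].
- move=> F _ tF tmF; rewrite setI_bigcupl; apply: theta_mean_bigcup => //.
  by apply/trivIsetP => i j _ _ ij; move/trivIsetP: tF => /(_ i j I I ij) Fij;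
    rewrite setIACA Fij set0I.
Qed.

Lemma theta_mean0 : theta_mean set0.
Proof.
split => //; first by under eq_fun do rewrite measure0; exact: measurable_cst.
by rewrite measure0 mule0; apply: integral0_eq => om _; rewrite measure0.
Qed.

(** A mesh and one cell index per point: countably many choices, which [E] enumerates. *)
Let grid := (nat * ({ffun 'I_k -> 'rV[int]_d} * {ffun 'I_l -> 'rV[int]_d}))%type.

Let gbox (g : grid) : set (n.-tuple T) :=
  if injectiveb g.2.1 && injectiveb g.2.2 then
    dbox (fun i => B `&` [set x | cellf (mesh R g.1) x == g.2.1 i])
         (fun i => B `&` [set x | cellf (mesh R g.1) x == g.2.2 i])
  else set0.

Let E (m : nat) : set (n.-tuple T) :=
  if choice.unpickle m is Some g then gbox g else set0.

Let gbox_bigcup g : gbox g `<=` \bigcup_m E m.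
Proof. by move=> z gz; exists (choice.pickle g) => //; rewrite /E choice.pickleK. Qed.

(** Distinctness is required within each half only: a point of one process may share a cell, or
    coincide, with a point of the other. *)
Let bigcup_separated (z : n.-tuple T) :
  injective (fun i => tnth z (lshift l i)) ->
  injective (fun j => tnth z (rshift k j)) ->
  (forall i, B (tnth z i)) -> (\bigcup_m E m) z.
Proof.
move=> u1 u2 zB; have [p pinj] := separate_seq z.
pose g : grid := (p, ([ffun i => cellf (mesh R p) (tnth z (lshift l i))],
  [ffun j => cellf (mesh R p) (tnth z (rshift k j))])).
apply: (@gbox_bigcup g); rewrite /gbox.
have inj1 : injective g.2.1.
  by move=> i j; rewrite !ffunE => /pinj; rewrite !mem_tnth => /(_ isT isT) /u1.
have inj2 : injective g.2.2.
  by move=> i j; rewrite !ffunE => /pinj; rewrite !mem_tnth => /(_ isT isT) /u2.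
have [/injectiveP -> /injectiveP ->] := (inj1, inj2).
by split => i; split => //=; rewrite ffunE.
Qed.

Let theta_mean_capE S m : measurable S -> theta_mean (S `&` E m).
Proof.
move=> mS; rewrite /E; case: choice.unpickle => [g|]; last first.
  by rewrite setI0; exact: theta_mean0.
rewrite /gbox; case: ifP => [/andP[/injectiveP i1 /injectiveP i2]|_]; last first.
  by rewrite setI0; exact: theta_mean0.
have mc v : measurable (B `&` [set x | cellf (mesh R g.1) x == v]).
  by apply: measurableI => //; apply: measurable_bool_set; exact: measurable_cellf (mesh_gt0 R _).
apply: theta_mean_capdbox => //.
- by move=> i j x [_ /eqP xi] [_ /eqP xj]; apply: i1; rewrite -xi -xj.
- by move=> i j x [_ /eqP xi] [_ /eqP xj]; apply: i2; rewrite -xi -xj.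
Qed.

Let in_points (J : Omega -> set T) om x : poisson_process P lam J ->
  x \in points J B om -> B x.
Proof. by move=> JP; rewrite (mem_points JP bB) => /set_mem[]. Qed.

Let split_list_cover om z : z \in split_list om -> (\bigcup_m E m) z.
Proof.
move=> /split_listP[t [t' [sX sX' pt pt' ztt']]].
have st : size t = k by rewrite (perm_size pt).
have st' : size t' = l by rewrite (perm_size pt').
have ut : uniq t by rewrite (perm_uniq pt); exact: (points_uniq H B om).
have ut' : uniq t' by rewrite (perm_uniq pt'); exact: (points_uniq H' B om).
apply: bigcup_separated => [i j|i j|i].
- rewrite !(tnth_nth 0) ztt' !nth_cat /= st !ltn_ord => /eqP.
  by rewrite nth_uniq ?st// => /eqP/val_inj.
- rewrite !(tnth_nth 0) ztt' !nth_cat /= st !ltnNge !leq_addr !addKn => /eqP.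
  by rewrite nth_uniq ?st'// => /eqP/val_inj.
- have : tnth z i \in z by exact: mem_tnth.
  rewrite -[_ \in z]/(_ \in tval z) ztt' mem_cat (perm_mem pt) (perm_mem pt').
  by move=> /orP[] /in_points; apply.
Qed.

Let mE m : measurable (E m).
Proof. by rewrite -[E m]setTI; have [] := theta_mean_capE m measurableT. Qed.

(** Independent uniform points of [B] are almost surely distinct and inside [B], hence separated by
    some grid. *)
Let power_cover : power u n (~` \bigcup_m E m) = 0%E.
Proof.
have mUn := @measurable_uniq_tuple R d n.
have mNU : measurable [set z : n.-tuple T | ~~ uniq z].
  rewrite (_ : [set z : n.-tuple T | ~~ uniq z] = ~` [set z : n.-tuple T | uniq z]).
    exact: measurableC.
  by apply/seteqP; split => z /= /negP.
have mIn : measurable [set z : n.-tuple T | forall i, B (tnth z i)].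
  exact: (measurable_tuple_box (fun=> mB)).
have pIn : power u n [set z : n.-tuple T | forall i, B (tnth z i)] = 1%E.
  rewrite (power_box u (A := fun=> B))// big1// => i _.
  have := leb_unif mB (@subset_refl _ B); rewrite lebesgue_rV_cube ?(ltW s_gt0)//.
  have sd : s ^+ d != 0 by rewrite expf_neq0// gt_eqF.
  rewrite -[LHS]/(s ^+ d) -[LHS]mulr1 => /(mulfI sd) e1.
  by rewrite -[LHS]fineK ?fin_num_measure// -e1.
apply/eqP; rewrite eq_le measure_ge0 andbT.
apply: (@le_trans _ _ (power u n ([set z : n.-tuple T | ~~ uniq z] `|`
    ~` [set z : n.-tuple T | forall i, B (tnth z i)]))).
  apply: le_measure; rewrite ?inE//.
  - by apply: measurableC; exact: bigcupT_measurable.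
  - by apply: measurableU => //; exact: measurableC.
  move=> z zE; have [uz|uz] := boolP (uniq z); last by left.
  right=> zB; apply: zE; have /tuple_uniqP inj := uz.
  by apply: bigcup_separated => // i j /inj; [exact: lshift_inj|exact: rshift_inj].
apply: (le_trans (measureU2 _ mNU (measurableC mIn))).
have := probability_setC (power u n) mIn.
rewrite pIn subee// => C0.
by have := power_not_uniq unif_box_diffuse n; move: C0 => /= -> ->; rewrite adde0.
Qed.

(** The covering boxes are made disjoint and their contributions summed. Outside their union both
    sides vanish: the atoms of [theta] are in it, and its complement is null for uniform points. *)
Lemma theta_meanT S : measurable S -> theta_mean S.
Proof.
move=> mS; set O := \bigcup_m E m.
have mO : measurable O by exact: bigcupT_measurable.
have mSO : measurable (S `&` ~` O) by apply: measurableI => //; exact: measurableC.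
have t1 : theta_mean (S `&` O).
  rewrite /O seqDU_bigcup_eq setI_bigcupr; apply: theta_mean_bigcup.
    apply/trivIsetP => i j _ _ ij.
    by have /trivIsetP/(_ i j I I ij) Eij := trivIset_seqDU E; rewrite setIACA Eij setI0.
  move=> m; rewrite /seqDU setDE setIA [X in theta_mean X]setIAC.
  apply: theta_mean_capE; apply: measurableI => //; apply: measurableC.
  by apply: bigsetU_measurable => i _.
have t2 : theta_mean (S `&` ~` O).
  have th0 om : theta om (S `&` ~` O) = 0%E.
    apply: (etrans (list_measureE t0 c (split_list om) _)).
    rewrite big_seq big1 ?mulr0// => z /split_list_cover zO.
    by rewrite indicE memNset// => -[].
  split => //; first by under eq_fun do rewrite th0; exact: measurable_cst.
  rewrite integral0_eq => [|om _]; last exact: th0.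
  rewrite (_ : power u n _ = 0%E) ?mule0//; apply/eqP; rewrite eq_le measure_ge0 andbT.
  rewrite -[leRHS]power_cover; apply: le_measure; rewrite ?inE//; first exact: measurableC.
rewrite -(setIT S) -(setUCr O) setIUr -bigcup2E; apply: theta_mean_bigcup.
  apply/trivIsetP => -[|[|i]] [|[|j]]//= _ _ _; rewrite /bigcup2/= ?setI0 ?set0I//.
  - by rewrite setIACA setICr setI0.
  - by rewrite setIACA setICl setI0.
by move=> [|[|i]] //; exact: theta_mean0.
Qed.

Section janossy.
Variable F : seq T -> seq T -> R.
Hypotheses (mF : mbf2 F) (F_ge0 : forall xs ys, 0 <= F xs ys).
Hypothesis F_perm : forall xs xs' ys ys', perm_eq xs xs' -> perm_eq ys ys' ->
  F xs ys = F xs' ys'.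

Let G om := if (size (X om) == k) && (size (X' om) == l) then F (X om) (X' om) else 0.
Let psi (z : n.-tuple T) := F (take k z) (drop k z).

Let mpsi : measurable_fun setT psi.
Proof. by have [] := mbf2_bmf_cat k l mF. Qed.

Let integral_theta om : (\int[theta om]_z (psi z)%:E = (G om)%:E)%E.
Proof.
rewrite integral_list_measure//; last by move=> z; exact: F_ge0.
congr (_%:E); rewrite /G /split_list; case: ifP => [/andP[/eqP sX /eqP sX']|_]; last first.
  by rewrite big_nil mulr0.
rewrite big_allpairs_dep /= (_ : \sum_(_ <- _) _ = k`!%:R * (l`!%:R * F (X om) (X' om))).
  have fk : k`!%:R != 0 :> R by rewrite pnatr_eq0 -lt0n fact_gt0.
  have fl : l`!%:R != 0 :> R by rewrite pnatr_eq0 -lt0n fact_gt0.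
  by field; rewrite fk fl.
transitivity (\sum_(t <- permutations (X om)) \sum_(t' <- permutations (X' om)) F (X om) (X' om)).
  rewrite big_seq [RHS]big_seq; apply: eq_bigr => t; rewrite mem_permutations => pt.
  rewrite big_seq [RHS]big_seq; apply: eq_bigr => t'; rewrite mem_permutations => pt'.
  have st : size t = k by rewrite (perm_size pt).
  have st' : size t' = l by rewrite (perm_size pt').
  rewrite /psi val_insubd size_cat st st' eqxx.
  by rewrite take_size_cat// drop_size_cat//; exact: F_perm.
rewrite !big_const_seq !count_predT !iter_addr !addr0.
rewrite !size_permutations; [|exact: points_uniq|exact: points_uniq].
by rewrite sX sX' !mulr_natl.
Qed.

(** [F] ignores the order of its arguments, so integrating it against the random orderings returns
    its value at the point sets; the mean of [theta] then gives the formula. Measurability of the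
    cost on [Omega] is obtained by the same route. *)
Lemma poisson_term : measurable_fun [set: Omega] (fun om => (G om)%:E) /\
  (\int[P]_om (G om)%:E = (pois k * pois l * EE u k (fun xs => EE u l (F xs)))%:E)%E.
Proof.
under eq_fun do rewrite -integral_theta.
have mth S : measurable S -> measurable_fun setT (theta ^~ S).
  by move=> mS; have [] := theta_meanT mS.
have psi0 z : (0 <= (psi z)%:E)%E by rewrite lee_fin F_ge0.
have mpsi' : measurable_fun setT (EFin \o psi) by exact/measurable_EFinP.
split; first exact: (measurable_fun_integral_kernel mth psi0 mpsi').
pose a : {nonneg R} := NngNum (mulr_ge0 (pois_ge0 k) (pois_ge0 l)).
rewrite -(integral_mixture (m := mscale a (power u n)) mth _ mpsi' psi0); last first.
  by move=> S mS; have [_ _ ->] := theta_meanT mS.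
apply: (etrans (ge0_integral_mscale (power u n) measurableT a mpsi' (fun z _ => psi0 z))).
apply: (etrans _ (esym (EFinM (pois k * pois l) _))).
apply: (congr1 (mule (pois k * pois l)%:E)).
by rewrite -(mbf2_catE u k l mF) /EE EFin_Ex//; exact: mbf2_bmf_cat.
Qed.

End janossy.

End tuples.
End poisson_pair.

(** * The matching cost of two samples *)

Section measurable_undup.
Context dX (X : measurableType dX) (R : realType) (d : nat).
Notation T := 'rV[R]_d.

Lemma measurable_mem (I : Type) (r : seq I) (f : I -> X -> T) (h : X -> T) :
  measurable_fun setT h -> (forall i, measurable_fun [set: X] (f i)) ->
  measurable_fun setT (fun x => h x \in [seq f i x | i <- r]).
Proof.
move=> mh mf; elim: r => [|i r IH] /=; first exact: measurable_cst.
under eq_fun do rewrite inE.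
by apply: measurable_or => //; exact: measurable_eq_rV.
Qed.

Lemma measurable_nat_bool (b : X -> bool) :
  measurable_fun setT b -> measurable_fun setT (fun x => nat_of_bool (b x)).
Proof. by move=> mb; apply: (measurableT_comp (f := nat_of_bool)). Qed.

Lemma measurable_size_undup (I : Type) (r : seq I) (f : I -> X -> T) :
  (forall i, measurable_fun [set: X] (f i)) ->
  measurable_fun setT (fun x => size (undup [seq f i x | i <- r])).
Proof.
move=> mf; elim: r => [|i r IH] /=; first exact: measurable_cst.
rewrite (_ : (fun x => _) = fun x => ((f i x \notin [seq f j x | j <- r]) +
    size (undup [seq f j x | j <- r]))%N); last first.
  by apply/funext => x; case: ifP.
apply: measurable_fun_addn => //; apply: measurable_nat_bool.
by apply: measurable_neg; exact: measurable_mem.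
Qed.

End measurable_undup.

Section sample_cost.
Context (R : realType) (d : nat).
Notation T := 'rV[R]_d.
Variable w : T -> R.
Hypotheses (w_ge0 : forall x, 0 <= w x) (w_ub : has_ubound (range w)).
Hypotheses (w_meas : measurable_fun [set: T] w) (W1 : condW1 w).
Notation M := (wmax w).
Let M0 : 0 <= M := wmax_ge0 w_ge0 w_ub.

Definition BMs (s : R) (xs ys : seq T) : R :=
  BM w [fset s *: x | x in xs]%fset [fset s *: y | y in ys]%fset.

(** Repeated points collapse in the finite sets, so the number of edges counts distinct points; the
    gain does not see multiplicities. *)
Lemma BMsE s xs ys : s != 0 ->
  BMs s xs ys = M * (size (undup (xs ++ ys)))./2%:R - MG (sgap w s) xs ys.
Proof.
move=> s0; rewrite /BMs BM_MG//; congr (_ * (_./2)%:R - _).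
  have -> : ([fset s *: x | x in xs] `|` [fset s *: y | y in ys] =
      [fset s *: x | x in undup (xs ++ ys)])%fset.
    apply/fsetP => z; rewrite in_fsetU; apply/orP/imfsetP => /=.
      by move=> [/imfsetP[x /= xs_ ->]|/imfsetP[x /= xs_ ->]]; exists x => //;
        rewrite mem_undup mem_cat xs_ ?orbT.
    by move=> [x]; rewrite mem_undup mem_cat => /orP[] xs_ ->; [left|right];
      apply/imfsetP; exists x.
  rewrite card_imfset//=; last exact: scalerI.
  by rewrite undup_id// undup_uniq.
rewrite (@eq_mem_MG _ _ _ M (gap_le w_ge0) M0 _ _ (map ( *:%R s) xs) (map ( *:%R s) ys)).
- rewrite (@MG_map _ _ _ (gap w) M ( *:%R s) ( *:%R s^-1))//.
  + by congr MG; apply/funext => x; apply/funext => y; rewrite /sgap /gap scalerBr.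
  + exact: gap_ge0.
  + exact: gap_le.
  + by move=> x; rewrite scalerA mulVf// scale1r.
  + by move=> x; rewrite scalerA mulfV// scale1r.
- move=> z; apply/imfsetP/mapP => /=.
    by move=> [x xs_ ->]; exists x.
  by move=> [x xs_ ->]; exists x.
- move=> z; apply/imfsetP/mapP => /=.
    by move=> [x xs_ ->]; exists x.
  by move=> [x xs_ ->]; exists x.
Qed.

Lemma mbf2_BMs s : s != 0 -> mbf2 (BMs s).
Proof.
move=> s0 k l.
rewrite (_ : (fun _ => _) = fun p : k.-tuple T * l.-tuple T =>
  M * (size (undup (p.1 ++ p.2)))./2%:R - MG (sgap w s) p.1 p.2); last first.
  by apply/funext => p; rewrite BMsE.
apply: mbfB; last exact: mbf2_MG.
apply: mbfZ.
have mh : bmf (k + l) (fun t : seq T => (size (undup t))./2%:R : R).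
  split; last first.
    exists (k + l)%:R => t; rewrite ger0_norm// ler_nat.
    by rewrite leq_half_double (leq_trans (size_undup _))// size_tuple -addnn; lia.
  apply: (measurableT_comp (f := fun m : nat => m./2%:R : R)) => //.
  rewrite (_ : (fun x => _) = fun t : (k + l).-tuple T => size (undup [seq tnth t i | i <- enum 'I_(k + l)])).
    by apply: measurable_size_undup => i; exact: measurable_tnth.
  by apply/funext => t; rewrite map_tnth_enum.
exact: (bmf_cat mh).
Qed.

Lemma BM_ge0 U V : 0 <= BM w U V.
Proof.
have [tau _ [-> _]] := BM_min w U V.
rewrite /matching_weight; apply: sumr_ge0 => e _; rewrite /edge_weight.
case: (enum_fset e) => [|x [|y [|? ?]]] //; by rewrite /wstar; case: ifP.
Qed.

Lemma BMs_perm s xs xs' ys ys' : perm_eq xs xs' -> perm_eq ys ys' ->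
  BMs s xs ys = BMs s xs' ys'.
Proof.
move=> pxs pys; rewrite /BMs; congr BM; apply: eq_imfset => // x.
- exact: (perm_mem pxs).
- exact: (perm_mem pys).
Qed.

(** For a diffuse law repetitions have probability zero, and the number of edges becomes
    deterministic. *)
Lemma EE_BMs (nu : probability T R) s k l : diffuse nu -> s != 0 ->
  EE nu k (fun xs => EE nu l (BMs s xs)) =
  M * ((k + l)./2)%:R - EE nu k (fun xs => EE nu l (MG (sgap w s) xs)).
Proof.
move=> dnu s0; have m1 := mbf2_BMs s0; have m2 := mbf2_MG w_ge0 w_ub w_meas s.
rewrite -(mbf2_catE nu k l m1) -(mbf2_catE nu k l m2).
have b1 := mbf2_bmf_cat k l m1; have b2 := mbf2_bmf_cat k l m2.
have b3 : bmf (k + l) (fun t => M * ((k + l)./2)%:R - MG (sgap w s) (take k t) (drop k t)).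
  by apply: mbfB => //; exact: mbf_cst.
rewrite [RHS](_ : _ = EE nu (k + l) (fun t => M * ((k + l)./2)%:R - MG (sgap w s) (take k t) (drop k t))); last first.
  by rewrite /EE ExB ?Ex_cst//; exact: mbf_cst.
have e t : size t = (k + l)%N -> uniq t ->
   BMs s (take k t) (drop k t) = M * ((k + l)./2)%:R - MG (sgap w s) (take k t) (drop k t).
  by move=> st ut; rewrite BMsE// cat_take_drop undup_id// st.
by apply/eqP; rewrite eq_le; apply/andP; split; apply: le_EE_uniq => // t st ut; rewrite e.
Qed.

End sample_cost.

(** * The limit for Poisson processes *)

Section poisson_moments.
Context (R : realType) (a : R).
Hypothesis a_gt0 : 0 < a.

Let p (k : nat) : R := a ^+ k / k`!%:R * expR (- a).

Let p_ge0 k : 0 <= p k.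
Proof.
apply: mulr_ge0; last exact: expR_ge0.
by apply: divr_ge0 => //; apply: exprn_ge0; exact: ltW.
Qed.

Local Open Scope ereal_scope.

Lemma poisson_mean_cst : \sum_(0 <= k <oo) (p k)%:E = 1.
Proof.
have := probability_setT (poisson_prob a 0%N).
rewrite /= /poisson_prob a_gt0 => e1; rewrite -[RHS]e1.
rewrite nneseries_esum; last by move=> n _; rewrite lee_fin.
rewrite (_ : [set _ | _] = setT); last by apply/seteqP.
by apply: eq_esum => k _; rewrite /poisson_pmf a_gt0.
Qed.

(** The identity E[k f(k)] = a E[f(k + 1)] that characterises the Poisson law; it yields the first
    two moments. *)
Let shift (f : nat -> R) : (forall k, 0 <= f k)%R ->
  \sum_(0 <= k <oo) (p k * (k%:R * f k))%:E = a%:E * \sum_(0 <= k <oo) (p k * f k.+1)%:E.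
Proof.
move=> f0; have f0' k : 0 <= (p k * (k%:R * f k))%:E.
  by rewrite lee_fin mulr_ge0// mulr_ge0.
rewrite nneseries_recl//= mul0r mulr0 add0e -nneseriesZl; last first.
  by move=> k _; rewrite lee_fin mulr_ge0.
rewrite -(@nneseries_addn _ (fun k => (p k * (k%:R * f k))%:E) 1)//.
apply: eq_eseriesr => k _; rewrite addn1 -EFinM; congr (_%:E).
rewrite /p factS natrM exprS.
have fk : (k`!%:R != 0 :> R)%R by rewrite pnatr_eq0 -lt0n fact_gt0.
have k1 : (k.+1%:R != 0 :> R)%R by rewrite pnatr_eq0.
by move: k1; move: (k.+1%:R : R)%R => K k1; field; rewrite fk k1.
Qed.

Lemma poisson_mean_id : \sum_(0 <= k <oo) (p k * k%:R)%:E = a%:E.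
Proof.
transitivity (\sum_(0 <= k <oo) (p k * (k%:R * (cst 1 k)))%:E).
  by apply: eq_eseriesr => k _; rewrite mulr1.
rewrite shift//; under eq_eseriesr do rewrite mulr1.
by rewrite poisson_mean_cst mule1.
Qed.

Lemma poisson_meanD (f g : nat -> R) : (forall k, 0 <= f k)%R -> (forall k, 0 <= g k)%R ->
  \sum_(0 <= k <oo) (p k * (f k + g k))%:E =
  \sum_(0 <= k <oo) (p k * f k)%:E + \sum_(0 <= k <oo) (p k * g k)%:E.
Proof.
move=> f0 g0; under eq_eseriesr do rewrite mulrDr EFinD.
by rewrite nneseriesD// => k _ _; rewrite lee_fin mulr_ge0.
Qed.

Lemma poisson_meanZ (c : R) (f : nat -> R) : (forall k, 0 <= f k)%R ->
  \sum_(0 <= k <oo) (p k * (c * f k))%:E = c%:E * \sum_(0 <= k <oo) (p k * f k)%:E.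
Proof.
move=> f0; under eq_eseriesr do rewrite mulrCA EFinM.
by rewrite nneseriesZl// => k _; rewrite lee_fin mulr_ge0.
Qed.

Lemma poisson_mean_const (c : R) : \sum_(0 <= k <oo) (p k * c)%:E = c%:E.
Proof.
under eq_eseriesr do rewrite mulrC EFinM.
rewrite nneseriesZl; last by move=> k _; rewrite lee_fin.
by rewrite poisson_mean_cst mule1.
Qed.

Lemma poisson_variance : \sum_(0 <= k <oo) (p k * (k%:R - a) ^+ 2)%:E = a%:E.
Proof.
have a0 : (0 <= a)%R := ltW a_gt0.
(* The cross term stands on the left so that both series have nonnegative terms. *)
have : \sum_(0 <= k <oo) (p k * ((k%:R - a) ^+ 2 + 2 * a * k%:R))%:E =
    \sum_(0 <= k <oo) (p k * (k%:R * k%:R + a ^+ 2))%:E.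
  by apply: eq_eseriesr => k _; congr (_%:E); ring.
rewrite poisson_meanD; last 2 first.
- by move=> k; exact: sqr_ge0.
- by move=> k; rewrite !mulr_ge0.
rewrite poisson_meanZ// poisson_mean_id poisson_meanD//; last by move=> k; exact: sqr_ge0.
rewrite (shift (f := fun k => k%:R)%R)// poisson_mean_const.
under [X in _ = _ * X + _ -> _]eq_eseriesr do rewrite -natr1.
rewrite poisson_meanD// poisson_mean_id poisson_mean_const.
rewrite (_ : a%:E * (a%:E + 1%:E) + (a ^+ 2)%:E = (a * (a + 1) + a ^+ 2)%:E)//.
rewrite -EFinM => e; rewrite -[LHS](@addeK _ (2 * a * a)%:E)// e -EFinB; congr (_%:E).
by ring.
Qed.

(** [alpha] dominates the deviation by the same quadratic bound as for binomial counts, and its mean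
    is explicit because the variance equals the mean. *)
Lemma poisson_mean_dist (k0 : nat) (kap : R) : (0 < kap)%R -> (`|a - k0%:R| <= 1)%R ->
  exists alpha : nat -> R, [/\ (forall k, `|k%:R - k0%:R| <= alpha k)%R &
    \sum_(0 <= k <oo) (p k * alpha k)%:E = ((kap * a + kap^-1) / 2 + 1)%:E].
Proof.
move=> kap0 ak0; exists (fun k => kap / 2 * (k%:R - a) ^+ 2 + (kap^-1 / 2 + 1))%R; split.
  move=> k; set y := `|k%:R - a|%R.
  have y2 : ((k%:R - a) ^+ 2 = y ^+ 2)%R by rewrite /y real_normK// num_real.
  have yy : (y <= kap / 2 * y ^+ 2 + kap^-1 / 2)%R.
    rewrite -subr_ge0 (_ : (_ - y)%R = ((kap * y - 1) ^+ 2 * (kap^-1 / 2))%R).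
      by rewrite mulr_ge0 ?sqr_ge0 ?divr_ge0 ?invr_ge0 ?ltW.
    by field; rewrite gt_eqF.
  have := ler_distD a k%:R k0%:R; rewrite -/y y2; lra.
have k20 : (0 <= kap / 2)%R by rewrite divr_ge0 ?ltW.
rewrite poisson_meanD; last 2 first.
- by move=> k; rewrite mulr_ge0 ?sqr_ge0.
- by move=> k; rewrite addr_ge0 ?divr_ge0 ?invr_ge0 ?ltW.
rewrite poisson_meanZ; last by move=> k; exact: sqr_ge0.
rewrite poisson_variance poisson_mean_const -EFinM -EFinD; congr (_%:E); ring.
Qed.

(** The mean over two independent Poisson counts of a quantity that stays near [b] up to a multiple
    of the deviations of both counts. *)
Lemma poisson_mean2 (m : nat -> nat -> R) (b C c : R) (alpha : nat -> R) :
  (0 <= b)%R -> (0 <= C)%R -> (forall k l, 0 <= m k l)%R -> (forall k, 0 <= alpha k)%R ->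
  \sum_(0 <= k <oo) (p k * alpha k)%:E = c%:E ->
  (forall k l, `|m k l - b| <= C * (1 + alpha k + alpha l))%R ->
  (b - C * (1 + 2 * c))%:E <= \sum_(0 <= k <oo) \sum_(0 <= l <oo) (p k * p l * m k l)%:E
    <= (b + C * (1 + 2 * c))%:E.
Proof.
move=> b0 C0 m0 al0 alc mb.
have ppr k l : (0 <= p k * p l)%R by exact: mulr_ge0.
have D0 k l : (0 <= C * (1 + alpha k + alpha l))%R by rewrite mulr_ge0// !addr_ge0.
have pp0 k l x : (0 <= x)%R -> 0 <= (p k * p l * x)%:E
  by move=> x0; rewrite lee_fin; apply: mulr_ge0 => //; exact: mulr_ge0.
have c0 : (0 <= c)%R.
  by rewrite -lee_fin -alc nneseries_ge0// => k _; rewrite lee_fin mulr_ge0.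
have inner x k : (0 <= x)%R ->
    \sum_(0 <= l <oo) (p k * p l * (x + C * (1 + alpha k + alpha l)))%:E =
    (p k * (x + C * (1 + c) + C * alpha k))%:E.
  move=> x0.
  transitivity (\sum_(0 <= l <oo) (p l * (p k * (x + C * (1 + alpha k)) + p k * C * alpha l))%:E).
    by apply: eq_eseriesr => l _; congr (_%:E); ring.
  rewrite poisson_meanD; last 2 first.
  - move=> _; apply: mulr_ge0 => //; apply: addr_ge0 => //.
    by apply: mulr_ge0 => //; exact: addr_ge0.
  - by move=> l; apply: mulr_ge0 => //; exact: mulr_ge0.
  rewrite poisson_mean_const poisson_meanZ// alc -EFinM -EFinD; congr (_%:E); ring.
have outer x : (0 <= x)%R ->
    \sum_(0 <= k <oo) \sum_(0 <= l <oo) (p k * p l * (x + C * (1 + alpha k + alpha l)))%:E =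
    (x + C * (1 + 2 * c))%:E.
  move=> x0; under eq_eseriesr do rewrite inner//.
  rewrite poisson_meanD; last 2 first.
  - by move=> _; apply: addr_ge0 => //; apply: mulr_ge0 => //; exact: addr_ge0.
  - by move=> l; exact: mulr_ge0.
  rewrite poisson_mean_const poisson_meanZ// alc -EFinM -EFinD; congr (_%:E); ring.
have in0 k x : (forall l, 0 <= x l)%R -> 0 <= \sum_(0 <= l <oo) (p k * p l * x l)%:E.
  by move=> x0; apply: nneseries_ge0 => l _ _; exact: pp0.
apply/andP; split; last first.
  rewrite -outer//; apply: lee_nneseries => [k _ _|k _]; first exact: in0.
  apply: lee_nneseries => [l _ _|l _]; first exact: pp0.
  rewrite lee_fin ler_wpM2l//.
  by have := mb k l; rewrite ler_norml; lra.
rewrite EFinB leeBlDr//.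
have -> : b%:E = \sum_(0 <= k <oo) \sum_(0 <= l <oo) (p k * p l * b)%:E.
  transitivity (\sum_(0 <= k <oo) (p k * b)%:E); first by rewrite poisson_mean_const.
  apply: eq_eseriesr => k _; rewrite -[LHS]poisson_mean_const.
  by apply: eq_eseriesr => l _; rewrite mulrCA mulrA.
(* The lower bound is proved as b <= m + error, with the error written as [outer] at 0, to avoid
   subtracting series. *)
rewrite -[X in _ <= _ + X%:E]add0r -outer// -nneseriesD; last 2 first.
- by move=> k _ _; exact: in0.
- by move=> k _ _; apply: in0 => l; rewrite add0r.
apply: lee_nneseries => [k _ _|k _]; first exact: in0.
rewrite -nneseriesD; last 2 first.
- by move=> l _ _; exact: pp0.
- by move=> l _ _; apply: pp0; rewrite add0r.
apply: lee_nneseries => [l _ _|l _]; first exact: pp0.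
rewrite -EFinD -mulrDr lee_fin ler_wpM2l//.
by have := mb k l; rewrite ler_norml; lra.
Qed.

End poisson_moments.

Section poisson_sum.
Context (R : realType) (d : nat) dO (Omega : measurableType dO).
Hypothesis d_gt0 : (0 < d)%N.
Notation T := 'rV[R]_d.
Variables (P : probability Omega R) (lam : R) (H H' : Omega -> set T).
Hypotheses (lam_gt0 : 0 < lam) (HP : poisson_process P lam H)
  (HP' : poisson_process P lam H') (HH' : independent_processes P H H').
Variables (c0 : T) (s : R).
Hypothesis s_gt0 : 0 < s.
Notation B := (box c0 s).
Hypothesis bB : bounded_set B.
Notation u := (unif_box c0 s).
Notation X := (points H B).
Notation X' := (points H' B).
Variable F : seq T -> seq T -> R.
Hypotheses (mF : mbf2 F) (F_ge0 : forall xs ys, 0 <= F xs ys).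
Hypothesis F_perm : forall xs xs' ys ys', perm_eq xs xs' -> perm_eq ys ys' ->
  F xs ys = F xs' ys'.

Local Open Scope ereal_scope.

Lemma nneseries_single (a : \bar R) j : 0 <= a ->
  \sum_(0 <= k <oo) (if j == k then a else 0) = a.
Proof.
move=> a0; rewrite (@nneseries_split _ _ 0 j.+1); last by move=> k _; case: ifP.
rewrite add0n eseries0 ?adde0; last by move=> k jk _; rewrite lt_eqF.
rewrite big_nat_recr//= eqxx big_nat big1 ?add0e// => k /andP[_ kj].
by rewrite gt_eqF.
Qed.

Let G k l om : R := if (size (X om) == k) && (size (X' om) == l) then F (X om) (X' om) else 0%R.

Let G0 k l om : 0 <= (G k l om)%:E.
Proof. by rewrite lee_fin /G; case: ifP. Qed.

Let GE om : (F (X om) (X' om))%:E = \sum_(0 <= k <oo) \sum_(0 <= l <oo) (G k l om)%:E.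
Proof.
rewrite -[LHS](nneseries_single (size (X om))); last by rewrite lee_fin.
apply: eq_eseriesr => k _; rewrite /G; case: eqP => _ /=; last first.
  by rewrite eseries0.
rewrite -[LHS](nneseries_single (size (X' om))); last by rewrite lee_fin.
by apply: eq_eseriesr => l _; case: eqP.
Qed.

(** The mean is split according to the two counts. *)
Lemma poisson_sum :
  measurable_fun [set: Omega] (fun om => (F (X om) (X' om))%:E) /\
  \int[P]_om (F (X om) (X' om))%:E = \sum_(0 <= k <oo) \sum_(0 <= l <oo)
    (pois d lam s k * pois d lam s l * EE u k (fun xs => EE u l (F xs)))%:E.
Proof.
have term k l := poisson_term d_gt0 lam_gt0 HP HP' HH' s_gt0 bB k l mF F_ge0 F_perm.
have mG k l : measurable_fun setT (fun om => (G k l om)%:E) by have [] := term k l.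
have mGk k : measurable_fun setT (fun om => \sum_(0 <= l <oo) (G k l om)%:E).
  by apply: (@ge0_emeasurable_sum _ _ _ _ (fun l om => (G k l om)%:E) xpredT).
split.
  under eq_fun do rewrite GE.
  apply: (@ge0_emeasurable_sum _ _ _ _ (fun k om => \sum_(0 <= l <oo) (G k l om)%:E) xpredT) => //.
  by move=> k om _ _; apply: nneseries_ge0.
under eq_integral do rewrite GE.
rewrite integral_nneseries//; last by move=> k om _; exact: nneseries_ge0.
apply: eq_eseriesr => k _; rewrite integral_nneseries//.
by apply: eq_eseriesr => l _; have [_] := term k l.
Qed.

End poisson_sum.

Section gain_lip.
Context (R : realType) (d : nat).
Notation T := 'rV[R]_d.
Variable w : T -> R.
Hypotheses (w_ge0 : forall x, 0 <= w x) (w_ub : has_ubound (range w)).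
Hypothesis w_meas : measurable_fun [set: T] w.
Notation M := (wmax w).

Lemma EE_lip (nu : probability T R) h (k l : nat) : (forall n, bmf n h) -> incr_le M h ->
  `|EE nu k h - EE nu l h| <= M * `|k%:R - l%:R|.
Proof.
move=> mh ih; wlog kl : k l / (k <= l)%N => [H|].
  by case: (leqP k l) => [/H //|/ltnW /H]; rewrite distrC (distrC k%:R).
have /andP[] := EE_incr nu mh ih kl; rewrite natrB//.
by rewrite (distrC k%:R) (@ger0_norm _ (l%:R - k%:R)) ?subr_ge0 ?ler_nat// ler_norml; lra.
Qed.

Lemma EE2_lip (nu : probability T R) s k l k0 :
  `|EE nu k (fun xs => EE nu l (MG (sgap w s) xs)) - EE2 nu k0 (MG (sgap w s))|
    <= M * (`|k%:R - k0%:R| + `|l%:R - k0%:R|).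
Proof.
have mF := mbf2_MG w_ge0 w_ub w_meas s.
have mr (xs : seq T) n : bmf n (MG (sgap w s) xs) := mbf2_bmfr n (in_tuple xs) mF.
have ml n k' : bmf n (fun xs => EE nu k' (MG (sgap w s) xs)) := mbf2_bmf n k' nu mF.
have il k' : incr_le M (fun xs => EE nu k' (MG (sgap w s) xs)).
  move=> s1 x s2; apply/andP; split.
    by apply: le_EE => // ys _; have /andP[] := MG_incrl w_ge0 w_ub s ys s1 x s2.
  by apply: le_EEDc => // ys _; have /andP[] := MG_incrl w_ge0 w_ub s ys s1 x s2.
rewrite -(subrKA (EE nu k0 (fun xs => EE nu l (MG (sgap w s) xs)))).
rewrite mulrDr (le_trans (ler_normD _ _))// lerD//.
  exact: EE_lip (ml^~ l) (il l).
apply: (le_trans (le_norm_ExB (power nu k0) (ml k0 l) (ml k0 k0))).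
apply: Ex_le; first by apply: mbf_norm; apply: mbfB; exact: ml.
by move=> xs; exact: EE_lip (mr xs) (MG_incrr w_ge0 w_ub s xs).
Qed.

End gain_lip.

Section poisson_limit.
Context (R : realType) (d : nat) dO (Omega : measurableType dO).
Hypothesis d_gt0 : (0 < d)%N.
Notation T := 'rV[R]_d.
Variables (P : probability Omega R) (lam : R) (H H' : Omega -> set T).
Hypotheses (lam_gt0 : 0 < lam) (HP : poisson_process P lam H)
  (HP' : poisson_process P lam H') (HH' : independent_processes P H H').
Variable w : T -> R.
Hypotheses (w_ge0 : forall x, 0 <= w x) (w_ub : has_ubound (range w)).
Hypotheses (w_meas : measurable_fun [set: T] w) (W1 : condW1 w).
Notation M := (wmax w).
Let M0 : 0 <= M := wmax_ge0 w_ge0 w_ub.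

Lemma cube_box (s : R) : cube d s = box (const_mx (- (s / 2)) : T) s.
Proof.
by apply/seteqP; split => x /= xs i; have := xs i; rewrite mxE;
  rewrite (_ : - (s / 2) + s = s / 2)//; lra.
Qed.

Lemma bounded_cube (s : R) : bounded_set (cube d s : set T).
Proof.
exists `|s|; split; first exact: num_real.
move=> K sK x xs; rewrite /Num.norm /= mx_normrE.
apply: bigmax_le => [|i _]; first by rewrite (le_trans _ (ltW sK)).
rewrite (le_trans _ (ltW sK))//.
have := xs i.2; rewrite (ord1 i.1) => /andP[h1 h2].
have s0 : 0 <= s by lra.
by rewrite (ger0_norm s0) ler_norml; apply/andP; split; lra.
Qed.

Definition poisson_cost (s : R) : \bar R :=
  'E_P[fun om => BM w (fset_set (H om `&` cube d s)) (fset_set (H' om `&` cube d s))].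

(** Given counts [k] and [l], the mean cost is M times (k + l) / 2, rounded down, minus a mean gain.
    Both terms are Lipschitz in the counts, so replacing the counts by [k0] costs their mean
    deviations from it. *)
Lemma poisson_cost_bound (s kap : R) : 0 < s -> 0 < kap ->
  let a := lam * s ^+ d in let k0 := Num.truncn a in
  let b := M * k0%:R - Jgain w s k0 in let C := 2 * M * (3 + kap * a + kap^-1) in
  is_true ((b - C)%:E <= poisson_cost s <= (b + C)%:E)%E.
Proof.
move=> s0 kap0 a k0 b C.
have a0 : 0 < a by rewrite mulr_gt0// exprn_gt0.
have bc := @bounded_cube s; rewrite cube_box in bc.
have [mS eS] := poisson_sum d_gt0 lam_gt0 HP HP' HH' s0 bc
  (mbf2_BMs w_ge0 w_ub w_meas W1 (oner_neq0 R)) (fun xs ys => BM_ge0 w_ge0 w_ub _ _)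
  (@BMs_perm R d w 1).
have -> : poisson_cost s = (\int[P]_om (BMs w 1 (points H (box (const_mx (- (s / 2))) s) om)
    (points H' (box (const_mx (- (s / 2))) s) om))%:E)%E.
  rewrite /poisson_cost unlock; apply: eq_integral => om _; congr (_%:E).
  rewrite /BMs /points cube_box; congr BM; apply/fsetP => z.
    apply/idP/imfsetP => /= [zH|[x xH ->]]; last by rewrite scale1r.
    by exists z; rewrite ?scale1r.
  apply/idP/imfsetP => /= [zH|[x xH ->]]; last by rewrite scale1r.
  by exists z; rewrite ?scale1r.
rewrite eS.
have [ak1 ak2] : `|a - k0%:R| <= 1 /\ k0%:R <= a.
  have /andP[k1 k2] := truncn_itv (ltW a0); rewrite -/k0 -natr1 in k1 k2.
  by split => //; rewrite ler_norml; apply/andP; split; lra.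
have [al [ald alc]] := poisson_mean_dist a0 kap0 ak1.
have al0 k : 0 <= al k by exact: le_trans (ald k).
have b0 : 0 <= b by rewrite subr_ge0; exact: Jgain_le.
have -> : C = 2 * M * (1 + 2 * ((kap * a + kap^-1) / 2 + 1)) by rewrite /C; field; rewrite gt_eqF.
apply: (poisson_mean2 a0 (m := fun k l => EE _ k (fun xs => EE _ l (BMs w 1 xs))) b0 _ _ al0 alc).
- by rewrite mulr_ge0.
- by move=> k l; apply: Ex_ge0 => xs; apply: Ex_ge0 => ys; exact: BM_ge0.
move=> k l.
rewrite EE_BMs//; last exact: unif_box_diffuse.
have L := EE2_lip w_ge0 w_ub w_meas (unif_box (const_mx (- (s / 2)) : T) s) 1 k l k0.
rewrite (EE2_unif_box w_ge0 w_ub w_meas _ 1 k0 s0) mul1r in L.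
move: L; set J := EE _ k _ => L.
(* The last 1 / 2 accounts for an odd total number of points. *)
have hm : `|((k + l)./2)%:R - k0%:R| <= (`|k%:R - k0%:R| + `|l%:R - k0%:R|) / 2 + 1 / 2 :> R.
  have e2 : ((k + l)./2)%:R * 2 + (odd (k + l))%:R = k%:R + l%:R :> R.
    by rewrite -[in LHS]natrM -!natrD muln2 addnC odd_double_half.
  have ob : 0 <= ((odd (k + l))%:R : R) <= 1 by case: odd; rewrite ?lexx ?ler01 ?andbT.
  have /ler_normlP[n1 n2] := lexx `|k%:R - k0%:R : R|.
  have /ler_normlP[n3 n4] := lexx `|l%:R - k0%:R : R|.
  by rewrite ler_norml; apply/andP; split; lra.
move: (normr_ge0 (k%:R - k0%:R : R)) (normr_ge0 (l%:R - k0%:R : R)) (ald k) (ald l) L hm.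
move: (`|k%:R - k0%:R| : R) (`|l%:R - k0%:R| : R) (((k + l)./2)%:R : R) => x y z x0 y0 xk yl L hm.
rewrite /b (_ : _ - _ = M * (z - k0%:R) - (J - Jgain w s k0)); last by ring.
rewrite (le_trans (ler_normB _ _))// normrM (ger0_norm M0).
apply: (@le_trans _ _ (M * ((x + y) / 2 + 1 / 2) + M * (x + y))).
  by rewrite lerD// ler_wpM2l.
rewrite -mulrDr [2 * M]mulrC -mulrA ler_wpM2l//.
lra.
Qed.


Lemma poisson_cost_limit :
  (poisson_cost s * ((lam * s ^+ d)^-1)%:E)%E @[s --> +oo] --> (M - Gam w lam / lam)%:E.
Proof.
apply/fine_cvgP; split.
  near=> s; have s0 : 0 < s by near: s; exact: nbhs_pinfty_gt.
  have /andP[h1 h2] := poisson_cost_bound s0 (@ltr01 R).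
  rewrite fin_numM// fin_numElt (lt_le_trans _ h1) ?ltNyr//=.
  by rewrite (le_lt_trans h2)// ltry.
apply/cvgrPdist_le => e e0.
have M1 : 0 < M + 1 by rewrite ltr_wpDl.
(* This makes 2 M kap at most e / 4; two more quarters go to the constants divided by [a] and to the
   convergence of the gain density. *)
pose kap : R := e / (8 * (M + 1)).
have kap0 : 0 < kap by rewrite divr_gt0// mulr_gt0.
have el0 : 0 < e * lam / 4 by rewrite divr_gt0// mulr_gt0.
have [S HS] := again_cvg d_gt0 w_ge0 w_ub w_meas (ltW lam_gt0) el0.
pose K : R := 2 * M * (3 + kap^-1) + M.
near=> s; have s0 : 0 < s by near: s; exact: nbhs_pinfty_gt.
have Ss : S <= s by near: s; apply: nbhs_pinfty_ge; exact: num_real.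
have s1 : 1 <= s by near: s; apply: nbhs_pinfty_ge; exact: num_real.
have Ks : 4 * K / (e * lam) <= s by near: s; apply: nbhs_pinfty_ge; exact: num_real.
set a := lam * s ^+ d; set k0 := Num.truncn a.
have a0 : 0 < a by rewrite mulr_gt0// exprn_gt0.
have sd0 : 0 < s ^+ d by rewrite exprn_gt0.
have := poisson_cost_bound s0 kap0.
rewrite /= -/a -/k0; case: (poisson_cost s) => [x| |]; rewrite ?leye_eq ?leeNy_eq ?andbF//.
rewrite !lee_fin => /andP[h1 h2].
have := HS s Ss; rewrite /again -/a -/k0; set J := Jgain w s k0 in h1 h2 * => HJ.
have [ak1 ak2] : a - k0%:R <= 1 /\ k0%:R <= a.
  have /andP[k1 k2] := truncn_itv (ltW a0); rewrite -/k0 -natr1 in k1 k2.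
  by split => //; lra.
have Ka : K / a <= e / 4.
  have K0 : 0 <= K.
    by rewrite addr_ge0// mulr_ge0// ?mulr_ge0// addr_ge0// invr_ge0 ltW.
  have ssd : s <= s ^+ d by rewrite -[leLHS]expr1 ler_weXn2l.
  rewrite ler_pdivrMr//; have := le_trans Ks ssd.
  rewrite ler_pdivrMr ?mulr_gt0// /a; lra.
have x1 : `|x / a - (M * k0%:R - J) / a| <= 2 * M * kap + 2 * M * (3 + kap^-1) / a.
  rewrite -mulrBl normrM (gtr0_norm (_ : 0 < a^-1)) ?invr_gt0//.
  rewrite ler_pdivrMr// mulrDl divfK ?gt_eqF// ler_norml; apply/andP; split; lra.
have x2 : `|M * k0%:R / a - M| <= M / a.
  rewrite ler_norml; apply/andP; split; last first.
    rewrite lerBlDr -[leRHS]addrC (@le_trans _ _ M)//.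
      by rewrite ler_pdivrMr// ler_wpM2l.
    by rewrite lerDl divr_ge0// ltW.
  rewrite -subr_ge0 opprK [leRHS](_ : _ = M * (1 - (a - k0%:R)) / a); last first.
    by field; rewrite gt_eqF.
  by rewrite divr_ge0 ?(ltW a0)// mulr_ge0// subr_ge0.
have x3 : `|J / a - Gam w lam / lam| <= e / 4.
  have -> : J / a = J / s ^+ d / lam by rewrite /a; field; rewrite !gt_eqF.
  rewrite -mulrBl normrM (gtr0_norm (_ : 0 < lam^-1)) ?invr_gt0//.
  by rewrite ler_pdivrMr// mulrAC.
have x4 : 2 * M * kap <= e / 4.
  rewrite /kap mulrA ler_pdivrMr ?mulr_gt0//.
  have : 0 <= e by exact: ltW.
  move=> e00; have : e * M <= e * (M + 1) by rewrite ler_wpM2l// lerDl.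
  lra.
have e5 : (M * k0%:R - J) / a = M * k0%:R / a - J / a by rewrite mulrBl.
have K5 : K / a = 2 * M * (3 + kap^-1) / a + M / a by rewrite /K mulrDl.
rewrite /= ler_norml; move: x1 x2 x3; rewrite e5 !ler_norml => /andP[? ?] /andP[? ?] /andP[? ?].
by apply/andP; split; lra.
Unshelve. all: by end_near. Qed.

End poisson_limit.

(** * Approximation by functions of dyadic cells *)

Section dyadic.
Context (R : realType) (d : nat).
Notation T := 'rV[R]_d.
Notation Z := 'rV[int]_d.

Definition dyad (p : nat) : R := (2 ^+ p)^-1.

Lemma dyad_gt0 p : 0 < dyad p.
Proof. by rewrite invr_gt0 exprn_gt0. Qed.

Definition coarse (m : nat) (v : Z) : Z := \row_i (v ord0 i %/ (2 ^ m)%N%:Z)%Z.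

(** Dyadic grids are nested, so two approximations at different levels have the common refinement
    used throughout this part. *)
Lemma coarse_cellf p m x : coarse m (cellf (dyad (p + m)) x) = cellf (dyad p) x.
Proof.
apply/rowP => i; rewrite !mxE; apply/esym; apply: floor_def.
set z := Num.floor _.
have /andP[f1 f2] := floor_itv (x ord0 i / dyad (p + m)); rewrite -/z in f1 f2.
have m0 : (2 ^ m)%N%:Z != 0 by rewrite -lt0n expn_gt0.
set q := (z %/ _)%Z.
have k0 : 0 < (2 ^ m)%N%:R :> R by rewrite ltr0n expn_gt0.
have xE : x ord0 i / dyad p = x ord0 i / dyad (p + m) / (2 ^ m)%N%:R.
  by rewrite /dyad !invrK exprD natrX mulrA mulfK// expf_neq0// pnatr_eq0.
have kE : ((2 ^ m)%N%:Z)%:~R = (2 ^ m)%N%:R :> R by [].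
rewrite xE ler_pdivlMr// ltr_pdivrMr//; apply/andP; split.
  apply: le_trans f1; rewrite -kE -intrM ler_int.
  by rewrite lez_floor.
apply: lt_le_trans f2 _; rewrite -kE -intrM ler_int.
by rewrite lezD1 ltz_ceil// ltz_nat expn_gt0.
Qed.

Definition cellset p (phi : pred Z) : set T := [set x | phi (cellf (dyad p) x)].

Lemma measurable_cellset p phi : measurable (cellset p phi).
Proof.
rewrite (_ : cellset p phi =
    \bigcup_v (if phi v then [set x | cellf (dyad p) x == v] else set0)).
  apply: countable_bigcupT_measurable => [|v]; first exact: countableP.
  case: ifP => // _; apply: measurable_bool_set.
  exact: measurable_cellf (dyad_gt0 p).
apply/seteqP; split => [x xp|x [v _]].
  by exists (cellf (dyad p) x) => //; rewrite (_ : phi _ = true) //=.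
by rewrite /cellset; case: ifP => // pv /= /eqP ->.
Qed.

Lemma cellset_coarse p m phi : cellset p phi = cellset (p + m) (phi \o coarse m).
Proof. by apply/seteqP; split => x; rewrite /cellset /= coarse_cellf. Qed.

Section approximable.
Variable m : {measure set T -> \bar R}.
Hypothesis m_fin : (m setT < +oo)%E.
Local Open Scope ereal_scope.

(** Closeness in [m] to a union of cells of a single dyadic level. These sets form a sigma-algebra
    containing the half-spaces. *)
Definition approximable (S : set T) := measurable S /\
  forall e : R, (0 < e)%R -> exists p phi, m (S `+` cellset p phi) <= e%:E.

Let msetY (A B : set T) : measurable A -> measurable B -> measurable (A `+` B).
Proof. by move=> mA mB; apply: measurableU; exact: measurableD. Qed.

Lemma approximable_cellset p phi : approximable (cellset p phi).
Proof.
split; first exact: measurable_cellset.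
move=> e e0; exists p, phi; rewrite (_ : _ `+` _ = set0) ?measure0 ?lee_fin ?ltW//.
by rewrite /setY setDv setU0.
Qed.

Lemma approximableC S : approximable S -> approximable (~` S).
Proof.
move=> [mS aS]; split; first exact: measurableC.
move=> e /aS[p [phi H]]; exists p, (predC phi).
rewrite (_ : _ `+` _ = S `+` cellset p phi)//.
apply/seteqP; split => x [] [] h1 h2.
- by right; split => //; apply: contrapT => h3; apply: h2; apply/negP.
- by left; split; [exact: contrapT|apply/negP].
- by right; split; [apply/negP|move=> /(_ h1)].
- by left; split => // /negP; apply.
Qed.

Lemma approximableU S S' : approximable S -> approximable S' -> approximable (S `|` S').
Proof.
move=> [mS aS] [mS' aS']; split; first exact: measurableU.
move=> e e0; have e2 : (0 < e / 2)%R by rewrite divr_gt0.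
have [p [phi H]] := aS _ e2; have [p' [phi' H']] := aS' _ e2.
exists (p + p')%N, (predU (phi \o coarse p') (phi' \o coarse p)).
have mc := measurable_cellset.
apply: (@le_trans _ _ (m ((S `+` cellset p phi) `|` (S' `+` cellset p' phi')))).
  apply: le_measure; rewrite ?inE; try (by apply: measurableU; exact: msetY).
    by apply: msetY => //; exact: measurableU.
  rewrite (cellset_coarse p p') (cellset_coarse p' p) addnC.
  move=> x [[[Sx|Sx] nc]|[/orP[pc|pc] nS]].
  - by left; left; split => // h; apply: nc; apply/orP; left.
  - by right; left; split => // h; apply: nc; apply/orP; right.
  - by left; right; split => // h; apply: nS; left.
  - by right; right; split => // h; apply: nS; right.
apply: (le_trans (measureU2 _ (msetY mS (mc _ _)) (msetY mS' (mc _ _)))).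
by rewrite (splitr e) EFinD; exact: leeD.
Qed.

Lemma approximable0 : approximable set0.
Proof.
by have := approximable_cellset 0 pred0; rewrite (_ : cellset _ _ = set0)//; apply/seteqP; split.
Qed.

(** Finiteness of [m] and continuity from above reduce the union to a finite one, up to half of the
    tolerance. *)
Lemma approximable_bigcup (F : (set T)^nat) : (forall i, approximable (F i)) ->
  approximable (\bigcup_i F i).
Proof.
move=> aF; have mF i : measurable (F i) by have [] := aF i.
have mUF : measurable (\bigcup_i F i) by exact: bigcupT_measurable.
split=> // e e0; have e2 : (0 < e / 2)%R by rewrite divr_gt0.
pose G K := \big[setU/set0]_(i < K) F i.
have aG K : approximable (G K).
  elim: K => [|K IH]; first by rewrite /G big_ord0; exact: approximable0.
  by rewrite /G big_ord_recr /=; exact: approximableU.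
have mG K : measurable (G K) by have [] := aG K.
have GU K : G K `<=` \bigcup_i F i.
  elim: K => [|K IH]; first by rewrite /G big_ord0; exact: sub0set.
  by rewrite /G big_ord_recr /= subUset; split => //; exact: bigcup_sup.
have [K HK] : exists K, m (\bigcup_i F i `\` G K) <= (e / 2)%:E.
  have c : (m (\bigcup_i F i `\` G n)) @[n --> \oo] --> m (\bigcap_n (\bigcup_i F i `\` G n)).
    apply: nonincreasing_cvg_mu.
    - by apply: le_lt_trans m_fin; apply: le_measure; rewrite ?inE//; exact: measurableD.
    - by move=> n; exact: measurableD.
    - by apply: bigcapT_measurable => n; exact: measurableD.
    - move=> n n' nn'; apply/subsetPset; apply: setDS.
      exact: subset_bigsetU.
  rewrite (_ : \bigcap_n _ = set0) ?measure0 in c; last first.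
    apply/seteqP; split => // x /= H; have [[i _ Fi] _] := H 0%N I.
    have [_] := H i.+1 I; apply; rewrite /G big_ord_recr /=; right; exact: Fi.
  have /fine_cvgP[_ /cvgrPdist_le/(_ _ e2)] := c.
  case=> K _ HK; exists K; have := HK K (leqnn _).
  rewrite /= sub0r normrN ger0_norm ?fine_ge0// -lee_fin fineK// ge0_fin_numE//.
  by apply: le_lt_trans m_fin; apply: le_measure; rewrite ?inE//; exact: measurableD.
have [_ /(_ _ e2)[p [phi H]]] := aG K; exists p, phi.
have mc := measurable_cellset p phi.
apply: (@le_trans _ _ (m ((\bigcup_i F i `\` G K) `|` (G K `+` cellset p phi)))).
  apply: le_measure; rewrite ?inE; [exact: msetY|by apply: measurableU; [exact: measurableD|exact: msetY]|].
  move=> x [[Fx nc]|[cx nF]]; last by right; right; split => // /GU.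
  by have [Gx|nG] := pselect (G K x); [right; left|left].
apply: (le_trans (measureU2 _ (measurableD mUF (mG K)) (msetY (mG K) mc))).
by rewrite (splitr e) EFinD; exact: leeD.
Qed.

(** An open half-space is the union over all levels of the cells whose lower corner is already
    beyond [c]. *)
Lemma approximable_ray (i : 'I_d) (c : R) : approximable [set x | (c < x ord0 i)%R].
Proof.
set S := (X in approximable X).
have -> : S = \bigcup_p cellset p (fun v => c < dyad p * (v ord0 i)%:~R)%R; last first.
  by apply: approximable_bigcup => p; exact: approximable_cellset.
apply/seteqP; split => [x /= cx|x [p _]].
  pose p := Num.truncn ((x ord0 i - c)^-1); exists p => //.
  have dp : (dyad p < x ord0 i - c)%R.
    rewrite /dyad invf_plt ?posrE ?exprn_gt0 ?subr_gt0//.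
    rewrite (lt_le_trans (truncnS_gt _))// -natrX ler_nat.
    exact: ltn_expl.
  rewrite /cellset /= mxE.
  have /andP[_] := floor_itv (x ord0 i / dyad p).
  by rewrite intrD ltr_pdivrMr ?dyad_gt0// mulrDl mul1r mulrC; lra.
rewrite /cellset /= mxE => /lt_le_trans; apply.
have /andP[+ _] := floor_itv (x ord0 i / dyad p).
by rewrite ler_pdivlMr ?dyad_gt0// mulrC.
Qed.

Lemma approximableT S : measurable S -> approximable S.
Proof.
move: S; rewrite [X in forall S, X S -> _]measurable_rVE.
apply: smallest_sub.
  split; first exact: approximable0.
  - by move=> S aS; rewrite setTD; exact: approximableC.
  - by move=> F aF; exact: approximable_bigcup.
move=> S; rewrite -bigcup_seq => -[i _ [B mB <-]]; rewrite setTI.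
move: B mB; rewrite [X in forall B, X B -> _]RGenOInfty.measurableE.
apply: smallest_sub.
  split; first by rewrite preimage_set0; exact: approximable0.
  - by move=> B aB; rewrite setTD preimage_setC; exact: approximableC.
  - by move=> F aF; rewrite preimage_bigcup; exact: approximable_bigcup.
move=> _ [c ->]; set S' := (X in approximable X).
have -> : S' = [set x | (c < x ord0 i)%R]; last exact: approximable_ray.
by apply/seteqP; split => x; rewrite /S' /rV_coord /= in_itv /= andbT.
Qed.

End approximable.

Lemma measurable_step p (psi : Z -> R) :
  measurable_fun [set: T] (fun x => psi (cellf (dyad p) x)).
Proof.
move=> _ B mB; rewrite setTI.
rewrite (_ : _ @^-1` _ = cellset p (fun v => psi v \in B)); first exact: measurable_cellset.
by apply/seteqP; split => x; [move=> ?; exact/mem_set|move=> /set_mem].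
Qed.

Local Notation leb := (lebesgue_rV R d).
Local Open Scope ereal_scope.

Import HBSimple.

(** The approximation of sets is applied to each level set of [g]; restriction to [Q] makes Lebesgue
    measure finite. *)
Lemma sfun_approximation (Q : set T) (g : {sfun T >-> R}) : measurable Q -> leb Q < +oo ->
  forall e : R, (0 < e)%R -> exists p psi C, (forall v, `|psi v| <= C)%R /\
    \int[leb]_(x in Q) (`|g x - psi (cellf (dyad p) x)|%R)%:E <= e%:E.
Proof.
move=> mQ Qfin; pose m := mrestr leb mQ.
have m_fin : m setT < +oo by rewrite /m /mrestr setTI.
suff H (s : seq R) (e : R) : (0 < e)%R -> exists p psi C, (forall v, `|psi v| <= C)%R /\
    \int[leb]_(x in Q)
      (`|\sum_(y <- s) y * \1_(g @^-1` [set y]) x - psi (cellf (dyad p) x)|%R)%:E <= e%:E.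
  move=> e e0; have [p [psi [C [HC Hi]]]] := H (fset_set (range g)) e e0.
  exists p, psi, C; split => //; apply: le_trans Hi.
  rewrite le_eqVlt; apply/orP; left; apply/eqP; apply: eq_integral => x _.
  by rewrite {1}fimfunE fsbig_finite.
elim: s e => [|y s IH] e e0.
  exists 0%N, (fun=> 0%R), 0%R; split; first by move=> v; rewrite normr0.
  rewrite integral0_eq ?lee_fin ?ltW// => x _.
  by rewrite big_nil subrr normr0.
have e2 : (0 < e / 2)%R by rewrite divr_gt0.
have [p [psi [C [HC Hi]]]] := IH _ e2.
have mgy : measurable (g @^-1` [set y]) by exact: measurable_sfunP.
have y1 : (0 < `|y| + 1)%R by rewrite ltr_wpDl.
(* Multiplied by |y|, the tolerance stays below e / 2, also when y = 0. *)
have e3 : (0 < e / 2 / (`|y| + 1))%R by rewrite divr_gt0.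
have [_ /(_ _ e3)[p' [phi Hphi]]] := approximableT m_fin mgy.
exists (p + p')%N, (fun v => y * (phi (coarse p v))%:R + psi (coarse p' v))%R, (`|y| + C)%R; split.
  move=> v; rewrite (le_trans (ler_normD _ _))// lerD// normrM.
  by case: (phi _); rewrite ?normr1 ?mulr1// normr0 mulr0.
set A := g @^-1` [set y]; set B := cellset p' phi.
have mS : measurable_fun setT (fun x => \sum_(y <- s) y * \1_(g @^-1` [set y]) x)%R.
  apply: measurable_sum => z; apply: measurable_funM; first exact: measurable_cst.
  exact: measurable_indic.
have mAB : measurable (A `+` B).
  by apply: measurableU; apply: measurableD => //; exact: measurable_cellset.
have le x : (`|\sum_(z <- y :: s) z * \1_(g @^-1` [set z]) x -
    (y * (phi (coarse p (cellf (dyad (p + p')) x)))%:R + psi (coarse p' (cellf (dyad (p + p')) x)))|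
    <= `|y| * \1_(A `+` B) x +
    `|\sum_(z <- s) z * \1_(g @^-1` [set z]) x - psi (cellf (dyad p) x)|)%R.
  rewrite coarse_cellf addnC coarse_cellf big_cons opprD addrACA.
  rewrite (le_trans (ler_normD _ _))// lerD2r -mulrBr normrM ler_wpM2l//.
  rewrite -/A !indicE.
  have -> : phi (cellf (dyad p') x) = (x \in B).
    by apply/idP/idP => [h|/set_mem//]; exact/mem_set.
  rewrite /setY in_setU !in_setD.
  by case: (x \in A); case: (x \in B); rewrite /= ?subrr ?normr0 ?subr0 ?sub0r ?normrN ?normr1.
have mpsi := measurable_step p psi.
have mi : measurable_fun setT (fun x => (`|\sum_(z <- s) z * \1_(g @^-1` [set z]) x - psi (cellf (dyad p) x)|%R)%:E).
  by apply/measurable_EFinP; apply: measurableT_comp => //; exact: measurable_funB.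
apply: (@le_trans _ _ (\int[leb]_(x in Q) ((`|y| * \1_(A `+` B) x)%:E +
   (`|\sum_(z <- s) z * \1_(g @^-1` [set z]) x - psi (cellf (dyad p) x)|%R)%:E))).
  apply: ge0_le_integral => //.
  - apply/measurable_EFinP; apply: measurable_funTS; apply: measurableT_comp => //.
    apply: measurable_funB; last exact: measurable_step (p + p')%N (fun v => y * (phi (coarse p v))%:R + psi (coarse p' v))%R.
    apply: measurable_sum => z; apply: measurable_funM; first exact: measurable_cst.
    exact: measurable_indic.
  - apply: emeasurable_funD; apply: measurable_funTS => //.
    by apply/measurable_EFinP; apply: measurable_funM => //; exact: measurable_indic.
  - by move=> x _; rewrite -EFinD lee_fin; exact: le.
rewrite ge0_integralD//; last 2 first.
- by apply/measurable_EFinP; apply: measurable_funM => //; apply: measurable_funTS; exact: measurable_indic.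
- exact: measurable_funTS.
rewrite (splitr e) EFinD; apply: leeD => //.
under eq_integral do rewrite EFinM.
rewrite ge0_integralZl//; last first.
  by apply/measurable_EFinP; apply: measurable_funTS; exact: measurable_indic.
rewrite integral_indic//.
apply: (@le_trans _ _ (`|y|%:E * (e / 2 / (`|y| + 1))%:E)).
  by rewrite lee_wpmul2l// lee_fin.
rewrite -EFinM lee_fin mulrCA ler_piMr// ?ltW//.
by rewrite ltr_pdivrMr// mul1r ltrDl.
Qed.

Lemma step_approximation (Q : set T) (f : T -> R) : measurable Q -> leb Q < +oo ->
  leb.-integrable setT (EFin \o f) ->
  forall e : R, (0 < e)%R -> exists p psi C, (forall v, `|psi v| <= C)%R /\
    \int[leb]_(x in Q) (`|f x - psi (cellf (dyad p) x)|%R)%:E <= e%:E.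
Proof.
move=> mQ Qfin fi e e0; have e2 : (0 < e / 2)%R by rewrite divr_gt0.
have mf : measurable_fun setT f by apply/measurable_EFinP; exact: measurable_int fi.
have [g_ [_ _ cg]] := approximation_sfun_integrable measurableT fi.
have [g Hg] : exists g : {sfun T >-> R}, \int[leb]_x (`|f x - g x|%R)%:E <= (e / 2)%:E.
  have /fine_cvgP[[K1 _ HK1] /cvgrPdist_le/(_ _ e2)[K _ HK]] := cg.
  exists (g_ (maxn K1 K)); have := HK (maxn K1 K) (leq_maxr _ _).
  have := HK1 (maxn K1 K) (leq_maxl _ _).
  rewrite /= sub0r normrN => fn; rewrite ger0_norm ?fine_ge0 ?integral_ge0//.
  by rewrite -lee_fin fineK//.
have [p [psi [C [HC Hp]]]] := sfun_approximation g mQ Qfin e2.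
exists p, psi, C; split => //.
have mg : measurable_fun setT g by [].
have m1 : measurable_fun setT (fun x => (`|f x - g x|%R)%:E).
  by apply/measurable_EFinP; apply: measurableT_comp => //; exact: measurable_funB.
have m2 : measurable_fun setT (fun x => (`|g x - psi (cellf (dyad p) x)|%R)%:E).
  apply/measurable_EFinP; apply: measurableT_comp => //; apply: measurable_funB => //.
  exact: measurable_step.
apply: (@le_trans _ _ (\int[leb]_(x in Q) ((`|f x - g x|%R)%:E +
    (`|g x - psi (cellf (dyad p) x)|%R)%:E))).
  apply: ge0_le_integral => //.
  - apply/measurable_EFinP; apply: measurable_funTS; apply: measurableT_comp => //.
    by apply: measurable_funB => //; exact: measurable_step.
  - by apply: measurable_funTS; exact: emeasurable_funD.
  - by move=> x _; rewrite -EFinD lee_fin ler_distD.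
rewrite ge0_integralD//; [|exact: measurable_funTS|exact: measurable_funTS].
rewrite (splitr e) EFinD; apply: leeD => //; apply: le_trans Hg.
by apply: ge0_subset_integral.
Qed.

End dyadic.

Section labelled.
Context dX (X : measurableType dX) (R : realType) (K : countType) (c : X -> K).
Hypothesis mc : forall v, measurable [set x | c x == v].

Lemma measurable_label (b : pred K) : measurable [set x | b (c x)].
Proof.
rewrite (_ : [set x | b (c x)] = \bigcup_v (if b v then [set x | c x == v] else set0)).
  apply: countable_bigcupT_measurable => [|v]; first exact: countableP.
  by case: ifP.
apply/seteqP; split => [x xp|x [v _]].
  by exists (c x) => //; rewrite (_ : b _ = true) //=.
by case: ifP => // pv /= /eqP ->.
Qed.

Local Open Scope ereal_scope.

Lemma set_label_cons v (s : seq K) :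
  [set x | c x \in v :: s] = [set x | c x == v] `|` [set x | c x \in s].
Proof. by apply/seteqP; split => x /=; rewrite inE => /orP. Qed.

Lemma label_disj v (s : seq K) : v \notin s ->
  [set x | c x == v] `&` [set x | c x \in s] = set0.
Proof.
move=> vs; apply/seteqP; split => // x [/= /eqP -> vs'].
by rewrite vs' in vs.
Qed.

Lemma measure_label (m : {measure set X -> \bar R}) (s : seq K) : uniq s ->
  m [set x | c x \in s] = \sum_(v <- s) m [set x | c x == v].
Proof.
elim: s => [|v s IH] /=.
  by rewrite big_nil (_ : [set _ | _] = set0) ?measure0//; apply/seteqP; split.
move=> /andP[vs us]; rewrite big_cons -IH// set_label_cons measureU//.
  exact: measurable_label.
exact: label_disj.
Qed.

Lemma integral_label (m : {measure set X -> \bar R}) (s : seq K) (f : X -> \bar R) :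
  uniq s -> measurable_fun setT f -> (forall x, 0 <= f x) ->
  \int[m]_(x in [set x | c x \in s]) f x =
  \sum_(v <- s) \int[m]_(x in [set x | c x == v]) f x.
Proof.
move=> + mf f0; elim: s => [|v s IH] /=.
  by rewrite big_nil (_ : [set _ | _] = set0) ?integral_set0//; apply/seteqP; split.
move=> /andP[vs us]; rewrite big_cons -IH// set_label_cons ge0_integral_setU//.
- exact: measurable_label.
- exact: measurable_funTS.
- by apply/disj_setPS => x; rewrite label_disj.
Qed.

End labelled.

(** * Integration against a measure with a singular part *)

Section density.
Context (R : realType) (d : nat).
Notation T := 'rV[R]_d.
Notation Z := 'rV[int]_d.
Local Notation leb := (lebesgue_rV R d).
Variables (mu : probability T R) (f : T -> R).
Hypotheses (mf : measurable_fun [set: T] f) (f_ge0 : forall x, 0 <= f x).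
Variables (mus : {measure set T -> \bar R}) (N : set T).
Hypotheses (mN : measurable N) (lebN : leb N = 0%E) (musN : mus (~` N) = 0%E).
Hypothesis muE : forall A, measurable A -> mu A = (\int[leb]_(x in A) (f x)%:E + mus A)%E.
Local Open Scope ereal_scope.

Let ref : {measure set T -> \bar R} := measure_add leb mus.
(** The density of [mu] with respect to the sum of Lebesgue measure and [mus]: on the Lebesgue-null
    carrier of [mus] it is 1, elsewhere it is [f]. *)
Let h (x : T) : R := if x \in N then 1%R else f x.

Let h_ge0 x : (0 <= h x)%R.
Proof. by rewrite /h; case: ifP. Qed.

Let mh : measurable_fun setT h.
Proof.
apply: measurable_fun_ifT => //.
by apply: measurable_set_bool; rewrite (_ : [set x | _] = N)//; apply/seteqP; split => x /=;
  [move/set_mem|move=> ?; exact/mem_set].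
Qed.

Let integral_ref (phi : T -> R) : measurable_fun setT phi -> (forall x, 0 <= phi x)%R ->
  \int[ref]_x (h x * phi x)%:E = \int[leb]_x (f x * phi x)%:E + \int[mus]_x (phi x)%:E.
Proof.
move=> mphi phi0.
have mhp : measurable_fun setT (fun x => (h x * phi x)%:E).
  by apply/measurable_EFinP; exact: measurable_funM.
rewrite ge0_integral_measure_add//; last by move=> x _; rewrite lee_fin mulr_ge0.
congr (_ + _).
  apply: ge0_ae_eq_integral => //.
  - by apply/measurable_EFinP; exact: measurable_funM.
  - by move=> x _; rewrite lee_fin mulr_ge0.
  - by move=> x _; rewrite lee_fin mulr_ge0.
  exists N; split => // x /= H; apply: contrapT => Nx; apply: H => _.
  by rewrite /h memNset.
apply: ge0_ae_eq_integral => //.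
- exact/measurable_EFinP.
- by move=> x _; rewrite lee_fin mulr_ge0.
- by move=> x _; rewrite lee_fin.
exists (~` N); split => //; first exact: measurableC.
move=> x /= H Nx; apply: H => _.
by rewrite /h mem_set// mul1r.
Qed.

Let integral_indicM (g : T -> R) (A : set T) : measurable A ->
  \int[leb]_x (g x * \1_A x)%:E = \int[leb]_(x in A) (g x)%:E.
Proof.
move=> mA; rewrite [RHS]integral_mkcond; apply: eq_integral => x _.
rewrite patchE indicE; case: (x \in A); by rewrite ?mulr1 ?mulr0.
Qed.

(** [mu] is the mixture, over the reference measure, of the point masses at x of weight h x. *)
Lemma integral_density (phi : T -> R) : measurable_fun setT phi -> (forall x, 0 <= phi x)%R ->
  \int[mu]_x (phi x)%:E = \int[leb]_x (f x * phi x)%:E + \int[mus]_x (phi x)%:E.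
Proof.
move=> mphi phi0.
pose l (x : T) : {measure set T -> \bar R} := mscale (NngNum (h_ge0 x)) (dirac x).
have lE x A : l x A = (h x * \1_A x)%:E by [].
rewrite (integral_mixture (P := ref) (m := mu) (l := l)).
- rewrite -integral_ref//; apply: eq_integral => x _.
  have mphi' : measurable_fun setT (fun y => (phi y)%:E) by exact/measurable_EFinP.
  apply: (etrans (ge0_integral_mscale (dirac x) measurableT (NngNum (h_ge0 x)) mphi' _)).
    by move=> y _; rewrite lee_fin.
  by rewrite integral_dirac// diracT mul1e.
- move=> A mA; under eq_fun do rewrite lE.
  by apply/measurable_EFinP; apply: measurable_funM => //; exact: measurable_indic.
- move=> A mA; under eq_integral do rewrite lE.
  have mA1 : measurable_fun setT (\1_A : T -> R) by exact: measurable_indic.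
  rewrite (integral_ref mA1)//.
  by apply: (etrans (muE mA)); rewrite integral_indicM// integral_indic// setIT.
- exact/measurable_EFinP.
- by move=> x; rewrite lee_fin.
Qed.

(** This supplies the closeness hypothesis needed for thinning with q = a b ^ d: on a cell, [mu]
    differs from a times Lebesgue measure by the L1 error of the constant [a] and the singular
    mass. *)
Lemma near_density (b a e : R) (v : Z) : (0 < b)%R -> (0 <= a)%R ->
  \int[leb]_(x in [set x | cellf b x == v]) (`|f x - a|%R)%:E +
    mus [set x | cellf b x == v] <= e%:E ->
  forall phi : T -> R, mbf phi -> (forall x, 0 <= phi x <= 1)%R ->
  (`|Ex mu (fun x => (cellf b x == v)%:R * phi x)
     - a * b ^+ d * Ex (unif_box (corner b v) b) phi| <= e)%R.
Proof.
move=> b0 a0 He phi mphi phi01; set B := [set x | cellf b x == v] in He *.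
have mB : measurable B by apply: measurable_bool_set; exact: measurable_cellf.
have phi0 x : (0 <= phi x)%R by have /andP[] := phi01 x.
have phi1 x : (phi x <= 1)%R by have /andP[] := phi01 x.
have [mphi1 _] := mphi.
have mb : mbf (fun x : T => (cellf b x == v)%:R * phi x)%R.
  by apply: mbfM => //; exact: mbf_bool.
have [mb1 _] := mb.
have b01 x : (0 <= (cellf b x == v)%:R * phi x :> R)%R by exact: mulr_ge0.
have restr (m : {measure set T -> \bar R}) (g : T -> R) :
    \int[m]_x (g x * ((cellf b x == v)%:R * phi x))%:E = \int[m]_(x in B) (g x * phi x)%:E.
  rewrite [RHS]integral_mkcond; apply: eq_integral => x _; rewrite patchE.
  case: ifPn => [/set_mem /= ->|/negP xB]; first by rewrite mul1r.
  rewrite (_ : (cellf b x == v) = false) ?mul0r ?mulr0//.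
  by apply/negP => cx; apply: xB; exact/mem_set.
have X1 : (Ex mu (fun x => (cellf b x == v)%:R * phi x))%:E =
    \int[leb]_(x in B) (f x * phi x)%:E + \int[mus]_(x in B) (phi x)%:E.
  rewrite EFin_Ex// integral_density// restr; congr (_ + _).
  transitivity (\int[mus]_x (1 * ((cellf b x == v)%:R * phi x))%:E).
    by apply: eq_integral => x _; rewrite mul1r.
  by rewrite restr; apply: eq_integral => x _; rewrite mul1r.
have X2 : (a * b ^+ d * Ex (unif_box (corner b v) b) phi)%:E =
    \int[leb]_(x in B) (a * phi x)%:E.
  under eq_integral do rewrite EFinM.
  rewrite ge0_integralZl//; first last.
  - by move=> x _; rewrite lee_fin.
  - by apply/measurable_EFinP; exact: measurable_funTS.
  by rewrite Ex_cell_leb// -EFinM mulrA.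
have mD : measurable_fun B (fun x => (`|f x - a|%R)%:E).
  apply: measurable_funTS; apply/measurable_EFinP; apply: measurableT_comp => //.
  by apply: measurable_funB => //; exact: measurable_cst.
have mfp : measurable_fun B (fun x => (f x * phi x)%:E).
  by apply: measurable_funTS; apply/measurable_EFinP; exact: measurable_funM.
have map' : measurable_fun B (fun x => (a * phi x)%:E).
  by apply: measurable_funTS; apply/measurable_EFinP; apply: measurable_funM => //; exact: measurable_cst.
have I1 : \int[leb]_(x in B) (f x * phi x)%:E <=
    \int[leb]_(x in B) (a * phi x)%:E + \int[leb]_(x in B) (`|f x - a|%R)%:E.
  rewrite -ge0_integralD//; last by move=> x _; rewrite lee_fin mulr_ge0.
  apply: ge0_le_integral => //.
  - by move=> x _; rewrite lee_fin mulr_ge0.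
  - exact: emeasurable_funD.
  - move=> x _; rewrite -EFinD lee_fin -lerBlDl -mulrBl.
    by rewrite (le_trans (ler_norm _))// normrM (ger0_norm (phi0 x)) ler_piMr.
have I2 : \int[leb]_(x in B) (a * phi x)%:E <=
    \int[leb]_(x in B) (f x * phi x)%:E + \int[leb]_(x in B) (`|f x - a|%R)%:E.
  rewrite -ge0_integralD//; last by move=> x _; rewrite lee_fin mulr_ge0.
  apply: ge0_le_integral => //.
  - by move=> x _; rewrite lee_fin mulr_ge0.
  - exact: emeasurable_funD.
  - move=> x _; rewrite -EFinD lee_fin -lerBlDl -mulrBl distrC.
    by rewrite (le_trans (ler_norm _))// normrM (ger0_norm (phi0 x)) ler_piMr.
have I3 : \int[mus]_(x in B) (phi x)%:E <= mus B.
  rewrite -[leRHS]mul1e -(integral_cst mus mB 1); apply: ge0_le_integral => //.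
  - by move=> x _; rewrite lee_fin.
  - by apply: measurable_funTS; exact/measurable_EFinP.
  - by move=> x _; rewrite lee_fin.
move: I1 I2 I3 He; rewrite -X2; move: X1.
set x1 := Ex mu _; set x2 := (a * _ * _)%R.
have J0 : 0 <= \int[leb]_(x in B) (`|f x - a|%R)%:E by exact: integral_ge0.
have K0 : 0 <= \int[mus]_(x in B) (phi x)%:E by apply: integral_ge0 => x _; rewrite lee_fin.
have F0 : 0 <= \int[leb]_(x in B) (f x * phi x)%:E.
  by apply: integral_ge0 => x _; rewrite lee_fin mulr_ge0.
have M0 : 0 <= mus B by exact: measure_ge0.
move: J0 K0 F0 M0.
case: (\int[leb]_(x in B) (`|f x - a|%R)%:E) => [j| |]//; case: (mus B) => [m| |]//.
case: (\int[mus]_(x in B) (phi x)%:E) => [k| |]//; case: (\int[leb]_(x in B) (f x * phi x)%:E) => [y| |]//.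
rewrite -!EFinD !lee_fin => j0 k0 y0 m0 [xE] I1 I2 I3 He.
by rewrite ler_norml; apply/andP; split; lra.
Qed.

End density.

(** * Good cells for the density, bad cells for the singular part *)

Section cell_approximation.
Context (R : realType) (d : nat).
Notation T := 'rV[R]_d.
Notation Z := 'rV[int]_d.
Local Notation leb := (lebesgue_rV R d).

Definition bigbox (L : nat) : set T := box (const_mx (- L%:R)) (2 * L%:R).

Lemma bigboxP L x : bigbox L x <-> forall i, - L%:R <= x ord0 i < L%:R.
Proof.
by split => xL i; have := xL i; rewrite mxE (_ : - L%:R + 2 * L%:R = L%:R)//; ring.
Qed.

Lemma leb_bigbox L : (leb (bigbox L) < +oo)%E.
Proof. by rewrite lebesgue_rV_cube ?ltry// mulr_ge0. Qed.

Lemma tail_bigbox (mu : probability T R) (e : R) : 0 < e ->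
  exists L, (mu (~` bigbox L) <= e%:E)%E.
Proof.
move=> e0; have mL L : measurable (~` bigbox L : set T) by apply: measurableC; exact: measurable_box.
have c : (mu (~` bigbox n))%E @[n --> \oo] --> mu (\bigcap_n ~` bigbox n).
  apply: nonincreasing_cvg_mu => //.
  - by rewrite (le_lt_trans (probability_le1 mu (mL 0%N)))// ltry.
  - exact: bigcapT_measurable.
  - move=> n m nm; apply/subsetPset; apply: subsetC => x /bigboxP xn.
    apply/bigboxP => i; have /andP[h1 h2] := xn i.
    have nm' : n%:R <= m%:R :> R by rewrite ler_nat.
    by apply/andP; split; lra.
rewrite (_ : \bigcap_n _ = set0) ?measure0 in c; last first.
  apply/seteqP; split => // x /(_ (Num.truncn (\sum_i `|x ord0 i|)).+1 I); apply.
  apply/bigboxP => i; set S := \sum_i _.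
  have xS : `|x ord0 i| <= S by rewrite /S (bigD1 i)//= lerDl; exact: sumr_ge0.
  have := truncnS_gt S => St; have := le_lt_trans xS St.
  by rewrite ltr_norml => /andP[h1 h2]; apply/andP; split => //; exact: ltW.
have /fine_cvgP[_ /cvgrPdist_le/(_ _ e0)] := c.
case=> K _ HK; exists K; have := HK K (leqnn _).
rewrite /= sub0r normrN ger0_norm ?fine_ge0// -lee_fin fineK//.
exact: fin_num_measure.
Qed.

(** The dyadic cells of level [p] that tile [bigbox L], obtained by shifting a grid with nonnegative
    indices. *)
Definition bigcells (L p : nat) : seq Z :=
  [seq \row_i (v ord0 i - (L * 2 ^ p)%N%:Z) | v : Z <- cells d (2 * (L * 2 ^ p))].

Lemma bigcells_uniq L p : uniq (bigcells L p).
Proof.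
rewrite map_inj_uniq ?cells_uniq// => u v /rowP uv; apply/rowP => i.
by have := uv i; rewrite !mxE => /addIr.
Qed.

Lemma mem_bigcells L p (x : T) : (cellf (dyad R p) x \in bigcells L p) <-> bigbox L x.
Proof.
have mE v : (v \in bigcells L p) = [forall i, - (L * 2 ^ p)%N%:Z <= v ord0 i < (L * 2 ^ p)%N%:Z].
  apply/mapP/forallP => [[u]|vb].
    by rewrite mem_cells => /forallP ub -> i; rewrite mxE; have := ub i; lia.
  exists (\row_i (v ord0 i + (L * 2 ^ p)%N%:Z)).
    by rewrite mem_cells; apply/forallP => i; rewrite mxE; have := vb i; lia.
  by apply/rowP => i; rewrite !mxE addrK.
have LE : (L * 2 ^ p)%N%:Z%:~R = L%:R / dyad R p :> R.
  by rewrite /dyad invrK -pmulrn natrM natrX.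
rewrite mE; split => [/forallP xb|/bigboxP xL].
  apply/bigboxP => i; have := xb i; rewrite mxE floor_ge_int floor_lt_int mulrNz LE.
  by rewrite -mulNr ler_pM2r ?invr_gt0 ?dyad_gt0// ltr_pM2r// invr_gt0 dyad_gt0.
apply/forallP => i; rewrite mxE floor_ge_int floor_lt_int mulrNz LE.
by rewrite -mulNr ler_pM2r ?invr_gt0 ?dyad_gt0// ltr_pM2r// invr_gt0 dyad_gt0.
Qed.

Definition step (b : R) (r : seq Z) (a : Z -> R) (x : T) : R :=
  if cellf b x \in r then a (cellf b x) else 0.

Lemma leb_cell (b : R) (v : Z) : 0 < b -> leb [set x | cellf b x == v] = (b ^+ d)%:E.
Proof. by move=> b0; rewrite cellf_boxE// lebesgue_rV_cube// ltW. Qed.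

Lemma measurable_cellf_pred (b : R) (phi : pred Z) : 0 < b ->
  measurable [set x : T | phi (cellf b x)].
Proof.
move=> b0; apply: (@measurable_label _ T Z (cellf b) _ phi) => v.
by apply: measurable_bool_set; exact: measurable_cellf.
Qed.

Lemma leb_cells (b : R) (r : seq Z) : 0 < b -> uniq r ->
  leb [set x | cellf b x \in r] = ((size r)%:R * b ^+ d)%:E.
Proof.
move=> b0 ur; rewrite measure_label//; last first.
  by move=> v; apply: measurable_bool_set; exact: measurable_cellf.
rewrite (eq_bigr (fun=> (b ^+ d)%:E)) => [|v _]; last exact: leb_cell.
by rewrite sumEFin big_const_seq count_predT iter_addr addr0 mulr_natl.
Qed.

Variables (mu : probability T R) (f : T -> R).
Hypotheses (mf : measurable_fun [set: T] f) (f_ge0 : forall x, 0 <= f x).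
Variables (mus : {measure set T -> \bar R}) (N : set T).
Hypotheses (mN : measurable N) (lebN : leb N = 0%E) (musN : mus (~` N) = 0%E).
Hypothesis muE : forall A, measurable A -> mu A = (\int[leb]_(x in A) (f x)%:E + mus A)%E.
Local Open Scope ereal_scope.

Let mcell b v : (0 < b)%R -> measurable [set x : T | cellf b x == v].
Proof. by move=> b0; apply: measurable_bool_set; exact: measurable_cellf. Qed.

Lemma mus_le A : measurable A -> mus A <= mu A.
Proof.
move=> mA; rewrite muE// leeDr// integral_ge0// => x _.
by rewrite lee_fin.
Qed.

Lemma density_le A : measurable A -> \int[leb]_(x in A) (f x)%:E <= mu A.
Proof. by move=> mA; rewrite muE// leeDl. Qed.

Lemma density_integrable : leb.-integrable setT (EFin \o f).
Proof.
apply/integrableP; split; first exact/measurable_EFinP.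
under eq_integral do rewrite gee0_abs ?lee_fin//.
by rewrite (le_lt_trans (density_le measurableT))// probability_setT ltry.
Qed.

Lemma measurable_fun_step (b : R) r a : (0 < b)%R -> measurable_fun setT (step b r a).
Proof.
move=> b0 _ B mB; rewrite setTI.
rewrite (_ : _ @^-1` _ = [set x : T | (fun v => (if v \in r then a v else 0%R) \in B) (cellf b x)]).
  exact: (measurable_cellf_pred (fun v => (if v \in r then a v else 0%R) \in B) b0).
by apply/seteqP; split => x; [move=> ?; exact/mem_set|move=> /set_mem].
Qed.

(** A dyadic set [D] approximates the carrier [N] for Lebesgue measure and [mus] at once. As [N] is
    Lebesgue-null, [D] has small volume; as [mus] lives on [N], [D] takes nearly all the singular
    mass. The cells of [D] are the bad ones. *)
Lemma step_singular_approximation (e : R) : (0 < e)%R ->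
  exists p good bad a, [/\ uniq (good ++ bad), forall v, (0 <= a v)%R,
    \int[leb]_x (`|f x - step (dyad R p) good a x|%R)%:E <= e%:E,
    ((size bad)%:R * dyad R p ^+ d <= e)%R &
    mus [set x | cellf (dyad R p) x \notin bad] <= e%:E].
Proof.
move=> e0; have e1 : (0 < e / 3)%R by rewrite divr_gt0.
have [L HL] := tail_bigbox mu e1.
have mQ : measurable (bigbox L) by exact: measurable_box.
have mQC := measurableC mQ.
have [p1 [psi [C [HC Hpsi]]]] := step_approximation mQ (leb_bigbox L) density_integrable e1.
have C0 : (0 <= C)%R by exact: le_trans (HC 0%R).
have C1 : (0 < C + 1)%R by rewrite ltr_wpDl.
(* The step function is bounded by [C] and is set to 0 on bad cells; their volume must be small
   compared with 1 / C. *)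
have e2 : (0 < e / 3 / (C + 1))%R by rewrite divr_gt0.
pose m : {measure set T -> \bar R} := measure_add (mrestr leb mQ) mus.
have mE A : m A = leb (A `&` bigbox L) + mus A by apply: (etrans (measure_addE _ _ _)).
have m_fin : m setT < +oo.
  rewrite mE setTI lte_add_pinfty ?leb_bigbox//.
  by rewrite (le_lt_trans (mus_le measurableT))// probability_setT ltry.
have [_ /(_ _ e2)[p2 [phi]]] := @approximableT R d m m_fin N mN.
set D := cellset p2 phi; rewrite mE => HD.
have mD : measurable D by exact: measurable_cellset.
have mND : measurable (N `+` D) by apply: measurableU; exact: measurableD.
have e21 : (e / 3 / (C + 1) <= e / 3)%R.
  by rewrite ler_pdivrMr// ler_peMr ?lerDr// ltW.
have HD1 : leb ((N `+` D) `&` bigbox L) <= (e / 3 / (C + 1))%:E.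
  by apply: le_trans HD; rewrite leeDl//; exact: measure_ge0.
have HD2 : mus (N `+` D) <= (e / 3 / (C + 1))%:E.
  by apply: le_trans HD; rewrite leeDr//; exact: measure_ge0.
have lebD : leb (D `&` bigbox L) <= (e / 3 / (C + 1))%:E.
  apply: (le_trans _ HD1).
  apply: (@le_trans _ _ (leb (N `|` ((N `+` D) `&` bigbox L)))).
    apply: le_measure; rewrite ?inE; [exact: measurableI|by apply: measurableU => //; exact: measurableI|].
    move=> x [Dx Lx]; have [Nx|nN] := pselect (N x); first by left.
    by right; split => //; right.
  rewrite -[leRHS]add0e -lebN; apply: measureU2 => //; exact: measurableI.
have musD : mus (~` D) <= (e / 3)%:E.
  apply: (@le_trans _ _ (e / 3 / (C + 1))%:E); last by rewrite lee_fin.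
  apply: (le_trans _ HD2).
  apply: (@le_trans _ _ (mus (~` N `|` (N `+` D)))).
    apply: le_measure; rewrite ?inE; [exact: measurableC|by apply: measurableU => //; exact: measurableC|].
    move=> x nD; have [Nx|nN] := pselect (N x); last by left.
    by right; left.
  rewrite -[leRHS]add0e -musN; apply: measureU2 => //; exact: measurableC.
pose p := (p1 + p2)%N; set r := bigcells L p.
have b0 := dyad_gt0 R p.
(* Both approximations are read at the common level [p]. The absolute value makes [a] nonnegative
   and does not increase the distance to f >= 0. *)
pose phi' v := phi (coarse p1 v); pose a v := (`|psi (coarse p2 v)|)%R.
have cD x : phi' (cellf (dyad R p) x) <-> D x by rewrite /phi' /p addnC coarse_cellf.
exists p, [seq v <- r | ~~ phi' v], [seq v <- r | phi' v], a; split => //.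
- rewrite uniq_catC cat_uniq !filter_uniq ?bigcells_uniq//= andbT.
  by apply/hasPn => v; rewrite !mem_filter => /andP[/negbTE -> _].
- by move=> v; rewrite /a normr_ge0.
- have lec x : (`|f x - step (dyad R p) [seq v <- r | ~~ phi' v] a x| <=
      f x * \1_(~` bigbox L) x +
      (`|f x - psi (cellf (dyad R p1) x)| * \1_(bigbox L) x + C * \1_(D `&` bigbox L) x))%R.
    rewrite /step mem_filter !indicE in_setI in_setC.
    have fp := f_ge0 x; have Cx := HC (cellf (dyad R p1) x).
    have -> : (x \in D) = phi' (cellf (dyad R p) x).
      by apply/idP/idP => [/set_mem/cD|/cD ?]; last exact/mem_set.
    have -> : (x \in bigbox L) = (cellf (dyad R p) x \in r).
      by apply/idP/idP => [/set_mem/(mem_bigcells L p)|/(mem_bigcells L p) ?]; last exact/mem_set.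
    have -> : a (cellf (dyad R p) x) = (`|psi (cellf (dyad R p1) x)|)%R by rewrite /a coarse_cellf.
    case: (cellf (dyad R p) x \in r); last first.
      by rewrite !andbF /= subr0 !mulr0 !addr0 mulr1 ger0_norm.
    case: (phi' _); rewrite /= ?mulr1 ?mulr0 ?add0r ?addr0 ?subr0.
      by rewrite (ger0_norm fp) -lerBlDr (le_trans _ (ler_norm _))// lerB// (le_trans (ler_norm _)).
    rewrite -[X in (X <= _)%R](ger0_norm (normr_ge0 _)).
    rewrite normr_id -[X in (`|X - _| <= _)%R](ger0_norm fp).
    exact: ler_dist_dist.
  have mpsi := measurable_step p1 psi.
  have m1 : measurable_fun setT (fun x => (f x * \1_(~` bigbox L) x)%:E).
    by apply/measurable_EFinP; apply: measurable_funM => //; exact: measurable_indic.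
  have m2 : measurable_fun setT (fun x => (`|f x - psi (cellf (dyad R p1) x)| * \1_(bigbox L) x)%:E).
    apply/measurable_EFinP; apply: measurable_funM; last exact: measurable_indic.
    by apply: measurableT_comp => //; exact: measurable_funB.
  have m3 : measurable_fun setT (fun x : T => (C * \1_(D `&` bigbox L) x)%:E).
    apply/measurable_EFinP; apply: measurable_funM; first exact: measurable_cst.
    by apply: measurable_indic; exact: measurableI.
  have ind (g : T -> R) A : measurable A -> \int[leb]_x (g x * \1_A x)%:E = \int[leb]_(x in A) (g x)%:E.
    move=> mA; rewrite [RHS]integral_mkcond; apply: eq_integral => x _.
    by rewrite patchE indicE; case: (x \in A); rewrite ?mulr1 ?mulr0.
  apply: (@le_trans _ _ (\int[leb]_x ((f x * \1_(~` bigbox L) x)%:E +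
      ((`|f x - psi (cellf (dyad R p1) x)| * \1_(bigbox L) x)%:E + (C * \1_(D `&` bigbox L) x)%:E)))).
    apply: ge0_le_integral => //.
    + apply/measurable_EFinP; apply: measurableT_comp => //; apply: measurable_funB => //.
      exact: measurable_fun_step.
    + by apply: emeasurable_funD => //; exact: emeasurable_funD.
    + by move=> x _; rewrite -!EFinD lee_fin; exact: lec.
  rewrite ge0_integralD//; last 3 first.
  + by move=> x _; rewrite lee_fin mulr_ge0.
  + by move=> x _; rewrite -EFinD lee_fin addr_ge0// mulr_ge0.
  + exact: emeasurable_funD.
  rewrite ge0_integralD//; last by move=> x _; rewrite lee_fin mulr_ge0.
  rewrite !ind//; last exact: measurableI.
  rewrite integral_cst; last exact: measurableI.
  have -> : e%:E = (e / 3)%:E + ((e / 3)%:E + (e / 3)%:E) by rewrite -!EFinD; congr (_%:E); field.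
  apply: leeD; first exact: le_trans (density_le mQC) HL.
  apply: leeD => //.
  apply: (@le_trans _ _ (C%:E * (e / 3 / (C + 1))%:E)); first by rewrite lee_wpmul2l// lee_fin.
  by rewrite -EFinM lee_fin mulrCA ler_piMr ?ltW// ltr_pdivrMr// mul1r ltrDl.
- rewrite -lee_fin -leb_cells ?filter_uniq ?bigcells_uniq//.
  rewrite (_ : [set _ | _] = D `&` bigbox L).
    apply: (le_trans lebD); rewrite lee_fin (le_trans e21)//.
    have e0' : (0 < (e : R))%R by [].
    by lra.
  apply/seteqP; split => x /=; rewrite mem_filter.
    by move=> /andP[/cD Dx /mem_bigcells Lx].
  by move=> [/cD -> Lx]; apply/mem_bigcells.
- apply: (@le_trans _ _ (mus (~` bigbox L `|` ~` D))).
    apply: le_measure; rewrite ?inE.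
    + exact: (measurable_cellf_pred (fun v => v \notin _) b0).
    + by apply: measurableU => //; exact: measurableC.
    move=> x /=; rewrite mem_filter negb_and => /orP[nD|nr].
      by right=> /cD Dx; rewrite Dx in nD.
    by left=> /(mem_bigcells L p) rx; rewrite rx in nr.
  apply: (le_trans (measureU2 _ mQC (measurableC mD))).
  apply: (@le_trans _ _ ((e / 3)%:E + (e / 3)%:E)).
    by apply: leeD => //; exact: le_trans (mus_le mQC) HL.
  by rewrite -EFinD lee_fin; lra.
Qed.

End cell_approximation.

Lemma lipschitz_measurable (R : realType) (phi : R -> R) (K : R) : 0 <= K ->
  (forall x y, `|phi x - phi y| <= K * `|x - y|) -> measurable_fun [set: R] phi.
Proof.
move=> K0 H; apply: continuous_measurable_fun => x.
apply/cvgrPdist_lt => e e0.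
have K1 : 0 < K + 1 by rewrite ltr_wpDl.
apply/nbhs_ballP; exists (e / (K + 1)); first exact: divr_gt0.
move=> y; rewrite /ball /= => xy; apply: (le_lt_trans (H _ _)).
apply: (@le_lt_trans _ _ ((K + 1) * `|x - y|)).
  by rewrite ler_wpM2r// lerDl.
by rewrite mulrC -ltr_pdivlMr.
Qed.

Section cell_approximation.
Context (R : realType) (d : nat).
Notation T := 'rV[R]_d.
Notation Z := 'rV[int]_d.
Local Notation leb := (lebesgue_rV R d).

Lemma Rintegral_step (b : R) (r : seq Z) (a : Z -> R) : 0 < b -> uniq r ->
  leb.-integrable setT (EFin \o step b r a) /\
  (\int[leb]_x step b r a x) = \sum_(v <- r) a v * b ^+ d.
Proof.
move=> b0; elim: r => [_|v r IH /= /andP[vr /IH[ir er]]].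
  rewrite big_nil /Rintegral (_ : EFin \o _ = cst 0%E)//.
  by split; [exact: integrable0|rewrite integral0].
pose B := [set x : T | cellf b x == v].
have mB : measurable B by apply: measurable_bool_set; exact: measurable_cellf.
have lB : (\int[leb]_x (\1_B x)%:E = (b ^+ d)%:E)%E.
  by rewrite integral_indic// setIT; exact: leb_cell.
have iB : leb.-integrable setT (EFin \o \1_B).
  apply/integrableP; split; first by apply/measurable_EFinP; exact: measurable_indic.
  under eq_integral do rewrite gee0_abs ?lee_fin//.
  by rewrite [X in (X < _)%E](_ : _ = (b ^+ d)%:E) ?ltry.
have sE : step b (v :: r) a = fun x => a v * \1_B x + step b r a x.
  apply/funext => x; rewrite /step inE indicE.
  have -> : (x \in B) = (cellf b x == v) by apply/idP/idP => [/set_mem|?]; last exact/mem_set.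
  case: eqVneq => [->|_] /=; first by rewrite (negbTE vr) mulr1 addr0.
  by rewrite mulr0 add0r.
have iaB : leb.-integrable setT (EFin \o (fun x => a v * \1_B x)).
  by rewrite (_ : _ \o _ = (fun x => (a v)%:E * (\1_B x)%:E)%E)//; exact: integrableZl.
rewrite sE big_cons; split; first by rewrite (_ : _ \o _ = ((EFin \o (fun x => a v * \1_B x)%R) \+ (EFin \o step b r a))%E)//; exact: integrableD.
rewrite RintegralD// er; congr (_ + _); rewrite RintegralZl//; congr (_ * _).
by rewrite /Rintegral lB.
Qed.

Variables (mu : probability T R) (f : T -> R).
Hypotheses (mf : measurable_fun [set: T] f) (f_ge0 : forall x, 0 <= f x).
Variables (mus : {measure set T -> \bar R}) (N : set T).
Hypotheses (mN : measurable N) (lebN : leb N = 0%E) (musN : mus (~` N) = 0%E).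
Hypothesis muE : forall A, measurable A -> mu A = (\int[leb]_(x in A) (f x)%:E + mus A)%E.

(** The value 0 at 0 gives |phi (f x)| <= K f x, which is integrable although Lebesgue measure is
    infinite. *)
Lemma lipschitz_integrable (phi : R -> R) (K : R) : 0 <= K ->
  (forall x y, `|phi x - phi y| <= K * `|x - y|) -> phi 0 = 0 ->
  leb.-integrable setT (EFin \o (phi \o f)).
Proof.
move=> K0 Hphi phi0; have fi := density_integrable mf f_ge0 muE.
apply: (le_integrable measurableT (g := fun x => (K%:E * (f x)%:E)%E)).
- apply/measurable_EFinP; apply: measurableT_comp => //.
  exact: lipschitz_measurable Hphi.
- move=> x _ /=; rewrite lee_fin (ger0_norm (mulr_ge0 K0 (f_ge0 x))).
  by have := Hphi (f x) 0; rewrite phi0 !subr0 (ger0_norm (f_ge0 x)).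
- exact: integrableZl.
Qed.

Lemma cell_approximation (e : R) : 0 < e ->
  exists (b : R) (good bad : seq Z) (a ev : Z -> R),
  [/\ 0 < b, uniq (good ++ bad), forall v, 0 <= a v,
   forall v, v \in good -> 0 <= ev v & \sum_(v <- good) ev v <= e] /\
  [/\ forall v, v \in good -> forall phi : T -> R, mbf phi -> (forall x, 0 <= phi x <= 1) ->
       `|Ex mu (fun x => (cellf b x == v)%:R * phi x)
         - a v * b ^+ d * Ex (unif_box (corner b v) b) phi| <= ev v,
     fine (mu [set x | cellf b x \notin good]) <= fine (mus setT) + e,
     fine (mus setT) - e <= \sum_(v <- bad) fine (mu [set x | cellf b x == v]),
     (size bad)%:R * b ^+ d <= e &
     forall (phi : R -> R) (K : R), 0 <= K -> (forall x y, `|phi x - phi y| <= K * `|x - y|) ->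
       phi 0 = 0 ->
       `|\sum_(v <- good) phi (a v) * b ^+ d - \int[leb]_x phi (f x)| <= K * e].
Proof.
move=> e0; have e2 : 0 < e / 2 by rewrite divr_gt0.
have [p [good [bad [a [ugb a0 Ha Hbad Hmus]]]]] :=
  step_singular_approximation mf f_ge0 mN lebN musN muE e2.
set b := dyad R p in Ha Hbad Hmus; have b0 : 0 < b := dyad_gt0 R p.
have := ugb; rewrite cat_uniq => /and3P[ug /hasPn gb ub].
pose B v := [set x : T | cellf b x == v].
have mB v : measurable (B v) by apply: measurable_bool_set; exact: measurable_cellf.
have msT : (mus setT <= 1)%E by rewrite -(probability_setT mu); exact: (mus_le f_ge0 muE measurableT).
have fmus A : measurable A -> mus A \is a fin_num.
  move=> mA; rewrite ge0_fin_numE//; apply: le_lt_trans (ltry 1).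
  by apply: le_trans msT; apply: le_measure; rewrite ?inE.
pose D (x : T) : R := `|f x - step b good a x|.
have mD : measurable_fun setT (fun x => (D x)%:E).
  apply/measurable_EFinP; apply: measurableT_comp => //; apply: measurable_funB => //.
  exact: measurable_fun_step.
have D0 x : (0 <= (D x)%:E)%E by rewrite lee_fin /D normr_ge0.
have Dsub A : measurable A -> (\int[leb]_(x in A) (D x)%:E <= (e / 2)%:E)%E.
  move=> mA; apply: le_trans Ha; apply: ge0_subset_integral => //.
have fD A : measurable A -> (\int[leb]_(x in A) (D x)%:E \is a fin_num)%E.
  move=> mA; rewrite ge0_fin_numE ?integral_ge0//.
  exact: le_lt_trans (Dsub A mA) (ltry _).
have mpred (q : pred Z) : measurable [set x : T | q (cellf b x)] := measurable_cellf_pred q b0.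
have evE v : v \in good -> (\int[leb]_(x in B v) (`|f x - a v|)%:E = \int[leb]_(x in B v) (D x)%:E)%E.
  by move=> vg; apply: eq_integral => x /set_mem /= /eqP xv; rewrite /D /step xv vg.
have fg : mus setT \is a fin_num by exact: fmus.
(* The error of a cell is its L1 error plus its singular mass. Summed over the good cells it is at
   most the global L1 error plus the singular mass outside the bad cells. *)
exists b, good, bad, a, (fun v => fine (\int[leb]_(x in B v) (D x)%:E + mus (B v))%E).
split; split => //.
- by move=> v _; rewrite fine_ge0// adde_ge0// integral_ge0.
- rewrite -lee_fin EFin_sum_fine; last by move=> v _; rewrite fin_numD fD//= fmus.
  rewrite big_split /= -(@measure_label _ T R Z (cellf b) mB mus)//.
  rewrite -(@integral_label _ T R Z (cellf b) mB leb)//.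
  rewrite (splitr e) EFinD; apply: leeD; first exact: Dsub (mpred _).
  apply: le_trans Hmus; apply: le_measure; rewrite ?inE; [exact: mpred|exact: mpred (fun v => v \notin bad)|].
  move=> x /= xg; apply/negP => xb; have := gb _ xb; by rewrite /= xg.
- move=> v vg; apply: (near_density mf f_ge0 mN lebN musN muE) => //.
  have fv : (\int[leb]_(x in B v) (D x)%:E + mus (B v))%E \is a fin_num.
    by rewrite fin_numD fD//= fmus.
  rewrite (fineK fv); apply: leeD => //.
  by rewrite le_eqVlt; apply/orP; left; apply/eqP; exact: evE.
- have mG := mpred (fun v => v \notin good).
  rewrite -lee_fin EFinD fineK ?fin_num_measure// fineK//.
  apply: (le_trans (y := (\int[leb]_(x in [set x | cellf b x \notin good]) (D x)%:E + mus setT)%E)).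
    rewrite [leLHS](muE mG); apply: leeD.
      apply: ge0_le_integral => //; first by move=> x _; rewrite lee_fin.
      + by apply: measurable_funTS; exact/measurable_EFinP.
      + exact: measurable_funTS.
      + by move=> x /= /negbTE xg; rewrite lee_fin /D /step xg subr0 ler_norm.
    by apply: le_measure; rewrite ?inE.
  rewrite addeC leeD2l// (le_trans (Dsub _ mG))// lee_fin; lra.
- have mb := mpred (fun v => v \in bad).
  rewrite lerBlDr -lee_fin EFinD EFin_sum_fine; last by move=> v _; exact: (fin_num_measure mu _ (mB v)).
  rewrite fineK// -(@measure_label _ T R Z (cellf b) mB mu)//.
  apply: (le_trans (y := (mus [set x | cellf b x \in bad] + mus [set x | cellf b x \notin bad])%E)).
    rewrite -measureU//.
    + by apply: le_measure; rewrite ?inE//; [apply: measurableU => //; exact: mpred (fun v => v \notin bad)|move=> x _ /=; case: (boolP (_ \in _)); [left|right]].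
    + exact: mpred (fun v => v \notin bad).
    + by apply/seteqP; split => // x /= [-> ].
  apply: leeD; first exact: (mus_le f_ge0 muE mb).
  apply: (le_trans Hmus); rewrite lee_fin; lra.
- by apply: (le_trans Hbad); lra.
move=> phi K K0 Hphi phi0.
have ifp := lipschitz_integrable K0 Hphi phi0.
have [isp <-] := Rintegral_step (fun v => phi (a v)) b0 ug.
rewrite distrC -RintegralB//.
have idf : leb.-integrable setT (EFin \o (fun x => phi (f x) - step b good (fun v => phi (a v)) x)).
  rewrite (_ : _ \o _ = ((EFin \o (phi \o f)) \- (EFin \o step b good (fun v => phi (a v))))%E)//.
  exact: integrableB.
apply: le_trans (le_normr_Rintegral measurableT idf) _.
rewrite -lee_fin /Rintegral fineK; last first.
  apply: integrable_fin_num => //; apply: integrable_norm => //.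
apply: (@le_trans _ _ (\int[leb]_x (K%:E * (D x)%:E))%E).
  apply: ge0_le_integral => //.
  - by move: (measurable_int _ idf) => /measurable_EFinP midf; apply/measurable_EFinP; exact: measurableT_comp.
  - by apply: emeasurable_funM => //; exact: measurable_cst.
  - move=> x _; rewrite -EFinM lee_fin /D.
    have -> : step b good (fun v => phi (a v)) x = phi (step b good a x).
      by rewrite /step; case: ifP.
    exact: Hphi.
rewrite ge0_integralZl// EFinM lee_wpmul2l ?lee_fin//.
by apply: (le_trans Ha); rewrite lee_fin; lra.
Qed.

End cell_approximation.

(** * Cells charged by the singular part *)

Lemma near_all_seq (I : eqType) (s : seq I) (Q : I -> nat -> Prop) :
  (forall i, i \in s -> \forall n \near \oo, Q i n) ->
  \forall n \near \oo, forall i, i \in s -> Q i n.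
Proof.
elim: s => [|i s IH] H; first by near=> n.
have H1 := H i (mem_head _ _).
have H2 : \forall n \near \oo, forall j, j \in s -> Q j n.
  by apply: IH => j js; apply: H; rewrite inE js orbT.
near=> n => j; rewrite inE => /predU1P[->|]; first by near: n.
by move: j; near: n.
Unshelve. all: by end_near. Qed.

Section thin_count.
Context (R : realType).

Lemma thin_id (q : R) n : thin q n (fun k => k%:R) = n%:R * q.
Proof.
elim: n => [|n IH] /=; first by rewrite mul0r.
have -> : (fun k => k%:R : R) \o succn = (fun k => k%:R + 1 : R).
  by apply/funext => k /=; rewrite natr1.
by rewrite thinD thin_cst IH -natr1; ring.
Qed.

Context dT (T : measurableType dT) (nu : probability T R) (a : pred T).
Hypothesis ma : measurable_fun [set: T] a.

Lemma bmf_count n (phi : nat -> R) : bmf n (fun s => phi (count a s)).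
Proof.
rewrite (_ : (fun s => _) = fun s => (fun s' => phi (size s')) [seq x <- s | a x]).
  apply: (bmf_filter (h := fun s' => phi (size s'))) => // k; split.
    rewrite (_ : (fun _ => _) = cst (phi k)); first exact: measurable_cst.
    by apply/funext => t; rewrite size_tuple.
  by exists `|phi k| => t; rewrite size_tuple.
by apply/funext => s; rewrite size_filter.
Qed.

(** The number of sample points in a region is binomial. *)
Lemma EE_count n (phi : nat -> R) :
  EE nu n (fun s => phi (count a s)) = thin (Ex nu (fun x => (a x)%:R)) n phi.
Proof.
elim: n phi => [|n IH] phi /=; first by rewrite EE0.
have mab : mbf (fun x => (a x)%:R : R) by apply: mbf_bool; exact: measurable_bool_set.
rewrite EES; last exact: bmf_count.
rewrite -!IH.
transitivity (Ex nu (fun x => (1 - (a x)%:R) * EE nu n (fun s => phi (count a s)) +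
    (a x)%:R * EE nu n (fun s => (phi \o succn) (count a s)))).
  congr Ex; apply/funext => x /=.
  by case: (a x); rewrite /= ?subrr ?subr0 ?mul0r ?mul1r ?add0r ?addr0.
have m1 : mbf (fun x => 1 - (a x)%:R : R) by apply: mbfB => //; exact: mbf_cst.
rewrite ExD; [|by apply: mbfM => //; exact: mbf_cst|by apply: mbfM => //; exact: mbf_cst].
under [X in Ex _ X + _]funext do rewrite mulrC.
under [X in _ + Ex _ X]funext do rewrite mulrC.
rewrite !ExZ// ExB//; last exact: mbf_cst.
by rewrite Ex_cst; congr (_ + _); exact: mulrC.
Qed.

Lemma EE_count_mean n : EE nu n (fun s => (count a s)%:R) = n%:R * Ex nu (fun x => (a x)%:R).
Proof. by rewrite (EE_count n (fun k => k%:R)) thin_id. Qed.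

Lemma Ex_bool01 : 0 <= Ex nu (fun x => (a x)%:R) <= 1.
Proof.
apply/andP; split; first exact: Ex_ge0.
apply: Ex_le; first by apply: mbf_bool; exact: measurable_bool_set.
by move=> x; case: (a x).
Qed.

Lemma EE_count_dist n (kap q : R) : 0 < kap -> q = Ex nu (fun x => (a x)%:R) ->
  EE nu n (fun s => `|(count a s)%:R - n%:R * q|) <= (kap * (n%:R * q) + kap^-1) / 2.
Proof.
move=> k0 qE; rewrite (EE_count n (fun k => `|k%:R - n%:R * q|)) qE.
exact: thin_dist Ex_bool01 n kap k0.
Qed.

End thin_count.

Section EE2_uniq.
Context (R : realType) (d : nat).
Notation T := 'rV[R]_d.
Variable nu : probability T R.
Implicit Types F : seq T -> seq T -> R.
Hypothesis nu_diffuse : diffuse nu.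

Lemma le_EE2_uniq n F F' : mbf2 F -> mbf2 F' ->
  (forall xs ys, size xs = n -> size ys = n -> uniq (xs ++ ys) -> F xs ys <= F' xs ys) ->
  EE2 nu n F <= EE2 nu n F'.
Proof.
move=> mF mF' le; rewrite /EE2 -(mbf2_catE nu n n mF) -(mbf2_catE nu n n mF').
apply: le_EE_uniq => //; [exact: mbf2_bmf_cat|exact: mbf2_bmf_cat|].
move=> s sn us; apply: le; last by rewrite cat_take_drop.
  by rewrite size_takel// sn leq_addr.
by rewrite size_drop sn addKn.
Qed.

Lemma mbf2_fst (h : seq T -> R) : (forall n, bmf n h) -> mbf2 (fun xs _ => h xs).
Proof. by move=> mh k l; apply: (mbf_comp (phi := fst) _ (mh k)). Qed.

Lemma mbf2_snd (h : seq T -> R) : (forall n, bmf n h) -> mbf2 (fun _ ys => h ys).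
Proof. by move=> mh k l; apply: (mbf_comp (phi := snd) _ (mh l)). Qed.

Lemma EE2_fst n (h : seq T -> R) : (forall n, bmf n h) ->
  EE2 nu n (fun xs _ => h xs) = EE nu n h.
Proof. by move=> mh; apply: eq_EE => xs _; rewrite /EE Ex_cst. Qed.

Lemma EE2_snd n (h : seq T -> R) : EE2 nu n (fun _ ys => h ys) = EE nu n h.
Proof. by rewrite /EE2 [in LHS]/EE Ex_cst. Qed.

Lemma mbf2Z c F : mbf2 F -> mbf2 (fun xs ys : seq T => c * F xs ys).
Proof. by move=> mF k l; apply: mbfZ; exact: mF. Qed.

Lemma EE2Z n c F : mbf2 F -> EE2 nu n (fun xs ys => c * F xs ys) = c * EE2 nu n F.
Proof. by move=> mF; rewrite !EE2E//; [rewrite ExZ//; exact: mF|exact: mbf2Z]. Qed.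

Lemma mbf2D F F' : mbf2 F -> mbf2 F' -> mbf2 (fun xs ys : seq T => F xs ys + F' xs ys).
Proof. by move=> mF mF' k l; apply: mbfD; [exact: mF|exact: mF']. Qed.

Lemma EE2_cst n c : EE2 nu n (fun _ _ => c) = c.
Proof. by rewrite /EE2 /EE !Ex_cst. Qed.

Lemma mbf2_cst c : mbf2 (fun _ _ : seq T => c : R).
Proof. by move=> k l; exact: mbf_cst. Qed.

End EE2_uniq.

Section micro_cells.
Context (R : realType) (d : nat).
Notation T := 'rV[R]_d.
Notation Z := 'rV[int]_d.

Definition micro (m : nat) (v : Z) : seq Z :=
  [seq \row_i (m%:Z * v ord0 i + j ord0 i) | j : Z <- cells d m].

Lemma micro_uniq m v : uniq (micro m v).
Proof.
rewrite map_inj_uniq ?cells_uniq// => i j /rowP ij; apply/rowP => k.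
by have := ij k; rewrite !mxE => /addrI.
Qed.

(** Dividing the side by [m] subdivides each cell exactly, so points are sorted into micro-cells
    without a boundary error. *)
Lemma mem_micro (b : R) m v (x : T) : 0 < b -> (0 < m)%N ->
  (cellf (b / m%:R) x \in micro m v) = (cellf b x == v).
Proof.
move=> b0 m0; have mE u : (u \in micro m v) =
    [forall i, m%:Z * v ord0 i <= u ord0 i < m%:Z * v ord0 i + m%:Z].
  apply/mapP/forallP => [[j]|ub].
    by rewrite mem_cells => /forallP jb -> i; rewrite mxE; have := jb i; lia.
  exists (\row_i (u ord0 i - m%:Z * v ord0 i)).
    by rewrite mem_cells; apply/forallP => i; rewrite mxE; have := ub i; lia.
  by apply/rowP => i; rewrite !mxE addrC subrK.
have m0' : 0 < m%:R :> R by rewrite ltr0n.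
have h0 : 0 < b / m%:R by rewrite divr_gt0.
have E i : (m%:Z * v ord0 i <= cellf (b / m%:R) x ord0 i < m%:Z * v ord0 i + m%:Z) =
    (corner b v ord0 i <= x ord0 i < corner b v ord0 i + b).
  rewrite !mxE floor_ge_int floor_lt_int ler_pdivlMr// ltr_pdivrMr//.
  rewrite intrD intrM -!pmulrn mulrDl !mulrA.
  have m1 : m%:R != 0 :> R by rewrite gt_eqF.
  have -> : m%:R * b / m%:R = b by field.
  by have -> : m%:R * (v ord0 i)%:~R * b / m%:R = b * (v ord0 i)%:~R by field.
rewrite mE; apply/forallP/idP => [H|/(cellf_box _ _ b0) xb i]; last by rewrite E; exact: xb.
by apply/(cellf_box _ _ b0) => i; rewrite -E.
Qed.

Lemma size_micro m v : size (micro m v) = (m ^ d)%N.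
Proof. by rewrite size_map size_cells. Qed.

End micro_cells.

Section bad_cell.
Context (R : realType) (d : nat).
Notation T := 'rV[R]_d.
Notation Z := 'rV[int]_d.
Variable w : T -> R.
Hypotheses (w_ge0 : forall x, 0 <= w x) (w_ub : has_ubound (range w)).
Hypothesis w_meas : measurable_fun [set: T] w.
Hypothesis W2 : condW2 w.
Notation M := (wmax w).
Let M0 : 0 <= M := wmax_ge0 w_ge0 w_ub.

Lemma W2_box (e : R) : 0 < e ->
  exists2 del : R, 0 < del & forall z : T, (forall i, `|z ord0 i| < del) -> w z <= e.
Proof.
move=> e0; have [_ /cvgrPdist_lt/(_ _ e0)] := W2.
move=> /nbhs_ballP[del /= del0 H]; exists del => // z zd.
have /H : ball (0 : T) del z.
  by rewrite -ball_normE /= sub0r normrN /Num.norm /= mx_normrE; apply/bigmax_ltP; split => // i _; rewrite (ord1 i.1).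
by rewrite sub0r normrN => /ltW; rewrite ger0_norm.
Qed.

Variables (mu : probability T R).
Hypothesis mu_diffuse : diffuse mu.

(* In a micro-cell of side at most del / s all costs are below e, so that all
   points but the imbalances between the two colours are matched for free. *)
Lemma micro_gain (s b del e kap : R) (m n : nat) (v : Z) :
  (forall z : T, (forall i, `|z ord0 i| < del) -> w z <= e) ->
  0 < b -> 0 < s -> (0 < m)%N -> s * (b / m%:R) <= del -> 0 <= e <= M -> 0 < kap ->
  let q := Ex mu (fun x => (cellf b x == v)%:R) in
  is_true ((M - e) * (n%:R * q - kap * (n%:R * q) - (m ^ d)%N%:R * kap^-1) <=
  EE2 mu n (fun xs ys => MG (sgap w s) (cell (cellf b) v xs) (cell (cellf b) v ys))).
Proof.
move=> we b0 s0 m0 smb /andP[e0 eM] kap0 q.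
set h := b / m%:R in smb; have h0 : 0 < h by rewrite divr_gt0// ltr0n.
have Me : 0 <= M - e by rewrite subr_ge0.
pose a u : pred T := fun x => cellf h x == u.
have ma u : measurable_fun [set: T] (a u) by exact: measurable_cellf.
have mv : measurable_fun [set: T] (fun x => cellf b x == v) by exact: measurable_cellf.
have mab u : mbf (fun x => (a u x)%:R : R) by apply: mbf_bool; exact: measurable_bool_set.
pose qu u := Ex mu (fun x => (a u x)%:R).
have qE : q = \sum_(u <- micro m v) qu u.
  rewrite -Ex_sum//; congr Ex; apply/funext => x.
  rewrite -(mem_micro v x b0 m0) -/h -count_uniq_mem ?micro_uniq// -sum1_count natr_sum big_mkcond /=.
  by apply: eq_bigr => u _; rewrite /a eq_sym; case: eqVneq.
pose D u (zs : seq T) := `|(count (a u) zs)%:R - n%:R * qu u|.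
have mD u k : bmf k (D u) by exact: (bmf_count (ma u) k (fun j => `|j%:R - n%:R * qu u|)).
(* Subtracting the deviations of both counts from their common mean gives a lower bound for the
   smaller count, hence for the number of pairs in the micro-cell. *)
pose L xs ys := \sum_(u <- micro m v) (M - e) * (n%:R * qu u + -1 * (D u xs + D u ys)).
have mDD u : mbf2 (fun xs ys => D u xs + D u ys).
  exact: (mbf2D (mbf2_fst (mD u)) (mbf2_snd (mD u))).
have mL1 u : mbf2 (fun xs ys => n%:R * qu u + -1 * (D u xs + D u ys)).
  by move=> k l; apply: mbfD; [exact: mbf_cst|exact: (mbfZ (-1) (mDD u k l))].
have mL : mbf2 L by apply: mbf2_sum => u; exact: mbf2Z.
have mG : mbf2 (fun xs ys => MG (sgap w s) (cell (cellf b) v xs) (cell (cellf b) v ys)).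
  by apply: mbf2_filter => //; exact: mbf2_MG.
apply: le_trans (le_EE2_uniq mu_diffuse mL mG _).
  rewrite EE2_sum; last by move=> u; exact: mbf2Z.
  rewrite (eq_bigr (fun u => (M - e) * (n%:R * qu u - (EE mu n (D u) + EE mu n (D u))))); last first.
    move=> u _; rewrite EE2Z//; congr (_ * _).
    rewrite (EE2D mu n (@mbf2_cst R d (n%:R * qu u)) (mbf2Z (-1) (mDD u))) EE2_cst; congr (_ + _).
    rewrite (EE2Z mu n (-1) (mDD u)) mulN1r.
    by rewrite (EE2D mu n (mbf2_fst (mD u)) (mbf2_snd (mD u))) EE2_fst// EE2_snd.
  rewrite -mulr_sumr ler_wpM2l//.
  apply: (@le_trans _ _ (\sum_(u <- micro m v) (n%:R * qu u - kap * (n%:R * qu u) - kap^-1))).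
    rewrite big_split big_split /= !sumrN -!mulr_sumr -qE.
    by rewrite big_const_seq count_predT iter_addr addr0 size_micro -[_^-1 *+ _]mulr_natl.
  apply: ler_sum => u _; have := EE_count_dist (nu := mu) (ma u) n kap0 (erefl (qu u)).
  rewrite -/(D u); lra.
move=> xs ys sx sy uxy; rewrite /L.
have g0 := sgap_ge0 w_ub s; have g1 := sgap_le w_ge0 s.
apply: le_trans (MG_cells g0 g1 M0 (cellf h) (cell (cellf b) v xs) (cell (cellf b) v ys) (micro_uniq m v)).
rewrite big_seq [leRHS]big_seq; apply: ler_sum => u umv.
have cE W : cell (cellf h) u (cell (cellf b) v W) = [seq x <- W | a u x].
  rewrite /cell -filter_predI; apply: eq_filter => x /=; rewrite /a.
  by case: eqVneq => //= xu; rewrite -(mem_micro v x b0 m0) -/h xu.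
rewrite !cE.
have le2 : (M - e) * (minn (size [seq x <- xs | a u x]) (size [seq x <- ys | a u x]))%:R <=
    MG (sgap w s) [seq x <- xs | a u x] [seq x <- ys | a u x].
  apply: (MG_min g1 M0).
    by rewrite -filter_cat filter_uniq.
  move=> x y; rewrite !mem_filter => /andP[/(cellf_box _ _ h0) xu _] /andP[/(cellf_box _ _ h0) yu _].
  rewrite /sgap lerD2l lerN2; apply: we => i; rewrite !mxE normrM (gtr0_norm s0).
  apply: lt_le_trans smb; rewrite ltr_pM2l//.
  by have := xu i; have := yu i; rewrite !mxE ltr_norml; lra.
apply: le_trans le2; rewrite ler_wpM2l// /D !size_filter.
move: (count (a u) xs) (count (a u) ys) => k l; rewrite mulN1r.
have /ler_normlP[n1 n2] := lexx `|k%:R - n%:R * qu u|.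
have /ler_normlP[n3 n4] := lexx `|l%:R - n%:R * qu u|.
have := normr_ge0 (k%:R - n%:R * qu u); have := normr_ge0 (l%:R - n%:R * qu u).
by case: leqP => _ ? ?; lra.
Qed.

End bad_cell.

Lemma thinning_error_arith (R : realFieldType) (n M ev kap ki nq del Q D eta : R) : 0 <= M ->
  D <= n * (ev + Q * del) + 1 -> kap * nq <= kap * n -> ki <= n * del * ki ->
  1 <= n * del -> n * (M * kap) <= n * (eta / 2) ->
  2 * (M * (n * (2 * ev) + (kap * nq + ki) / 2 + D)) <=
  n * (6 * M * ev + eta / 2 + del * (M * ki + 2 * M * Q + 2 * M)).
Proof.
move=> M0 HD kq kd nd Mk.
apply: (@le_trans _ _ (2 * (M * (n * (2 * ev) + (kap * n + n * del * ki) / 2 +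
    (n * (ev + Q * del) + n * del))))); last by lra.
by rewrite ler_wpM2l// ler_wpM2l//; lra.
Qed.

(** * The gain of one cell in the thermodynamic scaling *)

Section scaling.
Context (R : realType) (d : nat).
Hypothesis d_gt0 : (0 < d)%N.
Notation T := 'rV[R]_d.
Notation Z := 'rV[int]_d.
Variable w : T -> R.
Hypotheses (w_ge0 : forall x, 0 <= w x) (w_ub : has_ubound (range w)).
Hypothesis w_meas : measurable_fun [set: T] w.
Notation M := (wmax w).
Let M0 : 0 <= M := wmax_ge0 w_ge0 w_ub.
Variables (mu : probability T R) (r : nat -> R) (t : R).
Hypothesis mu_diffuse : diffuse mu.
Hypotheses (r_gt0 : forall n, (0 < n)%N -> 0 < r n) (t_gt0 : 0 < t).
Hypothesis r_lim : n%:R * r n ^+ d @[n --> \oo] --> t.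

Lemma near_ratio (del : R) : 0 < del ->
  \forall n \near \oo, `|1 - t / (n%:R * r n ^+ d)| <= del.
Proof.
move=> del0; have t0 : t != 0 by rewrite gt_eqF.
have c : (t / (n%:R * r n ^+ d)) @[n --> \oo] --> t / t.
  by apply: cvgMr; apply: cvgV.
rewrite divff// in c.
by have /cvgrPdist_le/(_ _ del0) := c.
Qed.

Lemma near_inv (del : R) : 0 < del -> \forall n \near \oo, (n%:R)^-1 <= del.
Proof.
move=> del0; near=> n; have n0 : (0 < n)%N by near: n; exact: nbhs_infty_gt.
have nd : (Num.truncn del^-1 < n)%N by near: n; exact: nbhs_infty_gt.
rewrite invf_ple ?posrE ?ltr0n// (le_trans (ltW (truncnS_gt _)))// ler_nat.
by [].
Unshelve. all: by end_near. Qed.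

(** Since n r_n ^ d has a finite limit, r_n tends to 0 and any fixed length becomes arbitrarily
    large after rescaling. *)
Lemma near_scale (S b : R) : 0 < b -> \forall n \near \oo, S <= (r n)^-1 * b.
Proof.
move=> b0; pose S1 := Num.max S 1.
have S1_gt0 : 0 < S1 by rewrite lt_max ltr01 orbT.
have bS : 0 < b ^+ d / (2 * t * S1 ^+ d) by rewrite divr_gt0 ?mulr_gt0 ?exprn_gt0.
near=> n; have n0 : (0 < n)%N by near: n; exact: nbhs_infty_gt.
have r0 := r_gt0 n0; have n0' : 0 < n%:R :> R by rewrite ltr0n.
have rho : `|1 - t / (n%:R * r n ^+ d)| <= 1 / 2.
  by near: n; apply: near_ratio; rewrite divr_gt0.
rewrite (@le_trans _ _ S1)// ?le_max ?lexx//.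
have ni : (n%:R)^-1 <= b ^+ d / (2 * t * S1 ^+ d).
  by near: n; exact: near_inv.
rewrite -(ler_pXn2r d_gt0) ?nnegrE ?(ltW S1_gt0)//; last first.
  by rewrite mulr_ge0 ?invr_ge0 ?ltW.
rewrite exprMn exprVn mulrC ler_pdivlMr ?exprn_gt0//.
have tau0 : 0 < n%:R * r n ^+ d by rewrite mulr_gt0 ?exprn_gt0.
have tau : n%:R * r n ^+ d <= 2 * t.
  have : 1 / 2 <= t / (n%:R * r n ^+ d) by move: rho; rewrite ler_norml => /andP[_]; lra.
  by rewrite ler_pdivlMr//; lra.
have Sd : 0 < S1 ^+ d by rewrite exprn_gt0.
rewrite mulrC (@le_trans _ _ (2 * t / n%:R * S1 ^+ d))//.
  by rewrite ler_wpM2r ?(ltW Sd)// ler_pdivlMr// mulrC.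
move: ni; rewrite ler_pdivlMr ?mulr_gt0//; lra.
Unshelve. all: by end_near. Qed.

Definition cell_gain (b : R) (v : Z) (n : nat) : R :=
  EE2 mu n (fun xs ys => MG (sgap w (r n)^-1) (cell (cellf b) v xs) (cell (cellf b) v ys)).

(** The constant [C] bounds the imbalance in the micro-cells, whose number is at most a fixed
    multiple of n b ^ d. It does not depend on [b] or [v], so the total loss is [C] times the volume
    of all the bad cells. *)
Lemma bad_cell_mean (e : R) : condW2 w -> 0 < e -> exists2 C, 0 <= C &
  forall (b : R) v, 0 < b -> \forall n \near \oo,
    (M - e) * Ex mu (fun x => (cellf b x == v)%:R) - C * b ^+ d <= n%:R^-1 * cell_gain b v n.
Proof.
move=> W2 e0.
have cg0 (b : R) v n : 0 <= n%:R^-1 * cell_gain b v n.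
  rewrite mulr_ge0 ?invr_ge0//; apply: Ex_ge0 => xs; apply: Ex_ge0 => ys.
  exact: MG_ge0 (sgap_ge0 w_ub _) (sgap_le w_ge0 _) M0 _ _.
have [Me|eM] := ltP M e.
  exists 0 => // b v b0; near=> n; apply: le_trans (cg0 b v n).
  rewrite mul0r subr0 nmulr_rle0 ?subr_lt0//.
  by apply: Ex_ge0.
have e2 : 0 < e / 2 by rewrite divr_gt0.
have [del del0 we] := W2_box w_ge0 W2 e2.
have M1 : 0 < M + 1 by rewrite ltr_wpDl.
(* M kap is at most e / 2; the other half of [e] bounds the weights inside a micro-cell. *)
pose kap : R := e / 2 / (M + 1); have kap0 : 0 < kap by rewrite divr_gt0.
pose C : R := M * kap^-1 * ((2 / del) ^+ d * (2 / t)).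
have ki : 0 <= kap^-1 by rewrite invr_ge0 ltW.
have C0 : 0 <= C.
  apply: mulr_ge0; first exact: mulr_ge0.
  apply: mulr_ge0; last by apply: divr_ge0 => //; exact: ltW.
  by apply: exprn_ge0; apply: divr_ge0 => //; exact: ltW.
exists C => // b v b0; near=> n.
have n0 : (0 < n)%N by near: n; exact: nbhs_infty_gt.
have r0 := r_gt0 n0; have n0' : 0 < n%:R :> R by rewrite ltr0n.
have rho : `|1 - t / (n%:R * r n ^+ d)| <= 1 by near: n; exact: near_ratio.
have B1 : 1 <= (r n)^-1 * (b / del) by near: n; apply: near_scale; exact: divr_gt0.
set B := _ * (b / del) in B1.
(* As B >= 1, [m] lies between B and 2 B: the lower bound makes the rescaled micro-cells smaller
   than [del], the upper one bounds their number. *)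
pose m := (Num.truncn B).+1.
have Bm : B <= m%:R by exact/ltW/truncnS_gt.
have mB : m%:R <= 2 * B.
  have B0 : 0 <= B by lra.
  by have /andP[k1 _] := truncn_itv B0; rewrite /m -natr1; lra.
have m0 : 0 < m%:R :> R by rewrite ltr0n.
have smb : (r n)^-1 * (b / m%:R) <= del.
  by rewrite mulrA ler_pdivrMr// [leRHS]mulrC -ler_pdivrMr// -mulrA.
have eM2 : 0 <= e / 2 <= M by apply/andP; split; lra.
have si : 0 < (r n)^-1 by rewrite invr_gt0.
have := micro_gain w_ge0 w_ub w_meas mu_diffuse n v we b0 si (ltn0Sn _) smb eM2 kap0.
rewrite /= -/(cell_gain b v n) -/m.
set q := Ex mu _; set G := cell_gain b v n => HG.
have q0 : 0 <= q by exact: Ex_ge0.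
have md : (m ^ d)%N%:R <= n%:R * (b ^+ d * ((2 / del) ^+ d * (2 / t))).
  rewrite natrX; apply: (@le_trans _ _ ((2 * B) ^+ d)).
    have B20 : 0 <= 2 * B by lra.
    by rewrite lerXn2r ?nnegrE ?(ltW m0).
  have -> : (2 * B) ^+ d = b ^+ d * (2 / del) ^+ d * (r n ^+ d)^-1.
    by rewrite -exprVn -!exprMn; congr (_ ^+ _); rewrite /B; field; rewrite !gt_eqF.
  rewrite [leRHS](_ : _ = b ^+ d * (2 / del) ^+ d * (n%:R * (2 / t))); last by ring.
  rewrite ler_wpM2l//.
    by rewrite mulr_ge0 ?exprn_ge0 ?divr_ge0 ?ltW.
  have : t / (n%:R * r n ^+ d) <= 2 by move: rho; rewrite ler_norml => /andP[]; lra.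
  have -> : t / (n%:R * r n ^+ d) = (r n ^+ d)^-1 * (t / n%:R).
    by field; rewrite !gt_eqF ?exprn_gt0.
  rewrite -ler_pdivlMr ?divr_gt0// => /le_trans; apply.
  by rewrite invf_div mulrCA.
rewrite [leRHS]mulrC ler_pdivlMr//; apply: le_trans HG.
have X1 : (M - e / 2) * ((m ^ d)%N%:R * kap^-1) <= n%:R * (C * b ^+ d).
  apply: (@le_trans _ _ (M * ((m ^ d)%N%:R * kap^-1))).
    by rewrite ler_wpM2r ?mulr_ge0// gerBl ltW.
  rewrite /C; have := ler_wpM2l (mulr_ge0 M0 ki) md; lra.
have X2 : (M - e / 2) * (kap * (n%:R * q)) <= e / 2 * (n%:R * q).
  rewrite mulrA ler_wpM2r ?mulr_ge0//.
  rewrite /kap mulrA ler_pdivrMr// mulrC ler_wpM2l ?ltW//.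
  by lra.
rewrite !mulrBr; lra.
Unshelve. all: by end_near. Qed.


(** The rescaled cell has side b / r_n and contains about t a points per unit volume, so its gain is
    near Gam (t a) times its volume. Of the error 6 M ev, a part 4 M ev comes from exchanging the
    laws of the points and 2 M ev from the number of points. *)
Lemma good_cell_mean (b a ev eta : R) (v : Z) : 0 < b -> 0 <= a -> 0 <= ev -> 0 < eta ->
  (forall phi : T -> R, mbf phi -> (forall x, 0 <= phi x <= 1) ->
    `|Ex mu (fun x => (cellf b x == v)%:R * phi x)
      - a * b ^+ d * Ex (unif_box (corner b v) b) phi| <= ev) ->
  \forall n \near \oo,
    `|n%:R^-1 * cell_gain b v n - Gam w (t * a) / t * b ^+ d| <= 6 * M * ev + eta.
Proof.
move=> b0 a0 ev0 eta0 near1.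
set u := unif_box _ b in near1; set Q := a * b ^+ d in near1.
have Q0 : 0 <= Q by rewrite mulr_ge0// exprn_ge0// ltW.
(* The mass of the approximating uniform measure may exceed 1, while thinning needs a probability.
   Truncation moves it by at most [ev], which doubles the closeness error. *)
pose q := Num.min Q 1.
have mv : measurable_fun [set: T] (fun x => cellf b x == v) by exact: measurable_cellf.
have q01 : 0 <= q <= 1 by rewrite /q le_min Q0 ler01 ge_min lexx orbT.
have Qq : 0 <= Q - q <= ev.
  rewrite /q; have := near1 (fun=> 1) (mbf_cst _ 1).
  rewrite Ex_cst mulr1 => /(_ (fun=> _)) near2.
  have h01 : 0 <= (1 : R) <= 1 by rewrite ler01 lexx.
  have {near2} := near2 h01.
  have : Ex mu (fun x => (cellf b x == v)%:R * 1) <= 1.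
    apply: Ex_le; first by apply: mbfM; [apply: mbf_bool; exact: measurable_bool_set|exact: mbf_cst].
    by move=> x; rewrite mulr1; case: eqP.
  move=> e1; rewrite ler_norml => /andP[e2 e3].
  by case: (leP Q 1) => Q1; apply/andP; split; lra.
have near2 (phi : T -> R) : mbf phi -> (forall x, 0 <= phi x <= 1) ->
    `|Ex mu (fun x => (cellf b x == v)%:R * phi x) - q * Ex u phi| <= 2 * ev.
  move=> mphi phi01; have := near1 phi mphi phi01.
  have E0 : 0 <= Ex u phi by apply: Ex_ge0 => x; have /andP[] := phi01 x.
  have E1 : Ex u phi <= 1 by apply: Ex_le => // x; have /andP[] := phi01 x.
  have /andP[Qq0 Qq1] := Qq.
  have X1 : 0 <= (Q - q) * Ex u phi <= ev.
    by rewrite mulr_ge0//= (le_trans _ Qq1)// ler_piMr.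
  rewrite !ler_norml; move: X1; rewrite mulrBl; lra.
have M1 : 0 < M + 1 by rewrite ltr_wpDl.
pose kap : R := eta / 2 / (M + 1).
have kap0 : 0 < kap by rewrite /kap !divr_gt0.
have ki : 0 <= kap^-1 by rewrite invr_ge0 ltW.
have ta0 : 0 <= t * a by rewrite mulr_ge0// ltW.
have /andP[G0 GM] := Gam_bound d_gt0 w_ge0 w_ub w_meas ta0.
set G := Gam w (t * a) in G0 GM *.
have bt0 : 0 <= b ^+ d / t by rewrite divr_ge0 ?exprn_ge0 ?ltW.
pose K : R := M * kap^-1 + 2 * M * Q + 2 * M + b ^+ d / t * (2 + G).
have K0 : 0 <= K.
  have M2 : 0 <= 2 * M by exact: mulr_ge0.
  have G2 : 0 <= 2 + G by exact: addr_ge0.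
  by rewrite /K; apply: addr_ge0; [apply: addr_ge0 => //; apply: addr_ge0|]; exact: mulr_ge0.
have K1 : 0 < K + 1 by rewrite ltr_wpDl.
pose del : R := Num.min 1 (eta / 2 / (K + 1)).
have del0 : 0 < del by rewrite lt_min ltr01 !divr_gt0.
have del1 : del <= 1 by rewrite ge_min lexx.
have delK : del * K <= eta / 2.
  apply: (@le_trans _ _ (eta / 2 / (K + 1) * K)); first by rewrite ler_wpM2r// ge_min lexx orbT.
  by rewrite mulrAC ler_pdivrMr// ler_wpM2l ?lerDl// ltW// divr_gt0.
have [S HS] := again_cvg d_gt0 w_ge0 w_ub w_meas ta0 del0.
near=> n.
have n0 : (0 < n)%N by near: n; exact: nbhs_infty_gt.
have r0 := r_gt0 n0; have n0' : 0 < n%:R :> R by rewrite ltr0n.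
have rho : `|1 - t / (n%:R * r n ^+ d)| <= del by near: n; exact: near_ratio.
have ni : (n%:R)^-1 <= del by near: n; exact: near_inv.
have Ss : S <= (r n)^-1 * b by near: n; exact: near_scale.
have := HS _ Ss; rewrite /again -/G.
set sb := (r n)^-1 * b; set th := t / _ in rho.
have sb0 : 0 < sb by rewrite mulr_gt0 ?invr_gt0.
have sbE : sb ^+ d = n%:R * (b ^+ d / t) * th.
  by rewrite /sb /th exprMn exprVn; field; rewrite !gt_eqF ?exprn_gt0.
set x := t * a * sb ^+ d; set k0 := Num.truncn x.
have x0 : 0 <= x by rewrite mulr_ge0// exprn_ge0// ltW.
(* The ratio [th] tends to 1, so the uniform sample size [k0] and the expected number n Q of points
   agree to first order. *)
have xE : x = n%:R * Q * th by rewrite /x sbE /Q; field; rewrite gt_eqF.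
have /andP[k1 k2] := truncn_itv x0; rewrite -/k0 -natr1 in k1 k2.
set J := Jgain w sb k0; set A := J / sb ^+ d => HA.
have JE : J = n%:R * (b ^+ d / t * th * A).
  rewrite /A (_ : n%:R * (_ * (J / _)) = n%:R * (b ^+ d / t) * th / sb ^+ d * J); last by ring.
  by rewrite -sbE divff ?mul1r// gt_eqF// exprn_gt0.
have := EE2_filter mv q01 M0 near2 n k0 kap0 (mbf2_MG w_ge0 w_ub w_meas (r n)^-1)
  (MG_incrl w_ge0 w_ub (r n)^-1) (MG_incrr w_ge0 w_ub (r n)^-1).
have -> : EE u k0 (fun xs => EE u k0 (fun ys => MG (sgap w (r n)^-1) xs ys)) = J.
  exact: (EE2_unif_box w_ge0 w_ub w_meas _ (r n)^-1 k0 b0).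
rewrite -[EE mu n _]/(cell_gain b v n); set CG := cell_gain b v n => HC.
have th2 : th <= 2 by move: rho; rewrite ler_norml => /andP[]; lra.
have th0 : 0 <= th by move: rho; rewrite ler_norml => /andP[]; lra.
have D1 : `|n%:R * q - k0%:R| <= n%:R * (ev + Q * del) + 1.
  have Y1 : `|n%:R * Q - x| <= n%:R * (Q * del).
    rewrite xE (_ : _ - _ = n%:R * (Q * (1 - th))); last by ring.
    rewrite normrM (gtr0_norm n0') ler_wpM2l ?(ltW n0')//.
    by rewrite normrM (ger0_norm Q0) ler_wpM2l.
  have Y2 : 0 <= n%:R * (Q - q) <= n%:R * ev.
    by have /andP[? ?] := Qq; rewrite mulr_ge0 ?(ltW n0')//= ler_wpM2l ?(ltW n0').
  move: Y1; rewrite !ler_norml; lra.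
have D2 : n%:R^-1 * `|CG - J| <= 6 * M * ev + eta / 2 + del * (M * kap^-1 + 2 * M * Q + 2 * M).
  rewrite ler_pdivrMl//; apply: (le_trans HC).
  have q1 : q <= 1 by case/andP: q01.
  have kq : kap * (n%:R * q) <= kap * n%:R.
    by rewrite ler_wpM2l ?(ltW kap0)// ler_piMr ?(ltW n0').
  have nd : 1 <= n%:R * del by rewrite -ler_pdivrMl// mulr1.
  have kd : kap^-1 <= n%:R * del * kap^-1 by rewrite ler_peMl.
  have Mk : M * kap <= eta / 2.
    by rewrite /kap mulrA ler_pdivrMr// mulrC ler_wpM2l ?lerDl// ltW// divr_gt0.
  have Mkn : n%:R * (M * kap) <= n%:R * (eta / 2) by rewrite ler_wpM2l ?(ltW n0').
  exact: thinning_error_arith.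
have D3 : `|n%:R^-1 * J - G / t * b ^+ d| <= del * (b ^+ d / t * (2 + G)).
  have -> : n%:R^-1 * J - G / t * b ^+ d = b ^+ d / t * ((A - G) * th + G * (th - 1)).
    by rewrite JE; field; rewrite !gt_eqF.
  rewrite normrM (ger0_norm bt0) [leRHS]mulrCA ler_wpM2l// (le_trans (ler_normD _ _))//.
  rewrite (normrM (A - G)) (ger0_norm th0) (normrM G) (ger0_norm G0) mulrDr.
  apply: lerD; first exact: ler_pM.
  by rewrite [leRHS]mulrC ler_wpM2l// distrC.
have -> : n%:R^-1 * CG - G / t * b ^+ d =
    n%:R^-1 * (CG - J) + (n%:R^-1 * J - G / t * b ^+ d) by ring.
rewrite (le_trans (ler_normD _ _))// normrM (@ger0_norm _ n%:R^-1) ?invr_ge0 ?(ltW n0')//.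
apply: (le_trans (lerD D2 D3)); move: delK; rewrite /K; lra.
Unshelve. all: by end_near. Qed.

End scaling.

(** * The mean gain of a sample *)

Section strip.
Context (R : realType) (d : nat).
Notation T := 'rV[R]_d.

Definition inner (c : T) (b h : R) (x : T) : bool :=
  [forall i, c ord0 i + h <= x ord0 i < c ord0 i + b - h].

Lemma inner_box c b h : [set x | inner c b h x] = box (c + const_mx h) (b - 2 * h).
Proof.
apply/seteqP; split => [x /= /forallP xi i|x xi].
  by have := xi i; rewrite !mxE; lra.
by apply/forallP => i; have := xi i; rewrite !mxE; lra.
Qed.

Lemma measurable_inner c b h : measurable_fun [set: T] (inner c b h).
Proof. by apply: measurable_set_bool; rewrite inner_box; exact: measurable_box. Qed.

Lemma bernoulli (x : R) n : 0 <= x <= 1 -> 1 - n%:R * x <= (1 - x) ^+ n.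
Proof.
move=> /andP[x0 x1]; elim: n => [|n IH]; first by rewrite mul0r subr0 expr0.
rewrite exprS (@le_trans _ _ ((1 - x) * (1 - n%:R * x)))//; last first.
  by rewrite ler_wpM2l// subr_ge0.
have : 0 <= n%:R * x * x by rewrite !mulr_ge0.
rewrite -natr1; lra.
Qed.

(** The inner cube has side b - 2 h; Bernoulli's inequality bounds what is left. *)
Lemma strip_unif c (b h : R) : 0 < b -> 0 <= h -> 2 * h <= b ->
  Ex (unif_box c b) (fun x => (~~ inner c b h x)%:R) <= d%:R * (2 * h / b).
Proof.
move=> b0 h0 hb; have mi := measurable_inner c b h.
have ms := measurable_bool_set mi.
have mib : mbf (fun x => (inner c b h x)%:R : R) by exact: mbf_bool.
rewrite (_ : (fun x => _) = fun x => 1 - (inner c b h x)%:R); last first.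
  by apply/funext => x; case: (inner _ _ _ x); rewrite ?subrr ?subr0.
rewrite ExB ?Ex_cst//; last exact: mbf_cst.
have := unif_boxE c b0 ms.
rewrite (_ : _ `&` _ = [set x | inner c b h x]); last first.
  apply/setIidPl => x /= /forallP xi i; have := xi i; lra.
rewrite {1}inner_box lebesgue_rV_cube; last by rewrite subr_ge0.
rewrite -Ex_bool// -EFinM => -[] e1.
have bd : b ^+ d != 0 by rewrite expf_neq0// gt_eqF.
have -> : Ex (unif_box c b) (fun x => (inner c b h x)%:R) = (1 - 2 * h / b) ^+ d.
  apply: (mulfI bd); rewrite -e1 -exprMn; congr (_ ^+ _); field.
  by rewrite gt_eqF.
have := @bernoulli (2 * h / b) d; rewrite divr_ge0 ?mulr_ge0 ?(ltW b0)// ler_pdivrMr// mul1r.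
by move=> /(_ hb); lra.
Qed.

End strip.

Lemma sample_gain_arith (R : realFieldType) (M g Gn G I0 S e' del Ce e1 : R) :
  Gn + (M * (S - e') - del - Ce) <= g -> g <= Gn + M * (S + e' + (2 * del + e')) + del ->
  - (6 * M * e' + del) <= Gn - G -> Gn - G <= 6 * M * e' + del ->
  - (2 * M * e') <= G - I0 -> G - I0 <= 2 * M * e' -> M * e' <= M * del -> 0 <= M * del ->
  12 * (M * del) + 4 * del <= e1 -> Ce <= del -> e' <= del -> 0 < del ->
  - e1 <= g - (I0 + M * S) <= e1.
Proof. by lra. Qed.

Section mean_limit.
Context (R : realType) (d : nat).
Hypothesis d_gt0 : (0 < d)%N.
Notation T := 'rV[R]_d.
Notation Z := 'rV[int]_d.
Local Notation leb := (lebesgue_rV R d).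
Variable w : T -> R.
Hypotheses (w_ge0 : forall x, 0 <= w x) (w_ub : has_ubound (range w)).
Hypothesis w_meas : measurable_fun [set: T] w.
Hypotheses (W2 : condW2 w) (W3 : condW3 w).
Notation M := (wmax w).
Let M0 : 0 <= M := wmax_ge0 w_ge0 w_ub.
Variables (mu : probability T R) (r : nat -> R) (t : R).
Hypothesis mu_diffuse : diffuse mu.
Hypotheses (r_gt0 : forall n, (0 < n)%N -> 0 < r n) (t_gt0 : 0 < t).
Hypothesis r_lim : n%:R * r n ^+ d @[n --> \oo] --> t.
Variable f : T -> R.
Hypotheses (mf : measurable_fun [set: T] f) (f_ge0 : forall x, 0 <= f x).
Variables (mus : {measure set T -> \bar R}) (N : set T).
Hypotheses (mN : measurable N) (lebN : leb N = 0%E) (musN : mus (~` N) = 0%E).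
Hypothesis muE : forall A, measurable A -> mu A = (\int[leb]_(x in A) (f x)%:E + mus A)%E.

(** The positive part extends the function to a Lipschitz one on the whole line, as the
    approximation by cells requires. *)
Definition gam_density (x : R) : R := Gam w (t * Num.max x 0) / t.

Lemma gam_density_lip x y : `|gam_density x - gam_density y| <= 2 * M * `|x - y|.
Proof.
rewrite /gam_density -mulrBl normrM (gtr0_norm (_ : 0 < t^-1)) ?invr_gt0//.
rewrite ler_pdivrMr//.
have p z : 0 <= t * Num.max z 0 by rewrite mulr_ge0 ?(ltW t_gt0)// le_max lexx orbT.
apply: (le_trans (Gam_lip d_gt0 w_ge0 w_ub w_meas (p x) (p y))).
rewrite -mulrBr normrM (gtr0_norm t_gt0) [t * _]mulrC mulrA ler_wpM2r ?(ltW t_gt0)//.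
rewrite ler_wpM2l ?mulr_ge0//.
rewrite !maxEle; case: ifP => hx; case: ifP => hy; rewrite ?subrr ?normr0 ?subr0 ?sub0r ?normrN //.
- have y0 : 0 < y by rewrite ltNge hy.
  by rewrite (gtr0_norm y0) distrC (le_trans _ (ler_norm _))//; lra.
- have x0 : 0 < x by rewrite ltNge hx.
  by rewrite (gtr0_norm x0) (le_trans _ (ler_norm _))//; lra.
Qed.

Lemma gam_density0 : gam_density 0 = 0.
Proof.
rewrite /gam_density maxxx mulr0; have := Gam_bound d_gt0 w_ge0 w_ub w_meas (lexx 0).
by rewrite mulr0 => /andP[g0 g1]; rewrite (_ : Gam w 0 = 0) ?mul0r//; apply/eqP; rewrite eq_le g1.
Qed.

(** One coordinate difference bounds the Euclidean distance from below; this suits cells, since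
    distinct cells are separated along some coordinate. *)
Lemma W3_gap (e : R) : 0 < e -> exists2 K : R, 0 < K & forall (s : R) (x y : T) i, 0 < s ->
  K <= s * `|y ord0 i - x ord0 i| -> sgap w s x y <= e.
Proof.
move=> e0; have [K0 HK] := W3 e0; exists (Num.max K0 0 + 1).
  by rewrite ltr_wpDl// le_max lexx orbT.
move=> s x y i s0 H; have : K0 < enorm (s *: (y - x)).
  apply: (@lt_le_trans _ _ (s * `|y ord0 i - x ord0 i|)).
    by apply: lt_le_trans H; rewrite ltr_pwDr// le_max lexx.
  rewrite /enorm -(gtr0_norm s0) -normrM -sqrtr_sqr ler_sqrt; last first.
    by apply: sumr_ge0 => j _; exact: sqr_ge0.
  by rewrite (bigD1 i)//= !mxE gtr0_norm// lerDl; apply: sumr_ge0 => j _; exact: sqr_ge0.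
by move=> /HK; rewrite ltr_norml /sgap; lra.
Qed.

Definition sample_gain (n : nat) : R := EE2 mu n (MG (sgap w (r n)^-1)).

Let mbf2_cell s (b : R) v : 0 < b ->
  mbf2 (fun xs ys => MG (sgap w s) (cell (cellf b) v xs) (cell (cellf b) v ys)).
Proof.
move=> b0; apply: mbf2_filter; [exact: measurable_cellf|exact: mbf2_MG].
Qed.

Lemma sample_gain_ge (b : R) (s : seq Z) n : 0 < b -> uniq s ->
  \sum_(v <- s) cell_gain w mu r b v n <= sample_gain n.
Proof.
move=> b0 us; rewrite -EE2_sum; last by move=> v; exact: mbf2_cell.
apply: le_EE2; [by apply: mbf2_sum => v; exact: mbf2_cell|exact: mbf2_MG|].
move=> xs ys _ _.
exact: (MG_cells (sgap_ge0 w_ub (r n)^-1) (sgap_le w_ge0 (r n)^-1) M0 (cellf b) xs ys us).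
Qed.

(* Points of good cells within h of the boundary count as bad. *)
Lemma sample_gain_le (b h e : R) (good : seq Z) (a ev : Z -> R) n : (0 < n)%N ->
  0 < b -> 0 <= h -> 2 * h <= b -> uniq good -> 0 <= e ->
  (forall (x y : T) i, h <= `|y ord0 i - x ord0 i| -> sgap w (r n)^-1 x y <= e) ->
  (forall v, 0 <= a v) ->
  (forall v, v \in good -> forall phi : T -> R, mbf phi -> (forall x, 0 <= phi x <= 1) ->
     `|Ex mu (fun x => (cellf b x == v)%:R * phi x)
       - a v * b ^+ d * Ex (unif_box (corner b v) b) phi| <= ev v) ->
  n%:R^-1 * sample_gain n <= \sum_(v <- good) n%:R^-1 * cell_gain w mu r b v n +
    M * (fine (mu [set x | cellf b x \notin good]) +
         \sum_(v <- good) (a v * b ^+ d * (d%:R * (2 * h / b)) + ev v)) + e.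
Proof.
move=> n0 b0 h0 hb ug e0 He a0 near1; have n0' : 0 < n%:R :> R by rewrite ltr0n.
have mc v := @measurable_cellf R d b v b0.
pose good1 (v : Z) (x : T) := (cellf b x == v) && inner (corner b v) b h x.
have mg v : measurable_fun [set: T] (good1 v).
  by apply: measurable_and => //; exact: measurable_inner.
pose bad : pred T := fun x => all (fun v => ~~ good1 v x) good.
have mbad : measurable_fun [set: T] bad.
  by apply: (@measurable_all _ _ _ _ (fun v x => ~~ good1 v x)) => v; exact: measurable_neg.
have badP x : ~~ bad x -> exists2 v, v \in good & good1 v x.
  by move=> /allPn[v vg]; rewrite negbK; exists v.
have g1 := sgap_le w_ge0 (r n)^-1.
have le1 xs ys : size xs = n -> size ys = n -> MG (sgap w (r n)^-1) xs ys <=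
    \sum_(v <- good) MG (sgap w (r n)^-1) (cell (cellf b) v xs) (cell (cellf b) v ys) +
    (M * (count bad xs)%:R + e * n%:R).
  move=> sx _; rewrite addrA; have -> : n%:R = (size xs)%:R :> R by rewrite sx.
  apply: (MG_local g1 M0) => //.
    by move=> x _ /badP[v vg /andP[/eqP -> _]].
  move=> x y /badP[v vg /andP[/eqP xv /forallP xi]]; rewrite xv eq_sym => yv.
  have [i yi] : exists i, ~~ (corner b v ord0 i <= y ord0 i < corner b v ord0 i + b).
    apply/existsP; apply: contraNT yv; rewrite negb_exists => /forallP yb.
    by apply/(cellf_box _ _ b0) => i; apply/negPn; exact: yb.
  apply: (He x y i); have := xi i; move: yi; rewrite negb_and -ltNge -leNgt => /orP[yi|yi] xi'.
    by rewrite distrC (le_trans _ (ler_norm _))//; lra.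
  by rewrite (le_trans _ (ler_norm _))//; lra.
have mcount : forall k, bmf k (fun xs => M * (count bad xs)%:R + e * n%:R : R).
  by move=> k; apply: mbfDc; apply: mbfZ; exact: (bmf_count mbad k (fun j => j%:R)).
have mS : mbf2 (fun xs ys => \sum_(v <- good) MG (sgap w (r n)^-1) (cell (cellf b) v xs) (cell (cellf b) v ys)).
  by apply: mbf2_sum => v; exact: mbf2_cell.
have : sample_gain n <= \sum_(v <- good) cell_gain w mu r b v n +
    (M * (n%:R * Ex mu (fun x => (bad x)%:R)) + e * n%:R).
  apply: (@le_trans _ _ (EE2 mu n (fun xs ys =>
      \sum_(v <- good) MG (sgap w (r n)^-1) (cell (cellf b) v xs) (cell (cellf b) v ys) +
      (M * (count bad xs)%:R + e * n%:R)))).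
    by apply: le_EE2 => //; [exact: mbf2_MG|exact: (mbf2D mS (mbf2_fst mcount))].
  rewrite (EE2D mu n mS (mbf2_fst mcount)) EE2_sum; last by move=> v; exact: mbf2_cell.
  rewrite lerD2l EE2_fst// /EE ExDc; last first.
    by apply: mbfZ; exact: (bmf_count mbad n (fun j => j%:R)).
  rewrite ExZ; last exact: (bmf_count mbad n (fun j => j%:R)).
  by rewrite -[Ex _ _]/(EE mu n (fun s => (count bad s)%:R)) (EE_count_mean mu mbad).
move=> le2; rewrite ler_pdivrMl//; apply: (le_trans le2).
set X := fine _ + _; suff bX : Ex mu (fun x => (bad x)%:R) <= X.
  rewrite [leRHS](_ : _ = \sum_(v <- good) cell_gain w mu r b v n + (M * (n%:R * X) + e * n%:R)).
    by rewrite lerD2l lerD2r ler_wpM2l// ler_wpM2l// ltW.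
  by rewrite -mulr_sumr; field; rewrite gt_eqF.
have mng : measurable [set x : T | cellf b x \notin good] := measurable_cellf_pred (fun v => v \notin good) b0.
have mb1 : mbf (fun x : T => (cellf b x \notin good)%:R : R) by exact: mbf_bool.
have mst v : mbf (fun x : T => (~~ inner (corner b v) b h x)%:R : R).
  by apply: mbf_bool; apply: measurable_bool_set; apply: measurable_neg; exact: measurable_inner.
have mb2 v : mbf (fun x : T => (cellf b x == v)%:R * (~~ inner (corner b v) b h x)%:R : R).
  by apply: mbfM => //; apply: mbf_bool; exact: measurable_bool_set.
(* A bad point lies outside the good cells or in the boundary strip of one of them. *)
apply: (@le_trans _ _ (Ex mu (fun x => (cellf b x \notin good)%:R + \sum_(v <- good)
    (cellf b x == v)%:R * (~~ inner (corner b v) b h x)%:R))).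
  apply: le_Ex; [by apply: mbf_bool; exact: measurable_bool_set|by apply: mbfD => //; exact: mbf_sum|].
  move=> x; have [xg|xg] := boolP (cellf b x \in good); last first.
    rewrite (@le_trans _ _ 1)//; first by case: (bad x).
    by rewrite lerDl; apply: sumr_ge0 => v _; exact: mulr_ge0.
  rewrite add0r (bigD1_seq (cellf b x))//= eqxx mul1r.
  apply: (@le_trans _ _ (~~ inner (corner b (cellf b x)) b h x)%:R).
    case: (boolP (bad x)) => // /allP/(_ _ xg).
    by rewrite /good1 eqxx /= => ->.
  by rewrite lerDl; apply: sumr_ge0 => v _; exact: mulr_ge0.
rewrite ExD//; last exact: mbf_sum.
rewrite Ex_sum//; apply: lerD.
  by rewrite -lee_fin Ex_bool// fineK// fin_num_measure.
rewrite big_seq [leRHS]big_seq; apply: ler_sum => v vg.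
have ph01 x : 0 <= ((~~ inner (corner b v) b h x)%:R : R) <= 1.
  by case: inner; rewrite /= ?lexx ?ler01.
have := near1 v vg _ (mst v) ph01; rewrite ler_norml => /andP[_ H].
have := strip_unif (corner b v) b0 h0 hb => S.
have := ler_wpM2l (mulr_ge0 (a0 v) (exprn_ge0 d (ltW b0))) S; lra.
Qed.

(** Lower bound: the gains of good and bad cells add up. Upper bound: pairs between cells are
    negligible except near boundaries, and all points outside the good cells are counted with the
    full gain [M]. Both agree because the mass outside the good cells is nearly the singular
    mass. *)
Lemma sample_gain_limit (e : R) : 0 < e -> \forall n \near \oo,
  `|n%:R^-1 * sample_gain n -
    (\int[leb]_x gam_density (f x) + M * fine (mus setT))| <= e.
Proof.
move=> e0; set I0 := \int[leb]_x _; set S := fine _.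
(* The factor 12 M + 4 collects all error terms of [sample_gain_arith]. *)
pose del : R := Num.min 1 (e / (12 * M + 4)).
have M4 : 0 < 12 * M + 4 by rewrite ltr_wpDl// mulr_ge0.
have del0 : 0 < del by rewrite lt_min ltr01 divr_gt0.
have del1 : del <= 1 by rewrite ge_min lexx.
have dele : del * (12 * M + 4) <= e by rewrite -ler_pdivlMr// ge_min lexx orbT.
have [C C0 HC] := bad_cell_mean d_gt0 w_ge0 w_ub w_meas mu_diffuse r_gt0 t_gt0 r_lim W2 del0.
have [K K0 HK] := W3_gap del0.
have C1 : 0 < C + 1 by rewrite ltr_wpDl.
(* [C] is already fixed here, so the volume of the bad cells can be taken below del / (C + 1). *)
pose e' : R := Num.min del (del / (C + 1)).
have e'0 : 0 < e' by rewrite lt_min del0 divr_gt0.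
have e'd : e' <= del by rewrite ge_min lexx.
have Ce' : C * e' <= del.
  apply: (@le_trans _ _ ((C + 1) * e')); first by rewrite ler_wpM2r ?(ltW e'0)// lerDl.
  by rewrite mulrC -ler_pdivlMr// ge_min lexx orbT.
have [b [good [bad [a [ev [[b0 ugb a0 ev0 Hev] [near1 Hng Hbad Hsz Happ]]]]]]] :=
  cell_approximation mf f_ge0 mN lebN musN muE e'0.
have := ugb; rewrite cat_uniq => /and3P[ug _ ub].
(* The slack of one good cell is chosen so that all of them together stay below [del]. *)
pose eta : R := del / (size good).+1%:R.
have mbc v : mbf (fun x : T => (cellf b x == v)%:R : R).
  by apply: mbf_bool; apply: measurable_bool_set; exact: measurable_cellf.
have cells1 (s : seq Z) : uniq s -> \sum_(v <- s) Ex mu (fun x : T => (cellf b x == v)%:R) <= 1.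
  move=> us; rewrite -Ex_sum// -[leRHS](Ex_cst mu 1).
  apply: le_Ex; [exact: mbf_sum|exact: mbf_cst|move=> x].
  have [xs|xs] := boolP (cellf b x \in s); last first.
    rewrite big_seq big1 ?ler01// => v vs; case: eqP => // xv.
    by rewrite xv vs in xs.
  rewrite (bigD1_seq (cellf b x))//= eqxx big1 ?addr0// => v.
  by rewrite eq_sym => /negPf ->.
pose G := \sum_(v <- good) gam_density (a v) * b ^+ d.
have GI : `|G - I0| <= 2 * M * e'.
  apply: Happ; [exact: mulr_ge0|exact: gam_density_lip|exact: gam_density0].
have Q2 : \sum_(v <- good) a v * b ^+ d <= 1 + e'.
  apply: le_trans (lerD (cells1 good ug) Hev); rewrite -big_split/=.
  rewrite big_seq [leRHS]big_seq; apply: ler_sum => v vg.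
  have := near1 v vg (fun=> 1) (mbf_cst _ 1); rewrite Ex_cst mulr1.
  under eq_fun do rewrite mulr1.
  move=> /(_ _); rewrite ler_norml ler01 lexx => /(_ (fun=> isT)) /andP[H _].
  by move: H; lra.
have bd0 : 0 <= b ^+ d by rewrite exprn_ge0// ltW.
have eta0 : 0 < eta by rewrite divr_gt0.
have etas : \sum_(v <- good) eta <= del.
  rewrite big_const_seq count_predT iter_addr_0 -mulr_natl /eta mulrA ler_pdivrMr//.
  by rewrite mulrC ler_wpM2l ?(ltW del0)// ler_nat leqnSn.
have S1 : S <= 1.
  have msT : (mus setT <= 1)%E.
    by rewrite -(probability_setT mu); exact: (mus_le f_ge0 muE measurableT).
  by rewrite -lee_fin fineK// ge0_fin_numE// (le_lt_trans msT)// ltry.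
have near_good : \forall n \near \oo, forall v, v \in good ->
    `|n%:R^-1 * cell_gain w mu r b v n - gam_density (a v) * b ^+ d| <= 6 * M * ev v + eta.
  apply: near_all_seq => v vg; rewrite /gam_density (max_idPl (a0 v)).
  by apply: good_cell_mean => //; [exact: ev0|exact: near1].
have near_bad : \forall n \near \oo, forall v, v \in bad ->
    (M - del) * Ex mu (fun x : T => (cellf b x == v)%:R) - C * b ^+ d
      <= n%:R^-1 * cell_gain w mu r b v n.
  by apply: near_all_seq => v _; exact: HC.
near=> n; have n0 : (0 < n)%N by near: n; exact: nbhs_infty_gt.
have r0 := r_gt0 n0; have ni0 : 0 <= n%:R^-1 :> R by rewrite invr_ge0.
have Hg : forall v, v \in good ->
    `|n%:R^-1 * cell_gain w mu r b v n - gam_density (a v) * b ^+ d| <= 6 * M * ev v + eta.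
  by near: n.
have Hb : forall v, v \in bad ->
    (M - del) * Ex mu (fun x : T => (cellf b x == v)%:R) - C * b ^+ d
      <= n%:R^-1 * cell_gain w mu r b v n.
  by near: n.
(* With strips of width K r_n, this single bound makes them fit into the cells and occupy at most a
   fraction [del] of each. *)
have Hr : 2 * K * (1 + d%:R / del) <= (r n)^-1 * b.
  by near: n; exact: (near_scale d_gt0 r_gt0 t_gt0 r_lim).
pose Gn := \sum_(v <- good) n%:R^-1 * cell_gain w mu r b v n.
have GnG : `|Gn - G| <= 6 * M * e' + del.
  rewrite /Gn /G -sumrB (le_trans (ler_norm_sum _ _ _))//.
  apply: (@le_trans _ _ (\sum_(v <- good) (6 * M * ev v + eta))).
    by rewrite big_seq [leRHS]big_seq; exact: ler_sum.
  by rewrite big_split/= -mulr_sumr lerD// ler_wpM2l// mulr_ge0.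
have h0 : 0 <= K * r n by rewrite mulr_ge0 ?ltW.
have hK : 2 * (K * r n) * (1 + d%:R / del) <= b.
  move: Hr; rewrite [leRHS]mulrC ler_pdivlMr//; apply: le_trans.
  by rewrite (_ : _ * _ = 2 * K * (1 + d%:R / del) * r n)//; ring.
have dd0 : 0 <= d%:R / del by rewrite divr_ge0// ltW.
have hb : 2 * (K * r n) <= b.
  by apply: le_trans hK; rewrite mulrDr mulr1 lerDl mulr_ge0// mulr_ge0.
have hd : d%:R * (2 * (K * r n) / b) <= del.
  rewrite mulrA ler_pdivrMr//; apply: (le_trans _ (ler_wpM2l (ltW del0) hK)).
  rewrite [leRHS](_ : _ = del * (2 * (K * r n)) + d%:R * (2 * (K * r n))).
    by rewrite lerDr !mulr_ge0// ltW.
  by field; rewrite gt_eqF.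
have HK' (x y : T) i : K * r n <= `|y ord0 i - x ord0 i| -> sgap w (r n)^-1 x y <= del.
  move=> H; apply: (HK _ _ _ i); rewrite ?invr_gt0//.
  by rewrite ler_pdivlMl// mulrC.
have up := sample_gain_le n0 b0 h0 hb ug (ltW del0) HK' a0 near1.
have lo : Gn + \sum_(v <- bad) n%:R^-1 * cell_gain w mu r b v n <= n%:R^-1 * sample_gain n.
  rewrite /Gn -big_cat/= -mulr_sumr ler_wpM2l//; exact: sample_gain_ge.
have lob : (M - del) * \sum_(v <- bad) Ex mu (fun x : T => (cellf b x == v)%:R) - C * e' <=
    \sum_(v <- bad) n%:R^-1 * cell_gain w mu r b v n.
  apply: (@le_trans _ _ (\sum_(v <- bad)
      ((M - del) * Ex mu (fun x : T => (cellf b x == v)%:R) - C * b ^+ d))); last first.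
    by rewrite big_seq [leRHS]big_seq; exact: ler_sum.
  rewrite sumrB -mulr_sumr lerD2l lerN2 big_const_seq count_predT iter_addr_0.
  by rewrite -mulr_natl mulrCA ler_wpM2l.
have upb : \sum_(v <- good) (a v * b ^+ d * (d%:R * (2 * (K * r n) / b)) + ev v) <= 2 * del + e'.
  rewrite big_split/= -mulr_suml lerD//.
  apply: (@le_trans _ _ ((1 + e') * del)); last first.
    by rewrite ler_wpM2r ?(ltW del0)// -[leRHS]/(1 + 1) lerD2l (le_trans e'd).
  apply: ler_pM => //; first by apply: sumr_ge0 => v _; exact: mulr_ge0.
  by rewrite mulr_ge0// divr_ge0 ?(ltW b0)// mulr_ge0.
have qb := cells1 bad ub.
have Hbad' : S - e' <= \sum_(v <- bad) Ex mu (fun x : T => (cellf b x == v)%:R).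
  apply: (le_trans Hbad); rewrite le_eqVlt; apply/orP; left; apply/eqP.
  apply: eq_bigr => v _; have := Ex_bool mu (measurable_bool_set (@measurable_cellf R d b v b0)).
  by move=> <-.
move: GI GnG; rewrite !ler_norml => /andP[GI1 GI2] /andP[Gn1 Gn2].
have Me : M * e' <= M * del by rewrite ler_wpM2l.
have Md : 0 <= M * del by rewrite mulr_ge0// ltW.
have upM : M * (fine (mu [set x | cellf b x \notin good]) +
    \sum_(v <- good) (a v * b ^+ d * (d%:R * (2 * (K * r n) / b)) + ev v)) <=
    M * (S + e' + (2 * del + e')) by rewrite ler_wpM2l// lerD.
have loM : M * (S - e') - del <= (M - del) * \sum_(v <- bad) Ex mu (fun x : T => (cellf b x == v)%:R).
  rewrite mulrBl; apply: lerB; first exact: ler_wpM2l.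
  by rewrite -[leRHS]mulr1 ler_wpM2l// ltW.
have dele' : 12 * (M * del) + 4 * del <= e
  by rewrite (_ : _ + _ = del * (12 * M + 4))//; ring.
have lo' : Gn + (M * (S - e') - del - C * e') <= n%:R^-1 * sample_gain n.
  by apply: le_trans lo; rewrite lerD2l; apply: le_trans lob; rewrite lerD2r.
have up' : n%:R^-1 * sample_gain n <= Gn + M * (S + e' + (2 * del + e')) + del.
  by apply: (le_trans up); rewrite lerD2r lerD2l.
apply: (sample_gain_arith lo' up' Gn1 Gn2 GI1 GI2 Me Md dele' Ce' e'd del0).
Unshelve. all: by end_near. Qed.

End mean_limit.

(** * Concentration *)

Section concentration.
Context dT (T : measurableType dT) (R : realType).
Implicit Types (nu : probability T R) (h : seq T -> R).

Definition bounded_differences (c : R) h :=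
  forall s1 s2 x y, `|h (s1 ++ x :: s2) - h (s1 ++ y :: s2)| <= c.

(** From exp (- y) >= 1 - y, and 1 / (1 - y) <= 1 + y + 2 y ^ 2 for y <= 1 / 2. *)
Lemma expR_quadratic (y : R) : y <= 1 / 2 -> expR y <= 1 + y + 2 * y ^+ 2.
Proof.
move=> y2; have y1 : 0 < 1 - y by lra.
rewrite -{1}[y]opprK expRN.
apply: (@le_trans _ _ (1 - y)^-1).
  by rewrite lef_pV2 ?posrE ?expR_gt0//; exact: expR_ge1Dx.
rewrite -[leLHS]mul1r ler_pdivrMr//.
have : 0 <= y ^+ 2 * (1 - 2 * y) by rewrite mulr_ge0 ?sqr_ge0//; lra.
lra.
Qed.

Lemma mbf_expR dX (X : measurableType dX) (f : X -> R) :
  mbf f -> mbf (fun x => expR (f x)).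
Proof.
move=> [mf [C fC]]; split; first exact: measurableT_comp.
exists (expR C) => x; rewrite ger0_norm ?expR_ge0// ler_expR.
exact: le_trans (ler_norm _) (fC x).
Qed.

(** The exponential moment step of the bounded differences method. Conditioning on the first point,
    its conditional mean deviates by at most [c] and is centred, so the linear term integrates to
    zero; the remaining points are left to the induction hypothesis. *)
Lemma EE_expR nu n h (c th : R) : bmf n h -> bounded_differences c h ->
  `|th| * c <= 1 / 2 ->
  EE nu n (fun s => expR (th * (h s - EE nu n h))) <= (1 + 2 * (th * c) ^+ 2) ^+ n.
Proof.
move=> + + thc; elim: n h => [|n IH] h mh bh.
  by rewrite !EE0 subrr mulr0 expR0 expr0.
set K := 1 + _; have K0 : 0 <= K by rewrite addr_ge0// mulr_ge0// sqr_ge0.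
pose g x := EE nu n (fun s => h (x :: s)); have mg : mbf g := mbf_EE_cons nu mh.
have mE : EE nu n.+1 h = Ex nu g := EES nu mh.
have gc x : `|g x - Ex nu g| <= c.
  rewrite -{1}(Ex_cst nu (g x)) -ExB//; last exact: mbf_cst.
  apply: le_Ex_norm => [|y]; first by apply: mbfB => //; exact: mbf_cst.
  rewrite /g /EE -ExB; [|exact: bmf_cons mh|exact: bmf_cons mh].
  apply: le_Ex_norm => [|s]; first by apply: mbfB; exact: bmf_cons mh.
  exact: (bh [::]).
rewrite mE; set m := Ex nu g in gc *.
have mexp : bmf n.+1 (fun s => expR (th * (h s - m))).
  by apply: mbf_expR; apply: mbfZ; exact: mbfBc.
rewrite EES//; apply: (@le_trans _ _ (Ex nu (fun x => (K + th * (g x - m)) * K ^+ n))); last first.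
  rewrite exprS le_eqVlt; apply/orP; left; apply/eqP.
  have m1 : mbf (fun x => th * (g x - m)) by apply: mbfZ; exact: mbfBc.
  under [X in Ex _ X = _]eq_fun do rewrite mulrC.
  rewrite ExZ; last by apply: mbfD => //; exact: mbf_cst.
  rewrite ExD ?Ex_cst//; last exact: mbf_cst.
  by rewrite ExZ ?ExBc ?subrr ?mulr0 ?addr0 1?mulrC//; exact: mbfBc.
apply: le_Ex; first exact: (mbf_EE_cons nu mexp).
  apply: (mbfM (g := fun=> K ^+ n)); last exact: mbf_cst.
  by apply: mbfD; [exact: mbf_cst|apply: mbfZ; exact: mbfBc].
move=> x; have mx : bmf n (fun s => h (x :: s)) := bmf_cons x mh.
have mxe : bmf n (fun s => expR (th * (h (x :: s) - g x))).
  by apply: mbf_expR; apply: mbfZ; exact: mbfBc.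
rewrite (@eq_EE _ _ _ nu n _ (fun s => expR (th * (g x - m)) * expR (th * (h (x :: s) - g x)))); last first.
  by move=> s _; rewrite -expRD; congr expR; lra.
rewrite /EE ExZ//; apply: ler_pM.
- exact: expR_ge0.
- by apply: Ex_ge0 => s; exact: expR_ge0.
- have y1 : `|th * (g x - m)| <= `|th| * c by rewrite normrM ler_wpM2l.
  apply: (le_trans (expR_quadratic (le_trans (ler_norm _) (le_trans y1 thc)))).
  rewrite /K [leRHS]addrAC lerD2l ler_wpM2l//.
  rewrite -[leLHS]real_normK ?num_real// -[leRHS]real_normK ?num_real//.
  apply: lerXn2r; rewrite ?nnegrE//; apply: (le_trans y1); rewrite normrM ler_wpM2l//.
  exact: ler_norm.
- by apply: IH => // s1 s2 y z; exact: (bh (x :: s1)).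
Qed.

(** Chernoff's bound for both signs. The rate [q] depends on [c] and [e] alone, which lets the
    functional change with [n]. *)
Lemma concentration (c e : R) : 0 < c -> 0 < e -> exists q : R, [/\ 0 < q, q < 1 &
  forall nu n h, bmf n h -> bounded_differences c h ->
    EE nu n (fun s => (e * n%:R < `|h s - EE nu n h|)%R%:R) <= 2 * q ^+ n].
Proof.
(* The first bound on [th] validates the quadratic estimate; the second keeps 2 (th c) ^ 2 below th
   e, so that q < 1. *)
move=> c0 e0; pose th : R := Num.min (1 / (2 * c)) (e / (4 * c ^+ 2)).
have th0 : 0 < th by rewrite lt_min !divr_gt0 ?mulr_gt0 ?exprn_gt0.
have thc : th * c <= 1 / 2.
  rewrite -ler_pdivlMr// (_ : 1 / 2 / c = 1 / (2 * c)); first by rewrite ge_min lexx.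
  by field; rewrite gt_eqF.
have the : th * (4 * c ^+ 2) <= e.
  by rewrite -ler_pdivlMr ?mulr_gt0 ?exprn_gt0// ge_min lexx orbT.
have q1 : 1 + 2 * (th * c) ^+ 2 < expR (th * e).
  apply: (lt_le_trans _ (expR_ge1Dx _)); rewrite ltrD2l exprMn expr2 -mulrA mulrCA ltr_pM2l//.
  by rewrite mulrCA; lra.
exists ((1 + 2 * (th * c) ^+ 2) / expR (th * e)); split.
- by rewrite divr_gt0 ?expR_gt0// addr_gt0// mulr_gt0// exprn_gt0// mulr_gt0.
- by rewrite ltr_pdivrMr ?expR_gt0// mul1r.
move=> nu n h mh bh; set m := EE nu n h.
have mhm : mbf (fun t : n.-tuple T => h t - m) by exact: mbfBc.
have tail k : `|k| = th -> mbf (fun t : n.-tuple T => expR (k * (h t - m) - th * e * n%:R)) /\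
    EE nu n (fun s => expR (k * (h s - m) - th * e * n%:R)) <= ((1 + 2 * (th * c) ^+ 2) / expR (th * e)) ^+ n.
  move=> kth; have mk : mbf (fun t : n.-tuple T => expR (k * (h t - m))) by apply: mbf_expR; exact: mbfZ.
  split; first by apply: mbf_expR; apply: mbfBc; exact: mbfZ.
  rewrite (@eq_EE _ _ _ nu n _ (fun s => expR (- (th * e * n%:R)) * expR (k * (h s - m)))); last first.
    by move=> s _; rewrite -expRD addrC.
  rewrite /EE ExZ// exprMn exprVn -expRM_natr expRN mulrC ler_wpM2r ?invr_ge0 ?expR_ge0//.
  have := @EE_expR nu n h c k mh bh; rewrite kth => /(_ thc).
  by rewrite exprMn -[k ^+ 2]real_normK ?num_real// kth -exprMn.
have [m1 t1] := tail th (gtr0_norm th0).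
have [m2 t2] := tail (- th) (etrans (normrN th) (gtr0_norm th0)).
apply: (@le_trans _ _ (EE nu n (fun s => expR (th * (h s - m) - th * e * n%:R) +
   expR (- th * (h s - m) - th * e * n%:R)))); last by rewrite /EE ExD// mulr2n mulrDl !mul1r lerD.
apply: le_Ex; [|exact: mbfD|].
  apply: mbf_bool; apply: measurable_bool_set; apply: measurable_fun_ltr.
    exact: measurable_cst.
  exact: (proj1 (mbf_norm mhm)).
move=> t; have e1 := expR_ge0 (th * (h t - m) - th * e * n%:R).
have e2 := expR_ge0 (- th * (h t - m) - th * e * n%:R).
case: (boolP (_ < _)) => /= [H|_]; last by rewrite addr_ge0.
have [hm|hm] := leP 0 (h t - m).
  rewrite ger0_norm// in H; apply: ler_wpDr => //.
  by rewrite -[leLHS]expR0 ler_expR -mulrA -mulrBr mulr_ge0 ?(ltW th0)// subr_ge0 ltW.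
rewrite ltr0_norm// in H; apply: ler_wpDl => //.
by rewrite -[leLHS]expR0 ler_expR mulNr -mulrN -mulrA -mulrBr mulr_ge0 ?(ltW th0)// subr_ge0 (ltW H).
Qed.

End concentration.

Section cost_differences.
Context (R : realType) (d : nat).
Notation T := 'rV[R]_d.
Variable w : T -> R.
Hypotheses (w_ge0 : forall x, 0 <= w x) (w_ub : has_ubound (range w)).
Hypotheses (w_meas : measurable_fun [set: T] w) (W1 : condW1 w).
Notation M := (wmax w).
Let M0 : 0 <= M := wmax_ge0 w_ge0 w_ub.

(** Changing one point alters the half-count of distinct points by at most 1 and moves the gain
    within an interval of length [M]. The bound holds for all lists, with repetitions too. *)
Lemma BMs_bounded_differences (s : R) n : s != 0 ->
  bounded_differences (2 * M) (fun t : seq T => BMs w s (take n t) (drop n t)).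
Proof.
move=> s0 s1 s2 x y; rewrite !BMsE// !cat_take_drop.
have size_le z : (size (undup (s1 ++ s2)) <= size (undup (s1 ++ z :: s2)) <= (size (undup (s1 ++ s2))).+1)%N.
  have -> : size (undup (s1 ++ z :: s2)) = size (undup (z :: s1 ++ s2)).
    by apply/perm_size/perm_undup => v; rewrite !(inE, mem_cat) orbCA.
  by rewrite /=; case: ifP => _ /=; rewrite ?leqnn ?leqnSn.
have gM := sgap_le w_ge0 s.
(* The common lower end [a] is the gain after deleting the point; the cases are the colour that the
   deleted position belongs to. *)
have [a aE] : exists a, forall z, a <= MG (sgap w s) (take n (s1 ++ z :: s2)) (drop n (s1 ++ z :: s2)) <= a + M.
  have [ns|sn] := ltnP n (size s1).
    exists (MG (sgap w s) (take n s1) (drop n s1 ++ s2)) => z.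
    rewrite take_cat drop_cat ns.
    have := MG_consr z (take n s1) (drop n s1 ++ s2) gM M0.
    rewrite (@eq_mem_MG _ _ _ _ gM M0 (take n s1) (z :: drop n s1 ++ s2) (take n s1) (drop n s1 ++ z :: s2))//.
    by move=> v; rewrite !(inE, mem_cat) orbCA.
  have E z : take n (s1 ++ z :: s2) = s1 ++ take (n - size s1) (z :: s2) /\
             drop n (s1 ++ z :: s2) = drop (n - size s1) (z :: s2).
    by rewrite take_cat drop_cat ltnNge sn.
  case: (n - size s1)%N E => [|k] E.
    exists (MG (sgap w s) s1 s2) => z; have [-> ->] := E z; rewrite take0 drop0 cats0.
    exact: (MG_consr z s1 s2 gM M0).
  exists (MG (sgap w s) (s1 ++ take k s2) (drop k s2)) => z; have [-> ->] := E z => /=.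
  have := MG_consl gM M0 z (s1 ++ take k s2) (drop k s2).
  rewrite (@eq_mem_MG _ _ _ _ gM M0 (z :: s1 ++ take k s2) (drop k s2) (s1 ++ z :: take k s2) (drop k s2))//.
  by move=> v; rewrite !(inE, mem_cat) orbCA.
have /andP[ax1 ax2] := aE x; have /andP[ay1 ay2] := aE y.
pose A z : R := (size (undup (s1 ++ z :: s2)))./2%:R.
have AA : `|A x - A y| <= 1.
  have /andP[x1 x2] := size_le x; have /andP[y1 y2] := size_le y.
  rewrite ler_norml lerBrDr lerBlDr addrC lerBlDr /A !natr1 nat1r !ler_nat.
  by apply/andP; split; lia.
have MA : `|M * A x - M * A y| <= M by rewrite -mulrBr normrM ger0_norm// -[leRHS]mulr1 ler_wpM2l.
move: MA; rewrite /A !ler_norml => /andP[MA1 MA2]; apply/andP; split; lra.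
Qed.

End cost_differences.

(** * Laws of samples *)

Section sample_law.
Context dT (T : measurableType dT) (R : realType).
Context dS (S : measurableType dS) (P : probability S R) (mu : probability T R).
Context (I : eqType) (X : I -> S -> T).
Hypotheses (mX : forall i, measurable_fun [set: S] (X i)).
Hypothesis lawX : forall i A, measurable A -> P (X i @^-1` A) = mu A.
Hypothesis indX : mutually_independent P X.
Variables (n : nat) (idx : 'I_n -> I).
Hypothesis idx_inj : injective idx.

Definition sample (om : S) : n.-tuple T := [tuple X (idx i) om | i < n].

Lemma measurable_sample : measurable_fun [set: S] sample.
Proof.
apply/measurable_fun_tnthP => i.
by rewrite (_ : _ \o _ = X (idx i))//; apply/funext => om /=; rewrite tnth_mktuple.
Qed.

Lemma sample_box (A : 'I_n -> set T) : (forall i, measurable (A i)) ->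
  P [set om | forall i, A i (tnth (sample om) i)] = (\prod_(i < n) mu (A i))%E.
Proof.
(* The sides of the box are transferred from positions to indices of the family, with the full space
   at indices outside the sample. *)
move=> mA; pose B j := if [pick i | idx i == j] is Some i then A i else setT.
have BE i : B (idx i) = A i.
  rewrite /B; case: pickP => [k /eqP/idx_inj -> //|/(_ i)]; by rewrite eqxx.
have mB j : measurable (B j) by rewrite /B; case: pickP.
have us : uniq [seq idx i | i <- enum 'I_n] by rewrite map_inj_uniq// enum_uniq.
have := indX us mB; rewrite (_ : \bigcap_(i in _) _ = [set om | forall i, A i (tnth (sample om) i)]).
  move=> ->; rewrite big_map big_enum/=; apply: eq_bigr => i _.
  by rewrite lawX// BE.
apply/seteqP; split => [om H i|om H _ /= /mapP[i _ ->]].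
  rewrite tnth_mktuple -BE; apply: (H (idx i)).
  by apply/mapP; exists i => //; rewrite mem_enum.
by have := H i; rewrite tnth_mktuple -BE.
Qed.

Lemma Ex_sample f : mbf f -> Ex P (f \o sample) = Ex (power mu n) f.
Proof.
move=> mf; pose Phi := HB.pack_for {mfun S >-> n.-tuple T} sample
  (isMeasurableFun.Build _ _ _ _ sample measurable_sample).
apply: etrans (esym (@Ex_distribution _ _ _ _ _ P Phi f mf)) _; apply: eq_Ex.
apply: (finite_measure_box_unique (f := fun i x => @tnth n T x i)).
- exact: measurable_tupleE.
- rewrite -[X in (X < _)%E]/(P (sample @^-1` setT)) preimage_setT probability_setT.
  exact: ltry.
- move=> A mA; exact: (etrans (sample_box mA) (esym (power_box mu mA))).
Qed.

End sample_law.

Lemma cvg_geometric_tail (R : realType) (q e : R) : 0 < q -> q < 1 -> 0 < e ->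
  \forall n \near \oo, q ^+ n <= e.
Proof.
move=> q0 q1 e0; have := @cvg_expr R q.
rewrite ger0_norm ?(ltW q0)// => /(_ q1)/cvgrPdist_le/(_ _ e0).
by apply: filterS => n; rewrite sub0r normrN ger0_norm// exprn_ge0// ltW.
Qed.

(** * Geometric tails give both modes of convergence *)

Section geometric_tail.
Context (R : realType) dS (S : measurableType dS) (P : probability S R).
Variables (xi : nat -> S -> R) (c : R).
Hypothesis mxi : forall n, mbf (xi n).
Hypothesis tail : forall e : R, 0 < e -> exists q C : R, [/\ 0 < q, q < 1, 0 <= C &
  forall n, Ex P (fun om => (e < `|xi n om - c|)%R%:R) <= C * q ^+ n].

Let mset (e : R) n : measurable [set om | e < `|xi n om - c|].
Proof.
apply: measurable_bool_set; apply: measurable_fun_ltr; first exact: measurable_cst.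
by have [] := mbf_norm (mbfBc c (mxi n)).
Qed.

Lemma geometric_tail_complete : converges_completely P xi c.
Proof.
move=> e e0; have [q [C [q0 q1 C0 H]]] := tail e0.
apply: (@le_lt_trans _ _ (C / (1 - q))%:E); last exact: ltry.
apply: lime_le; first by apply: is_cvg_nneseries => k _ _; exact: measure_ge0.
apply: nearW => n; apply: (@le_trans _ _ (\sum_(1 <= i < n) (C * q ^+ i)%:E)%E).
  apply: lee_sum => i _; rewrite -(Ex_bool P (mset e i)) lee_fin; exact: H.
rewrite sumEFin lee_fin -mulr_sumr ler_wpM2l//.
rewrite -[leRHS]mul1r ler_pdivlMr ?subr_gt0//.
case: n => [|n]; first by rewrite big_geq// mul0r.
apply: (@le_trans _ _ ((\sum_(0 <= i < n.+1) q ^+ i) * (1 - q))).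
  rewrite ler_wpM2r ?subr_ge0 ?(ltW q1)// [leRHS]big_nat_recl// big_add1 /=.
  by rewrite lerDr expr0 ler01.
rewrite big_mkord mulrC -opprB mulNr -subrX1 opprB lerBlDr lerDl.
by rewrite exprn_ge0// ltW.
Qed.

(** The second moment is at most B ^ 2 times the probability of a deviation above [e1], plus e1 ^ 2;
    the choice of [e1] makes the last term at most e / 2. *)
Lemma geometric_tail_L2 (B : R) : (forall n om, `|xi n om - c| <= B) ->
  converges_L2 P xi c.
Proof.
move=> xiB; rewrite /converges_L2.
have msq n : mbf (fun om => `|xi n om - c| ^+ 2).
  by apply: mbfM; apply: mbf_norm; exact: mbfBc.
rewrite (_ : (fun n => _) = EFin \o (fun n => Ex P (fun om => `|xi n om - c| ^+ 2))); last first.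
  by apply/funext => n; rewrite /= EFin_Ex// unlock.
apply: cvg_EFin; first by near=> n.
apply/cvgrPdist_le => e e0; pose e1 : R := Num.min 1 (e / 2).
have e10 : 0 < e1 by rewrite lt_min ltr01 divr_gt0.
have [q [C [q0 q1 C0 H]]] := tail e10.
have D0 : 0 < B ^+ 2 * C + 1 by rewrite ltr_wpDl// mulr_ge0// sqr_ge0.
near=> n; rewrite sub0r normrN ger0_norm; last by apply: Ex_ge0 => om; exact: sqr_ge0.
have qn : q ^+ n <= e / 2 / (B ^+ 2 * C + 1).
  by near: n; apply: cvg_geometric_tail => //; rewrite divr_gt0 ?divr_gt0.
have mb : mbf (fun om => (e1 < `|xi n om - c|)%R%:R : R) := mbf_bool R (mset e1 n).
apply: (@le_trans _ _ (Ex P (fun om => B ^+ 2 * (e1 < `|xi n om - c|)%R%:R + e1 ^+ 2))).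
  apply: le_Ex => //; first by apply: mbfDc; exact: mbfZ.
  move=> om; case: ltP => [_|h].
    rewrite mulr1 ler_wpDr ?sqr_ge0// lerXn2r ?nnegrE//.
    exact: le_trans (xiB n om).
  by rewrite mulr0 add0r lerXn2r ?nnegrE ?(ltW e10).
rewrite ExDc; last exact: mbfZ.
rewrite ExZ//; have := ler_wpM2l (sqr_ge0 B) (H n).
have e12 : e1 ^+ 2 <= e / 2.
  rewrite expr2 (@le_trans _ _ (e1 * 1))// ?ler_wpM2l ?(ltW e10)// ?ge_min ?lexx//.
  by rewrite mulr1 ge_min lexx orbT.
have : (B ^+ 2 * C + 1) * q ^+ n <= e / 2 by rewrite mulrC -ler_pdivlMr.
have : 0 <= q ^+ n by rewrite exprn_ge0// ltW.
lra.
Unshelve. all: by end_near. Qed.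

End geometric_tail.

(** * Convergence of the matching cost *)

Section matching_limit.
Context (R : realType) (d : nat).
Hypothesis d_gt0 : (0 < d)%N.
Notation T := 'rV[R]_d.
Local Notation leb := (lebesgue_rV R d).
Variable w : T -> R.
Hypotheses (w_ge0 : forall x, 0 <= w x) (w_ub : has_ubound (range w)).
Hypothesis w_meas : measurable_fun [set: T] w.
Hypotheses (W1 : condW1 w) (W2 : condW2 w) (W3 : condW3 w).
Notation M := (wmax w).
Let M0 : 0 <= M := wmax_ge0 w_ge0 w_ub.
Context (dS : measure_display) (S : measurableType dS) (P : probability S R).
Variables (mu : probability T R) (U V : nat -> {RV P >-> T}).
Variables (f : T -> R) (r : nat -> R) (t : R).
Hypothesis mu_diffuse : diffuse mu.
Hypothesis lawU : forall i A, measurable A -> distribution P (U i) A = mu A.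
Hypothesis lawV : forall i A, measurable A -> distribution P (V i) A = mu A.

Let X (j : nat + nat) : S -> T :=
  match j with inl i => U i : S -> T | inr i => V i : S -> T end.

Hypothesis indUV : mutually_independent P X.
Hypotheses (r_gt0 : forall n, (0 < n)%N -> 0 < r n) (t_gt0 : 0 < t).
Hypothesis r_lim : n%:R * r n ^+ d @[n --> \oo] --> t.
Hypotheses (mf : measurable_fun [set: T] f) (f_ge0 : forall x, 0 <= f x).
Variables (mus : {measure set T -> \bar R}) (N : set T).
Hypotheses (mN : measurable N) (lebN : leb N = 0%E) (musN : mus (~` N) = 0%E).
Hypothesis muE : forall A, measurable A -> mu A = (\int[leb]_(x in A) (f x)%:E + mus A)%E.

Definition cost_rate (lam : R) : R := M - Gam w lam / lam.

(** The pooled sample puts the first [n] points of [U] before those of [V], so that joint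
    independence makes it one sample of size 2 n. *)
Let side n (i : 'I_(n + n)) : nat + nat :=
  match fintype.split i with inl j => inl (val j) | inr j => inr (val j) end.

Let side_inj n : injective (@side n).
Proof.
move=> i j; rewrite /side -{2}[i]splitK -{2}[j]splitK.
by case: (fintype.split i) => a; case: (fintype.split j) => b // [] /val_inj ->.
Qed.

Let mX j : measurable_fun [set: S] (X j).
Proof. by case: j => i; exact: measurable_funPT. Qed.

Let lawX j A : measurable A -> P (X j @^-1` A) = mu A.
Proof. by case: j => i; [exact: lawU|exact: lawV]. Qed.

Let pooled n (om : S) : (n + n).-tuple T := sample X (@side n) om.

Let pooledE n om : pooled n om =
  [tuple U (nat_of_ord i) om | i < n] ++ [tuple V (nat_of_ord i) om | i < n] :> seq T.
Proof.
pose t2 := [tuple of [tuple U (nat_of_ord i) om | i < n] ++ [tuple V (nat_of_ord i) om | i < n]].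
rewrite -[RHS]/(tval t2); congr tval; apply: eq_from_tnth => i.
rewrite tnth_mktuple /side -{2}[i]splitK.
by case: (fintype.split i) => j /=; rewrite ?tnth_lshift ?tnth_rshift tnth_mktuple.
Qed.

Let cost n (s : seq T) : R := BMs w (r n)^-1 (take n s) (drop n s).

Let cost_pooled n om :
  BMr w (r n) (first_points U n om) (first_points V n om) = cost n (pooled n om).
Proof.
rewrite /cost pooledE take_size_cat ?size_tuple// drop_size_cat ?size_tuple//.
have E (Y : nat -> {RV P >-> T}) : first_points (fun i => Y i : S -> T) n om =i
    [tuple Y (nat_of_ord i) om | i < n].
  move=> x; apply/imfsetP/tnthP => /=.
    by move=> [i _ ->]; exists i; rewrite tnth_mktuple.
  by move=> [i ->]; exists i => //; rewrite tnth_mktuple.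
by rewrite /BMr /BMs; congr BM; apply: eq_imfset => // x; exact: E.
Qed.

Let mcost n : (0 < n)%N -> bmf (n + n) (cost n).
Proof.
move=> n0; apply: (mbf2_bmf_cat (F := BMs w (r n)^-1)).
by apply: mbf2_BMs => //; rewrite invr_eq0 gt_eqF// r_gt0.
Qed.

Let cost_le n s : (0 < n)%N -> size s = (n + n)%N -> 0 <= cost n s <= M * n%:R.
Proof.
move=> n0 sn; rewrite [X in X && _]BM_ge0//=.
have r0 : (r n)^-1 != 0 by rewrite invr_eq0 gt_eqF// r_gt0.
rewrite /cost BMsE// lerBlDr (@le_trans _ _ (M * n%:R))//.
  rewrite ler_wpM2l// ler_nat cat_take_drop.
  rewrite (leq_trans (half_leq (size_undup _)))// sn addnn doubleK//.
by rewrite lerDl; exact: MG_ge0 (sgap_ge0 w_ub _) (sgap_le w_ge0 _) M0 _ _.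
Qed.

Let EE_cost n : (0 < n)%N -> EE mu (n + n) (cost n) = M * n%:R - sample_gain w mu r n.
Proof.
move=> n0; have r0 : (r n)^-1 != 0 by rewrite invr_eq0 gt_eqF// r_gt0.
rewrite /cost (mbf2_catE (F := BMs w (r n)^-1)); last exact: mbf2_BMs.
by rewrite EE_BMs// addnn doubleK.
Qed.

Let xi n om := n%:R^-1 * BMr w (r n) (first_points U n om) (first_points V n om).

Let mxi n : mbf (xi n).
Proof.
case: n => [|n]; first by rewrite /xi; under [X in mbf X]eq_fun do rewrite invr0 mul0r; exact: mbf_cst.
apply: mbfZ; under [X in mbf X]eq_fun do rewrite cost_pooled.
apply: (mbf_comp (phi := pooled n.+1) _ (mcost (ltn0Sn n))).
exact: measurable_sample.
Qed.

(** Where the density vanishes, the quotient in [cost_rate] is multiplied by 0 and both sides are 0;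
    elsewhere the quotient cancels. *)
Lemma cost_rateE x : cost_rate (t * f x) * f x = M * f x - gam_density w t (f x).
Proof.
rewrite /cost_rate /gam_density (max_idPl (f_ge0 x)).
have [->|fx] := eqVneq (f x) 0.
  have := gam_density0 d_gt0 w_ge0 w_ub w_meas t; rewrite /gam_density maxxx => ->.
  by rewrite !mulr0 subrr.
by field; rewrite fx gt_eqF.
Qed.

Let density_int := density_integrable mf f_ge0 muE.

Let gam_int : leb.-integrable setT (EFin \o (gam_density w t \o f)).
Proof.
apply: (lipschitz_integrable mf f_ge0 muE (K := 2 * M)); first exact: mulr_ge0.
- exact: gam_density_lip.
- exact: gam_density0.
Qed.

Let cost_rate_fun : (fun x => cost_rate (t * f x) * f x) = (fun x => M * f x - gam_density w t (f x)).
Proof. by apply/funext => x; exact: cost_rateE. Qed.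

Lemma cost_rate_integrable :
  leb.-integrable setT (EFin \o (fun x => cost_rate (t * f x) * f x)).
Proof.
rewrite cost_rate_fun.
exact: (integrableB measurableT (integrableZl measurableT M density_int) gam_int).
Qed.

Let c := \int[leb]_x (cost_rate (t * f x) * f x).

(** The total mass 1 is the integral of [f] plus the singular mass, so M times the singular mass
    disappears from the cost. *)
Lemma cost_rate_integral :
  c = M - (\int[leb]_x gam_density w t (f x) + M * fine (mus setT)).
Proof.
rewrite /c cost_rate_fun RintegralB//; last exact: (integrableZl measurableT M density_int).
rewrite RintegralZl//.
have := muE measurableT; rewrite probability_setT.
have msT : (mus setT <= 1)%E.
  by rewrite -(probability_setT mu); exact: (mus_le f_ge0 muE measurableT).
have fm : mus setT \is a fin_num by rewrite ge0_fin_numE// (le_lt_trans msT)// ltry.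
rewrite -(fineK fm) -(fineK (integrable_fin_num measurableT density_int)) -EFinD => -[].
rewrite -[fine (\int[leb]_(_ in _) _)%E]/(\int[leb]_x f x) => e1.
rewrite /= -[X in _ = X - _]mulr1 e1; ring.
Qed.

Let xi_tail (e : R) : 0 < e -> exists q C : R, [/\ 0 < q, q < 1, 0 <= C &
  forall n, Ex P (fun om => (e < `|xi n om - c|)%R%:R) <= C * q ^+ n].
Proof.
move=> e0; have M2 : 0 < 2 * M + 1 by rewrite ltr_wpDl// mulr_ge0.
have e4 : 0 < e / 4 by rewrite divr_gt0.
have e2 : 0 < e / 2 by rewrite divr_gt0.
(* The pooled sample has 2 n points, so a rate e / 4 per point is a deviation e / 2 of the
   normalised cost; the other e / 2 is for the mean. The constant 2 M + 1 is positive even if M =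
   0. *)
have [q [q0 q1 Hq]] := concentration T M2 e4.
have := sample_gain_limit d_gt0 w_ge0 w_ub w_meas W2 W3 mu_diffuse r_gt0 t_gt0 r_lim
  mf f_ge0 mN lebN musN muE e2.
(* The second summand of the constant makes the bound at least 1, hence trivial, for n <= n1. *)
move=> [n1 _ Hn1]; exists q, (2 + q ^- n1.+1); split => //.
  by rewrite addr_ge0// invr_ge0 exprn_ge0// ltW.
have mb n : mbf (fun om => (e < `|xi n om - c|)%R%:R : R).
  apply: mbf_bool; apply: measurable_bool_set; apply: measurable_fun_ltr.
    exact: measurable_cst.
  by have [] := mbf_norm (mbfBc c (mxi n)).
move=> n; have qn : 0 <= q ^+ n by rewrite exprn_ge0// ltW.
rewrite mulrDl; have [nn|nn] := leqP n n1.
  apply: (@le_trans _ _ 1).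
    by apply: Ex_le => // om; case: (_ < _)%R.
  apply: ler_wpDl; first by rewrite mulr_ge0.
  rewrite mulrC ler_pdivlMr ?exprn_gt0// mul1r.
  by rewrite ler_wiXn2l ?(ltW q0) ?(ltW q1)// ltnW.
have n0 : (0 < n)%N by exact: leq_ltn_trans nn.
have n0' : 0 < n%:R :> R by rewrite ltr0n.
apply: ler_wpDr; first by rewrite mulr_ge0// invr_ge0 exprn_ge0// ltW.
have r0 : (r n)^-1 != 0 by rewrite invr_eq0 gt_eqF// r_gt0.
have bd : bounded_differences (2 * M + 1) (cost n).
  move=> s1 s2 x y; have := BMs_bounded_differences w_ge0 w_ub W1 n r0 s1 s2 x y.
  by move=> /le_trans; apply; rewrite lerDl.
pose dev (s : seq T) := (e / 4 * (n + n)%:R < `|cost n s - EE mu (n + n) (cost n)|)%R.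
have mdev : bmf (n + n) (fun s => (dev s)%:R : R).
  apply: mbf_bool; apply: measurable_bool_set; apply: measurable_fun_ltr.
    exact: measurable_cst.
  by have [] := mbf_norm (mbfBc (EE mu (n + n) (cost n)) (mcost n0)).
apply: (@le_trans _ _ (2 * q ^+ (n + n))); last first.
  rewrite ler_wpM2l// ler_wiXn2l ?(ltW q0) ?(ltW q1)// leq_addr//.
apply: le_trans (Hq mu (n + n)%N (cost n) (mcost n0) bd).
rewrite -[leRHS](Ex_sample mX lawX indUV (@side_inj n) mdev).
apply: le_Ex => //; first by apply: mbf_comp mdev; exact: measurable_sample.
move=> om; rewrite ler_nat /=.
have := Hn1 n (ltnW nn); rewrite /= -/(pooled n om).
have : xi n om - c = n%:R^-1 * (cost n (pooled n om) - EE mu (n + n) (cost n)) -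
   (n%:R^-1 * sample_gain w mu r n -
     (\int[leb]_x gam_density w t (f x) + M * fine (mus setT))).
  rewrite /xi cost_pooled cost_rate_integral EE_cost//; field.
  by rewrite gt_eqF.
move=> -> h; case: (boolP (dev _)) => [_|]; first by case: (_ < _)%R.
rewrite /dev -leNgt => h2.
rewrite ltNge (le_trans (ler_normB _ _))// (_ : e = e / 2 + e / 2) ?lerD//; last by lra.
rewrite normrM ger0_norm ?invr_ge0// ler_pdivrMl//; apply: (le_trans h2).
by rewrite natrD; lra.
Qed.

Lemma matching_complete : converges_completely P xi c.
Proof. exact: (geometric_tail_complete mxi xi_tail). Qed.

Lemma matching_L2 : converges_L2 P xi c.
Proof.
apply: (geometric_tail_L2 mxi xi_tail (B := M + `|c|)) => n om.
apply: (le_trans (ler_normB _ _)); rewrite lerD2r /xi.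
have [->|n0] := posnP n; first by rewrite invr0 mul0r normr0.
have n0' : 0 < n%:R :> R by rewrite ltr0n.
have /andP[h1 h2] := cost_le n0 (size_tuple (pooled n om)).
rewrite cost_pooled ger0_norm ?mulr_ge0 ?invr_ge0//.
by rewrite ler_pdivrMl// mulrC.
Qed.

End matching_limit.

Theorem theorem4p9 (R : realType) (d : nat) (d_gt0 : (0 < d)%N)
    (w : 'rV[R]_d -> R) (w_ge0 : forall x, 0 <= w x)
    (w_meas : measurable_fun [set: 'rV[R]_d] w)
    (wmax_fin : has_ubound (range w))
    (W1 : condW1 w) (W2 : condW2 w) (W3 : condW3 w)
    (dO : measure_display) (Omega : measurableType dO)
    (PO : probability Omega R) (H H' : R -> Omega -> set 'rV[R]_d)
    (H_poisson : forall lam : R, 0 < lam -> poisson_process PO lam (H lam))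
    (H'_poisson : forall lam : R, 0 < lam -> poisson_process PO lam (H' lam))
    (HH'_indep : forall lam : R, 0 < lam ->
       independent_processes PO (H lam) (H' lam)) :
  exists rho : R -> R,
    (forall lam : R, 0 < lam ->
       ('E_PO[fun om => BM w (fset_set (H lam om `&` cube d s))
                             (fset_set (H' lam om `&` cube d s))]
          * ((lam * s ^+ d)^-1)%:E)%E @[s --> +oo] --> (rho lam)%:E)
    /\
    (forall (dS : measure_display) (S : measurableType dS)
        (P : probability S R) (mu : probability 'rV[R]_d R)
        (U V : nat -> {RV P >-> 'rV[R]_d})
        (f : 'rV[R]_d -> R) (r : nat -> R) (t : R),
      diffuse mu ->
      (forall i A, measurable A -> distribution P (U i) A = mu A) ->
      (forall i A, measurable A -> distribution P (V i) A = mu A) ->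
      mutually_independent P
        (fun j : nat + nat => match j with inl i => U i : S -> 'rV[R]_d
                                         | inr i => V i : S -> 'rV[R]_d end) ->
      ac_density mu f ->
      (forall n, (0 < n)%N -> 0 < r n) ->
      0 < t ->
      n%:R * r n ^+ d @[n --> \oo] --> t ->
      let xi n om := n%:R^-1 * BMr w (r n) (first_points U n om)
                                          (first_points V n om) in
      let c := \int[lebesgue_rV R d]_x (rho (t * f x) * f x) in
      [/\ (lebesgue_rV R d).-integrable [set: 'rV[R]_d]
            (EFin \o (fun x => rho (t * f x) * f x)),
          converges_completely P xi c
        & converges_L2 P xi c]).
Proof.
(* This function depends on [w] alone and is fixed before any sample or law [mu] is given, so it
   serves both statements. *)
exists (fun lam => wmax w - Gam w lam / lam); split=> [lam lam0|].
  exact: (poisson_cost_limit d_gt0 lam0 (H_poisson _ lam0) (H'_poisson _ lam0)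
    (HH'_indep _ lam0) w_ge0 wmax_fin w_meas W1).
move=> dS S P mu U V f r t dmu lawU lawV indUV [mf f_ge0 [mus [[N [mN lebN musN]] muE]]].
move=> r_gt0 t_gt0 r_lim xi c; split.
- exact: (cost_rate_integrable d_gt0 w_ge0 wmax_fin w_meas t_gt0 mf f_ge0 muE).
- exact: (matching_complete d_gt0 w_ge0 wmax_fin w_meas W1 W2 W3 dmu lawU lawV indUV
    r_gt0 t_gt0 r_lim mf f_ge0 mN lebN musN muE).
- exact: (matching_L2 d_gt0 w_ge0 wmax_fin w_meas W1 W2 W3 dmu lawU lawV indUV
    r_gt0 t_gt0 r_lim mf f_ge0 mN lebN musN muE).
Qed.
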